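(* (1) Let $1<p\le\infty$. A vector field $\bm{u}:\mathbb{B}\to\mathbb{R}^3$ belongs to $\bm{h}^p_e(\mathbb{B})$ if and only if $\bm{u}=\bm{P}_e\bm{f}$ for some $\bm{f}\in\bm{L}^p(\mathbb{S})$. (2) $\bm{u}\in\bm{h}^1_e(\mathbb{B})$ if and only if $\bm{u}=\bm{P}_e\bm{\mu}$ for some $\bm{\mu}\in\bm{M}(\mathbb{S})$.
   Context: $\mathbb{B}$ is the open unit ball of $\mathbb{R}^3$, $\mathbb{S}$ the unit sphere, $\sigma$ surface measure. Lamé constants $\mu>0$, $2\mu+\lambda>0$; $\Delta^*\bm{u}=\mu\Delta\bm{u}+(\lambda+\mu)\nabla\,\mathrm{div}\,\bm{u}$. For $1\le p<\infty$, $\bm{h}^p_e(\mathbb{B})$ is the space of solutions $\bm{u}:\mathbb{B}\to\mathbb{R}^3$ of $\Delta^*\bm{u}=0$ with $\sup_{0\le r<1}(\int_{\mathbb{S}}|\bm{u}(rw)|^pd\sigma(w))^{1/p}<\infty$; $\bm{h}^\infty_e(\mathbb{B})$ is the space of bounded solutions. $\bm{M}(\mathbb{S})$ is the space of $\mathbb{R}^3$-valued Borel measures $\bm{\mu}=(\mu_1,\mu_2,\mu_3)$ on $\mathbb{S}$ (each $\mu_i$ a finite signed Borel measure). With $\beta=\frac{\lambda+\mu}{2\lambda+6\mu}$, $\alpha=\frac{\lambda+2\mu}{\lambda+3\mu}$, $P(x,\eta)=\frac{1}{4\pi}\frac{1-|x|^2}{|x-\eta|^3}$, $\Phi(x,\eta)=\frac{1}{4\pi}\int_0^1\big(\frac{1-t^2|x|^2}{(1-2tx\cdot\eta+t^2|x|^2)^{3/2}}-1-3tx\cdot\eta\big)\frac{dt}{t^{1+\alpha}}$,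 the elastic Poisson kernel is $\mathcal{P}_e(x,\eta)=P(x,\eta)\mathcal{I}+\mathcal{L}(x,\eta)$, $\mathcal{L}_{ij}=\beta(1-|x|^2)\partial_{x_i}\partial_{x_j}\Phi$. $\bm{P}_e\bm{f}(x)=\int_{\mathbb{S}}\mathcal{P}_e(x,\eta)\bm{f}(\eta)d\sigma(\eta)$ and $\bm{P}_e\bm{\mu}(x)=\int_{\mathbb{S}}\mathcal{P}_e(x,\eta)(d\mu_1,d\mu_2,d\mu_3)^t(\eta)$. *)

(* Defs.v *)
From HB Require Import structures.
From mathcomp Require Import all_boot all_order all_algebra.
From mathcomp Require Import all_classical all_reals all_analysis.
From mathcomp Require Import measurable_realfun.
Set Implicit Arguments. Unset Strict Implicit. Unset Printing Implicit Defensive.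
Import Order.TTheory GRing.Theory Num.Theory numFieldNormedType.Exports.
Local Open Scope classical_set_scope.
Local Open Scope ring_scope.

Section Elastic.
Variable R : realType.

Definition V3 := ((R * R) * R)%type.
Definition mk3 (a b c : R) : V3 := ((a, b), c).
Definition x1 (y : V3) : R := y.1.1.
Definition x2 (y : V3) : R := y.1.2.
Definition x3 (y : V3) : R := y.2.
Definition coord (i : 'I_3) (y : V3) : R :=
  if val i == 0%N then x1 y else if val i == 1%N then x2 y else x3 y.
Definition vec3 (F : 'I_3 -> R) : V3 := mk3 (F (inord 0)) (F (inord 1)) (F (inord 2)).
Definition ebasis (i : 'I_3) : V3 := vec3 (fun j => (i == j)%:R).

Definition dot (x y : V3) : R := \sum_(i < 3) coord i x * coord i y.
Definition enorm (x : V3) : R := Num.sqrt (dot x x).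

Definition ball3 : set V3 := [set x | enorm x < 1].
Definition sphere3 : set V3 := [set x | enorm x = 1].


Definition sq3 (y : V3) : R := x1 y ^+ 2 + x2 y ^+ 2 + x3 y ^+ 2.
Definition normalize3 (y : V3) : V3 :=
  let c := powR (sq3 y) (- 2^-1) in mk3 (c * x1 y) (c * x2 y) (c * x3 y).

Definition LR := measurableTypeR R.
Definition W3 := ((LR * LR) * LR)%type.
Definition normalizeW (y : W3) : V3 := normalize3 y.

Lemma measurable_sqW : measurable_fun [set: W3] (sq3 : W3 -> R).
Proof.
rewrite /sq3 /x1 /x2 /x3.
apply: measurable_funD; first apply: measurable_funD.
all: apply: measurable_funX.
- exact: (measurableT_comp measurable_fst measurable_fst).
- exact: (measurableT_comp measurable_snd measurable_fst).
- exact: measurable_snd.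
Qed.

Lemma measurable_normalizeW : measurable_fun setT normalizeW.
Proof.
have mc : measurable_fun [set: W3] (fun y : W3 => powR (sq3 y) (- 2^-1)).
  exact: (measurableT_comp (f := @powR R ^~ (- 2^-1)) _ measurable_sqW).
rewrite /normalizeW /normalize3 /mk3 /x1 /x2 /x3.
apply: measurable_fun_pair; first apply: measurable_fun_pair.
- exact: measurable_funM mc (measurableT_comp measurable_fst measurable_fst).
- exact: measurable_funM mc (measurableT_comp measurable_snd measurable_fst).
- exact: measurable_funM mc measurable_snd.
Qed.

Definition pballW : set W3 := (sq3 : W3 -> R) @^-1` `]0%R, 1%R].
Lemma measurable_pballW : measurable pballW.
Proof. by rewrite /pballW -[X in measurable X]setTI; exact: measurable_sqW. Qed.

Local Open Scope ereal_scope.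
Definition lebesgue3 : {measure set W3 -> \bar R} :=
  (lebesgue_measure \x lebesgue_measure) \x lebesgue_measure.

Definition ball_restr : {measure set W3 -> \bar R} := mrestr lebesgue3 measurable_pballW.

Definition sphere0 : set V3 -> \bar R := pushforward ball_restr normalizeW.

Let sphere0_0 : sphere0 set0 = 0.
Proof. by rewrite /sphere0 /pushforward preimage_set0 measure0. Qed.

Let sphere0_ge0 A : 0 <= sphere0 A.
Proof.
by rewrite /sphere0 /pushforward; exact: measure_ge0.
Qed.

Let sphere0_sigma_additive : semi_sigma_additive sphere0.
Proof.
move=> F mF tF mUF; rewrite /sphere0 /pushforward preimage_bigcup.
apply: measure_semi_sigma_additive.
- by move=> n; rewrite -[X in measurable X]setTI; exact: measurable_normalizeW.
- apply/trivIsetP => /= i j _ _ ij; rewrite -preimage_setI.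
  by move/trivIsetP : tF => /(_ _ _ _ _ ij) ->//; rewrite preimage_set0.
- by rewrite -preimage_bigcup -[X in measurable X]setTI; exact: measurable_normalizeW.
Qed.

HB.instance Definition _ := isMeasure.Build _ _ _
  sphere0 sphere0_0 sphere0_ge0 sphere0_sigma_additive.

(* surface measure on the unit sphere:
   sigma(A) = 3 * |{ y : 0 < |y| <= 1, y/|y| \in A }| (Lebesgue measure) *)
Definition sigma3 : {measure set V3 -> \bar R} := mscale ((3%:R : R)%:nng)%R sphere0.

Local Close Scope ereal_scope.

Definition pd (k : 'I_3) (g : V3 -> R) (x : V3) : R := 'D_(ebasis k) g x.

Definition lame_op_comp (lam mu : R) (u : V3 -> V3) (i : 'I_3) (x : V3) : R :=
  mu * (\sum_(k < 3) pd k (pd k (coord i \o u)) x)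
  + (lam + mu) * (\sum_(j < 3) pd i (pd j (coord j \o u)) x).

Definition lame_solution (lam mu : R) (u : V3 -> V3) : Prop :=
  forall x, ball3 x ->
    differentiable u x /\
    (forall k : 'I_3, differentiable ('D_(ebasis k) u) x) /\
    (forall i : 'I_3, lame_op_comp lam mu u i x = 0).

Definition hardy_e (lam mu : R) (p : \bar R) (u : V3 -> V3) : Prop :=
  lame_solution lam mu u /\
  match p with
  | +oo%E => exists C : R, forall x, ball3 x -> enorm (u x) <= C
  | p'%:E => exists C : R, forall r : R, 0 <= r < 1 ->
      (Lnorm sigma3 p'%:E (fun w => (enorm (u (r *: w)))%:E) <= C%:E)%E
  | -oo%E => False
  end.

Definition Lp_sphere (p : \bar R) (f : V3 -> V3) : Prop :=
  (forall i : 'I_3, measurable_fun sphere3 (coord i \o f)) /\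
  (Lnorm sigma3 p (fun w => (enorm (f w))%:E) < +oo)%E.

Definition beta_e (lam mu : R) : R := (lam + mu) / (2 * lam + 6 * mu).
Definition alpha_e (lam mu : R) : R := (lam + 2 * mu) / (lam + 3 * mu).

Definition poissonP (x eta : V3) : R :=
  (1 - enorm x ^+ 2) / (4 * pi * enorm (x - eta) ^+ 3).

Definition Phi_e (lam mu : R) (x eta : V3) : R :=
  (4 * pi)^-1 * Rintegral lebesgue_measure `]0%R, 1%R[%classic
    (fun t : R =>
      ((1 - t ^+ 2 * enorm x ^+ 2)
         / powR (1 - 2 * t * dot x eta + t ^+ 2 * enorm x ^+ 2) (3 / 2)
       - 1 - 3 * t * dot x eta) * powR t (- (1 + alpha_e lam mu))).

Definition L_e (lam mu : R) (i j : 'I_3) (x eta : V3) : R :=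
  beta_e lam mu * (1 - enorm x ^+ 2)
  * pd i (pd j (fun y => Phi_e lam mu y eta)) x.

Definition Pe_kernel (lam mu : R) (i j : 'I_3) (x eta : V3) : R :=
  (if i == j then poissonP x eta else 0) + L_e lam mu i j x eta.

Definition Pe_fun (lam mu : R) (f : V3 -> V3) (x : V3) : V3 :=
  vec3 (fun i => \sum_(j < 3)
    Rintegral sigma3 sphere3 (fun eta => Pe_kernel lam mu i j x eta * coord j (f eta))).

(* a finite signed measure (charge) on R^3 is a measure on S when its
   total variation does not charge the complement of S *)
Definition charge_on_sphere (nu : {charge set V3 -> \bar R}) : Prop :=
  forall A : set V3, measurable A -> nu (A `\` sphere3) = 0%E.

Definition charge_integral (nu : {charge set V3 -> \bar R}) (g : V3 -> R) : R :=
  let PN := cid (Hahn_decomposition nu) in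
  let NN := cid (projT2 PN) in
  Rintegral (jordan_pos (projT2 NN)) setT g
  - Rintegral (jordan_neg (projT2 NN)) setT g.

Definition Pe_meas (lam mu : R) (nu : 'I_3 -> {charge set V3 -> \bar R}) (x : V3) : V3 :=
  vec3 (fun i => \sum_(j < 3) charge_integral (nu j) (fun eta => Pe_kernel lam mu i j x eta)).

End Elastic.

(* Main.v *)
(* Let K = 4 pi P_e. Both directions rest on the bound |K| <= C P, with P the Poisson kernel, and on the identity
   sigma(S) u_i(x) = sum_j int_S u_j(e) K_ij(x, e) for fields u that solve the system beyond the closed ball.
   For smooth u the identity comes from the splitting u = U + beta (1 - |x|^2) W, where W solves an Euler equation
   whose right-hand side is a multiple of grad div u: then U is harmonic, hence the Poisson integral of u on S.
   A solution is only assumed to be twice differentiable, without continuity of the second derivatives. Averaging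
   over cubes gains derivatives, and Goursat's subdivision argument, applied to the flux of the stress, shows that
   averages of solutions are solutions; so u is a uniform limit of smooth solutions on smaller balls.

   Given u in h^p_e, the identity is applied to u(r .) and r tends to 1 along an ultrafilter. For p > 1, Young's
   inequality makes the traces uniformly integrable, so their limit is a charge with a density in L^p. For p = 1 the
   positive and negative parts of the traces converge to positive linear forms on C(S), which are measures by the
   Riesz representation theorem. Conversely the columns of K solve the system and derivatives pass under positive
   linear forms on C(S); the norms are controlled by |K| <= C P, Jensen's inequality and Tonelli's theorem, because
   P(r w, e) = P(r e, w) has constant mass. The value sigma(S) = 4 pi is never needed: densities are rescaled. *)
From HB Require Import structures.
From mathcomp Require Import all_boot all_order all_algebra.
From mathcomp Require Import all_classical all_reals all_analysis.
From mathcomp Require Import ring lra measurable_realfun ess_sup_inf.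
Require Import Defs.
Set Implicit Arguments. Unset Strict Implicit. Unset Printing Implicit Defensive.
Import Order.TTheory GRing.Theory Num.Theory numFieldNormedType.Exports.
Local Open Scope classical_set_scope.
Local Open Scope ring_scope.

(** One operator runs through the proof: the radial average [Tf g f x], the integral over t in
    [0, 1] of t^g f(t x), which inverts the Euler operator x . grad + (g + 1) on a star-shaped
    domain. The Hessian of Phi is such an average of the Hessian of P, with g = 1 - alpha, so the
    kernel and W obey Euler equations and are matched by uniqueness, without evaluating an integral.
    The equation for W first appears with g = 1/2; trading grad div u for grad div U, which the
    boundary values determine, changes the exponent to 1 - alpha: this is the origin of alpha. For p
    > 1 the limit of the traces is taken against all bounded measurable functions: this makes
    Radon-Nikodym applicable and lets the limit be tested against truncated powers of itself. The
    case p = +oo is run with exponent 2, the essential bound being recovered afterwards. The sphere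
    is never parametrised: rotation invariance comes from shears of Lebesgue measure. Integrals over
    spheres and segments are all positive linear forms on continuous functions over a compact set,
    so one argument lets derivatives pass under each of them. *)

(** * Coordinates and Euclidean geometry of three-space *)

Section Geometry.
Variable R : realType.
Notation V3 := (V3 R).
Implicit Types (x y : V3) (i j k : 'I_3).

Lemma ord3P i : [\/ i = inord 0, i = inord 1 | i = inord 2].
Proof.
by case: i => -[|[|[|//]]] hi; [apply: Or31|apply: Or32|apply: Or33];
  apply: val_inj; rewrite /= inordK.
Qed.

Lemma sum3E (V : nmodType) (F : 'I_3 -> V) :
  \sum_(i < 3) F i = F (inord 0) + F (inord 1) + F (inord 2).
Proof.
rewrite !big_ord_recl big_ord0 addr0 addrA.
by congr (F _ + F _ + F _); apply: val_inj; rewrite /= inordK.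
Qed.

Lemma coord0E x : coord (inord 0) x = x.1.1.
Proof. by rewrite /coord /= inordK. Qed.
Lemma coord1E x : coord (inord 1) x = x.1.2.
Proof. by rewrite /coord /= inordK. Qed.
Lemma coord2E x : coord (inord 2) x = x.2.
Proof. by rewrite /coord /= inordK. Qed.
Definition coordE := (coord0E, coord1E, coord2E).

Lemma vec3K i (F : 'I_3 -> R) : coord i (vec3 F) = F i.
Proof. by case: (ord3P i) => ->; rewrite coordE. Qed.

Lemma coord_inj x y : (forall i, coord i x = coord i y) -> x = y.
Proof.
move=> h; move: (h (inord 0)) (h (inord 1)) (h (inord 2)); rewrite !coordE.
by case: x {h} => -[a b] c; case: y => -[a' b'] c' /= -> -> ->.
Qed.

Lemma coordD i x y : coord i (x + y) = coord i x + coord i y.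
Proof. by case: (ord3P i) => ->; rewrite !coordE. Qed.
Lemma coordN i x : coord i (- x) = - coord i x.
Proof. by case: (ord3P i) => ->; rewrite !coordE. Qed.
Lemma coordB i x y : coord i (x - y) = coord i x - coord i y.
Proof. by rewrite coordD coordN. Qed.
Lemma coordZ i a x : coord i (a *: x) = a * coord i x.
Proof. by case: (ord3P i) => ->; rewrite !coordE. Qed.
Lemma coord0 i : coord i (0 : V3) = 0.
Proof. by case: (ord3P i) => ->; rewrite !coordE. Qed.
Lemma coord_ebasis i k : coord i (ebasis R k) = (k == i)%:R.
Proof. by rewrite vec3K. Qed.

Lemma coord_cont i : continuous (coord i : V3 -> R).
Proof.
move=> x; case: (ord3P i) => ->.
- have -> : coord (inord 0) = fst \o fst :> (V3 -> R) by apply/funext => z; rewrite coordE.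
  by apply: continuous_comp; [exact: cvg_fst|exact: cvg_fst].
- have -> : coord (inord 1) = snd \o fst :> (V3 -> R) by apply/funext => z; rewrite coordE.
  by apply: continuous_comp; [exact: cvg_fst|exact: cvg_snd].
- have -> : coord (inord 2) = snd :> (V3 -> R) by apply/funext => z; rewrite coordE.
  exact: cvg_snd.
Qed.

Lemma norm3E x : `|x| = Num.max (Num.max `|x.1.1| `|x.1.2|) `|x.2|.
Proof. by []. Qed.

Lemma coord_le_norm i x : `|coord i x| <= `|x|.
Proof.
rewrite norm3E !le_max; case: (ord3P i) => ->; rewrite coordE lexx ?orbT //.
Qed.

Lemma norm_le_coord x e : (forall i, `|coord i x| <= e) -> `|x| <= e.
Proof.
move=> h; rewrite norm3E !ge_max; move: (h (inord 0)) (h (inord 1)) (h (inord 2)).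
by rewrite !coordE => -> -> ->.
Qed.

Lemma ebasis_sum x : x = \sum_(i < 3) coord i x *: ebasis R i.
Proof.
apply: coord_inj => i; rewrite sum3E !coordD !coordZ !coord_ebasis.
by case: (ord3P i) => ->; rewrite -!val_eqE /= !inordK //=; ring.
Qed.

Lemma dotE x y : dot x y = x.1.1 * y.1.1 + x.1.2 * y.1.2 + x.2 * y.2.
Proof. by rewrite /dot sum3E !coordE. Qed.

Lemma dotC x y : dot x y = dot y x.
Proof. by rewrite !dotE; ring. Qed.
Lemma dotDl x y z : dot (x + y) z = dot x z + dot y z.
Proof. by rewrite !dotE /=; ring. Qed.
Lemma dotZl a x z : dot (a *: x) z = a * dot x z.
Proof. by rewrite !dotE /= /GRing.scale /=; ring. Qed.
Lemma dotNl x z : dot (- x) z = - dot x z.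
Proof. by rewrite -scaleN1r dotZl mulN1r. Qed.
Lemma dotDr x y z : dot z (x + y) = dot z x + dot z y.
Proof. by rewrite dotC dotDl !(dotC _ z). Qed.
Lemma dotZr a x z : dot z (a *: x) = a * dot z x.
Proof. by rewrite dotC dotZl dotC. Qed.
Lemma dotNr x z : dot z (- x) = - dot z x.
Proof. by rewrite dotC dotNl dotC. Qed.
Lemma dotBB x y : dot (x - y) (x - y) = dot x x - 2 * dot x y + dot y y.
Proof. by rewrite !dotE /=; ring. Qed.

Lemma dot_ge0 x : 0 <= dot x x.
Proof. by rewrite dotE -!expr2 !addr_ge0 ?sqr_ge0. Qed.
Lemma enorm_ge0 x : 0 <= enorm x.
Proof. exact: sqrtr_ge0. Qed.
Lemma enorm2 x : enorm x ^+ 2 = dot x x.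
Proof. by rewrite sqr_sqrtr ?dot_ge0. Qed.
Lemma enormZ a x : enorm (a *: x) = `|a| * enorm x.
Proof.
by rewrite /enorm dotZl dotZr mulrA -expr2 sqrtrM ?sqr_ge0 // sqrtr_sqr.
Qed.
Lemma enormN x : enorm (- x) = enorm x.
Proof. by rewrite -scaleN1r enormZ normrN1 mul1r. Qed.
Lemma enorm0 : enorm (0 : V3) = 0.
Proof. by rewrite /enorm -(scale0r 0) dotZl mul0r sqrtr0. Qed.
Lemma coord_sqr_le i x : coord i x ^+ 2 <= dot x x.
Proof.
rewrite dotE -!expr2; have := sqr_ge0 x.1.1; have := sqr_ge0 x.1.2; have := sqr_ge0 x.2.
by case: (ord3P i) => ->; rewrite coordE; move: (_ ^+ 2) (_ ^+ 2) (_ ^+ 2) => a b c; lra.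
Qed.
Lemma coord_le_enorm i x : `|coord i x| <= enorm x.
Proof. by rewrite -sqrtr_sqr ler_wsqrtr // coord_sqr_le. Qed.
Lemma norm_le_enorm x : `|x| <= enorm x.
Proof. by apply: norm_le_coord => i; exact: coord_le_enorm. Qed.

Lemma cauchy_schwarz x y : dot x y <= enorm x * enorm y.
Proof.
apply: le_trans (ler_norm _) _; rewrite -sqrtr_sqr /enorm -sqrtrM ?dot_ge0 //.
apply: ler_wsqrtr; rewrite !dotE -subr_ge0.
have -> : (x.1.1 * x.1.1 + x.1.2 * x.1.2 + x.2 * x.2) *
  (y.1.1 * y.1.1 + y.1.2 * y.1.2 + y.2 * y.2) -
  (x.1.1 * y.1.1 + x.1.2 * y.1.2 + x.2 * y.2) ^+ 2 =
  (x.1.1 * y.1.2 - x.1.2 * y.1.1) ^+ 2 + (x.1.1 * y.2 - x.2 * y.1.1) ^+ 2 +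
  (x.1.2 * y.2 - x.2 * y.1.2) ^+ 2 by ring.
by rewrite !addr_ge0 ?sqr_ge0.
Qed.

Lemma enormD x y : enorm (x + y) <= enorm x + enorm y.
Proof.
rewrite -(ler_pXn2r (n := 2)) ?nnegrE ?addr_ge0 ?enorm_ge0 //.
rewrite enorm2 sqrrD !enorm2 dotDl !dotDr (dotC y x).
have := cauchy_schwarz x y; lra.
Qed.
Lemma enormB x y : enorm x - enorm y <= enorm (x - y).
Proof. by have := enormD (x - y) y; rewrite subrK; lra. Qed.
(** The topology of [V3] is that of the product, hence of the sup norm, while the theorem speaks of
    the Euclidean [enorm]; this crude comparison and [norm_le_enorm] pass between the two. *)
Lemma enorm_le_norm x : enorm x <= 3 * `|x|.
Proof.
rewrite {1}(ebasis_sum x); have e1 i : enorm (ebasis R i) = 1.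
  rewrite /enorm /dot sum3E !coord_ebasis.
  by case: (ord3P i) => ->; rewrite -!val_eqE /= !inordK //= !(mulr0, mulr1, addr0, add0r) sqrtr1.
rewrite sum3E; have h i : enorm (coord i x *: ebasis R i) <= `|x|.
  by rewrite enormZ e1 mulr1 coord_le_norm.
apply: le_trans (enormD _ _) _; apply: le_trans (lerD (enormD _ _) (lexx _)) _.
have := h (inord 0); have := h (inord 1); have := h (inord 2); lra.
Qed.

Lemma enorm_cont : continuous (@enorm R).
Proof.
move=> x; apply/cvgrPdist_lt => e e0; near=> y.
have h1 := enormB x y; have h2 := enormB y x.
rewrite -(opprB x) enormN in h2.
have h3 := enorm_le_norm (x - y).
have h4 : `|x - y| < e / 3.
  by near: y; apply: cvgr_dist_lt; [exact: cvg_id|exact: divr_gt0].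
by rewrite ltr_norml; lra.
Unshelve. all: by end_near. Qed.

Lemma ball3_open : open (@ball3 R).
Proof.
have -> : @ball3 R = @enorm R @^-1` [set r | r < 1] by [].
by apply: open_comp; [move=> *; exact: enorm_cont|exact: open_lt].
Qed.
Lemma sphere3_closed : closed (@sphere3 R).
Proof.
have -> : @sphere3 R = @enorm R @^-1` [set 1] by [].
by apply: closed_comp; [move=> *; exact: enorm_cont|exact: closed_eq].
Qed.
Lemma cball3_closed : closed [set x : V3 | enorm x <= 1].
Proof.
have -> : [set x : V3 | enorm x <= 1] = @enorm R @^-1` [set r | r <= 1] by [].
by apply: closed_comp; [move=> *; exact: enorm_cont|exact: closed_le].
Qed.
Lemma segment_compactV3 : compact [set x : V3 | `|x| <= 1].
Proof.
have -> : [set x : V3 | `|x| <= 1] = (`[-1, 1] `*` `[-1, 1]) `*` `[-1, 1].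
  apply/seteqP; split => x /=; rewrite norm3E !ge_max !ler_norml !in_itv /=.
    by move=> /andP[/andP[-> ->] ->].
  by move=> [[-> ->] ->].
by apply: compact_setX; [apply: compact_setX|]; exact: segment_compact.
Qed.
Lemma cball3_compact : compact [set x : V3 | enorm x <= 1].
Proof.
apply: (subclosed_compact cball3_closed segment_compactV3) => x /=.
exact: le_trans (norm_le_enorm x).
Qed.
Lemma sphere3_compact : compact (@sphere3 R).
Proof.
apply: (subclosed_compact sphere3_closed segment_compactV3) => x /= h.
by apply: le_trans (norm_le_enorm x) _; rewrite h.
Qed.
Lemma sphere3_dot x : sphere3 x -> dot x x = 1.
Proof. by rewrite /sphere3 /= -enorm2 => ->; rewrite expr1n. Qed.
Lemma ball3_dot x : ball3 x -> dot x x < 1.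
Proof.
rewrite /ball3 /= -enorm2 => h; rewrite -(expr1n _ 2) ltr_pXn2r // ?nnegrE //; exact: enorm_ge0.
Qed.
Lemma ball3Z t x : ball3 x -> 0 <= t <= 1 -> ball3 (t *: x).
Proof.
rewrite /ball3 /= => h /andP[t0 t1]; rewrite enormZ ger0_norm //.
by apply: le_lt_trans h; rewrite ler_piMl ?enorm_ge0.
Qed.
Lemma ball3_sphere x w : ball3 x -> sphere3 w -> 0 < enorm (x - w).
Proof.
rewrite /ball3 /sphere3 /= => h1 h2; have := enormB w x.
by rewrite h2 -(opprB x) enormN; lra.
Qed.
End Geometry.

(** * Continuity relative to a set *)

Section WithinContinuity.

(** Kernels and test functions are total functions that mean something only on a set such as the
    ball times the sphere. Continuity is therefore taken along the filter of [A], so that values off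
    [A] have no influence, even at boundary points. *)
Definition wcont (T U : topologicalType) (A : set T) (f : T -> U) :=
  forall x, A x -> f y @[y --> within A (nbhs x)] --> f x.

Lemma wcont_comp (T U V : topologicalType) (A : set T) (B : set U) (f : T -> U) (g : U -> V) :
  (forall x, A x -> B (f x)) -> wcont A f -> wcont B g -> wcont A (fun x => g (f x)).
Proof.
move=> AB hf hg x Ax W hW.
have := hf x Ax _ (hg _ (AB _ Ax) _ hW).
rewrite /= /within /= !nbhs_simpl /=.
by apply: filterS => y h Ay; exact: h Ay (AB _ Ay).
Qed.

Lemma cont_wcont (T U : topologicalType) (A : set T) (f : T -> U) : continuous f -> wcont A f.
Proof. by move=> cf x Ax; apply: cvg_within_filter; exact: cf. Qed.

Lemma wcont_sub (T U : topologicalType) (A B : set T) (f : T -> U) :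
  A `<=` B -> wcont B f -> wcont A f.
Proof.
move=> AB hf; apply: (@wcont_comp _ _ _ A B id f) => //.
by apply: cont_wcont => x; exact: cvg_id.
Qed.

Lemma wcont_pair (T U V : topologicalType) (A : set T) (f : T -> U) (g : T -> V) :
  wcont A f -> wcont A g -> wcont A (fun x => (f x, g x)).
Proof. by move=> hf hg x Ax; apply: cvg_pair; [exact: hf|exact: hg]. Qed.

Lemma wcont_cst (T U : topologicalType) (A : set T) (c : U) : wcont A (fun _ => c).
Proof. by move=> x Ax; exact: cvg_cst. Qed.

Lemma wcont_id (T : topologicalType) (A : set T) : wcont A (fun x => x).
Proof. by apply: cont_wcont => x; exact: cvg_id. Qed.
Lemma wcont_fst (T U : topologicalType) (A : set (T * U)) : wcont A (fun x => x.1).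
Proof. by apply: cont_wcont => x; exact: cvg_fst. Qed.
Lemma wcont_snd (T U : topologicalType) (A : set (T * U)) : wcont A (fun x => x.2).
Proof. by apply: cont_wcont => x; exact: cvg_snd. Qed.

Lemma wcont_eq (T U : topologicalType) (A : set T) (f g : T -> U) :
  (forall x, A x -> f x = g x) -> wcont A f -> wcont A g.
Proof.
move=> fg hf x Ax W; rewrite -(fg _ Ax) => hW; have := hf x Ax _ hW.
rewrite /= /within /= !nbhs_simpl /=; apply: filterS => y h Ay.
by rewrite /= -(fg _ Ay); exact: h.
Qed.

Lemma wcont_open (T U : topologicalType) (A : set T) (f : T -> U) x :
  open A -> wcont A f -> A x -> {for x, continuous f}.
Proof.
move=> oA hf Ax W hW; have := hf x Ax _ hW; rewrite /= /within /= !nbhs_simpl /= => h.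
have hA : nbhs x A by exact: open_nbhs_nbhs.
by apply: filterS2 hA h => y Ay; apply.
Qed.

Lemma wcont_setT (T U : topologicalType) (f : T -> U) : wcont setT f -> continuous f.
Proof. by move=> h x; apply: (wcont_open openT h). Qed.

Variable R : realType.
Variables (T : topologicalType) (A : set T).
Implicit Types f g : T -> R.

Lemma wcontD f g : wcont A f -> wcont A g -> wcont A (fun x => f x + g x).
Proof. by move=> hf hg x Ax; apply: cvgD; [exact: hf|exact: hg]. Qed.
Lemma wcontM f g : wcont A f -> wcont A g -> wcont A (fun x => f x * g x).
Proof. by move=> hf hg x Ax; apply: cvgM; [exact: hf|exact: hg]. Qed.
Lemma wcontN f : wcont A f -> wcont A (fun x => - f x).
Proof. by move=> hf x Ax; apply: cvgN; exact: hf. Qed.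
Lemma wcontB f g : wcont A f -> wcont A g -> wcont A (fun x => f x - g x).
Proof. by move=> hf hg; apply: wcontD => //; exact: wcontN. Qed.
Lemma wcontZ (a : R) f : wcont A f -> wcont A (fun x => a * f x).
Proof. by apply: wcontM; exact: wcont_cst. Qed.
Lemma wcontX f n : wcont A f -> wcont A (fun x => f x ^+ n).
Proof.
move=> hf; elim: n => [|n IH]; first by apply: (@wcont_eq T R A (fun _ => 1)); [move=> x _; rewrite expr0|exact: wcont_cst].
by apply: wcont_eq (wcontM hf IH) => x _; rewrite exprS.
Qed.
Lemma wcontV f : (forall x, A x -> f x != 0) -> wcont A f -> wcont A (fun x => (f x)^-1).
Proof. by move=> h hf x Ax; apply: cvgV; [exact: h|exact: hf]. Qed.
Lemma wcont_powR f (a : R) : (forall x, A x -> 0 < f x) -> wcont A f -> wcont A (fun x => powR (f x) a).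
Proof.
move=> h hf; apply: (@wcont_comp _ _ _ A [set x : R | 0 < x] f (fun y => powR y a)) => // y /= y0.
apply: cvg_within_filter.
have [d _] : is_derive y 1 (fun y : R => powR y a) (a * powR y (a - 1)) by exact: is_derive1_powR.
have : {for y, continuous (fun y : R => powR y a)} by apply: differentiable_continuous; apply/derivable1_diffP.
by [].
Qed.
Lemma wcont_sum (I : Type) (s : seq I) (F : I -> T -> R) :
  (forall i, wcont A (F i)) -> wcont A (fun x => \sum_(i <- s) F i x).
Proof.
move=> h; elim: s => [|i s IH].
  by apply: (@wcont_eq _ _ _ (fun _ => 0)); [move=> x _; rewrite big_nil|exact: wcont_cst].
by apply: wcont_eq (wcontD (h i) IH) => x _; rewrite big_cons.
Qed.
Lemma wcont_max f g : wcont A f -> wcont A g -> wcont A (fun x => Num.max (f x) (g x)).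
Proof.
move=> hf hg; have -> : (fun x => Num.max (f x) (g x)) = (fun x => 2^-1 * (f x + g x + `|f x - g x|)).
  by apply/funext => x; case: (lerP (f x) (g x)) => h; rewrite ?(ler0_norm (x := _ - _)) ?(ger0_norm (x := _ - _)); lra.
apply: wcontZ; apply: wcontD; first exact: wcontD.
by move=> x Ax; apply: cvg_norm; exact: (wcontB hf hg).
Qed.

Lemma wcont_bounded f : compact A -> wcont A f -> exists M, 0 < M /\ forall x, A x -> `|f x| <= M.
Proof.
move=> cA hf.
have : compact (f @` A).
  apply: continuous_compact => //; apply/subspace_continuousP => x Ax; exact: hf.
move/compact_bounded => [M [_ hM]]; exists (Num.max 1 (M + 1)); split; first by rewrite lt_max ltr01.
move=> x Ax; apply: (le_trans (y := M + 1)); last by rewrite le_max lexx orbT.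
by apply: hM; [rewrite ltrDl|exists x].
Qed.
End WithinContinuity.

(** * Directional derivatives along lines *)

Section Directional.
Variable R : realType.
Notation V3 := (V3 R).

(** The quotient defining a directional derivative is that of a function of one real variable, so
    the chain rule and the mean value theorem on the line apply to functions known only to have
    partial derivatives. *)
Lemma line_quotient (g : V3 -> R) (x v : V3) (s : R) :
  (fun h : R => h^-1 *: (((fun t : R => g (x + t *: v)) \o shift s) (h *: (1 : R)) - g (x + s *: v)))
  = (fun h => h^-1 *: ((g \o shift (x + s *: v)) (h *: v) - g (x + s *: v))).
Proof.
apply/funext => h /=; congr (_ *: (g _ - _)).
by rewrite /= [h *: 1]mulr1 scalerDl addrCA.
Qed.

Lemma derivable_line (g : V3 -> R) (x v : V3) (s : R) :
  derivable (fun t : R => g (x + t *: v)) s 1 = derivable g (x + s *: v) v.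
Proof. by rewrite /derivable line_quotient. Qed.

Lemma derive_line (g : V3 -> R) (x v : V3) (s : R) :
  'D_1 (fun t : R => g (x + t *: v)) s = 'D_v g (x + s *: v).
Proof. by rewrite /derive line_quotient. Qed.

Lemma derive_compR (f : R -> R) (g : V3 -> R) (x v : V3) :
  derivable g x v -> derivable f (g x) 1 ->
  derivable (f \o g) x v /\ 'D_v (f \o g) x = 'D_1 f (g x) * 'D_v g x.
Proof.
have ex : x = x + (0 : R) *: v by rewrite scale0r addr0.
move=> dg df; pose l := fun t : R => g (x + t *: v).
have dl : derivable l 0 1 by rewrite derivable_line -ex.
have l0 : l 0 = g x by rewrite /l -ex.
have df' : derivable f (l 0) 1 by rewrite l0.
have d1 : derivable (f \o l) 0 1.
  by apply: (ex_derive (is_derive := is_derive1_comp (derivableP df') (derivableP dl))).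
have e1 : 'D_1 (f \o l) 0 = 'D_v (f \o g) (x + 0 *: v) := derive_line (f \o g) x v 0.
have e2 : 'D_1 l 0 = 'D_v g (x + 0 *: v) := derive_line g x v 0.
have e3 : derivable (f \o l) 0 1 = derivable (f \o g) (x + 0 *: v) v := derivable_line (f \o g) x v 0.
rewrite -ex in e1 e2 e3; rewrite -e3 -e1 -e2 -l0; split=> //.
by have := derive1_comp dl df'; rewrite !derive1E.
Qed.

(** The increment [s] may have either sign, hence the symmetric localisation of [t]; difference
    quotients at zero need both sides. *)
Lemma mvt_line (g : V3 -> R) (x v : V3) (s : R) :
  (forall t, `|t| <= `|s| -> derivable g (x + t *: v) v) ->
  exists2 t, `|t| <= `|s| & g (x + s *: v) - g x = s * 'D_v g (x + t *: v).
Proof.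
move=> dg; pose l := fun t : R => g (x + t *: v).
have dl (t : R) : `|t| <= `|s| -> is_derive t 1 l ('D_v g (x + t *: v)).
  move=> ht; split; first by rewrite derivable_line; exact: dg.
  exact: derive_line.
have l0 : l 0 = g x by rewrite /l scale0r addr0.
have H (a b : R) : a <= b -> (forall t, a <= t <= b -> `|t| <= `|s|) ->
    exists2 t, `|t| <= `|s| & l b - l a = (b - a) * 'D_v g (x + t *: v).
  move=> ab hab.
  have [||c] := @MVT_segment R l (fun t => 'D_v g (x + t *: v)) a b ab.
  - move=> t; rewrite in_itv /= => /andP[h1 h2]; apply: dl; apply: hab.
    by rewrite !ltW.
  - apply: derivable_within_continuous => t; rewrite in_itv /= => ht.
    by have [] := dl t (hab _ ht).
  - by rewrite in_itv /= => hc e; exists c; [exact: hab|rewrite e mulrC].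
case: (lerP 0 s) => s0.
  have [||t ht] := H 0 s => //.
    by move=> t /andP[h1 h2]; rewrite !ger0_norm //.
  by rewrite subr0 l0 => e; exists t.
have [||t ht] := H s 0; [exact: ltW| |].
  by move=> t /andP[h1 h2]; rewrite !ler0_norm ?(ltW s0) // lerN2.
by rewrite sub0r l0 mulNr => e; exists t => //; rewrite -[LHS]opprB e opprK.
Qed.
End Directional.

(** * Joint regularity and positive functionals *)
Section JointRegularity.
Variable R : realType.
Notation V3 := (V3 R).

(* [JC D S n K]: the map [(x, p) |-> K x p] and its iterated partial derivatives in [x] of order
   at most [n] exist and are jointly continuous on [D `*` S]. *)
Fixpoint JC (P : topologicalType) (D : set V3) (S : set P) (n : nat) (K : V3 -> P -> R) : Prop :=
  wcont (D `*` S) (fun z => K z.1 z.2) /\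
  if n is n'.+1 then forall k,
    (forall x p, D x -> S p -> derivable (K^~ p) x (ebasis R k)) /\
    JC D S n' (fun x p => pd k (K^~ p) x)
  else True.

Section Closure.
Variables (P : topologicalType) (D : set V3) (S : set P).
Hypothesis oD : open D.
Implicit Types K : V3 -> P -> R.

Lemma JC_wcont n K : JC D S n K -> wcont (D `*` S) (fun z => K z.1 z.2).
Proof. by case: n => [|n] []. Qed.

Lemma JC_derivable n K k x p : JC D S n.+1 K -> D x -> S p -> derivable (K^~ p) x (ebasis R k).
Proof. by move=> [_ /(_ k)[h _]]; exact: h. Qed.

Lemma JC_pd n K k : JC D S n.+1 K -> JC D S n (fun x p => pd k (K^~ p) x).
Proof. by move=> [_ /(_ k)[_]]. Qed.

Lemma JC_wcontx n K p : JC D S n K -> S p -> wcont D (K^~ p).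
Proof.
move=> /JC_wcont hK Sp; apply: (@wcont_comp _ _ _ D (D `*` S) (fun x => (x, p)) (fun z => K z.1 z.2)) => //.
by apply: wcont_pair; [exact: wcont_id|exact: wcont_cst].
Qed.

Lemma JC_leS n K : JC D S n.+1 K -> JC D S n K.
Proof.
elim: n K => [|n IH] K; first by move=> [].
move=> [h1 h2]; split=> // k; have [h3 h4] := h2 k; split=> //; exact: IH.
Qed.

Lemma JC_le m n K : (m <= n)%N -> JC D S n K -> JC D S m K.
Proof.
move=> mn; rewrite -(subnK mn); elim: (n - m)%N => [//|k IH] h.
by apply: IH; apply: JC_leS.
Qed.

Lemma JC_eq n K K' : (forall x p, D x -> S p -> K x p = K' x p) -> JC D S n K -> JC D S n K'.
Proof.
elim: n K K' => [|n IH] K K' e.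
  by move=> [h _]; split=> //; apply: wcont_eq h => -[x p] /= [Dx Sp]; exact: e.
move=> [h h']; split; first by apply: wcont_eq h => -[x p] /= [Dx Sp]; exact: e.
have E x p : D x -> S p -> \forall y \near x, K y p = K' y p.
  move=> Dx Sp; have : nbhs x D by exact: open_nbhs_nbhs.
  by apply: filterS => y Dy; exact: e.
move=> k; have [d1 d2] := h' k; split.
  by move=> x p Dx Sp; apply: near_eq_derivable (d1 x p Dx Sp); exact: E.
by apply: IH d2 => x p Dx Sp; apply: near_eq_derive; exact: E.
Qed.

(** Candidates for the partial derivatives are enough: an explicit [K'] may replace [pd k] on [D]
    times [S], and since [D] is open the replacement respects higher derivatives. *)
Lemma JC_S n K : wcont (D `*` S) (fun z => K z.1 z.2) ->
  (forall k, exists2 K', (forall x p, D x -> S p -> derivable (K^~ p) x (ebasis R k) /\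
       pd k (K^~ p) x = K' x p) & JC D S n K') -> JC D S n.+1 K.
Proof.
move=> hw h; split=> // k; have [K' h1 h2] := h k; split.
  by move=> x p Dx Sp; have [] := h1 x p Dx Sp.
by apply: JC_eq h2 => x p Dx Sp; have [_ ->] := h1 x p Dx Sp.
Qed.

Lemma JC_param n (f : P -> R) : wcont S f -> JC D S n (fun _ p => f p).
Proof.
have hw g : wcont S g -> wcont (D `*` S) (fun z : V3 * P => g z.2 : R).
  by move=> hg; apply: (@wcont_comp _ _ _ _ S) hg => //; [move=> z []|exact: wcont_snd].
elim: n f => [|n IH] f hf; first by split=> //; exact: hw.
apply: JC_S; first exact: hw.
move=> k; exists (fun _ _ => 0); last by apply: (IH (fun=> 0)); exact: wcont_cst.
by move=> x p _ _; split; [exact: derivable_cst|exact: derive_cst].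
Qed.

Lemma JC_cst n (c : R) : JC D S n (fun _ _ => c).
Proof. by apply: (@JC_param n (fun=> c)); exact: wcont_cst. Qed.

Lemma derive_coord i (x v : V3) : derivable (coord i) x v /\ 'D_v (coord i) x = coord i v.
Proof.
have h : (fun h : R => h^-1 *: ((coord i \o shift x) (h *: v) - coord i x)) @ 0^' --> coord i v.
  apply: cvg_near_cst; near=> h; rewrite /= coordD coordZ addrK.
  rewrite /GRing.scale /= mulKf //.
  by near: h; exact: nbhs_dnbhs_neq.
split; first by apply/cvg_ex; exists (coord i v).
exact/cvg_lim.
Unshelve. all: by end_near. Qed.

Lemma pd_coord i k (x : V3) : pd k (coord i) x = (k == i)%:R.
Proof. by rewrite /pd (derive_coord i x _).2 coord_ebasis. Qed.

Lemma JC_coord n i : JC D S n (fun x _ => coord i x).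
Proof.
have hw : wcont (D `*` S) (fun z : V3 * P => coord i z.1).
  by apply: (@wcont_comp _ _ _ _ D) => //; [move=> z []|exact: wcont_fst|exact/cont_wcont/coord_cont].
case: n => [|n]; first by [].
apply: JC_S => // k; exists (fun _ _ => (k == i)%:R); last exact: JC_cst.
by move=> x p _ _; split; [exact: (derive_coord i x _).1|exact: pd_coord].
Qed.

Lemma JC_add n K L : JC D S n K -> JC D S n L -> JC D S n (fun x p => K x p + L x p).
Proof.
elim: n K L => [|n IH] K L hK hL.
  by split=> //; apply: wcontD; [exact: JC_wcont hK|exact: JC_wcont hL].
apply: JC_S; first by apply: wcontD; [exact: JC_wcont hK|exact: JC_wcont hL].
move=> k; exists (fun x p => pd k (K^~ p) x + pd k (L^~ p) x).
  move=> x p Dx Sp; have d1 := JC_derivable (k := k) hK Dx Sp; have d2 := JC_derivable (k := k) hL Dx Sp.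
  by split; [exact: (derivableD d1 d2)|exact: (deriveD d1 d2)].
by apply: IH; exact: JC_pd.
Qed.

Lemma JC_mul n K L : JC D S n K -> JC D S n L -> JC D S n (fun x p => K x p * L x p).
Proof.
elim: n K L => [|n IH] K L hK hL.
  by split=> //; apply: wcontM; [exact: JC_wcont hK|exact: JC_wcont hL].
apply: JC_S; first by apply: wcontM; [exact: JC_wcont hK|exact: JC_wcont hL].
move=> k; exists (fun x p => K x p * pd k (L^~ p) x + L x p * pd k (K^~ p) x).
  move=> x p Dx Sp; have d1 := JC_derivable (k := k) hK Dx Sp; have d2 := JC_derivable (k := k) hL Dx Sp.
  by split; [exact: (derivableM d1 d2)|exact: (deriveM d1 d2)].
by apply: JC_add; apply: IH; (exact: JC_leS || exact: JC_pd).
Qed.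

Lemma JC_scale n (c : R) K : JC D S n K -> JC D S n (fun x p => c * K x p).
Proof. by apply: JC_mul; exact: JC_cst. Qed.

Lemma JC_opp n K : JC D S n K -> JC D S n (fun x p => - K x p).
Proof. by move=> h; apply: JC_eq (JC_scale (-1) h) => x p _ _; rewrite mulN1r. Qed.

Lemma JC_sub n K L : JC D S n K -> JC D S n L -> JC D S n (fun x p => K x p - L x p).
Proof. by move=> hK hL; apply: JC_add => //; exact: JC_opp. Qed.

Lemma JC_sum n (I : Type) (s : seq I) (F : I -> V3 -> P -> R) :
  (forall i, JC D S n (F i)) -> JC D S n (fun x p => \sum_(i <- s) F i x p).
Proof.
move=> h; elim: s => [|i s IH].
  by apply: JC_eq (JC_cst n 0) => x p _ _; rewrite big_nil.
by apply: JC_eq (JC_add (h i) IH) => x p _ _; rewrite big_cons.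
Qed.

Lemma JC_dot n : JC D S n (fun x _ => dot x x).
Proof. by rewrite /dot; apply: JC_sum => i; apply: JC_mul; exact: JC_coord. Qed.

Lemma derive_powR (a : R) (g : V3 -> R) (x v : V3) : derivable g x v -> 0 < g x ->
  derivable (fun x => powR (g x) a) x v /\
  'D_v (fun x => powR (g x) a) x = a * powR (g x) (a - 1) * 'D_v g x.
Proof.
move=> dg g0; have [d e] := is_derive1_powR a g0.
by have [d1 d2] := derive_compR dg d; split => //; rewrite -e -d2.
Qed.

Lemma JC_powR n (a : R) K : (forall x p, D x -> S p -> 0 < K x p) ->
  JC D S n K -> JC D S n (fun x p => powR (K x p) a).
Proof.
move=> h0; have hw m b : JC D S m K -> wcont (D `*` S) (fun z => powR (K z.1 z.2) b).
  by move=> /JC_wcont; apply: wcont_powR => -[x p] [Dx Sp]; exact: h0.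
elim: n a => [|n IH] a hK; first by split=> //; exact: hw hK.
apply: JC_S; first exact: hw hK.
move=> k; exists (fun x p => a * powR (K x p) (a - 1) * pd k (K^~ p) x).
  by move=> x p Dx Sp; apply: derive_powR; [exact: JC_derivable hK _ _|exact: h0].
apply: JC_mul; last exact: JC_pd.
by apply: JC_scale; apply: IH; exact: JC_leS.
Qed.
End Closure.

Lemma derive_affine (f : V3 -> R) (a : R) (b x v : V3) : derivable f (a *: x + b) v ->
  derivable (fun y => f (a *: y + b)) x v /\
  'D_v (fun y => f (a *: y + b)) x = a * 'D_v f (a *: x + b).
Proof.
move=> df; pose l := fun t : R => f (a *: x + b + t *: v).
have dl : derivable l 0 1 by rewrite derivable_line scale0r addr0.
have dz : is_derive (0 : R) 1 (fun t : R => a * t) a.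
  have := is_deriveM (is_derive_cst a (0 : R) (1 : R)) (is_derive_id (0 : R) (1 : R)).
  by move=> h; apply: is_derive_eq h _; rewrite /GRing.scale /= mulr0 addr0 mulr1.
have e : (fun t : R => f (a *: (x + t *: v) + b)) = l \o (fun t => a * t).
  by apply/funext => t; rewrite /l /= scalerDr scalerA addrAC.
have dl' : is_derive (a * 0) 1 l ('D_v f (a *: x + b)).
  rewrite mulr0; split=> //.
  by rewrite (derive_line f (a *: x + b) v 0) scale0r addr0.
have [d1 d2] := is_derive1_comp dl' dz; rewrite -e in d1 d2.
have e1 := derivable_line (fun y => f (a *: y + b)) x v 0.
have e2 := derive_line (fun y => f (a *: y + b)) x v 0.
rewrite scale0r addr0 in e1 e2.
by rewrite -e1 -e2 d2 mulrC.
Qed.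

(** Dilations, translations, restrictions and changes of parameter are all instances of the
    substitution [a p *: x + b p]; the chain rule along lines contributes the factor [a p]. *)
Lemma JC_affine (P P' : topologicalType) (D D' : set V3) (S : set P) (S' : set P') n
  (a : P' -> R) (b : P' -> V3) (c : P' -> P) (K : V3 -> P -> R) :
  open D -> open D' -> wcont S' a -> wcont S' b -> wcont S' c ->
  (forall x p, D' x -> S' p -> D (a p *: x + b p) /\ S (c p)) ->
  JC D S n K -> JC D' S' n (fun x p => K (a p *: x + b p) (c p)).
Proof.
move=> oD oD' ha hb hc hDS.
have hw2 (U : topologicalType) (g : P' -> U) : wcont S' g -> wcont (D' `*` S') (fun z : V3 * P' => g z.2).
  by move=> hg; apply: (@wcont_comp _ _ _ _ S') hg => //; [move=> z []|exact: wcont_snd].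
have hw L : wcont (D `*` S) (fun z => L z.1 z.2 : R) ->
    wcont (D' `*` S') (fun z => L (a z.2 *: z.1 + b z.2) (c z.2)).
  apply: (@wcont_comp _ _ _ (D' `*` S') (D `*` S) (fun z => (a z.2 *: z.1 + b z.2, c z.2)) (fun z => L z.1 z.2)).
    by move=> [x p] [/= Dx Sp]; exact: hDS.
  apply: wcont_pair; last exact: hw2.
  move=> z hz; apply: cvgD; last exact: (hw2 _ _ hb).
  apply: cvgZ; first exact: (hw2 _ _ ha).
  exact: (@wcont_fst V3 P').
elim: n K => [|n IH] K hK; first by split=> //; apply: hw; exact: JC_wcont hK.
apply: JC_S => //; first by apply: hw; exact: JC_wcont hK.
move=> k; exists (fun x p => a p * pd k (K^~ (c p)) (a p *: x + b p)).
  move=> x p Dx Sp; have [h1 h2] := hDS x p Dx Sp.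
  by have [d1 d2] := derive_affine (JC_derivable (k := k) hK h1 h2); split; [exact: d1|exact: d2].
apply: JC_mul => //; first exact: JC_param.
exact: (IH (fun x p => pd k (K^~ p) x) (JC_pd k hK)).
Qed.

Lemma JC_subset (P : topologicalType) (D D' : set V3) (S S' : set P) n K :
  open D -> open D' -> D' `<=` D -> S' `<=` S -> JC D S n K -> JC D' S' n K.
Proof.
move=> oD oD' DD SS h.
apply: JC_eq (JC_affine (a := fun=> 1) (b := fun=> 0) (c := fun p => p) oD oD' _ _ _ _ h) => //.
- by move=> x p _ _; rewrite scale1r addr0.
- exact: wcont_cst.
- exact: wcont_cst.
- exact: wcont_id.
- by move=> x p Dx Sp; rewrite scale1r addr0; split; [exact: DD|exact: SS].
Qed.

Lemma JC_fix (P Q : topologicalType) (D : set V3) (S : set P) (S' : set Q) n K (c : Q -> P) :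
  open D -> wcont S' c -> (forall q, S' q -> S (c q)) -> JC D S n K -> JC D S' n (fun x q => K x (c q)).
Proof.
move=> oD hc SS h.
apply: JC_eq (JC_affine (a := fun=> 1) (b := fun=> 0) (c := c) oD oD _ _ _ _ h) => //.
- by move=> x p _ _; rewrite scale1r addr0.
- exact: wcont_cst.
- exact: wcont_cst.
- by move=> x p Dx Sp; rewrite scale1r addr0; split; [|exact: SS].
Qed.
End JointRegularity.

(** * Positive linear forms and differentiation under them *)

Section PositiveFunctionals.
Variable R : realType.
Notation V3 := (V3 R).

(* Only the values on [S] of functions continuous on [S] matter: a positive linear form on C(S). *)
Definition posfun (T : topologicalType) (S : set T) (L : (T -> R) -> R) :=
  (forall (a b : R) (f g : T -> R), wcont S f -> wcont S g -> L (fun t => a * f t + b * g t) = a * L f + b * L g) /\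
  (forall f : T -> R, wcont S f -> (forall t, S t -> 0 <= f t) -> 0 <= L f).

Section Basics.
Variables (T : topologicalType) (S : set T) (L : (T -> R) -> R).
Hypothesis hL : posfun S L.
Implicit Types (f g : T -> R) (a c e : R).

Lemma posfunZ a f : wcont S f -> L (fun t => a * f t) = a * L f.
Proof.
move=> hf; have := hL.1 a 0 f f hf hf; rewrite mul0r addr0 => <-.
by f_equal; apply/funext => t; rewrite mul0r addr0.
Qed.
Lemma posfunD f g : wcont S f -> wcont S g -> L (fun t => f t + g t) = L f + L g.
Proof.
move=> hf hg; have := hL.1 1 1 f g hf hg; rewrite !mul1r => <-.
by f_equal; apply/funext => t; rewrite !mul1r.
Qed.
Lemma posfunB f g : wcont S f -> wcont S g -> L (fun t => f t - g t) = L f - L g.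
Proof.
move=> hf hg; have := hL.1 1 (-1) f g hf hg; rewrite mul1r mulN1r => <-.
by f_equal; apply/funext => t; rewrite mul1r mulN1r.
Qed.
Lemma posfun0 : L (fun _ => 0) = 0.
Proof.
by rewrite -[RHS](mul0r (L (fun _ => 0))) -posfunZ; [f_equal; apply/funext => t; rewrite mul0r|exact: wcont_cst].
Qed.
Lemma posfun_le f g : wcont S f -> wcont S g -> (forall t, S t -> f t <= g t) -> L f <= L g.
Proof.
move=> hf hg h; rewrite -subr_ge0 -posfunB //; apply: hL.2; first exact: wcontB.
by move=> t St; rewrite subr_ge0 h.
Qed.
Lemma posfun_eq f g : wcont S f -> (forall t, S t -> f t = g t) -> L f = L g.
Proof.
move=> hf h; have hg : wcont S g by exact: wcont_eq hf.
by apply/le_anti/andP; split; apply: posfun_le => // t St; rewrite h.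
Qed.
Lemma posfun_cst c : L (fun _ => c) = c * L (fun _ => 1).
Proof.
rewrite -posfunZ; last exact: wcont_cst.
by f_equal; apply/funext => t; rewrite mulr1.
Qed.
Lemma posfun1_ge0 : 0 <= L (fun _ => 1).
Proof. by apply: hL.2; [exact: wcont_cst|]. Qed.
Lemma posfun_norm f e : wcont S f -> (forall t, S t -> `|f t| <= e) -> `|L f| <= e * L (fun _ => 1).
Proof.
move=> hf h; rewrite -posfun_cst ler_norml.
have -> : - L (fun _ => e) = L (fun _ => - e) by rewrite (posfun_cst e) (posfun_cst (- e)) mulNr.
apply/andP; split; apply: posfun_le => //; try exact: wcont_cst.
all: by move=> t St; have := h t St; rewrite ler_norml => /andP[].
Qed.
Lemma posfun_sum (I : Type) (s : seq I) (F : I -> T -> R) : (forall i, wcont S (F i)) ->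
  L (fun t => \sum_(i <- s) F i t) = \sum_(i <- s) L (F i).
Proof.
move=> h; elim: s => [|i s IH].
  by rewrite big_nil -[RHS]posfun0; f_equal; apply/funext => t; rewrite big_nil.
rewrite big_cons -IH -posfunD //; last exact: wcont_sum.
by f_equal; apply/funext => t; rewrite big_cons.
Qed.
End Basics.

(** Compactness of [S] turns joint continuity into continuity uniform in the second variable, as in
    the tube lemma. *)
Lemma wcont_uniform (X T : topologicalType) (A : set X) (S : set T) (F : X * T -> R) x0 (e : R) :
  compact S -> wcont (A `*` S) F -> A x0 -> 0 < e ->
  \forall x \near within A (nbhs x0), forall t, S t -> `|F (x0, t) - F (x, t)| <= e.
Proof.
move=> /compact_near_coveringP/near_covering_withinP cS hF Ax0 e0.
apply: cS => t0 St0.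
have e2 : 0 < e / 2 by rewrite divr_gt0.
have /cvgrPdist_lt/(_ _ e2) := hF (x0, t0) (conj Ax0 St0).
case=> -[U V] [/= nU nV] UV.
exists (V, (fun x => A x /\ U x)).
  split=> //=; rewrite /within /= nbhs_simpl.
  by apply: filterS nU => x Ux Ax.
move=> [t x] /= [Vt [Ax Ux]] St.
have h1 := UV (x, t) (conj Ux Vt) (conj Ax St).
have h2 := UV (x0, t) (conj (nbhs_singleton nU) Vt) (conj Ax0 St).
have -> : F (x0, t) - F (x, t) = (F (x0, t0) - F (x, t)) - (F (x0, t0) - F (x0, t)) by ring.
apply: le_trans (ler_normB _ _) _; rewrite /= in h1 h2; lra.
Qed.

Section ParameterIntegral.
Variables (P T : topologicalType) (D : set V3) (S : set P) (S' : set T) (L : (T -> R) -> R).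
Hypotheses (oD : open D) (cS' : compact S') (hL : posfun S' L).
Implicit Types (K : V3 -> P * T -> R) (e : R).

Lemma JC_slice n K x p : JC D (S `*` S') n K -> D x -> S p -> wcont S' (fun t => K x (p, t)).
Proof.
move=> /JC_wcont hK Dx Sp.
apply: (@wcont_comp _ _ _ S' (D `*` (S `*` S')) (fun t => (x, (p, t))) (fun z => K z.1 z.2)) => //.
apply: wcont_pair; first exact: wcont_cst.
by apply: wcont_pair; [exact: wcont_cst|exact: wcont_id].
Qed.

Lemma posfun_near K x p e : JC D (S `*` S') 0 K -> D x -> S p -> 0 < e ->
  \forall z \near within (D `*` S) (nbhs (x, p)), forall t, S' t ->
    `|K x (p, t) - K z.1 (z.2, t)| <= e.
Proof.
move=> [hK _] Dx Sp e0.
apply: (@wcont_uniform (V3 * P)%type T (D `*` S) S' (fun w => K w.1.1 (w.1.2, w.2)) (x, p)) => //.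
apply: (@wcont_comp _ _ _ _ (D `*` (S `*` S')) (fun w : V3 * P * T => (w.1.1, (w.1.2, w.2)))
  (fun z => K z.1 z.2)) => //.
  by move=> -[[y q] t] /= [[Dy Sq] St].
have w1 : wcont ((D `*` S) `*` S') (fun w : V3 * P * T => w.1) by exact: wcont_fst.
apply: wcont_pair; last apply: wcont_pair; last exact: wcont_snd.
- by apply: (@wcont_comp _ _ _ _ setT _ (fun z : V3 * P => z.1)) w1 _ => //; exact: wcont_fst.
- by apply: (@wcont_comp _ _ _ _ setT _ (fun z : V3 * P => z.2)) w1 _ => //; exact: wcont_snd.
Qed.

Lemma wcont_posfun K : JC D (S `*` S') 0 K ->
  wcont (D `*` S) (fun z => L (fun t => K z.1 (z.2, t))).
Proof.
move=> hK [x p] [Dx Sp]; have M0 := posfun1_ge0 hL; set M := L (fun _ => 1) in M0.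
apply/cvgrPdist_le => e e0 /=.
(* The total mass [M] may vanish, hence the divisor [M + 1]. *)
have e1 : 0 < e / (M + 1) by rewrite divr_gt0 // ltr_wpDl.
have := posfun_near hK Dx Sp e1; rewrite !near_withinE; apply: filterS => -[y q] /= h [/= Dy Sq].
have w1 := JC_slice hK Dx Sp; have w2 := JC_slice hK Dy Sq.
rewrite -(posfunB hL) //.
apply: le_trans (posfun_norm hL (wcontB w1 w2) (h (conj Dy Sq))) _.
by rewrite -/M mulrAC ler_pdivrMr ?ltr_wpDl // ler_pM2l // lerDl.
Qed.

(** By the mean value theorem the difference quotient is close to the derivative uniformly on the
    compact [S'], and a positive form is bounded by its value at 1 times the sup norm. Regularity is
    asked in the direction [k] alone, because averages of merely continuous functions gain their
    derivatives one direction at a time. *)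
Lemma derive_posfun_dir K k x p : JC D (S `*` S') 0 K ->
  (forall x q, D x -> (S `*` S') q -> derivable (K^~ q) x (ebasis R k)) ->
  JC D (S `*` S') 0 (fun x p => pd k (K^~ p) x) -> D x -> S p ->
  derivable (fun x => L (fun t => K x (p, t))) x (ebasis R k) /\
  pd k (fun x => L (fun t => K x (p, t))) x = L (fun t => pd k (K^~ (p, t)) x).
Proof.
move=> hK dK hdK Dx Sp; have M0 := posfun1_ge0 hL; set M := L (fun _ => 1) in M0.
set v := ebasis R k.
suff H : (fun h : R => h^-1 *: (((fun x => L (fun t => K x (p, t))) \o shift x) (h *: v)
    - L (fun t => K x (p, t)))) @ 0^' --> L (fun t => pd k (K^~ (p, t)) x).
  split; first by apply/cvg_ex; exists (L (fun t => pd k (K^~ (p, t)) x)).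
  exact/cvg_lim.
apply/cvgrPdist_le => e e0.
have e1 : 0 < e / (M + 1) by rewrite divr_gt0 // ltr_wpDl.
have hx : \forall y \near x, D y /\ forall t, S' t ->
    `|pd k (K^~ (p, t)) x - pd k (K^~ (p, t)) y| <= e / (M + 1).
  have := posfun_near hdK Dx Sp e1; rewrite near_withinE => -[[U V] [/= nU nV] UV].
  have nD : nbhs x D by exact: open_nbhs_nbhs.
  apply: filterS2 nU nD => y Uy Dy; split=> //.
  exact: (UV (y, p) (conj Uy (nbhs_singleton nV)) (conj Dy Sp)).
have [d /= d0 hd] := (nbhs_normP _ _).1 hx.
have hd' : \forall h \near (0 : R), `|h| < d / (`|v| + 1).
  have d1 : 0 < d / (`|v| + 1) by rewrite divr_gt0 // ltr_wpDl.
  by have := nbhs0_lt d1.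
near=> h.
have h0 : h != 0 by near: h; exact: nbhs_dnbhs_neq.
have hh : `|h| < d / (`|v| + 1) by near: h; exact: cvg_within hd'.
have good s : `|s| <= `|h| -> D (x + s *: v) /\ forall t, S' t ->
    `|pd k (K^~ (p, t)) x - pd k (K^~ (p, t)) (x + s *: v)| <= e / (M + 1).
  move=> sh; apply: hd; rewrite /ball_ /= opprD addrA subrr sub0r normrN normrZ.
  apply: le_lt_trans (_ : `|h| * (`|v| + 1) < d); last by rewrite -ltr_pdivlMr // ltr_wpDl.
  by apply: ler_pM => //; rewrite lerDl.
have Dh : D (x + h *: v) by have [] := good h (lexx _).
have w1 := JC_slice hK Dx Sp; have w2 := JC_slice hK Dh Sp; have w3 := JC_slice hdK Dx Sp.
rewrite /= (addrC (h *: v)) -(posfunB hL w2 w1) /GRing.scale /=.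
have w4 : wcont S' (fun t => h^-1 * (K (x + h *: v) (p, t) - K x (p, t))).
  by apply: wcontZ; exact: wcontB.
rewrite -(posfunZ hL _ (wcontB w2 w1)) -(posfunB hL w3 w4).
apply: le_trans (posfun_norm hL (e := e / (M + 1)) (wcontB w3 w4) _) _.
  move=> t St.
  have [|s sh ->] := @mvt_line R (K^~ (p, t)) x v h.
    by move=> s sh; have [Ds _] := good s sh; exact: (dK _ (p, t) Ds (conj Sp St)).
  by rewrite mulKf //; have [_ hs] := good s sh; exact: hs.
by rewrite -/M mulrAC ler_pdivrMr ?ltr_wpDl // ler_pM2l // lerDl.
Unshelve. all: by end_near. Qed.

Lemma derive_posfun K k x p : JC D (S `*` S') 1 K -> D x -> S p ->
  derivable (fun x => L (fun t => K x (p, t))) x (ebasis R k) /\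
  pd k (fun x => L (fun t => K x (p, t))) x = L (fun t => pd k (K^~ (p, t)) x).
Proof.
move=> hK; apply: derive_posfun_dir; [exact: JC_leS hK| |exact: JC_pd].
by move=> y q Dy Sq; exact: JC_derivable hK Dy Sq.
Qed.

Lemma JC_posfun n K : JC D (S `*` S') n K -> JC D S n (fun x p => L (fun t => K x (p, t))).
Proof.
elim: n K => [|n IH] K hK; first by split=> //; exact: wcont_posfun.
apply: JC_S => //; first exact/wcont_posfun/(JC_le (leq0n _) hK).
move=> k; exists (fun x p => L (fun t => pd k (K^~ (p, t)) x)); last exact: (IH _ (JC_pd k hK)).
move=> x p Dx Sp; apply: derive_posfun => //; exact: JC_le hK.
Qed.
End ParameterIntegral.
End PositiveFunctionals.

(** * Continuously differentiable functions: increments, mixed derivatives, interior maxima *)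

Local Ltac path_bound ht c0 c1 :=
  (rewrite (_ : _ - _ = 0); [by rewrite normr0|ring]) ||
  (match type of ht with is_true (`|?t| <= _) => rewrite (_ : _ - _ = t); [exact: ht|ring] end) ||
  (rewrite (_ : _ - _ = c0); [exact: coord_le_norm|ring]) ||
  (rewrite (_ : _ - _ = c1); [exact: coord_le_norm|ring]).

Section Smoothness.
Variable R : realType.
Notation V3 := (V3 R).

(* The parameter of type [R] is a dummy. *)
Definition JCf (D : set V3) n (f : V3 -> R) := JC D [set: R] n (fun x _ => f x).

Lemma JCf_pd (D : set V3) n k f : JCf D n.+1 f -> JCf D n (pd k f).
Proof. exact: JC_pd. Qed.
Lemma JCf_derivable (D : set V3) n k f x : JCf D n.+1 f -> D x -> derivable f x (ebasis R k).
Proof. by move=> h Dx; exact: (@JC_derivable R R D setT n (fun x _ => f x) k x 0 h Dx I). Qed.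
Lemma JCf_wcont (D : set V3) n f : JCf D n f -> wcont D f.
Proof. by move=> h; exact: (JC_wcontx (p := 0) h). Qed.
Lemma JC_JCf (P : topologicalType) (D : set V3) (S : set P) n K p :
  open D -> JC D S n K -> S p -> JCf D n (fun x => K x p).
Proof. by move=> oD h Sp; apply: (JC_fix (c := fun=> p) oD) h; [exact: wcont_cst|]. Qed.
Definition linform (c : 'I_3 -> R) (h : V3) : R := \sum_(i < 3) coord i h * c i.
Fact linform_is_linear c : linear (linform c : V3 -> R^o).
Proof.
move=> a u v; rewrite /linform !sum3E !coordD !coordZ /GRing.scale /=; ring.
Qed.
HB.instance Definition _ c := @GRing.isLinear.Build R V3 R^o _ (linform c : V3 -> R^o) (linform_is_linear c).

(** The increment is followed along three edges parallel to the axes. In the sup norm every point of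
    this path stays as close to [x] as its end point, and the mean value theorem on each edge costs
    a third of the error. *)
Lemma C1_increment (D : set V3) f x (e : R) : open D -> JCf D 1 f -> D x -> 0 < e ->
  \forall h \near (0 : V3), `|f (h + x) - f x - linform (fun k => pd k f x) h| <= e * `|h|.
Proof.
move=> oD hf Dx e0; have e3 : 0 < e / 3 by rewrite divr_gt0.
have hx : \forall y \near x, D y /\ forall k, `|pd k f x - pd k f y| <= e / 3.
  have hk k : \forall y \near x, `|pd k f x - pd k f y| <= e / 3.
    have := wcont_open oD (JCf_wcont (JCf_pd k hf)) Dx.
    by move=> /cvgrPdist_le/(_ _ e3).
  have nD : nbhs x D by exact: open_nbhs_nbhs.
  apply: filterS (filterI nD (filterI (hk (inord 0)) (filterI (hk (inord 1)) (hk (inord 2))))).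
  move=> y [Dy [a0 [a1 a2]]]; split; first exact: Dy.
  by move=> k; case: (ord3P k) => ->; [exact: a0|exact: a1|exact: a2].
have [d /= d0 hd] := (nbhs_normP _ _).1 hx.
have hh : \forall h \near (0 : V3), `|h| < d by have := nbhs0_lt d0.
apply: filterS hh => h hlt.
have good y : (forall i, `|coord i (y - x)| <= `|h|) -> D y /\ forall k, `|pd k f x - pd k f y| <= e / 3.
  by move=> hy; apply: hd; rewrite /ball_ /= distrC; apply: le_lt_trans (norm_le_coord hy) hlt.
have step y k : (forall t, `|t| <= `|coord k h| -> forall i, `|coord i (y + t *: ebasis R k - x)| <= `|h|) ->
    `|f (y + coord k h *: ebasis R k) - f y - coord k h * pd k f x| <= e / 3 * `|h|.
  move=> hy; have [|t ht ->] := @mvt_line R f y (ebasis R k) (coord k h).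
    by move=> t ht; have [Dy _] := good _ (hy t ht); exact: (JCf_derivable hf Dy).
  have [_ /(_ k) h1] := good _ (hy t ht).
  rewrite -mulrBr normrM mulrC; apply: ler_pM => //; last exact: coord_le_norm.
  by rewrite distrC.
set c0 := coord (inord 0) h; set c1 := coord (inord 1) h; set c2 := coord (inord 2) h.
have hc i : `|coord i h| <= `|h| by exact: coord_le_norm.
have aux (k : 'I_3) (t : R) : `|t| <= `|coord k h| -> `|t| <= `|h| by move=> ht; exact: le_trans ht (hc k).
have s1 := step x (inord 0); have s2 := step (x + c0 *: ebasis R (inord 0)) (inord 1).
have s3 := step (x + c0 *: ebasis R (inord 0) + c1 *: ebasis R (inord 1)) (inord 2).
have e1 : x + c0 *: ebasis R (inord 0) + c1 *: ebasis R (inord 1) + c2 *: ebasis R (inord 2) = x + h.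
  by rewrite [in RHS](ebasis_sum h) sum3E !addrA.
rewrite -/c0 -/c1 -/c2 in s1 s2 s3; rewrite e1 in s3.
rewrite (addrC h x).
have -> : f (x + h) - f x - linform (fun k => pd k f x) h =
   (f (x + c0 *: ebasis R (inord 0)) - f x - c0 * pd (inord 0) f x)
 + (f (x + c0 *: ebasis R (inord 0) + c1 *: ebasis R (inord 1)) - f (x + c0 *: ebasis R (inord 0)) - c1 * pd (inord 1) f x)
 + (f (x + h) - f (x + c0 *: ebasis R (inord 0) + c1 *: ebasis R (inord 1)) - c2 * pd (inord 2) f x).
  rewrite /linform sum3E -/c0 -/c1 -/c2; move: (pd (inord 0) f x) (pd (inord 1) f x) (pd (inord 2) f x) => d0' d1' d2'.
  by move: (f _) (f _) (f _) (f _) => a0 a1 a2 a3; ring.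
apply: le_trans (ler_normD _ _) _; apply: le_trans (lerD (ler_normD _ _) (lexx _)) _.
have -> : e * `|h| = e / 3 * `|h| + e / 3 * `|h| + e / 3 * `|h| by field.
apply: lerD; first apply: lerD.
- by apply: s1 => t /aux ht i; rewrite !(coordD, coordN, coordZ, coord_ebasis);
    case: (ord3P i) => ->; rewrite -!val_eqE /= !inordK //=; path_bound ht c0 c1.
- by apply: s2 => t /aux ht i; rewrite !(coordD, coordN, coordZ, coord_ebasis);
    case: (ord3P i) => ->; rewrite -!val_eqE /= !inordK //=; path_bound ht c0 c1.
- by apply: s3 => t /aux ht i; rewrite !(coordD, coordN, coordZ, coord_ebasis);
    case: (ord3P i) => ->; rewrite -!val_eqE /= !inordK //=; path_bound ht c0 c1.
Qed.

Lemma linform_continuous c : continuous (linform c).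
Proof.
apply: wcont_setT; rewrite /linform; apply: wcont_sum => i; apply: wcontM; last exact: wcont_cst.
exact/cont_wcont/coord_cont.
Qed.

Lemma C1_differentiable (D : set V3) f x : open D -> JCf D 1 f -> D x -> differentiable f x.
Proof.
move=> oD hf Dx; pose c := fun k => pd k f x.
have h : (f : V3 -> R^o) \o shift x = cst (f x : R^o) + (linform c : V3 -> R^o) +o_ (0 : V3) id.
  apply/eqaddoP => e e0; have := C1_increment oD hf Dx e0.
  by apply: filterS => h; rewrite /= !fctE /= opprD addrA.
have cl : continuous (linform c : V3 -> R^o) by exact: linform_continuous.
have e : 'd (f : V3 -> R^o) x = (linform c : V3 -> R^o) :> (V3 -> R^o) by exact: diff_unique cl h.
by apply/diff_locallyP; rewrite e.
Qed.

Lemma C1_differentiable3 (D : set V3) (u : V3 -> V3) x :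
  open D -> (forall i, JCf D 1 (coord i \o u)) -> D x -> differentiable u x.
Proof.
move=> oD hu Dx.
have -> : u = (fun y => ((coord (inord 0) \o u) y, (coord (inord 1) \o u) y, (coord (inord 2) \o u) y)).
  by apply/funext => y; rewrite /= !coordE -!surjective_pairing.
by apply: differentiable_pair; [apply: differentiable_pair|]; exact: C1_differentiable (hu _) Dx.
Qed.

Lemma dist_half_trans (a b c c' e : R) : c' = c -> `|a - c| <= e / 2 -> `|b - c'| <= e / 2 -> `|a - b| <= e.
Proof. by move=> ->; rewrite !ler_norml => /andP[a1 a2] /andP[a3 a4]; lra. Qed.

(** The mean value theorem is applied to the increment in direction [l], then to [pd k f]. The left
    side is symmetric in [k] and [l] and the right side is not, which gives [schwarz]; with [k = l]
    it gives [interior_max]. *)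
Lemma second_difference (D : set V3) f x k l (h : R) : JCf D 2 f ->
  (forall s t : R, `|s| <= `|h| -> `|t| <= `|h| -> D (x + s *: ebasis R k + t *: ebasis R l)) ->
  exists s t : R, [/\ `|s| <= `|h|, `|t| <= `|h| &
    f (x + h *: ebasis R k + h *: ebasis R l) - f (x + h *: ebasis R l) - f (x + h *: ebasis R k) + f x
     = h * (h * pd l (pd k f) (x + s *: ebasis R k + t *: ebasis R l))].
Proof.
move=> hf hd; pose g y := f (y + h *: ebasis R l) - f y.
have Dg (s : R) : `|s| <= `|h| -> D (x + s *: ebasis R k) /\ D (x + s *: ebasis R k + h *: ebasis R l).
  move=> hs; split; last exact: hd.
  by have := hd s 0 hs; rewrite normr0 scale0r addr0; apply.
have dg (s : R) : `|s| <= `|h| -> derivable g (x + s *: ebasis R k) (ebasis R k) /\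
   pd k g (x + s *: ebasis R k) = pd k f (x + s *: ebasis R k + h *: ebasis R l) - pd k f (x + s *: ebasis R k).
  move=> hs; have [D1 D2] := Dg s hs.
  have d1 : derivable f (1 *: (x + s *: ebasis R k) + h *: ebasis R l) (ebasis R k).
    by rewrite scale1r; exact: JCf_derivable hf D2.
  have d2 : derivable f (x + s *: ebasis R k) (ebasis R k) by exact: JCf_derivable hf D1.
  have [] := derive_affine d1; rewrite mul1r !scale1r => d3 e3.
  have eg : g = (fun y => f (1 *: y + h *: ebasis R l)) - f.
    by apply/funext => y; rewrite /g fctE scale1r.
  split; first by rewrite eg; exact: (derivableB d3 d2).
  by rewrite /pd eg (deriveB d3 d2) e3.
have [|s hs e1] := @mvt_line R g x (ebasis R k) h; first by move=> s hs; have [] := dg s hs.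
have [|t ht e4] := @mvt_line R (pd k f) (x + s *: ebasis R k) (ebasis R l) h.
  by move=> t ht; exact: (JCf_derivable (JCf_pd k hf) (hd s t hs ht)).
exists s, t; split; [exact: hs|exact: ht|].
by rewrite -e4 -(dg s hs).2 -e1 /g; move: (f _) (f _) (f _) (f _) => a0 a1 a2 a3; ring.
Qed.

Lemma small_step x (d : R) k l (s t : R) : 0 < d -> `|s| <= `|d / 3| -> `|t| <= `|d / 3| ->
  ball_ Num.norm x d (x + s *: ebasis R k + t *: ebasis R l).
Proof.
move=> d0; have h0 : 0 < d / 3 by rewrite divr_gt0.
rewrite !(gtr0_norm h0) => hs ht; rewrite /ball_ /= -addrA opprD addrA subrr sub0r normrN.
have nb m : `|ebasis R m| <= 1.
  by apply: norm_le_coord => n; rewrite coord_ebasis normr_nat; case: (_ == _).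
apply: le_lt_trans (ler_normD _ _) _; rewrite !normrZ.
have q1 := ler_pM (normr_ge0 s) (normr_ge0 _) hs (nb k).
have q2 := ler_pM (normr_ge0 t) (normr_ge0 _) ht (nb l).
by apply: le_lt_trans (lerD q1 q2) _; lra.
Qed.

Lemma schwarz (D : set V3) f x i j : open D -> JCf D 2 f -> D x ->
  pd i (pd j f) x = pd j (pd i f) x.
Proof.
move=> oD hf Dx; apply/eqP; rewrite -subr_eq0 -normr_le0; apply/ler_addgt0Pl => e e0; rewrite addr0.
have e2 : 0 < e / 2 by rewrite divr_gt0.
have cc k l : \forall y \near x, `|pd k (pd l f) x - pd k (pd l f) y| <= e / 2.
  have := wcont_open oD (JCf_wcont (JCf_pd k (JCf_pd l hf))) Dx.
  by move=> /cvgrPdist_le/(_ _ e2).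
have hx : \forall y \near x, [/\ D y, `|pd i (pd j f) x - pd i (pd j f) y| <= e / 2
    & `|pd j (pd i f) x - pd j (pd i f) y| <= e / 2].
  have nD : nbhs x D by exact: open_nbhs_nbhs.
  apply: filterS (filterI nD (filterI (cc i j) (cc j i))) => y [Dy [a0 a1]]; split; [exact: Dy|exact: a0|exact: a1].
have [d /= d0 hd] := (nbhs_normP _ _).1 hx.
pose h := d / 3; have h0 : 0 < h by rewrite divr_gt0.
have key k l := @second_difference D f x k l h hf (fun s t hs ht => let: And3 a _ _ := hd _ (small_step x k l d0 hs ht) in a).
have [s [t [hs ht ez]]] := key i j; have [s' [t' [hs' ht' ez']]] := key j i.
have [_ h1 h2] := hd _ (small_step x i j d0 hs ht); have [_ h1' h2'] := hd _ (small_step x j i d0 hs' ht').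
have ee : pd j (pd i f) (x + s *: ebasis R i + t *: ebasis R j) = pd i (pd j f) (x + s' *: ebasis R j + t' *: ebasis R i).
  apply: (mulfI (lt0r_neq0 h0)); apply: (mulfI (lt0r_neq0 h0)).
  apply: etrans (esym ez) _; apply: etrans _ ez'; rewrite (addrAC x (h *: ebasis R j)).
  by move: (f _) (f _) (f _) (f _) => a0 a1 a2 a3; ring.
exact: (dist_half_trans ee h1' h2).
Qed.

(* At an interior maximum the second difference is nonpositive, hence so is the second derivative. *)
Lemma interior_max (D : set V3) f x k : open D -> JCf D 2 f -> D x ->
  (forall y, D y -> f y <= f x) -> pd k (pd k f) x <= 0.
Proof.
move=> oD hf Dx hmax; apply/ler_addgt0Pl => e e0; rewrite addr0.
have hx : \forall y \near x, D y /\ `|pd k (pd k f) x - pd k (pd k f) y| <= e.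
  have nD : nbhs x D by exact: open_nbhs_nbhs.
  have := wcont_open oD (JCf_wcont (JCf_pd k (JCf_pd k hf))) Dx.
  move=> /cvgrPdist_le/(_ _ e0) cc.
  by apply: filterS (filterI nD cc) => y [Dy a0]; split; [exact: Dy|exact: a0].
have [d /= d0 hd] := (nbhs_normP _ _).1 hx.
pose h := d / 3 / 2; have h0 : 0 < h by rewrite !divr_gt0.
have d3 : 0 < d / 3 by rewrite divr_gt0.
have hd3 (s : R) : `|s| <= `|h| -> `|s - h| <= `|d / 3|.
  rewrite (gtr0_norm h0) (gtr0_norm d3) !ler_norml => /andP[a b]; apply/andP; move: a b; rewrite /h; split; lra.
have hd4 (s : R) : `|s| <= `|h| -> `|s| <= `|d / 3|.
  by move=> hs; apply: le_trans hs _; rewrite (gtr0_norm h0) (gtr0_norm d3) /h; lra.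
(* Starting at [x - h e_k] centres the second difference at [x]: it becomes f(x + h e_k) - 2 f(x) +
   f(x - h e_k), nonpositive at a maximum. *)
pose x' := x + (- h) *: ebasis R k.
have mv (s t : R) : x' + s *: ebasis R k + t *: ebasis R k = x + (s - h) *: ebasis R k + t *: ebasis R k.
  by rewrite /x' scalerBl scaleNr -!addrA (addrCA (- _)) addrC -!addrA; congr (_ + _); rewrite addrC -addrA addrC -addrA (addrC (t *: _)).
have ok (s t : R) : `|s| <= `|h| -> `|t| <= `|h| -> D (x' + s *: ebasis R k + t *: ebasis R k) /\
    `|pd k (pd k f) x - pd k (pd k f) (x' + s *: ebasis R k + t *: ebasis R k)| <= e.
  by move=> hs ht; rewrite mv; exact: hd _ (small_step x k k d0 (hd3 _ hs) (hd4 _ ht)).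
have [s [t [hs ht ez]]] := second_difference hf (fun s t hs ht => (ok s t hs ht).1).
have [_ h1] := ok s t hs ht.
have e1 : x' + h *: ebasis R k = x by rewrite /x' scaleNr subrK.
have Dp : D (x + h *: ebasis R k).
  by have [] := ok h h (lexx _) (lexx _); rewrite e1.
have Dm : D x'.
  by have [] := ok 0 0; rewrite ?normr0 // !scale0r !addr0.
have q1 := hmax _ Dp; have q2 := hmax _ Dm.
rewrite e1 in ez.
have le0 : h * (h * pd k (pd k f) (x' + s *: ebasis R k + t *: ebasis R k)) <= 0.
  by rewrite -ez; move: q1 q2; move: (f _) (f _) (f _) => a b c; lra.
rewrite pmulr_rle0 // pmulr_rle0 // in le0.
move: h1 le0; move: (pd k (pd k f) x) (pd k (pd k f) _) => a b.
by rewrite ler_norml => /andP[a1 a2]; lra.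
Qed.
End Smoothness.

(** * Radial averages and Euler equations on star-shaped domains *)

Section RadialAverage.
Variable R : realType.
Notation V3 := (V3 R).
Local Notation leb := (@lebesgue_measure R).
Local Notation I01 := [set t : R | 0 <= t <= 1].

Lemma JCf_leS (D : set V3) n f : JCf D n.+1 f -> JCf D n f.
Proof. exact: JC_leS. Qed.

Lemma I01E : I01 = `[0, 1]%classic :> set R.
Proof. by apply/seteqP; split=> t; rewrite /= in_itv. Qed.

Lemma I01_compact : compact I01.
Proof. by rewrite I01E; exact: segment_compact. Qed.

Lemma wcont_within (A : set R) (f : R -> R) : wcont A f -> {within A, continuous f}.
Proof. by move=> h; apply/subspace_continuousP. Qed.

Lemma wcont_integrable (f : R -> R) : wcont I01 f -> leb.-integrable `[0, 1] (EFin \o f).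
Proof.
move=> hf; apply: continuous_compact_integrable; first exact: segment_compact.
by rewrite -I01E; exact: wcont_within.
Qed.

Lemma posfun_weighted (w : R -> R) : wcont I01 w -> (forall t, I01 t -> 0 <= w t) ->
  posfun I01 (fun f => \int[leb]_(t in `[0, 1]) (w t * f t)).
Proof.
move=> hw w0; split=> [a b f g hf hg|f hf f0]; last first.
  apply: Rintegral_ge0 => t; rewrite -I01E => ht; apply: mulr_ge0; [exact: w0|exact: f0].
have h1 := wcont_integrable (wcontM hw hf); have h2 := wcont_integrable (wcontM hw hg).
have m01 : measurable (`[0, 1]%classic : set R) by exact: measurable_itv.
rewrite -!RintegralZl // -RintegralD //; last 2 first.
- by apply: wcont_integrable; apply: wcontZ; exact: wcontM.
- by apply: wcont_integrable; apply: wcontZ; exact: wcontM.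
by apply: eq_Rintegral => t _; ring.
Qed.

Lemma wcont_powR0 (g : R) : 0 < g -> wcont I01 (fun t => powR t g).
Proof.
move=> g0 t /= /andP[t0 t1]; move: t0; rewrite le_eqVlt => /predU1P[<-|t0]; last first.
  apply: cvg_within_filter.
  have [d _] := is_derive1_powR g t0.
  have : {for t, continuous (fun y : R => powR y g)} by apply: differentiable_continuous; apply/derivable1_diffP.
  by [].
rewrite powR0 ?gt_eqF //; apply/cvgrPdist_lt => e e0.
rewrite near_withinE; near=> s => /andP[s0 s1].
rewrite sub0r normrN ger0_norm ?powR_ge0 //.
have -> : e = powR (powR e g^-1) g by rewrite -powRrM mulVf ?gt_eqF // powRr1 ?ltW.
apply: gt0_ltr_powR => //; rewrite ?nnegrE ?powR_ge0 //.
near: s; have e1 : 0 < powR e g^-1 by exact: powR_gt0.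
by apply: lt_nbhsl.
Unshelve. all: by end_near. Qed.

(** The derivative is asked for in the open interval only, because real powers of [t] are
    differentiated at positive arguments. *)
Lemma FTC01 (F f : R -> R) : wcont I01 f -> wcont I01 F ->
  (forall t : R, 0 < t < 1 -> is_derive t (1 : R) F (f t)) ->
  \int[leb]_(t in `[0, 1]) f t = F 1 - F 0.
Proof.
move=> hf hF h; have cF : {within `[0, 1], continuous F} by rewrite -I01E; exact: wcont_within.
have [_ c0 c1] := (continuous_within_itvP F ltr01).1 cF.
rewrite /Rintegral (@continuous_FTC2 R f F) ?ltr01 //.
- by rewrite -I01E; exact: wcont_within.
- by split=> // t; rewrite in_itv /= => /h [].
- by move=> t; rewrite in_itv /= => /h [_ <-]; rewrite derive1E.
Qed.

(** The weight for which t^(g + 1) f(t x) is a primitive along the ray once the Euler operator x .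
    grad + (g + 1) is applied to f; see [radial_ftc] and [euler_radial]. *)
Definition radial (g : R) (f : R -> R) : R := \int[leb]_(t in `[0, 1]) (powR t g * f t).

Lemma posfun_radial g : 0 < g -> posfun I01 (radial g).
Proof. by move=> g0; apply: posfun_weighted => [|t _]; [exact: wcont_powR0|exact: powR_ge0]. Qed.

Lemma derive_dir (D : set V3) f (y v : V3) : open D -> JCf D 1 f -> D y ->
  derivable f y v /\ 'D_v f y = \sum_(i < 3) coord i v * pd i f y.
Proof.
move=> oD hf Dy; have df := C1_differentiable oD hf Dy; split; first exact: diff_derivable.
rewrite deriveE // [in LHS](ebasis_sum v) !sum3E !linearD !linearZ /=.
by rewrite /pd !deriveE.
Qed.

Section Radial.
Variables (D : set V3) (g : R).
Hypotheses (oD : open D) (starD : forall (x : V3) t, D x -> 0 <= t <= 1 -> D (t *: x)) (g0 : 0 < g).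

Lemma powR_succ (t : R) : 0 <= t -> powR t (g + 1) = powR t g * t.
Proof.
move=> t0; rewrite powRD ?powRr1 //; apply/implyP => /eqP h; exfalso; move: h g0; lra.
Qed.

Lemma wcont_ray f x : JCf D 0 f -> D x -> wcont I01 (fun t => f (t *: x)).
Proof.
move=> /JCf_wcont hf Dx; apply: (@wcont_comp _ _ _ I01 D (fun t : R => t *: x)) hf.
  by move=> t ht; exact: starD.
by move=> t _; apply: cvg_within_filter; apply: cvgZr_tmp; exact: cvg_id.
Qed.

Lemma radial_ftc f x : JCf D 1 f -> D x ->
  f x = radial g (fun t => \sum_(i < 3) coord i (t *: x) * pd i f (t *: x) + (g + 1) * f (t *: x)).
Proof.
move=> hf Dx; pose F t := powR t (g + 1) * f (t *: x).
have wf := wcont_ray (JCf_leS hf) Dx.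
have wp := wcont_powR0 g0.
have wd i : wcont I01 (fun t => pd i f (t *: x)) := wcont_ray (JCf_pd i hf) Dx.
have g1 : 0 < g + 1 by rewrite addr_gt0.
transitivity (F 1 - F 0); first by rewrite /F scale1r powR1 mul1r powR0 ?gt_eqF // mul0r subr0.
apply/esym; apply: FTC01.
- apply: wcontM => //; apply: wcontD; last exact: wcontZ.
  apply: wcont_sum => i; apply: wcontM => //.
  by apply: (wcont_ray _ Dx); exact: JC_coord.
- by apply: wcontM => //; exact: wcont_powR0.
move=> t /andP[t0 t1]; have Dtx : D (t *: x) by apply: starD => //; rewrite !ltW.
have [d1 d2] := derive_dir x oD hf Dtx.
have il : is_derive t 1 (fun s => f (s *: x)) (\sum_(i < 3) coord i x * pd i f (t *: x)).
  have e1 := derivable_line f 0 x t; have e2 := derive_line f 0 x t.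
  rewrite add0r in e1 e2; have e3 : (fun s => f (0 + s *: x)) = (fun s => f (s *: x)).
    by apply/funext => s; rewrite add0r.
  by rewrite e3 in e1 e2; split; [rewrite e1|rewrite e2 d2].
have ip := is_derive1_powR (g + 1) t0.
apply: is_derive_eq (is_deriveM ip il) _.
rewrite addrK powR_succ ?ltW // !sum3E !coordZ /GRing.scale /=; ring.
Qed.

(** Uniqueness for the Euler equation: as [g + 1] is positive, no nonzero homogeneous solution is
    regular at the origin, so a solution is recovered from its right-hand side. *)
Lemma radial_solve f w x : JCf D 1 f -> (forall y, D y -> \sum_(i < 3) coord i y * pd i f y + (g + 1) * f y = w y) ->
  D x -> f x = radial g (fun t => w (t *: x)).
Proof.
move=> hf h Dx; rewrite (radial_ftc hf Dx); apply: eq_Rintegral => t.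
rewrite inE -I01E => ht; rewrite h //; exact: starD.
Qed.

Section Kernel.
Variables (P : topologicalType) (S : set P).

Lemma JC_ray n (K : V3 -> P -> R) : JC D S n K ->
  JC D (S `*` I01) n (fun x (q : P * R) => K (q.2 *: x) q.1).
Proof.
move=> hK.
apply: JC_eq (JC_affine (S' := S `*` I01) (a := fun q => q.2) (b := fun=> 0) (c := fun q => q.1) oD oD _ _ _ _ hK) => //.
- by move=> x p _ _; rewrite addr0.
- exact: wcont_snd.
- exact: wcont_cst.
- exact: wcont_fst.
- by move=> x [p t] Dx [/= Sp ht]; rewrite addr0; split => //; exact: starD.
Qed.

Lemma JC_radial n (K : V3 -> P -> R) : JC D S n K -> JC D S n (fun x p => radial g (fun t => K (t *: x) p)).
Proof. by move=> /JC_ray; apply: JC_posfun => //; [exact: I01_compact|exact: posfun_radial]. Qed.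

(** The chain rule in [t *: x] contributes a factor [t], which the weight absorbs by raising its
    exponent by one. *)
Lemma pd_radial (K : V3 -> P -> R) k x p : JC D S 1 K -> D x -> S p ->
  pd k (fun x => radial g (fun t => K (t *: x) p)) x =
  radial (g + 1) (fun t => pd k (K^~ p) (t *: x)).
Proof.
move=> hK Dx Sp; have [_ ->] := derive_posfun oD I01_compact (posfun_radial g0) k (JC_ray hK) Dx Sp.
apply: eq_Rintegral => t; rewrite inE -I01E => ht; have Dt := starD Dx ht; rewrite /= /pd.
have d0 : derivable (K^~ p) (t *: x + 0) (ebasis R k) by rewrite addr0; exact: JC_derivable hK Dt Sp.
have [_] := derive_affine d0.
have -> : (fun y => K (t *: y + 0) p) = (fun y => K (t *: y) p) by apply/funext => y; rewrite addr0.
by move=> ->; rewrite powR_succ ?(andP ht).1 // addr0 mulrA.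
Qed.

Lemma euler_radial (K : V3 -> P -> R) x p : JC D S 1 K -> D x -> S p ->
  \sum_(i < 3) coord i x * pd i (fun x => radial g (fun t => K (t *: x) p)) x
   + (g + 1) * radial g (fun t => K (t *: x) p) = K x p.
Proof.
move=> hK Dx Sp; have hf : JCf D 1 (K^~ p) := JC_JCf oD hK Sp.
have pr := posfun_radial g0; have g1 : 0 < g + 1 by rewrite addr_gt0.
have wf := wcont_ray (JCf_leS hf) Dx.
have wd i : wcont I01 (fun t => pd i (K^~ p) (t *: x)) := wcont_ray (JCf_pd i hf) Dx.
have wc i : wcont I01 (fun t => coord i x * (t * pd i (K^~ p) (t *: x))).
  by apply: wcontZ; apply: wcontM => //; exact: wcont_id.
have e i : coord i x * pd i (fun x => radial g (fun t => K (t *: x) p)) x =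
    radial g (fun t => coord i x * (t * pd i (K^~ p) (t *: x))).
  rewrite (posfunZ pr); last by apply: wcontM => //; exact: wcont_id.
  rewrite pd_radial //; congr (_ * _); apply: eq_Rintegral => t; rewrite inE -I01E => ht.
  by rewrite powR_succ ?(andP ht).1 // mulrA.
rewrite (eq_bigr _ (fun i _ => e i)) -(posfun_sum pr) // -(posfunZ pr) // -(posfunD pr) //; last 2 first.
- exact: wcont_sum.
- exact: wcontZ.
rewrite [RHS](radial_ftc hf Dx); congr radial; apply/funext => t; congr (_ + _).
by apply: eq_bigr => i _; rewrite coordZ; ring.
Qed.
End Kernel.
End Radial.
End RadialAverage.

(** * Calculus of partial derivatives and of the Laplacian *)

Section PartialCalculus.
Variable R : realType.
Notation V3 := (V3 R).
Variable D : set V3.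
Hypothesis oD : open D.
Implicit Types (f g : V3 -> R) (x : V3) (i j k l : 'I_3).

Lemma pd_on f g k x : (forall y, D y -> f y = g y) -> D x -> pd k f x = pd k g x.
Proof.
move=> e Dx; apply: near_eq_derive.
by have : nbhs x D by [exact: open_nbhs_nbhs]; apply: filterS => y Dy; exact: e.
Qed.

Lemma pd_D f g k x : JCf D 1 f -> JCf D 1 g -> D x ->
  pd k (fun y => f y + g y) x = pd k f x + pd k g x.
Proof. by move=> hf hg Dx; exact: (deriveD (JCf_derivable hf Dx) (JCf_derivable hg Dx)). Qed.

Lemma pd_B f g k x : JCf D 1 f -> JCf D 1 g -> D x ->
  pd k (fun y => f y - g y) x = pd k f x - pd k g x.
Proof. by move=> hf hg Dx; exact: (deriveB (JCf_derivable hf Dx) (JCf_derivable hg Dx)). Qed.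

Lemma pd_M f g k x : JCf D 1 f -> JCf D 1 g -> D x ->
  pd k (fun y => f y * g y) x = f x * pd k g x + g x * pd k f x.
Proof. by move=> hf hg Dx; exact: (deriveM (JCf_derivable hf Dx) (JCf_derivable hg Dx)). Qed.

Lemma pd_cst (c : R) k x : pd k (fun=> c) x = 0.
Proof. exact: derive_cst. Qed.

Lemma pd_Z (c : R) f k x : JCf D 1 f -> D x -> pd k (fun y => c * f y) x = c * pd k f x.
Proof.
move=> hf Dx; have c1 : JCf D 1 (fun=> c) by exact: JC_cst.
by rewrite (pd_M k c1 hf Dx) pd_cst mulr0 addr0.
Qed.

Lemma pd_powR f a k x : JCf D 1 f -> D x -> 0 < f x ->
  pd k (fun y => powR (f y) a) x = a * powR (f x) (a - 1) * pd k f x.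
Proof. by move=> hf Dx f0; exact: (derive_powR a (JCf_derivable hf Dx) f0).2. Qed.

Local Opaque JC pd.

Lemma JCf_sum n (F : 'I_3 -> V3 -> R) : (forall i, JCf D n (F i)) -> JCf D n (fun y => \sum_(i < 3) F i y).
Proof. exact: JC_sum. Qed.

Lemma pd_sum (F : 'I_3 -> V3 -> R) k x : (forall i, JCf D 1 (F i)) -> D x ->
  pd k (fun y => \sum_(i < 3) F i y) x = \sum_(i < 3) pd k (F i) x.
Proof.
move=> hF Dx; rewrite sum3E.
have -> : (fun y => \sum_(i < 3) F i y) = (fun y => F (inord 0) y + F (inord 1) y + F (inord 2) y).
  by apply/funext => y; rewrite sum3E.
by rewrite (pd_D k (JC_add oD (hF _) (hF _)) (hF _) Dx) (pd_D k (hF _) (hF _) Dx).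
Qed.

Lemma JCf_le m n f : (m <= n)%N -> JCf D n f -> JCf D m f.
Proof. exact: JC_le. Qed.

Definition lap f x := \sum_(k < 3) pd k (pd k f) x.

Lemma JCf_lap n f : JCf D n.+2 f -> JCf D n (lap f).
Proof. by move=> hf; apply: JCf_sum => i; exact: JCf_pd (JCf_pd _ hf). Qed.

Lemma lap_pd f k x : JCf D 3 f -> D x -> lap (pd k f) x = pd k (lap f) x.
Proof.
move=> hf Dx.
apply: etrans _ (esym (pd_sum (F := fun i => pd i (pd i f)) k (fun i => JCf_pd i (JCf_pd i hf)) Dx)).
apply: eq_bigr => i _; apply: etrans _ (schwarz i k oD (JCf_pd i hf) Dx).
by apply: pd_on Dx => y Dy; exact: schwarz oD (JCf_leS hf) Dy.
Qed.

Lemma lap_on f g x : (forall y, D y -> f y = g y) -> D x -> lap f x = lap g x.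
Proof.
by move=> e Dx; apply: eq_bigr => i _; apply: pd_on Dx => y Dy; exact: pd_on Dy.
Qed.

Lemma pd_eq0 f k x : (forall y, D y -> f y = 0) -> D x -> pd k f x = 0.
Proof. by move=> e Dx; apply: etrans (pd_on k e Dx) (pd_cst 0 k x). Qed.

Lemma lap_D f g x : JCf D 2 f -> JCf D 2 g -> D x -> lap (fun y => f y + g y) x = lap f x + lap g x.
Proof.
move=> hf hg Dx; rewrite /lap -big_split /=; apply: eq_bigr => i _.
apply: etrans (pd_on (g := fun y => pd i f y + pd i g y) _ _ Dx) _.
  by move=> y Dy; exact: pd_D (JCf_leS hf) (JCf_leS hg) Dy.
exact: pd_D (JCf_pd i hf) (JCf_pd i hg) Dx.
Qed.

Lemma lap_Z (c : R) f x : JCf D 2 f -> D x -> lap (fun y => c * f y) x = c * lap f x.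
Proof.
move=> hf Dx; rewrite /lap mulr_sumr; apply: eq_bigr => i _.
apply: etrans (pd_on (g := fun y => c * pd i f y) _ _ Dx) _.
  by move=> y Dy; exact: pd_Z (JCf_leS hf) Dy.
exact: pd_Z (JCf_pd i hf) Dx.
Qed.

Definition weight x : R := 1 - dot x x.

Lemma JCf_dot n : JCf D n (fun x => dot x x).
Proof. exact: JC_dot. Qed.

Lemma JCf_weight n : JCf D n weight.
Proof. by apply: JC_sub => //; [exact: JC_cst|exact: JC_dot]. Qed.

Lemma JCf_coord n i : JCf D n (coord i).
Proof. exact: JC_coord. Qed.

Lemma pd_dot k x : D x -> pd k (fun y => dot y y) x = 2 * coord k x.
Proof.
move=> Dx; rewrite /dot pd_sum //; last by move=> i; apply: JC_mul => //; exact: JC_coord.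
rewrite (eq_bigr (fun i => (i == k)%:R * (2 * coord k x))); last first.
  move=> i _; rewrite (pd_M k (JCf_coord 1 i) (JCf_coord 1 i) Dx) !pd_coord eq_sym.
  by case: eqP => [->|_]; rewrite ?mulr0 ?addr0 ?mul0r // mulr1 mul1r mulrDl mul1r.
rewrite (bigD1 k) //= big1 ?addr0 ?eqxx ?mul1r // => i /negbTE ->; exact: mul0r.
Qed.

Lemma pd_weight k x : D x -> pd k weight x = - 2 * coord k x.
Proof.
move=> Dx; have c1 : JCf D 1 (fun=> 1) by exact: JC_cst.
apply: etrans (pd_B k c1 (JCf_dot 1) Dx) _.
by rewrite pd_cst pd_dot // sub0r mulNr.
Qed.

(** The product rule with grad weight = - 2 x and lap weight = - 6. *)
Lemma lap_weight f x : JCf D 2 f -> D x ->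
  lap (fun y => weight y * f y) x =
  weight x * lap f x - 4 * (\sum_(k < 3) coord k x * pd k f x) - 6 * f x.
Proof.
move=> hf Dx; have h1 := JCf_leS hf.
have e k : pd k (pd k (fun y => weight y * f y)) x =
    weight x * pd k (pd k f) x + (- 4) * (coord k x * pd k f x) - 2 * f x.
  apply: etrans (pd_on (g := fun y => weight y * pd k f y + f y * (- 2 * coord k y)) _ _ Dx) _.
    by move=> y Dy; rewrite (pd_M k (JCf_weight 1) h1 Dy) (pd_weight k Dy).
  have hc : JCf D 1 (fun y => - 2 * coord k y) by exact: (JC_scale oD (- 2) (JCf_coord 1 k)).
  have w1 := JCf_weight 1; have p1 := JCf_pd k hf.
  rewrite (pd_D k (JC_mul oD w1 p1) (JC_mul oD h1 hc) Dx) (pd_M k w1 p1 Dx) (pd_M k h1 hc Dx).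
  rewrite (pd_weight k Dx) (pd_Z (- 2) k (JCf_coord 1 k) Dx) pd_coord eqxx mulr1.
  by move: (pd k (pd k f) x) (pd k f x) => a b; ring.
apply: etrans (eq_bigr _ (fun k _ => e k)) _.
rewrite !big_split /= sumrN -!mulr_sumr -/(lap f x).
rewrite (sum3E (fun=> f x)).
by move: (lap f x) (\sum_(i < 3) _) => a b; ring.
Qed.

Section Star.
Hypothesis starD : forall (x : V3) t, D x -> 0 <= t <= 1 -> D (t *: x).
Definition Tf (g : R) f x := radial g (fun t => f (t *: x)).
Variable (g : R).
Hypothesis g0 : 0 < g.

Lemma JCf_Tf n f : JCf D n f -> JCf D n (Tf g f).
Proof. by move=> h; exact: (JC_radial oD starD g0 h). Qed.

Lemma pd_Tf f k x : JCf D 1 f -> D x -> pd k (Tf g f) x = Tf (g + 1) (pd k f) x.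
Proof. by move=> h Dx; exact: (pd_radial oD starD g0 (K := fun x (_ : R) => f x) k h Dx (p := 0) I). Qed.

Lemma euler_Tf f x : JCf D 1 f -> D x ->
  \sum_(i < 3) coord i x * pd i (Tf g f) x = f x - (g + 1) * Tf g f x.
Proof.
move=> h Dx; have <- := euler_radial oD starD g0 (K := fun x (_ : R) => f x) h Dx (p := 0) I.
by rewrite addrK.
Qed.

Lemma Tf_on f f' x : (forall y, D y -> f y = f' y) -> D x -> Tf g f x = Tf g f' x.
Proof.
move=> e Dx; apply: eq_Rintegral => t; rewrite inE -I01E => ht; rewrite e //; exact: starD.
Qed.

Lemma Tf_eq0 f x : (forall y, D y -> f y = 0) -> D x -> Tf g f x = 0.
Proof.
move=> e Dx; rewrite (Tf_on e Dx); have := posfun0 (posfun_radial g0); by [].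
Qed.

Lemma Tf_sum (F : 'I_3 -> V3 -> R) x : (forall i, JCf D 0 (F i)) -> D x ->
  \sum_(i < 3) Tf g (F i) x = Tf g (fun y => \sum_(i < 3) F i y) x.
Proof.
move=> h Dx; rewrite /Tf (posfun_sum (posfun_radial g0)) // => i.
exact: (wcont_ray starD (h i) Dx).
Qed.
End Star.

Lemma lap_Tf (starD : forall (x : V3) t, D x -> 0 <= t <= 1 -> D (t *: x)) (g : R) f x :
  0 < g -> JCf D 2 f -> (forall y, D y -> lap f y = 0) -> D x -> lap (Tf g f) x = 0.
Proof.
move=> g0 hf h0 Dx; have g1 : 0 < g + 1 by rewrite addr_gt0.
have g2 : 0 < g + 1 + 1 by rewrite addr_gt0.
rewrite /lap (eq_bigr (fun k => Tf (g + 1 + 1) (pd k (pd k f)) x)).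
  rewrite (Tf_sum starD g2 (F := fun k => pd k (pd k f))) //.
    exact: (Tf_eq0 starD g2 h0 Dx).
  by move=> i; exact: (JCf_pd i (JCf_pd i hf)).
move=> k _; apply: etrans (pd_on k _ Dx) (pd_Tf starD g1 k (JCf_pd k hf) Dx).
by move=> y Dy; exact: (pd_Tf starD g0 k (JCf_leS hf) Dy).
Qed.
End PartialCalculus.

(** * Solutions of the system built from a harmonic function *)

Section LameColumn.
Variable R : realType.
Notation V3 := (V3 R).
Variables (lam mu : R).
Hypotheses (hmu : 0 < mu) (hlm : 0 < 2 * mu + lam).
Notation al := (alpha_e lam mu).
Notation be := (beta_e lam mu).
Local Opaque JC pd.

Lemma lam3mu_gt0 : 0 < lam + 3 * mu. Proof. by move: hmu hlm; lra. Qed.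
Lemma alpha_lt1 : 0 < 1 - al.
Proof.
rewrite /alpha_e; have h := lam3mu_gt0; rewrite subr_gt0 ltr_pdivrMr //; move: hmu hlm; lra.
Qed.
Definition lameop (v : 'I_3 -> V3 -> R) (i : 'I_3) (x : V3) : R :=
  mu * lap (v i) x + (lam + mu) * (\sum_(j < 3) pd i (pd j (v j)) x).

Lemma lameopE (u : V3 -> V3) i x : lame_op_comp lam mu u i x = lameop (fun j => coord j \o u) i x.
Proof. by []. Qed.

Variable D : set V3.
Hypotheses (oD : open D) (starD : forall (x : V3) t, D x -> 0 <= t <= 1 -> D (t *: x)).

(** The coefficients of [W] and of [m] vanish separately: the first condition fixes [beta_e], the
    second [alpha_e]. Here [W] stands for a second derivative of a harmonic function and [m] for its
    radial average. *)
Lemma lame_algebra (W m : R) :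
  mu * (be * (- 4 * (W - (1 - al + 1) * m) - 6 * m)) +
  (lam + mu) * (W - 2 * be * (m + (W - (1 - al + 1) * m))) = 0.
Proof.
have h := lam3mu_gt0; have h0 : lam + 3 * mu != 0 by rewrite gt_eqF.
have -> : be = (lam + mu) / (2 * (lam + 3 * mu)) by rewrite /beta_e; congr (_ / _); ring.
rewrite /alpha_e; field.
by rewrite h0.
Qed.

(** The fields [M i], radial averages of second derivatives of the harmonic [p], are harmonic,
    divergence free and curl free. With the Euler equation every term of the operator becomes a
    combination of [pd i (pd j p) x] and [M i x], and [lame_algebra] concludes. *)
Lemma lame_column (p : V3 -> R) j i x : JCf D 5 p -> (forall y, D y -> lap p y = 0) -> D x ->
  lameop (fun i y => (i == j)%:R * p y + be * (weight y * Tf (1 - al) (pd i (pd j p)) y)) i x = 0.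
Proof.
move=> hp h0 Dx; have a1 := alpha_lt1; have a2 : 0 < 1 - al + 1 by rewrite addr_gt0.
pose M i := Tf (1 - al) (pd i (pd j p)).
have hq k : JCf D 3 (pd k (pd j p)) by exact: JCf_pd (JCf_pd _ hp).
have hM k : JCf D 3 (M k) := JCf_Tf oD starD a1 (hq k).
have hM2 k := JCf_le (n := 3) (m := 2) isT (hM k).
have hM1 k := JCf_le (m := 1) (n := 3) isT (hM k).
have hp4 := JCf_leS hp; have hp3 := JCf_leS hp4; have hp2 := JCf_leS hp3; have hp1 := JCf_leS hp2.
have hw n := JCf_weight oD n.
have hwM k : JCf D 2 (fun y => weight y * M k y) := JC_mul oD (hw 2) (hM2 k).
have hlp y : D y -> lap (pd j p) y = 0.
  by move=> Dy; rewrite (lap_pd oD j hp3 Dy); exact: (@pd_eq0 R D oD (lap p) j y h0 Dy).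
have pdM l k y : D y -> pd l (M k) y = Tf (1 - al + 1) (pd l (pd k (pd j p))) y.
  by move=> Dy; exact: (pd_Tf oD starD a1 l (JCf_le (m := 1) (n := 3) isT (hq k)) Dy).
have divM y : D y -> \sum_(l < 3) pd l (M l) y = 0.
  move=> Dy; rewrite (eq_bigr _ (fun l _ => pdM l l y Dy)).
  rewrite (Tf_sum starD a2 (F := fun l => pd l (pd l (pd j p))) _ Dy); last first.
    by move=> l; exact: (JCf_le (m := 0) (n := 2) isT (JCf_pd l (hq l))).
  exact: (Tf_eq0 starD a2 hlp Dy).
have symM l k y : D y -> pd l (M k) y = pd k (M l) y.
  move=> Dy; apply: etrans (pdM l k y Dy) _; apply: etrans _ (esym (pdM k l y Dy)).
  apply: (Tf_on starD _ _ Dy) => z Dz.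
  exact: (schwarz l k oD (JCf_pd j hp3) Dz).
have eulM k y : D y -> \sum_(l < 3) coord l y * pd l (M k) y = pd k (pd j p) y - (1 - al + 1) * M k y.
  by move=> Dy; exact: (euler_Tf oD starD a1 (JCf_le (m := 1) (n := 3) isT (hq k)) Dy).
pose v k y := (k == j)%:R * p y + be * (weight y * M k y).
have hdp k y : D y -> pd k (v k) y =
    (k == j)%:R * pd k p y + be * (M k y * (- 2 * coord k y) + weight y * pd k (M k) y).
  move=> Dy; rewrite /v (pd_D k (JC_scale oD _ hp1) (JC_scale oD _ (JCf_leS (hwM k))) Dy).
  rewrite (pd_Z oD _ k hp1 Dy) (pd_Z oD _ k (JCf_leS (hwM k)) Dy).
  rewrite (pd_M k (hw 1) (hM1 k) Dy) (pd_weight oD k Dy).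
  by rewrite [X in be * X]addrC.
have hdiv y : D y -> \sum_(k < 3) pd k (v k) y = pd j p y - 2 * be * (\sum_(k < 3) coord k y * M k y).
  move=> Dy; rewrite (eq_bigr _ (fun k _ => hdp k y Dy)) big_split /=; congr (_ + _).
    rewrite (bigD1 j) //= eqxx mul1r big1 ?addr0 // => k /negbTE ->; exact: mul0r.
  rewrite -mulr_sumr big_split /= -mulr_sumr divM // mulr0 addr0 -mulNr mulrC.
  rewrite mulr_suml mulr_sumr; apply: eq_bigr => k _.
  by move: (M k y) (coord k y) => a b; ring.
have hcM k : JCf D 1 (fun y => coord k y * M k y) := JC_mul oD (JCf_coord oD 1 k) (hM1 k).
have hvk k : JCf D 2 (v k) := JC_add oD (JC_scale oD _ hp2) (JC_scale oD _ (hwM k)).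
have e2 : \sum_(k < 3) pd i (pd k (v k)) x =
    pd i (pd j p) x - 2 * be * (M i x + (pd i (pd j p) x - (1 - al + 1) * M i x)).
  rewrite -(pd_sum oD (F := fun k => pd k (v k)) i (fun k => JCf_pd k (hvk k)) Dx).
  rewrite (pd_on oD i hdiv Dx).
  have hs := JCf_sum oD hcM.
  rewrite (pd_B i (JCf_pd j hp2) (JC_scale oD (2 * be) hs) Dx) (pd_Z oD _ i hs Dx).
  rewrite (pd_sum oD i hcM Dx); congr (_ - _ * _).
  rewrite -(eulM i x Dx).
  have e k : pd i (fun y => coord k y * M k y) x = (k == i)%:R * M i x + coord k x * pd k (M i) x.
    rewrite (pd_M i (JCf_coord oD 1 k) (hM1 k) Dx) pd_coord (symM i k x Dx) addrC eq_sym.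
    by congr (_ + _); case: eqP => [->|_]; rewrite ?mulr1 ?mul1r ?mulr0 ?mul0r.
  rewrite (eq_bigr _ (fun k _ => e k)) big_split /=; congr (_ + _).
  rewrite (bigD1 i) //= eqxx mul1r big1 ?addr0 // => k /negbTE ->; exact: mul0r.
have e1 : lap (v i) x = be * (- 4 * (pd i (pd j p) x - (1 - al + 1) * M i x) - 6 * M i x).
  rewrite /v (lap_D oD (JC_scale oD _ hp2) (JC_scale oD _ (hwM i)) Dx).
  rewrite (lap_Z oD _ hp2 Dx) (lap_Z oD _ (hwM i) Dx) h0 // mulr0 add0r.
  rewrite (lap_weight oD (hM2 i) Dx) (eulM i x Dx).
  rewrite (lap_Tf oD starD a1 (JCf_le (m := 2) (n := 3) isT (hq i)) _ Dx); last first.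
    move=> y Dy; rewrite (lap_pd oD i (JCf_pd j hp4) Dy); exact: (@pd_eq0 R D oD (lap (pd j p)) i y hlp Dy).
  by move: (pd i (pd j p) x) (M i x) => a b; ring.
apply: etrans (f_equal2 (fun a b => mu * a + (lam + mu) * b) e1 e2) _.
exact: lame_algebra.
Qed.
End LameColumn.

(** * The elastic Poisson kernel *)
Section Kernels.
Variable R : realType.
Notation V3 := (V3 R).
Local Notation B := (@ball3 R).
Local Notation S := (@sphere3 R).
Local Notation I01 := [set t : R | 0 <= t <= 1].
Local Notation leb := (@lebesgue_measure R).
Implicit Types (x e : V3) (i j k : 'I_3).

Definition sqd x e : R := dot (x - e) (x - e).
Definition Aq (a : R) x e : R := powR (sqd x e) a.
(** [4 pi] times the Poisson kernel ([poissonP_Pn]), in real powers of the squared distance so that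
    [JC_powR] applies. *)
Definition Pn x e : R := weight x * Aq (- (3 / 2)) x e.
(** The Hessian of [Pn] in [x] ([pd2_Pn]), sorted by powers of the distance to the pole with a view
    to [Wk_bound]. *)
Definition Wk i j x e : R :=
  - 2 * (i == j)%:R * Aq (- (3 / 2)) x e
  + (6 * (coord i x * coord j (x - e) + coord j x * coord i (x - e))
     - 3 * (i == j)%:R * weight x) * Aq (- (3 / 2) - 1) x e
  + 15 * weight x * (coord i (x - e) * coord j (x - e)) * Aq (- (3 / 2) - 1 - 1) x e.

Lemma B_open : open B. Proof. exact: ball3_open. Qed.
Lemma B_star x (t : R) : B x -> 0 <= t <= 1 -> B (t *: x).
Proof. exact: ball3Z. Qed.

Lemma sqd_gt0 x e : B x -> S e -> 0 < sqd x e.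
Proof. by move=> Bx Se; rewrite /sqd -enorm2 exprn_gt0 // ball3_sphere. Qed.

Lemma wcont_coordS k : wcont S (coord k : V3 -> R).
Proof. exact/cont_wcont/coord_cont. Qed.

Lemma JC_coordB n k : JC B S n (fun x e => coord k (x - e)).
Proof.
apply: (JC_eq B_open _ (JC_sub B_open (JC_coord S B_open n k) (JC_param B_open n (@wcont_coordS k)))).
by move=> x e _ _; rewrite coordB.
Qed.

Lemma JC_sqd n : JC B S n sqd.
Proof.
by rewrite /sqd /dot; apply: (JC_sum B_open) => i; apply: (JC_mul B_open); exact: JC_coordB.
Qed.

Lemma JC_Aq n a : JC B S n (Aq a).
Proof. by apply: (JC_powR B_open) (JC_sqd n) => x e; exact: sqd_gt0. Qed.

Lemma JC_weight n : JC B S n (fun x _ => weight x).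
Proof. by apply: (JC_sub B_open); [exact: (JC_cst _ B_open)|exact: (JC_dot _ B_open)]. Qed.

Lemma JC_Pn n : JC B S n Pn.
Proof. by apply: (JC_mul B_open); [exact: JC_weight|exact: JC_Aq]. Qed.

Lemma JC_Wk n i j : JC B S n (Wk i j).
Proof.
have b := B_open; have c (r : R) : JC B S n (fun _ _ => r) by exact: (JC_cst _ b).
have cc k : JC B S n (fun x _ => coord k x) by exact: (JC_coord _ b).
apply: (JC_add b); first apply: (JC_add b).
- exact: (JC_mul b (c _) (JC_Aq n _)).
- apply: (JC_mul b _ (JC_Aq n _)); apply: (JC_sub b); last exact: (JC_mul b (c _) (JC_weight n)).
  by apply: (JC_mul b (c _)); apply: (JC_add b); apply: (JC_mul b (cc _)); exact: JC_coordB.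
- apply: (JC_mul b _ (JC_Aq n _)); apply: (JC_mul b (JC_mul b (c _) (JC_weight n))).
  by apply: (JC_mul b); exact: JC_coordB.
Qed.

Section FixedPole.
Variable e : V3.
Hypothesis Se : S e.
Local Notation oB := B_open.

Let fJ n (K : V3 -> V3 -> R) : JC B S n K -> JCf B n (K^~ e).
Proof. by move=> h; exact: (JC_JCf B_open h Se). Qed.

Let hA n a : JCf B n (Aq a ^~ e). Proof. exact: fJ (JC_Aq n a). Qed.
Let hy n k : JCf B n (fun x => coord k (x - e)). Proof. exact: fJ (JC_coordB n k). Qed.
Let hw n : JCf B n (@weight R). Proof. exact: JCf_weight B_open n. Qed.

Local Opaque JC pd.

Lemma pd_coordB i k x : B x -> pd i (fun x => coord k (x - e)) x = (i == k)%:R.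
Proof.
move=> Bx; have -> : (fun x => coord k (x - e)) = (fun x => coord k x - coord k e).
  by apply/funext => y; rewrite coordB.
have hc : JCf B 1 (fun=> coord k e) by exact: (JC_cst _ oB).
by rewrite (pd_B i (JCf_coord oB 1 k) hc Bx) pd_coord pd_cst subr0.
Qed.

Lemma pd_sqd k x : B x -> pd k (sqd^~ e) x = 2 * coord k (x - e).
Proof.
move=> Bx; rewrite /sqd /dot.
have hyy i : JCf B 1 (fun x => coord i (x - e) * coord i (x - e)) := JC_mul oB (hy 1 i) (hy 1 i).
rewrite (pd_sum oB k hyy Bx).
have E i : pd k (fun x => coord i (x - e) * coord i (x - e)) x = (i == k)%:R * (2 * coord k (x - e)).
  rewrite (pd_M k (hy 1 i) (hy 1 i) Bx) (pd_coordB k i Bx) eq_sym.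
  by case: eqP => [->|_]; rewrite ?mulr0 ?addr0 ?mul0r // mulr1 mul1r mulrDl mul1r.
rewrite (eq_bigr _ (fun i _ => E i)) (bigD1 k) //= big1 ?addr0 ?eqxx ?mul1r // => i /negbTE ->; exact: mul0r.
Qed.

Lemma pd_Aq a k x : B x -> pd k (Aq a ^~ e) x = 2 * a * coord k (x - e) * Aq (a - 1) x e.
Proof.
move=> Bx; apply: etrans (pd_powR a k (fJ (JC_sqd 1)) Bx (sqd_gt0 Bx Se)) _.
by rewrite pd_sqd // -/(Aq (a - 1) x e); move: (Aq _ x e) => q; ring.
Qed.

Lemma pd_Pn j x : B x ->
  pd j (Pn^~ e) x = - 2 * (coord j x * Aq (- (3 / 2)) x e) + - 3 * (weight x * (coord j (x - e) * Aq (- (3 / 2) - 1) x e)).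
Proof.
move=> Bx; rewrite /Pn (pd_M j (hw 1) (hA 1 _) Bx) (pd_Aq _ j Bx) (pd_weight oB j Bx).
by move: (Aq _ x e) (Aq _ x e) => q q'; field.
Qed.

Lemma pd2_Pn i j x : B x -> pd i (pd j (Pn^~ e)) x = Wk i j x e.
Proof.
move=> Bx; apply: etrans (pd_on oB i (fun y => @pd_Pn j y) Bx) _.
set a0 := - (3 / 2).
have c1 : JCf B 1 (fun y => coord j y * Aq a0 y e) := JC_mul oB (JCf_coord oB 1 j) (hA 1 a0).
have c2 : JCf B 1 (fun y => coord j (y - e) * Aq (a0 - 1) y e) := JC_mul oB (hy 1 j) (hA 1 (a0 - 1)).
have c3 : JCf B 1 (fun y => weight y * (coord j (y - e) * Aq (a0 - 1) y e)) := JC_mul oB (hw 1) c2.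
rewrite (pd_D i (JC_scale oB (-2) c1) (JC_scale oB (-3) c3) Bx) (pd_Z oB _ i c1 Bx) (pd_Z oB _ i c3 Bx).
rewrite (pd_M i (JCf_coord oB 1 j) (hA 1 a0) Bx) (pd_M i (hw 1) c2 Bx) (pd_M i (hy 1 j) (hA 1 (a0 - 1)) Bx).
rewrite !(pd_Aq _ i Bx) pd_coord (pd_coordB i j Bx) (pd_weight oB i Bx) /Wk -/a0.
move: (Aq _ x e) (Aq _ x e) (Aq _ x e) => q0 q1 q2; rewrite /a0.
by move: (coord i x) (coord j x) (coord i _) (coord j _) (weight x) ((i == j)%:R) => b1 b2 b3 b4 b5 b6; field.
Qed.

Lemma Aq_succ a x : B x -> Aq a x e = sqd x e * Aq (a - 1) x e.
Proof.
move=> Bx; have h := sqd_gt0 Bx Se; rewrite /Aq -[X in X * _](powRr1 (ltW h)) -powRD.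
  by congr powR; ring.
by apply/implyP => _; rewrite gt_eqF.
Qed.

Lemma lap_Pn x : B x -> lap (Pn^~ e) x = 0.
Proof.
move=> Bx; rewrite /lap (eq_bigr _ (fun i _ => pd2_Pn i i Bx)) sum3E /Wk !eqxx.
set a0 := - (3 / 2); rewrite (Aq_succ a0 Bx) (Aq_succ (a0 - 1) Bx).
have : dot e e = 1 by exact: sphere3_dot.
rewrite /sqd /weight !dotE /= !coordE /=; move: (Aq _ x e) => q.
move: x.1.1 x.1.2 x.2 e.1.1 e.1.2 e.2 => x1 x2 x3 e1 e2 e3 he.
(* The Laplacian factors through |e|^2 - 1, which vanishes for a pole on the sphere. *)
transitivity (6 * q * (((x1 - e1) * (x1 - e1) + (x2 - e2) * (x2 - e2) + (x3 - e3) * (x3 - e3))) *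
   ((e1 * e1 + e2 * e2 + e3 * e3) - 1) * (-1)); first by ring.
by rewrite he subrr mulr0 mul0r.
Qed.

(** The remainder of [Pn] after its Taylor polynomial 1 + 3 x . e of degree one at the origin, as in
    the integrand of Phi. *)
Definition Hn x := Pn x e - 1 - 3 * dot x e.

Lemma JCf_dote n : JCf B n (fun x => dot x e).
Proof.
rewrite /dot; apply: (JCf_sum oB) => i.
have hc : JCf B n (fun=> coord i e) by exact: (JC_cst _ oB).
exact: (JC_mul oB (JCf_coord oB n i) hc).
Qed.

Lemma pd_dote k x : B x -> pd k (fun x => dot x e) x = coord k e.
Proof.
move=> Bx; rewrite /dot.
have hc i : JCf B 1 (fun=> coord i e) by exact: (JC_cst _ oB).
rewrite (pd_sum oB k (fun i => JC_mul oB (JCf_coord oB 1 i) (hc i)) Bx).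
have E i : pd k (fun x => coord i x * coord i e) x = (i == k)%:R * coord k e.
  rewrite (pd_M k (JCf_coord oB 1 i) (hc i) Bx) pd_cst pd_coord mulr0 add0r eq_sym mulrC.
  by case: eqP => [->|_] //; rewrite !mul0r.
rewrite (eq_bigr _ (fun i _ => E i)) (bigD1 k) //= big1 ?addr0 ?eqxx ?mul1r // => i /negbTE ->; exact: mul0r.
Qed.

Lemma JCf_Hn n : JCf B n Hn.
Proof.
have h1 : JCf B n (fun=> 1) by exact: (JC_cst _ oB).
exact: (JC_sub oB (JC_sub oB (fJ (JC_Pn n)) h1) (JC_scale oB 3 (JCf_dote n))).
Qed.

Lemma pd_Hn j x : B x -> pd j Hn x = pd j (Pn^~ e) x - 3 * coord j e.
Proof.
move=> Bx; have h1 : JCf B 1 (fun=> 1) by exact: (JC_cst _ oB).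
have hP := fJ (JC_Pn 1); have hd := JCf_dote 1.
rewrite (pd_B j (JC_sub oB hP h1) (JC_scale oB 3 hd) Bx) (pd_B j hP h1 Bx) (pd_Z oB _ j hd Bx) pd_cst subr0.
by rewrite (pd_dote j Bx).
Qed.

Lemma pd2_Hn i j x : B x -> pd i (pd j Hn) x = Wk i j x e.
Proof.
move=> Bx; apply: etrans (pd_on oB i (fun y => @pd_Hn j y) Bx) _.
have h1 : JCf B 1 (fun=> 3 * coord j e) by exact: (JC_cst _ oB).
by rewrite (pd_B i (JCf_pd j (fJ (JC_Pn 2))) h1 Bx) pd_cst subr0 pd2_Pn.
Qed.

Lemma B0 : B 0. Proof. by rewrite /ball3 /= enorm0. Qed.

Lemma Aq0 a : Aq a 0 e = 1.
Proof.
rewrite /Aq /sqd sub0r dotNl dotNr opprK sphere3_dot // powR1 //.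
Qed.

Lemma Hn0 : Hn 0 = 0.
Proof.
by rewrite /Hn /Pn Aq0 /weight -(scale0r (0 : V3)) !dotZl !mul0r subr0 mulr1 subrr mulr0 subr0.
Qed.

Lemma pdHn0 j : pd j Hn 0 = 0.
Proof.
rewrite pd_Hn ?pd_Pn; [|exact: B0..].
rewrite !Aq0 /weight coord0 mul0r mulr0 -(scale0r (0 : V3)) dotZl mul0r scale0r sub0r coordN; ring.
Qed.

(** Taylor's formula with integral remainder, value and gradient of [Hn] being zero at the origin.
    It shows [Hn] as quadratic in [y] with smooth coefficients, so that [Hn e (t *: x)] can be
    divided by [t ^+ 2]. *)
Lemma taylor_Hn y : B y ->
  Hn y = \int[leb]_(s in `[0, 1]) ((1 - s) * \sum_(a < 3) \sum_(b < 3) coord a y * coord b y * Wk a b (s *: y) e).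
Proof.
(* In the derivative of [G] the first-order terms cancel, leaving [1 - s] times the second
   derivative along the ray. *)
move=> By; pose G s := (1 - s) * (\sum_(b < 3) coord b y * pd b Hn (s *: y)) + Hn (s *: y).
have wid : wcont I01 (fun s : R => 1 - s) by apply: wcontB; [exact: wcont_cst|exact: wcont_id].
have wr n f : JCf B n f -> wcont I01 (fun s => f (s *: y)).
  by move=> hf; exact: (wcont_ray B_star (JCf_le (m := 0) (n := n) (leq0n _) hf) By).
have wW a b : wcont I01 (fun s => Wk a b (s *: y) e) := wr 0%N _ (fJ (JC_Wk 0 a b)).
have -> : Hn y = G 1 - G 0.
  rewrite /G subrr mul0r add0r scale1r subr0 mul1r scale0r Hn0 addr0.
  by rewrite big1 ?subr0 // => b _; rewrite pdHn0 mulr0.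
apply/esym; apply: FTC01.
- apply: wcontM => //; apply: wcont_sum => a; apply: wcont_sum => b.
  by apply: wcontM; [exact: wcont_cst|exact: wW].
- apply: wcontD; last exact: wr (JCf_Hn 0).
  apply: wcontM => //; apply: wcont_sum => b; apply: wcontM; first exact: wcont_cst.
  exact: wr (JCf_pd b (JCf_Hn 1)).
move=> s /andP[s0 s1]; have Bs : B (s *: y) by apply: B_star => //; rewrite !ltW.
have il f : JCf B 1 f -> is_derive s (1 : R) (fun s => f (s *: y)) (\sum_(a < 3) coord a y * pd a f (s *: y)).
  move=> hf; have [d1 d2] := derive_dir y oB hf Bs.
  have e1 := derivable_line f 0 y s; have e2 := derive_line f 0 y s.
  rewrite add0r in e1 e2; have e3 : (fun s => f (0 + s *: y)) = (fun s => f (s *: y)).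
    by apply/funext => r; rewrite add0r.
  by rewrite e3 in e1 e2; split; [rewrite e1|rewrite e2 d2].
have i1 := il _ (JCf_Hn 1).
pose g z := \sum_(b < 3) coord b y * pd b Hn z.
have hg : JCf B 1 g.
  by apply: (JCf_sum oB) => b; exact: (JC_scale oB _ (JCf_pd b (JCf_Hn 2))).
have i2 := il _ hg.
have i3 : is_derive s (1 : R) (fun s : R => 1 - s) (-1).
  have h := is_deriveB (is_derive_cst (1 : R) s (1 : R)) (is_derive_id s (1 : R)).
  by apply: is_derive_eq h _; rewrite sub0r.
apply: is_derive_eq (is_deriveD (is_deriveM i3 i2) i1) _.
transitivity ((1 - s) * (\sum_(a < 3) coord a y * pd a g (s *: y)) + g (s *: y) * (- 1) + g (s *: y)); first by [].
rewrite mulrN1 subrK; congr (_ * _); apply: eq_bigr => a _; rewrite /g.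
rewrite (pd_sum oB (F := fun b z => coord b y * pd b Hn z) a _ Bs); last first.
  by move=> b; exact: (JC_scale oB _ (JCf_pd b (JCf_Hn 2))).
rewrite mulr_sumr; apply: eq_bigr => b _.
by rewrite (pd_Z oB _ a (JCf_pd b (JCf_Hn 2)) Bs) pd2_Hn // mulrA.
Qed.
End FixedPole.
End Kernels.

(** * The elastic kernel without singular integrals *)

Section ElasticKernel.
Variable R : realType.
Notation V3 := (V3 R).
Variables (lam mu : R).
Hypotheses (hmu : 0 < mu) (hlm : 0 < 2 * mu + lam).
Notation al := (alpha_e lam mu).
Notation be := (beta_e lam mu).
Local Notation B := (@ball3 R).
Local Notation S := (@sphere3 R).
Local Notation I01 := [set t : R | 0 <= t <= 1].
Local Notation leb := (@lebesgue_measure R).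
Local Notation oB := (@B_open R).
Implicit Types (x e : V3) (i j k : 'I_3).

Definition Mk i j x e : R := radial (1 - al) (fun t => Wk i j (t *: x) e).
(** [4 pi] times the elastic Poisson kernel on the ball times the sphere ([Pe_kernelE]), in a form
    whose smoothness up to every order is immediate. *)
Definition Kn i j x e : R := (i == j)%:R * Pn x e + be * (weight x * Mk i j x e).

Lemma JC_Mk n i j : JC B S n (Mk i j).
Proof. exact: (JC_radial oB (@B_star R) (alpha_lt1 hmu hlm) (JC_Wk R n i j)). Qed.

Lemma JC_Kn n i j : JC B S n (Kn i j).
Proof.
apply: (JC_add oB); first exact: (JC_scale oB _ (JC_Pn R n)).
by apply: (JC_scale oB); apply: (JC_mul oB); [exact: JC_weight|exact: JC_Mk].
Qed.

Local Opaque JC pd.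

Lemma lameop_on (v v' : 'I_3 -> V3 -> R) i x (D : set V3) : open D ->
  (forall k y, D y -> v k y = v' k y) -> D x -> lameop lam mu v i x = lameop lam mu v' i x.
Proof.
move=> oD h Dx; apply: (f_equal2 (fun a b => mu * a + (lam + mu) * b)); first exact: (lap_on oD (h i) Dx).
by apply: eq_bigr => k _; apply: (pd_on oD _ _ Dx) => y Dy; exact: (pd_on oD _ (h k) Dy).
Qed.

Lemma Kn_lame i j x e : S e -> B x -> lameop lam mu (fun i y => Kn i j y e) i x = 0.
Proof.
move=> Se Bx.
have hP := JC_JCf oB (JC_Pn R 5) Se.
have lP y : B y -> lap (@Pn R ^~ e) y = 0 by exact: lap_Pn.
apply: etrans _ (lame_column hmu hlm oB (@B_star R) j i hP lP Bx).
apply: (lameop_on _ oB _ Bx) => k y By; rewrite /Kn; congr (_ + _ * (_ * _)).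
exact: (Tf_on (@B_star R) (1 - al) (f := fun z => Wk k j z e) (fun z Bz => esym (pd2_Pn Se k j Bz)) By).
Qed.

Lemma wcont_1s : wcont I01 (fun s : R => 1 - s).
Proof. by apply: wcontB; [exact: wcont_cst|exact: wcont_id]. Qed.

Definition tayl (f : R -> R) : R := \int[leb]_(s in `[0, 1]) ((1 - s) * f s).
Lemma posfun_tayl : posfun I01 tayl.
Proof. by apply: posfun_weighted => [|s /andP[_ h]]; [exact: wcont_1s|rewrite subr_ge0]. Qed.

(* [Hquot x (e, t)] is the smooth extension of [Hn e (t x) / t^2] to [t = 0]. *)
Definition Hquot x (q : V3 * R) : R :=
  tayl (fun s => \sum_(a < 3) \sum_(b < 3) coord a x * coord b x * Wk a b ((s * q.2) *: x) q.1).

Lemma JC_Hquot n : JC B (S `*` I01) n Hquot.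
Proof.
apply: (JC_posfun oB (@I01_compact R) posfun_tayl (K := fun x (q : V3 * R * R) =>
   \sum_(a < 3) \sum_(b < 3) coord a x * coord b x * Wk a b ((q.2 * q.1.2) *: x) q.1.1)).
apply: (JC_sum oB) => a; apply: (JC_sum oB) => b.
apply: (JC_mul oB); first by apply: (JC_mul oB); exact: (JC_coord _ oB).
apply: (JC_eq oB _ (JC_affine (S' := (S `*` I01) `*` I01) (a := fun q => q.2 * q.1.2) (b := fun=> 0)
  (c := fun q => q.1.1) oB oB _ _ _ _ (JC_Wk R n a b))).
- by move=> x q _ _; rewrite addr0.
- apply: wcontM; first exact: wcont_snd.
  by apply: (@wcont_comp _ _ _ _ setT (fun q : V3 * R * R => q.1) (fun z => z.2)) => //; [exact: wcont_fst|exact: wcont_snd].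
- exact: wcont_cst.
- by apply: (@wcont_comp _ _ _ _ setT (fun q : V3 * R * R => q.1) (fun z => z.1)) => //; exact: wcont_fst.
move=> x [[e t] s] Bx [[/= Se /andP[t0 t1]] /andP[s0 s1]]; rewrite addr0; split=> //.
apply: B_star => //; apply/andP; split; first exact: mulr_ge0.
by rewrite -[1](mulr1 1); apply: ler_pM.
Qed.

Lemma Hn_Hquot e x t : S e -> B x -> 0 <= t <= 1 -> Hn e (t *: x) = t ^+ 2 * Hquot x (e, t).
Proof.
move=> Se Bx ht; rewrite (taylor_Hn Se (B_star Bx ht)) -/(tayl _).
have w : wcont I01 (fun s => \sum_(a < 3) \sum_(b < 3) coord a x * coord b x * Wk a b ((s * t) *: x) e).
  apply: wcont_sum => a; apply: wcont_sum => b; apply: wcontM; first exact: wcont_cst.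
  have h := wcont_ray (@B_star R) (JC_JCf oB (JC_Wk R 0 a b) Se) (B_star Bx ht).
  by apply: wcont_eq h => s _; rewrite scalerA.
rewrite /Hquot -(posfunZ posfun_tayl _ w); f_equal; apply/funext => s.
rewrite mulr_sumr; apply: eq_bigr => a _; rewrite mulr_sumr; apply: eq_bigr => b _.
by rewrite scalerA !coordZ /=; move: (Wk _ _ _ _) => q; ring.
Qed.

Lemma pd_scale (f : V3 -> R) t k x : JCf B 1 f -> B (t *: x) ->
  pd k (fun y => f (t *: y)) x = t * pd k f (t *: x).
Proof.
move=> hf Btx; have d0 : derivable f (t *: x + 0) (ebasis R k).
  by rewrite addr0; exact: JCf_derivable hf Btx.
have [_] := derive_affine d0; rewrite addr0.
by have -> : (fun y => f (t *: y + 0)) = (fun y => f (t *: y)) by apply/funext => y; rewrite addr0.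
Qed.

(** Two derivatives of [Hn e (t *: x)] produce the factor [t ^+ 2] that the division cancels, and
    the affine part removed in [Hn] has no second derivative. *)
Lemma pd2_Hquot i j e x t : S e -> B x -> 0 < t <= 1 ->
  pd i (pd j (Hquot^~ (e, t))) x = Wk i j (t *: x) e.
Proof.
move=> Se Bx /andP[t0 t1]; have ht : 0 <= t <= 1 by rewrite ltW.
have tn : t ^+ 2 != 0 by rewrite expf_neq0 // gt_eqF.
have hH n := JCf_Hn Se n.
have hHt n : JCf B n (fun y => Hn e (t *: y)).
  have h := JC_affine (S := [set: R]) (S' := [set: R]) (a := fun=> t) (b := fun=> 0) (c := fun p => p) oB oB
    (@wcont_cst _ _ _ _) (@wcont_cst _ _ _ _) (@wcont_id _ _) _ (hH n).
  apply: (JC_eq oB _ (h _)) => [y p _ _|y p By _]; rewrite addr0 //; split => //; exact: B_star.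
have e1 y : B y -> Hquot y (e, t) = (t ^+ 2)^-1 * Hn e (t *: y).
  by move=> By; rewrite (Hn_Hquot Se By ht) mulKf.
have e2 y : B y -> pd j (Hquot^~ (e, t)) y = (t ^+ 2)^-1 * (t * pd j (Hn e) (t *: y)).
  move=> By; apply: etrans (pd_on oB j e1 By) _.
  by rewrite (pd_Z oB _ j (hHt 1%N) By) (pd_scale j (hH 1%N) (B_star By ht)).
apply: etrans (pd_on oB i e2 Bx) _.
have hpt : JCf B 1 (fun y => pd j (Hn e) (t *: y)).
  have h := JC_affine (S := [set: R]) (S' := [set: R]) (a := fun=> t) (b := fun=> 0) (c := fun p => p) oB oB
    (@wcont_cst _ _ _ _) (@wcont_cst _ _ _ _) (@wcont_id _ _) _ (JCf_pd j (hH 2%N)).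
  apply: (JC_eq oB _ (h _)) => [y p _ _|y p By _]; rewrite addr0 //; split => //; exact: B_star.
rewrite (pd_Z oB _ i (JC_scale oB t hpt) Bx) (pd_Z oB _ i hpt Bx).
rewrite (pd_scale i (JCf_pd j (hH 2%N)) (B_star Bx ht)) (pd2_Hn Se i j (B_star Bx ht)).
by rewrite [t * (t * _)]mulrA -expr2 mulKf.
Qed.

(** The weight t^(-(1 + alpha)) of Phi times the factor t^2 from [Hn_Hquot] is t^(1 - alpha),
    continuous up to 0 because alpha < 1. The singular integral becomes the positive form
    [radial (1 - al)], under which derivatives pass. *)
Lemma Phi_Hquot e x : S e -> B x ->
  Phi_e lam mu x e = (4 * pi)^-1 * radial (1 - al) (fun t => Hquot x (e, t)).
Proof.
move=> Se Bx; rewrite /Phi_e; congr (_ * _).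
have w : wcont I01 (fun t => powR t (1 - al) * Hquot x (e, t)).
  apply: wcontM; first exact: wcont_powR0 (alpha_lt1 hmu hlm).
  exact: (JC_slice (JC_Hquot 0) Bx Se).
have int1 := wcont_integrable w.
have int2 : leb.-integrable `]0, 1] (EFin \o (fun t => powR t (1 - al) * Hquot x (e, t))).
  by apply: integrableS int1 => //; apply: subset_itvr; rewrite bnd_simp.
have int3 : leb.-integrable `]0, 1[ (EFin \o (fun t => powR t (1 - al) * Hquot x (e, t))).
  by apply: integrableS int1 => //; apply: subset_itv; rewrite bnd_simp.
rewrite /radial -(Rintegral_itv_obnd_cbnd int2) -(Rintegral_itv_bndo_bndc int3).
apply: eq_Rintegral => t; rewrite inE /= in_itv /= => /andP[t0 t1].
have ht : 0 <= t <= 1 by rewrite !ltW.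
have -> : (1 - t ^+ 2 * enorm x ^+ 2) / powR (1 - 2 * t * dot x e + t ^+ 2 * enorm x ^+ 2) (3 / 2)
    - 1 - 3 * t * dot x e = Hn e (t *: x).
  have E1 : 1 - t ^+ 2 * enorm x ^+ 2 = weight (t *: x).
    by rewrite /weight dotZl dotZr enorm2; ring.
  have E2 : 1 - 2 * t * dot x e + t ^+ 2 * enorm x ^+ 2 = sqd (t *: x) e.
    by rewrite /sqd dotBB (sphere3_dot Se) !dotZl dotZr enorm2; ring.
  by rewrite E1 E2 /Hn /Pn /Aq powRN dotZl mulrA.
rewrite (Hn_Hquot Se Bx ht) mulrAC -powR_mulrn ?ltW // -powRD; last by apply/implyP => _; rewrite gt_eqF.
by congr (powR _ _ * _); ring.
Qed.

Lemma pd2_Phi i j e x : S e -> B x ->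
  pd i (pd j (fun y => Phi_e lam mu y e)) x = (4 * pi)^-1 * Mk i j x e.
Proof.
move=> Se Bx; have a1 := alpha_lt1 hmu hlm; have pr := posfun_radial a1.
pose F y := radial (1 - al) (fun t => Hquot y (e, t)).
have hF n : JCf B n F := JC_JCf oB (JC_posfun oB (@I01_compact R) pr (JC_Hquot n)) Se.
have E1 y : B y -> Phi_e lam mu y e = (4 * pi)^-1 * F y by exact: Phi_Hquot.
have E2 y : B y -> pd j (fun y => Phi_e lam mu y e) y = (4 * pi)^-1 * pd j F y.
  by move=> By; apply: etrans (pd_on oB j E1 By) _; exact: (pd_Z oB _ j (hF 1%N) By).
apply: etrans (pd_on oB i E2 Bx) _; rewrite (pd_Z oB _ i (JCf_pd j (hF 2%N)) Bx); congr (_ * _).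
have E3 y : B y -> pd j F y = radial (1 - al) (fun t => pd j (Hquot^~ (e, t)) y).
  by move=> By; exact: (derive_posfun oB (@I01_compact R) pr j (JC_Hquot 1) By Se).2.
apply: etrans (pd_on oB i E3 Bx) _.
rewrite (derive_posfun oB (@I01_compact R) pr i (JC_pd j (JC_Hquot 2)) Bx Se).2.
(* At [t = 0] the weight vanishes on both sides; elsewhere [pd2_Hquot] applies. *)
apply: eq_Rintegral => t; rewrite inE -I01E => /andP[]; rewrite le_eqVlt => /predU1P[<- _|t0 t1].
  by rewrite powR0 ?gt_eqF // !mul0r.
by congr (_ * _); apply: pd2_Hquot => //; rewrite t0.
Qed.

Lemma poissonP_Pn x e : poissonP x e = (4 * pi)^-1 * Pn x e.
Proof.
rewrite /poissonP enorm2 /Pn /Aq /weight powRN.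
have -> : enorm (x - e) ^+ 3 = powR (sqd x e) (3 / 2).
  by rewrite /enorm -powR12_sqrt ?dot_ge0 // -powR_mulrn ?powR_ge0 // -powRrM mulrC.
by rewrite invfM; ring.
Qed.

Lemma Pe_kernelE i j x e : S e -> B x -> Pe_kernel lam mu i j x e = (4 * pi)^-1 * Kn i j x e.
Proof.
move=> Se Bx; rewrite /Pe_kernel /L_e (pd2_Phi i j Se Bx) poissonP_Pn /Kn enorm2 -/(weight x).
move: (Pn x e) (Mk i j x e) (weight x) ((4 * pi)^-1) => p m w c.
by case: (i == j) => /=; ring.
Qed.
End ElasticKernel.

(** * Domination of the elastic kernel by the Poisson kernel *)

Section KernelBound.
Variable R : realType.
Notation V3 := (V3 R).
Variables (lam mu : R).
Hypotheses (hmu : 0 < mu) (hlm : 0 < 2 * mu + lam).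
Notation be := (beta_e lam mu).
Local Notation B := (@ball3 R).
Local Notation S := (@sphere3 R).
Local Notation I01 := [set t : R | 0 <= t <= 1].
Local Notation leb := (@lebesgue_measure R).
Implicit Types (x e : V3) (i j k : 'I_3).

Lemma Aq_inv n (a : R) x e : 2 * a = - n%:R -> Aq a x e = (enorm (x - e))^-1 ^+ n.
Proof.
move=> h; rewrite /Aq /sqd -enorm2 -powR_mulrn ?enorm_ge0 // -powRrM.
by rewrite h powRN powR_mulrn ?enorm_ge0 // exprVn.
Qed.

Lemma weight_ge0 x : B x -> 0 <= weight x.
Proof. by move=> /ball3_dot h; rewrite subr_ge0 ltW. Qed.

Lemma weight_le x e : B x -> S e -> weight x <= 2 * enorm (x - e).
Proof.
move=> Bx Se; have h := enormB e x; rewrite -(opprB x) enormN in h.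
have h1 := enorm_ge0 x; have -> : weight x = (1 - enorm x) * (1 + enorm x) by rewrite /weight -enorm2; ring.
rewrite /sphere3 /= in Se; rewrite Se in h; rewrite /ball3 /= in Bx.
by rewrite mulrC; apply: ler_pM => //; lra.
Qed.

Lemma Pn_ge0 x e : B x -> 0 <= Pn x e.
Proof. by move=> Bx; rewrite mulr_ge0 ?powR_ge0 ?weight_ge0. Qed.

Lemma Pn_sym (r : R) w e : S w -> S e -> Pn (r *: w) e = Pn (r *: e) w.
Proof.
move=> Sw Se; rewrite /Pn /weight /Aq /sqd !dotBB !dotZl !dotZr (sphere3_dot Sw) (sphere3_dot Se).
by rewrite (dotC w e).
Qed.

(** As 1 - |x|^2 is at most 2 |x - e|, each occurrence of the weight absorbs one power of the
    singularity, which leaves order 4 throughout. The constant is 2 . 2 + 6 + 6 + 3 . 2 + 15 . 2. *)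
Lemma Wk_bound i j x e : B x -> S e -> `|Wk i j x e| <= 52 * (enorm (x - e))^-1 ^+ 4.
Proof.
move=> Bx Se; have h0 := ball3_sphere Bx Se; set rho := enorm (x - e) in h0 *.
have hw0 := weight_ge0 Bx; have hw := weight_le Bx Se; rewrite -/rho in hw.
have hr2 : rho <= 2.
  have := enormD x (- e); rewrite enormN -/rho; rewrite /sphere3 /= in Se; rewrite Se.
  rewrite /ball3 /= in Bx; lra.
have cx k : `|coord k x| <= 1 by apply: le_trans (coord_le_enorm k x) (ltW Bx).
have cy k : `|coord k (x - e) * rho^-1| <= 1.
  by rewrite normrM (ger0_norm (x := rho^-1)) ?invr_ge0 ?(ltW h0) // ler_pdivrMr // mul1r coord_le_enorm.
have hd : `|((i == j)%:R : R)| <= 1 by rewrite normr_nat; case: (_ == _).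
rewrite /Wk (@Aq_inv 3 (- (3 / 2))) ?(@Aq_inv 5 (- (3 / 2) - 1)) ?(@Aq_inv 7 (- (3 / 2) - 1 - 1)); [|by field..].
rewrite -/rho.
have -> : - 2 * (i == j)%:R * rho^-1 ^+ 3 +
  (6 * (coord i x * coord j (x - e) + coord j x * coord i (x - e)) - 3 * (i == j)%:R * weight x) * rho^-1 ^+ 5 +
  15 * weight x * (coord i (x - e) * coord j (x - e)) * rho^-1 ^+ 7 =
  (- 2 * (i == j)%:R * rho + (6 * (coord i x * (coord j (x - e) * rho^-1)) + 6 * (coord j x * (coord i (x - e) * rho^-1)))
   - 3 * (i == j)%:R * (weight x * rho^-1)
   + 15 * (weight x * rho^-1) * ((coord i (x - e) * rho^-1) * (coord j (x - e) * rho^-1))) * rho^-1 ^+ 4.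
  move: ((i == j)%:R) (coord i x) (coord j x) (coord i _) (coord j _) (weight x) => d a b c c' w.
  by field; rewrite gt_eqF.
have r4 : 0 <= rho^-1 ^+ 4 by rewrite exprn_ge0 // invr_ge0 ltW.
rewrite normrM (ger0_norm r4); apply: ler_wpM2r => //.
have ho : 0 <= weight x * rho^-1 <= 2.
  by apply/andP; split; [rewrite mulr_ge0 // invr_ge0 ltW|rewrite ler_pdivrMr].
have cyi := cy i; have cyj := cy j; have cxi := cx i; have cxj := cx j.
move: hd cxi cxj cyi cyj ho.
move: ((i == j)%:R) (coord i x) (coord j x) (coord i _ * _) (coord j _ * _) (weight x * _) => d a b c c' w hd ha hb hc hc' /andP[w0 w2].
have p1 : `|a * c'| <= 1 by rewrite normrM -[1](mulr1 1); apply: ler_pM.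
have p2 : `|b * c| <= 1 by rewrite normrM -[1](mulr1 1); apply: ler_pM.
have p3 : `|c * c'| <= 1 by rewrite normrM -[1](mulr1 1); apply: ler_pM.
have p4 : `|w * (c * c')| <= 2.
  by rewrite normrM -[2](mulr1 2) (ger0_norm w0); apply: ler_pM.
have p5 : `|d * w| <= 2 by rewrite normrM -[2](mul1r 2) (ger0_norm w0); apply: ler_pM.
have p6 : `|d * rho| <= 2 by rewrite normrM -[2](mul1r 2) (gtr0_norm h0); apply: ler_pM => //; exact: ltW.
have -> : - 2 * d * rho + (6 * (a * c') + 6 * (b * c)) - 3 * d * w + 15 * w * (c * c') =
  - 2 * (d * rho) + 6 * (a * c') + 6 * (b * c) - 3 * (d * w) + 15 * (w * (c * c')) by ring.
move: p1 p2 p4 p5 p6; move: (a * c') (b * c) (w * _) (d * w) (d * rho) => q1 q2 q4 q5 q6.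
rewrite !ler_norml => /andP[? ?] /andP[? ?] /andP[? ?] /andP[? ?] /andP[? ?]; lra.
Qed.

Lemma radial_abs_le (g : R) (f G : R -> R) : 0 < g -> wcont I01 f -> wcont I01 G ->
  (forall t, I01 t -> `|f t| <= G t) -> `|radial g f| <= \int[leb]_(t in `[0, 1]) G t.
Proof.
move=> g0 hf hG h; have pr := posfun_radial g0.
apply: (le_trans (y := radial g G)).
  rewrite ler_norml; have -> : - radial g G = radial g (fun t => (-1) * G t) by rewrite (posfunZ pr) // mulN1r.
  by apply/andP; split; apply: (posfun_le pr) => //; [exact: wcontZ|..] => t /h;
    rewrite ler_norml ?mulN1r => /andP[].
apply: le_Rintegral; first exact: measurable_itv.
- by apply: wcont_integrable; apply: wcontM => //; exact: wcont_powR0.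
- exact: wcont_integrable.
move=> t; rewrite -I01E => /[dup] ht /andP[t0 t1].
rewrite ler_piMl //; first exact: le_trans (normr_ge0 _) (h t ht).
have <- : powR 1 g = 1 by rewrite powR1.
by apply: ge0_ler_powR; rewrite ?nnegrE ?(ltW g0).
Qed.

(** From 1 - t <= |t x - e| and |x - e| <= |t x - e| + (1 - t) follows |t x - e| >= (|x - e| + 1 -
    t) / 3. Integrating the inverse fourth power in t gains one order, and 52 . 27 is 52 . 3^4 /
    3. *)
Lemma Mk_bound i j x e : B x -> S e -> `|Mk lam mu i j x e| <= 52 * 27 * (enorm (x - e))^-1 ^+ 3.
Proof.
move=> Bx Se; have h0 := ball3_sphere Bx Se; set rho := enorm (x - e) in h0 *.
have wl : wcont I01 (fun t : R => rho + 1 - t) by apply: wcontB; [exact: wcont_cst|exact: wcont_id].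
have lp t : I01 t -> 0 < rho + 1 - t by move=> /andP[? ?]; lra.
have wG n : wcont I01 (fun t => (rho + 1 - t)^-1 ^+ n).
  by apply: wcontX; apply: wcontV => // t /lp h; rewrite gt_eqF.
have [c [hc c0]] : exists c : R, c = 52 * 81 /\ 0 <= c by exists (52 * 81); split=> //; rewrite mulr_ge0 // ler0n.
have wG4 : wcont I01 (fun t => c * (rho + 1 - t)^-1 ^+ 4) by apply: wcontZ; exact: wG.
apply: (le_trans (radial_abs_le (alpha_lt1 hmu hlm) _ wG4 _)).
- exact: (wcont_ray (@B_star R) (JC_JCf (@B_open R) (JC_Wk R 0 i j) Se) Bx).
- move=> t ht; have Bt := B_star Bx ht; apply: le_trans (Wk_bound i j Bt Se) _.
  have h1 := ball3_sphere Bt Se; set s := enorm (t *: x - e) in h1 *.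
  have /andP[t0 t1] := ht.
  have l1 : 1 - t <= s.
    have := enormB e (t *: x); rewrite -(opprB _ e) enormN -/s enormZ ger0_norm //.
    rewrite /sphere3 /= in Se; rewrite Se /ball3 /= in Bx *.
    have : t * enorm x <= t by rewrite ler_piMr // ltW.
    lra.
  have l2 : rho <= s + (1 - t).
    have -> : rho = enorm ((t *: x - e) + (1 - t) *: x).
      by rewrite /rho; congr enorm; apply: coord_inj => k; rewrite !(coordD, coordN, coordZ); ring.
    apply: le_trans (enormD _ _) _; rewrite lerD2l enormZ ger0_norm ?subr_ge0 // ler_piMr ?subr_ge0 //.
    exact: ltW.
  have l3 : s^-1 <= 3 * (rho + 1 - t)^-1.
    by rewrite ler_pdivlMr ?lp // mulrC ler_pdivrMr //; lra.
  have l4 : s^-1 ^+ 4 <= (3 * (rho + 1 - t)^-1) ^+ 4.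
    by apply: lerXn2r => //; rewrite nnegrE ?mulr_ge0 ?invr_ge0 // ltW // lp.
  rewrite exprMn in l4; apply: le_trans (ler_wpM2l (ler0n R 52) l4) _.
  rewrite mulrA; apply: ler_wpM2r; first by rewrite exprn_ge0 // invr_ge0 ltW // lp.
  by rewrite hc; lra.
pose F (t : R) := (c / 3) * powR (rho + 1 - t) (- 3%:R).
have pE n t : I01 t -> powR (rho + 1 - t) (- n%:R) = (rho + 1 - t)^-1 ^+ n.
  by move=> /lp h; rewrite powRN powR_mulrn ?(ltW h) // exprVn.
have -> : \int[leb]_(t in `[0, 1]) (c * (rho + 1 - t)^-1 ^+ 4) = F 1 - F 0.
  apply: FTC01; first exact: wG4.
    apply: wcontZ; apply: (@wcont_eq _ _ _ (fun t => (rho + 1 - t)^-1 ^+ 3)); last exact: wG.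
    by move=> t ht; rewrite pE.
  move=> t /andP[t0 t1]; have ht : I01 t by rewrite /= !ltW.
  have lt := lp _ ht.
  have i1 : is_derive t (1 : R) (fun t : R => rho + 1 - t) (-1).
    have h := is_deriveB (is_derive_cst (rho + 1 : R) t (1 : R)) (is_derive_id t (1 : R)).
    by apply: is_derive_eq h _; rewrite sub0r.
  have i2 := is_derive1_comp (g := fun t : R => rho + 1 - t) (is_derive1_powR (- 3%:R) lt) i1.
  have i3 := is_deriveZ (c / 3) i2.
  apply: is_derive_eq i3 _.
  have -> : - 3%:R - 1 = - 4%:R :> R by ring.
  by rewrite (pE 4%N _ ht); move: (_ ^+ 4) => q; rewrite /GRing.scale /=; field.
have h01 : I01 (0 : R) by rewrite /= lexx ler01.
have h11 : I01 (1 : R) by rewrite /= lexx ler01.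
have -> : 52 * 27 = c / 3 by rewrite hc; lra.
rewrite /F (pE 3%N _ h01) (pE 3%N _ h11) addrK lerBlDr lerDl.
by rewrite mulr_ge0 ?divr_ge0 // exprn_ge0 // invr_ge0 ltW // lp.
Qed.

Definition Kbound : R := 1 + `|be| * (52 * 27).

(** The weight times the third-order bound of [Mk_bound] is a multiple of [Pn] itself. *)
Lemma Kn_bound i j x e : B x -> S e -> `|Kn lam mu i j x e| <= Kbound * Pn x e.
Proof.
move=> Bx Se; have p0 := Pn_ge0 e Bx; have w0 := weight_ge0 Bx.
have pE : Pn x e = weight x * (enorm (x - e))^-1 ^+ 3.
  by rewrite /Pn (@Aq_inv 3) //; field.
have -> : Kbound * Pn x e = Pn x e + `|be| * (52 * 27) * Pn x e by rewrite /Kbound mulrDl mul1r.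
rewrite /Kn; apply: le_trans (ler_normD _ _) (lerD _ _).
  by case: (i == j); rewrite ?mul1r ?mul0r ?normr0 // ger0_norm.
have -> : `|be * (weight x * Mk lam mu i j x e)| = `|be| * (weight x * `|Mk lam mu i j x e|).
  by rewrite !normrM (ger0_norm w0).
have -> : `|be| * (52 * 27) * Pn x e = `|be| * (weight x * (52 * 27 * (enorm (x - e))^-1 ^+ 3)).
  by rewrite pE -mulrA [52 * 27 * _]mulrCA.
by apply: ler_wpM2l; [exact: normr_ge0|apply: ler_wpM2l; [exact: w0|exact: Mk_bound]].
Qed.

Lemma Kbound_ge0 : 0 <= Kbound.
Proof. by apply: addr_ge0; [exact: ler01|apply: mulr_ge0; [exact: normr_ge0|apply: mulr_ge0; exact: ler0n]]. Qed.
End KernelBound.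

(** * Surface measure *)
Section BorelV3.
Variable R : realType.
Notation V3 := (V3 R).

Lemma measurable_coord i : measurable_fun [set: V3] (coord i).
Proof.
have m1 : measurable_fun [set: V3] (fun y : V3 => y.1) by exact: measurable_fst.
have m2 : measurable_fun [set: R * R] (fun y : R * R => y.1) by exact: measurable_fst.
have m3 : measurable_fun [set: R * R] (fun y : R * R => y.2) by exact: measurable_snd.
case: (ord3P i) => ->.
- rewrite (_ : coord _ = fun y : V3 => y.1.1); last by apply/funext => y; exact: coord0E.
  exact: (measurableT_comp m2 m1).
- rewrite (_ : coord _ = fun y : V3 => y.1.2); last by apply/funext => y; exact: coord1E.
  exact: (measurableT_comp m3 m1).
- rewrite (_ : coord _ = fun y : V3 => y.2); last by apply/funext => y; exact: coord2E.
  exact: measurable_snd.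
Qed.

Lemma measurable_to_V3 d (T : measurableType d) (f : T -> V3) :
  (forall i, measurable_fun setT (coord i \o f)) -> measurable_fun setT f.
Proof.
move=> h; have h0 := h (inord 0); have h1 := h (inord 1); have h2 := h (inord 2).
have e : f = (fun t => ((coord (inord 0) (f t), coord (inord 1) (f t)), coord (inord 2) (f t))).
  by apply/funext => t; rewrite !coordE -!surjective_pairing.
by rewrite e; exact: (measurable_fun_pair (measurable_fun_pair h0 h1) h2).
Qed.

Definition ratbox (q : rat * rat * rat * rat) : set V3 :=
  (ball (ratr q.1.1.1 : R) (ratr q.2 : R) `*` ball (ratr q.1.1.2 : R) (ratr q.2 : R)) `*` ball (ratr q.1.2 : R) (ratr q.2 : R).

(** Measurable sets of [V3] are those of the product sigma-algebra; an open set is reached as a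
    countable union of boxes with rational centre and radius, enumerated by [unpickle]. *)
Lemma open_measurableV3 (A : set V3) : open A -> measurable A.
Proof.
move=> oA; pose F (n : nat) : set V3 :=
  if @unpickle (rat * rat * rat * rat)%type n is Some q then
    (if `[< ratbox q `<=` A >] then ratbox q else set0) else set0.
have -> : A = \bigcup_n F n.
  apply/seteqP; split => [x Ax|x [n _]]; last first.
    rewrite /F; case: unpickle => [q|//]; case: asboolP => [h|//]; exact: h.
  have : nbhs x A by exact: open_nbhs_nbhs.
  move=> /nbhs_normP[d /= d0 hd].
  have d2 : 0 < d / 2 by rewrite divr_gt0.
  have [r] := rat_in_itvoo d2; rewrite in_itv /= => /andP[r0 rd].
  have ex (y : R) : exists q : rat, `|ratr q - y| < ratr r.
    have lt : y - ratr r < y + ratr r by lra.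
    have [q] := rat_in_itvoo lt.
    by rewrite in_itv /= => /andP[a b]; exists q; rewrite ltr_norml; lra.
  have [a ha] := ex x.1.1; have [b hb] := ex x.1.2; have [c hc] := ex x.2.
  have [q qx qA] : exists2 q, ratbox q x & ratbox q `<=` A.
    exists (a, b, c, r); first by rewrite /ratbox /= /ball /=; split; [split|]; rewrite /= ?ha ?hb ?hc.
    move=> y [[/= ya yb] yc]; apply: hd; rewrite /ball_ /=.
    rewrite /ball /= in ya yb yc.
    rewrite norm3E !gt_max /=; move: ha hb hc ya yb yc; rewrite !ltr_norml.
    move=> /andP[? ?] /andP[? ?] /andP[? ?] /andP[? ?] /andP[? ?] /andP[? ?].
    by apply/andP; split; [apply/andP; split|]; apply/andP; split; lra.
  exists (pickle q); first exact: I.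
  by rewrite /F pickleK; case: asboolP.
apply: bigcup_measurable => n _; rewrite /F.
case: unpickle => [q|]; last exact: measurable0.
case: asboolP => _; last exact: measurable0.
by rewrite /ratbox; apply: measurableX; [apply: measurableX|]; exact: measurable_ball.
Qed.

Lemma closed_measurableV3 (A : set V3) : closed A -> measurable A.
Proof. by move/closed_openC/open_measurableV3/measurableC; rewrite setCK. Qed.

Lemma measurable_sphere3 : measurable (@sphere3 R).
Proof. by apply: closed_measurableV3; exact: sphere3_closed. Qed.

Lemma wcont_measurable (A : set V3) (f : V3 -> R) :
  measurable A -> wcont A f -> measurable_fun A f.
Proof.
move=> mA /subspace_continuousP/continuousP cf.
apply: (measurability _ (RGenOpens.measurableE R)) => _ [_ [a [b ->] <-]].
have oab : open (`]a, b[%classic : set R) by exact: interval_open.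
have := cf _ oab.
move/open_subspaceP => [V oV VD]; rewrite setIC -VD.
by apply: measurableI => //; exact: open_measurableV3.
Qed.

Lemma measurable_enorm : measurable_fun [set: V3] (@enorm R).
Proof. by apply: wcont_measurable => //; exact/cont_wcont/enorm_cont. Qed.
End BorelV3.

(** * Invariance of Lebesgue measure under shears and rotations *)

Section MeasurePreserving.
Local Open Scope ereal_scope.

Section Product.
Context d1 d2 (T1 : measurableType d1) (T2 : measurableType d2) (R : realType).
Variables (m1 : {sigma_finite_measure set T1 -> \bar R}) (m2 : {sigma_finite_measure set T2 -> \bar R}).

(** Slice by slice: a map that moves the second coordinate alone and preserves every slice preserves
    the product measure. [preserve_left] rests on integrating in the other order. *)
Lemma preserve_right (phi : T1 -> T2 -> T2) (A : set (T1 * T2)) : measurable A ->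
  (forall x B, measurable B -> m2 (phi x @^-1` B) = m2 B) ->
  (m1 \x m2) ((fun z => (z.1, phi z.1 z.2)) @^-1` A) = (m1 \x m2) A.
Proof.
move=> mA h; apply: eq_integral => x _ /=.
rewrite -(h x (xsection A x)); last exact: measurable_xsection.
by congr (m2 _); apply/seteqP; split => y; rewrite /xsection /= !inE.
Qed.

Lemma product_measure12 (A : set (T1 * T2)) : measurable A -> (m1 \x m2) A = (m1 \x^ m2) A.
Proof. by move=> mA; apply: product_measure_unique => // B C mB mC; exact: product_measure2E. Qed.

Lemma preserve_left (phi : T2 -> T1 -> T1) (A : set (T1 * T2)) : measurable A ->
  measurable_fun setT (fun z : T1 * T2 => (phi z.2 z.1, z.2)) ->
  (forall y B, measurable B -> m1 (phi y @^-1` B) = m1 B) ->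
  (m1 \x m2) ((fun z => (phi z.2 z.1, z.2)) @^-1` A) = (m1 \x m2) A.
Proof.
move=> mA mF h; rewrite !product_measure12 //; last first.
  by rewrite -[X in measurable X]setTI; exact: mF.
apply: eq_integral => y _ /=.
rewrite -(h y (ysection A y)); last exact: measurable_ysection.
by congr (m1 _); apply/seteqP; split => x; rewrite /ysection /= !inE.
Qed.
End Product.

Variable R : realType.
Notation V3 := (V3 R).
Local Notation leb := (@lebesgue_measure R).

Lemma lebesgue_translation (c : R) (A : set R) : measurable A ->
  leb ((fun x => x + c)%R @^-1` A) = leb A.
Proof.
move=> mA; apply/esym.
have mf : measurable_fun setT (fun x : measurableTypeR R => (x + c)%R : measurableTypeR R).
  by apply: measurable_funD => //; exact: measurable_cst.
apply: (@lebesgue_measure_unique R (pushforward leb (fun x : measurableTypeR R => (x + c)%R : measurableTypeR R))) => // X.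
case=> -[a b] /= _ <-.
have e : ((fun x => x + c)%R @^-1` `]a, b]%classic) = `](a - c)%R, (b - c)%R]%classic.
  by apply/seteqP; split=> x; rewrite /= !in_itv /= => /andP[h1 h2]; apply/andP; split; lra.
rewrite /pushforward e !lebesgue_measure_itv /= !lte_fin.
by rewrite ltrD2r; case: ifP => // _; rewrite -!EFinB; congr EFin; ring.
Qed.

Local Open Scope ring_scope.

Notation LR := (measurableTypeR R).
Notation W3 := (LR * LR * LR)%type.

(** A name of its own lets the plane measure carry the sigma-finiteness instance under which it can
    serve as a factor in [preserve_left]. *)
Definition leb2 : set (LR * LR) -> \bar R := (leb \x leb)%E.
HB.instance Definition _ := Measure.on leb2.
Lemma sigma_finite_leb2 : sigma_finite setT leb2.
Proof.
exists (fun n : nat => `[(- n%:R)%R, (n%:R)%R]%classic `*` `[(- n%:R)%R, (n%:R)%R]%classic).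
  apply/seteqP; split => // -[a b] _.
  pose c : R := `|a| + `|b|.
  have [n hn] : exists n : nat, c < n%:R.
    by exists (Num.bound c); apply: archi_boundP; rewrite addr_ge0.
  exists n; first exact: I.
  have ha : `|a| <= n%:R by apply: ltW; apply: le_lt_trans hn; rewrite lerDl.
  have hb : `|b| <= n%:R by apply: ltW; apply: le_lt_trans hn; rewrite lerDr.
  by split; rewrite /= in_itv /= -ler_norml.
move=> n; split; first by apply: measurableX; exact: measurable_itv.
have mi : measurable (`[(- n%:R)%R, (n%:R)%R]%classic : set LR) by exact: measurable_itv.
have h : (leb `[(- n%:R)%R, (n%:R)%R]%classic < +oo)%E.
  by rewrite lebesgue_measure_itv /=; case: ifP => _; rewrite ltry.
by rewrite /leb2 (product_measure1E _ _ mi mi); apply: lte_mul_pinfty => //; rewrite ge0_fin_numE.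
Qed.
HB.instance Definition _ := Measure_isSigmaFinite.Build _ _ _ leb2 sigma_finite_leb2.

Lemma lebesgue_plane_translation (c : R) (A : set (LR * LR)) : measurable A ->
  (leb \x leb)%E (((fun z : R * R => (z.1 + c, z.2)) : LR * LR -> LR * LR) @^-1` A) = (leb \x leb)%E A.
Proof.
move=> mA; apply: (@preserve_left _ _ LR LR R leb leb (fun _ x : R => x + c) A mA).
  apply: measurable_fun_pair; last exact: measurable_snd.
  by apply: measurable_funD; [exact: measurable_fst|exact: measurable_cst].
by move=> _ B mB; exact: lebesgue_translation.
Qed.

Lemma lebesgue_plane_shear1 (a : R) (A : set (LR * LR)) : measurable A ->
  (leb \x leb)%E (((fun z : R * R => (z.1 + a * z.2, z.2)) : LR * LR -> LR * LR) @^-1` A) = (leb \x leb)%E A.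
Proof.
move=> mA; apply: (@preserve_left _ _ LR LR R leb leb (fun y x : R => x + a * y) A mA).
  apply: measurable_fun_pair; last exact: measurable_snd.
  apply: measurable_funD; first exact: measurable_fst.
  by apply: measurable_funM; [exact: measurable_cst|exact: measurable_snd].
by move=> y B mB; exact: lebesgue_translation.
Qed.

Lemma lebesgue_plane_shear2 (a : R) (A : set (LR * LR)) : measurable A ->
  (leb \x leb)%E (((fun z : R * R => (z.1, z.2 + a * z.1)) : LR * LR -> LR * LR) @^-1` A) = (leb \x leb)%E A.
Proof.
move=> mA; apply: (@preserve_right _ _ LR LR R leb leb (fun x y : R => y + a * x) A mA).
by move=> y B mB; exact: lebesgue_translation.
Qed.

Definition mp3 (T : V3 -> V3) := measurable_fun setT (T : W3 -> W3) /\
  forall A : set W3, measurable A -> lebesgue3 R ((T : W3 -> W3) @^-1` A) = lebesgue3 R A.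

Lemma mp3_comp T T' : mp3 T -> mp3 T' -> mp3 (T \o T').
Proof.
move=> [m1 h1] [m2 h2]; split; first exact: (measurableT_comp m1 m2).
move=> A mA; apply: etrans (h2 (T @^-1` A) _) (h1 A mA).
by rewrite -[X in measurable X]setTI; exact: m1.
Qed.

Let mc0 : measurable_fun [set: W3] (fun z : W3 => z.1.1).
Proof. exact: (measurableT_comp measurable_fst measurable_fst). Qed.
Let mc1 : measurable_fun [set: W3] (fun z : W3 => z.1.2).
Proof. exact: (measurableT_comp measurable_snd measurable_fst). Qed.
Let mc2 : measurable_fun [set: W3] (fun z : W3 => z.2).
Proof. exact: measurable_snd. Qed.
Let mD (f g : W3 -> LR) (a : R) : measurable_fun setT f -> measurable_fun setT g ->
  measurable_fun [set: W3] ((fun z => (f z : R) + a * (g z : R)) : W3 -> LR).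
Proof.
move=> hf hg; apply: measurable_funD; first exact: hf.
by apply: measurable_funM; [exact: measurable_cst|exact: hg].
Qed.

Lemma mp3_shear01 a : mp3 (fun z => ((z.1.1 + a * z.1.2, z.1.2), z.2)).
Proof.
have mT : measurable_fun setT ((fun z : V3 => ((z.1.1 + a * z.1.2, z.1.2), z.2)) : W3 -> W3).
  exact: (measurable_fun_pair (measurable_fun_pair (mD a mc0 mc1) mc1) mc2).
split; first exact: mT.
move=> A mA; apply: (@preserve_left _ _ (LR * LR)%type LR R leb2 leb (fun (_ : R) (p : R * R) => (p.1 + a * p.2, p.2)) A mA mT).
by move=> _ B mB; exact: lebesgue_plane_shear1.
Qed.

Lemma mp3_shear10 a : mp3 (fun z => ((z.1.1, z.1.2 + a * z.1.1), z.2)).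
Proof.
have mT : measurable_fun setT ((fun z : V3 => ((z.1.1, z.1.2 + a * z.1.1), z.2)) : W3 -> W3).
  exact: (measurable_fun_pair (measurable_fun_pair mc0 (mD a mc1 mc0)) mc2).
split; first exact: mT.
move=> A mA; apply: (@preserve_left _ _ (LR * LR)%type LR R leb2 leb
  (fun (_ : R) (p : R * R) => (p.1, p.2 + a * p.1)) A mA mT).
by move=> _ B mB; exact: lebesgue_plane_shear2.
Qed.

Lemma mp3_shear02 a : mp3 (fun z => ((z.1.1 + a * z.2, z.1.2), z.2)).
Proof.
have mT : measurable_fun setT ((fun z : V3 => ((z.1.1 + a * z.2, z.1.2), z.2)) : W3 -> W3).
  exact: (measurable_fun_pair (measurable_fun_pair (mD a mc0 mc2) mc1) mc2).
split; first exact: mT.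
move=> A mA; apply: (@preserve_left _ _ (LR * LR)%type LR R leb2 leb
  (fun (w : R) (p : R * R) => (p.1 + a * w, p.2)) A mA mT).
by move=> w B mB; exact: lebesgue_plane_translation.
Qed.

Lemma mp3_shear20 a : mp3 (fun z => (z.1, z.2 + a * z.1.1)).
Proof.
have mT : measurable_fun setT ((fun z : V3 => (z.1, z.2 + a * z.1.1)) : W3 -> W3).
  by apply: measurable_fun_pair; [exact: measurable_fst|exact: (mD a mc2 mc0)].
split; first exact: mT.
move=> A mA; apply: (@preserve_right _ _ (LR * LR)%type LR R leb2 leb
  (fun (p : R * R) (w : R) => w + a * p.1) A mA).
by move=> p B mB; exact: lebesgue_translation.
Qed.

Definition rot01 (c s : R) (z : V3) : V3 := ((c * z.1.1 - s * z.1.2, s * z.1.1 + c * z.1.2), z.2).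
Definition rot02 (c s : R) (z : V3) : V3 := ((c * z.1.1 - s * z.2, z.1.2), s * z.1.1 + c * z.2).

(* A plane rotation is a product of three shears. *)
Lemma mp3_rot01 c s : 0 <= c -> c ^+ 2 + s ^+ 2 = 1 -> mp3 (rot01 c s).
Proof.
(* The slope of the outer shears is minus the tangent of half the angle; a nonnegative cosine keeps
   [1 + c] away from zero. *)
move=> c0 cs; have c1 : 1 + c != 0 by rewrite gt_eqF //; lra.
have := mp3_comp (mp3_shear01 (- (s / (1 + c)))) (mp3_comp (mp3_shear10 s) (mp3_shear01 (- (s / (1 + c))))).
congr mp3; apply/funext => z; rewrite /rot01 /=.
have e : s * s = (1 - c) * (1 + c) by rewrite -!expr2 in cs *; lra.
have e1 : s * (s / (1 + c)) = 1 - c by rewrite mulrA e mulfK.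
have e2 : 1 - s * (s / (1 + c)) = c by rewrite e1; ring.
congr ((_, _), _).
- transitivity ((1 - s * (s / (1 + c))) * z.1.1 - (s / (1 + c)) * (1 + (1 - s * (s / (1 + c)))) * z.1.2); first by ring.
  by rewrite e2 mulfVK.
- by transitivity (s * z.1.1 + (1 - s * (s / (1 + c))) * z.1.2); [ring|rewrite e2].
Qed.

Lemma mp3_rot02 c s : 0 <= c -> c ^+ 2 + s ^+ 2 = 1 -> mp3 (rot02 c s).
Proof.
move=> c0 cs; have c1 : 1 + c != 0 by rewrite gt_eqF //; lra.
have := mp3_comp (mp3_shear02 (- (s / (1 + c)))) (mp3_comp (mp3_shear20 s) (mp3_shear02 (- (s / (1 + c))))).
congr mp3; apply/funext => z; rewrite /rot02 /=.
have e : s * s = (1 - c) * (1 + c) by rewrite -!expr2 in cs *; lra.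
have e1 : s * (s / (1 + c)) = 1 - c by rewrite mulrA e mulfK.
have e2 : 1 - s * (s / (1 + c)) = c by rewrite e1; ring.
congr ((_, _), _).
- transitivity ((1 - s * (s / (1 + c))) * z.1.1 - (s / (1 + c)) * (1 + (1 - s * (s / (1 + c)))) * z.2); first by ring.
  by rewrite e2 mulfVK.
- by transitivity (s * z.1.1 + (1 - s * (s / (1 + c))) * z.2); [ring|rewrite e2].
Qed.

Definition isometry3 (T : V3 -> V3) := [/\ mp3 T, forall (a : R) x, T (a *: x) = a *: T x,
  forall x y, T (x - y) = T x - T y & forall x, dot (T x) (T x) = dot x x].

Lemma isometry3_comp T T' : isometry3 T -> isometry3 T' -> isometry3 (T \o T').
Proof.
move=> [a1 a2 a3 a4] [b1 b2 b3 b4]; split=> [|a x|x y|x] /=; first exact: mp3_comp.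
- by rewrite b2 a2.
- by rewrite b3 a3.
- by rewrite a4 b4.
Qed.

Lemma isometry3_rot01 c s : 0 <= c -> c ^+ 2 + s ^+ 2 = 1 -> isometry3 (rot01 c s).
Proof.
move=> c0 cs; split=> [|a x|x y|x]; first exact: mp3_rot01.
- by apply: coord_inj => i; rewrite coordZ; case: (ord3P i) => ->; rewrite !coordE /= /GRing.scale /=; ring.
- by apply: coord_inj => i; rewrite coordB; case: (ord3P i) => ->; rewrite !coordE /=; ring.
- rewrite !dotE /=; transitivity ((c ^+ 2 + s ^+ 2) * (x.1.1 * x.1.1 + x.1.2 * x.1.2) + x.2 * x.2); first by ring.
  by rewrite cs mul1r.
Qed.

Lemma isometry3_rot02 c s : 0 <= c -> c ^+ 2 + s ^+ 2 = 1 -> isometry3 (rot02 c s).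
Proof.
move=> c0 cs; split=> [|a x|x y|x]; first exact: mp3_rot02.
- by apply: coord_inj => i; rewrite coordZ; case: (ord3P i) => ->; rewrite !coordE /= /GRing.scale /=; ring.
- by apply: coord_inj => i; rewrite coordB; case: (ord3P i) => ->; rewrite !coordE /=; ring.
- rewrite !dotE /=; transitivity ((c ^+ 2 + s ^+ 2) * (x.1.1 * x.1.1 + x.2 * x.2) + x.1.2 * x.1.2); first by ring.
  by rewrite cs mul1r; ring.
Qed.

(** The cosine is kept nonnegative, as [mp3_rot01] demands, by the choice of the sense of rotation;
    in return the remaining coordinate [r] may be negative. *)
Lemma planar_rotation (a b : R) : exists c s r : R,
  [/\ 0 <= c, c ^+ 2 + s ^+ 2 = 1, s * a + c * b = 0 & c * a - s * b = r].
Proof.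
have [h0|h0] := eqVneq (a ^+ 2 + b ^+ 2) 0.
  have a0 : a = 0 by apply/eqP; rewrite -sqrf_eq0; have := sqr_ge0 a; have := sqr_ge0 b => *; apply/eqP; lra.
  have b0 : b = 0 by apply/eqP; rewrite -sqrf_eq0; have := sqr_ge0 a; have := sqr_ge0 b => *; apply/eqP; lra.
  by exists 1, 0, 0; rewrite a0 b0; split => //; lra.
have p0 : 0 < a ^+ 2 + b ^+ 2 by rewrite lt_neqAle eq_sym h0 addr_ge0 ?sqr_ge0.
pose r := Num.sqrt (a ^+ 2 + b ^+ 2); have r0 : 0 < r by rewrite sqrtr_gt0.
have r2 : r ^+ 2 = a ^+ 2 + b ^+ 2 by rewrite sqr_sqrtr // ltW.
have rn : r != 0 by rewrite gt_eqF.
have hs (e : R) : e ^+ 2 = 1 -> (e * a / r) ^+ 2 + (- e * b / r) ^+ 2 = 1.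
  move=> he; transitivity (e ^+ 2 * (a ^+ 2 + b ^+ 2) / r ^+ 2); first by field.
  by rewrite he mul1r r2 divff.
have [a0|a0] := lerP 0 a.
  exists (1 * a / r), (- 1 * b / r), (1 * a / r * a - - 1 * b / r * b); split => //.
  - by rewrite mul1r divr_ge0 // ltW.
  - by apply: hs; rewrite expr1n.
  - by field.
exists (-1 * a / r), (- - 1 * b / r), (- 1 * a / r * a - - - 1 * b / r * b); split => //.
- by rewrite divr_ge0 ?(ltW r0) //; lra.
- by apply: hs; rewrite sqrrN expr1n.
- by field.
Qed.

Definition e0 : V3 := ebasis R (inord 0).

Lemma e0E : e0 = ((1, 0), 0).
Proof.
by apply: coord_inj => i; rewrite coord_ebasis; case: (ord3P i) => ->; rewrite coordE -val_eqE /= !inordK.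
Qed.

Lemma isometry3_axis x : exists T, isometry3 T /\ T x = enorm x *: e0.
Proof.
have [c [s [r [c0 cs h1 h2]]]] := planar_rotation x.1.1 x.1.2.
have [c' [s' [r' [c0' cs' h1' h2']]]] := planar_rotation r x.2.
pose T := rot02 c' s' \o rot01 c s.
have iT : isometry3 T by apply: isometry3_comp; [exact: isometry3_rot02|exact: isometry3_rot01].
have Tx : T x = r' *: e0.
  rewrite /T /rot02 /rot01 /= h1 h2 h1' h2' e0E.
  by apply: coord_inj => i; rewrite coordZ; case: (ord3P i) => ->; rewrite !coordE /= ?mulr1 ?mulr0.
have dT : enorm x = `|r'|.
  have [_ _ _ hd] := iT; rewrite /enorm -hd Tx dotZl dotZr e0E dotE /= !mulr0 !addr0 !mulr1.
  by rewrite -expr2 sqrtr_sqr.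
have [r0|r0] := lerP 0 r'; first by exists T; split; [exact: iT|rewrite Tx dT ger0_norm].
(* A negative coordinate is reversed by a half turn, the square of the quarter turn [rot01 0 1]. *)
have i1 : isometry3 (rot01 0 1) by apply: isometry3_rot01 => //; rewrite expr0n expr1n add0r.
exists (rot01 0 1 \o (rot01 0 1 \o T)); split; first exact: (isometry3_comp i1 (isometry3_comp i1 iT)).
rewrite dT ltr0_norm // -[LHS]/(rot01 0 1 (rot01 0 1 (T x))) Tx e0E.
by apply: coord_inj => i; rewrite coordZ /rot01 /= /GRing.scale /=; case: (ord3P i) => ->; rewrite !coordE /=; ring.
Qed.
End MeasurePreserving.

(** * Finiteness, positivity and rotation invariance of surface measure *)

Section SurfaceMeasure.
Variable R : realType.
Notation V3 := (V3 R).
Notation LR := (measurableTypeR R).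
Notation W3 := (LR * LR * LR)%type.
Local Notation S := (@sphere3 R).
Local Notation sigma := (sigma3 R).

Lemma sigma3E (A : set V3) :
  sigma A = (3%:E * lebesgue3 R (@normalizeW R @^-1` A `&` @pballW R))%E.
Proof. by []. Qed.

Lemma sq3E (y : V3) : sq3 y = dot y y.
Proof. by rewrite /sq3 dotE !expr2. Qed.

Lemma normalize3E (y : V3) : normalize3 y = powR (dot y y) (- 2^-1) *: y.
Proof. by rewrite /normalize3 sq3E. Qed.

Lemma normalize3_sphere (y : V3) : 0 < dot y y -> S (normalize3 y).
Proof.
move=> h; rewrite normalize3E /sphere3 /= enormZ ger0_norm ?powR_ge0 //.
rewrite powRN powR12_sqrt ?dot_ge0 // mulVf // gt_eqF // sqrtr_gt0 //.
Qed.

Lemma pballW_dot (y : V3) : pballW y -> 0 < dot y y.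
Proof. by rewrite /pballW /= in_itv /= sq3E => /andP[]. Qed.

Lemma sigma3_out : sigma (~` S) = 0%E.
Proof.
rewrite sigma3E (_ : _ `&` _ = set0) ?measure0 ?mule0 //.
apply/seteqP; split => // y [h /pballW_dot /normalize3_sphere]; exact: h.
Qed.

Lemma isometry3_measurable T : @isometry3 R T -> measurable_fun [set: V3] T.
Proof.
move=> [_ _ hB hd]; apply: measurable_to_V3 => i.
have cT : continuous T.
  move=> x; apply/cvgrPdist_lt => e e_gt0; near=> y.
  rewrite -hB; apply: le_lt_trans (norm_le_enorm _) _; rewrite /enorm hd -/(enorm _).
  apply: le_lt_trans (enorm_le_norm _) _; rewrite mulrC -ltr_pdivlMr //.
  by near: y; apply: cvgr_dist_lt; [exact: cvg_id|exact: divr_gt0].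
apply: wcont_measurable => //; apply: cont_wcont => x.
exact: (continuous_comp (cT x) (@coord_cont R i _)).
Unshelve. all: by end_near. Qed.

Lemma isometry3_sphere T : @isometry3 R T -> T @^-1` S = S.
Proof.
by move=> [_ _ _ hd]; apply/seteqP; split => x; rewrite /sphere3 /= /enorm hd.
Qed.

(** [sigma3] measures the cone over [A] in the unit ball. A linear isometry commutes with
    normalisation and preserves the ball, so it carries cones to cones, and these have equal
    volume. *)
Lemma sigma3_isometry T (A : set V3) : isometry3 T -> measurable A -> sigma (T @^-1` A) = sigma A.
Proof.
move=> iT mA; have [[mT hT] hZ _ hd] := iT; rewrite !sigma3E.
have mNA : measurable (@normalizeW R @^-1` A `&` @pballW R).
  apply: measurableI; last exact: measurable_pballW.
  by rewrite -[X in measurable X]setTI; exact: measurable_normalizeW.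
rewrite -(hT _ mNA); f_equal; f_equal.
apply/seteqP; split => y [h1 h2]; split.
- by move: h1; rewrite /= /normalizeW !normalize3E hZ hd.
- by move: h2; rewrite /pballW /= !in_itv /= !sq3E hd.
- by move: h1; rewrite /= /normalizeW !normalize3E hZ hd.
- by move: h2; rewrite /pballW /= !in_itv /= !sq3E hd.
Qed.

Lemma lebesgue3_box (a b : R) : a <= b ->
  lebesgue3 R ((`[a, b]%classic `*` `[a, b]%classic) `*` `[a, b]%classic) = ((b - a) ^+ 3)%:E.
Proof.
move=> ab; have mi : measurable (`[a, b]%classic : set LR) by exact: measurable_itv.
have li : lebesgue_measure (`[a, b]%classic : set LR) = (b - a)%:E.
  rewrite lebesgue_measure_itv /= lte_fin; move: ab; rewrite le_eqVlt => /predU1P[->|->] //.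
  by rewrite ltxx subrr.
have e2 : @leb2 R (`[a, b]%classic `*` `[a, b]%classic) = ((b - a) * (b - a))%:E.
  by rewrite /leb2 (product_measure1E _ _ mi mi) [X in (X * _)%E]li [X in (_ * X)%E]li.
transitivity ((@leb2 R (`[a, b]%classic `*` `[a, b]%classic) * lebesgue_measure (`[a, b]%classic : set LR))%E).
  by apply: (product_measure1E (@leb2 R)) => //; exact: measurableX.
by rewrite e2 li -EFinM exprSr expr2.
Qed.

Lemma sigma3_finite : (sigma setT < +oo)%E.
Proof.
rewrite sigma3E; apply: lte_mul_pinfty => //.
have mb (a b : R) : measurable ((`[a, b]%classic `*` `[a, b]%classic) `*` `[a, b]%classic : set W3).
  by apply: measurableX; [apply: measurableX|]; exact: measurable_itv.
apply: (@le_lt_trans _ _ (lebesgue3 R ((`[(-1), 1]%classic `*` `[(-1), 1]%classic) `*` `[(-1), 1]%classic))); last first.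
  by rewrite lebesgue3_box ?ltry //; lra.
apply: le_measure; rewrite ?inE //; first by rewrite preimage_setT setTI; exact: measurable_pballW.
move=> y [_]; rewrite /pballW /= in_itv /= sq3E dotE -!expr2 => /andP[_ h].
have sq (r : R) : r ^+ 2 <= 1 -> r \in `[(-1), 1].
  by move=> hr; rewrite in_itv /= -ler_norml -(ler_pXn2r (n := 2)) ?nnegrE // expr1n real_normK // num_real.
have := sqr_ge0 y.1.1; have := sqr_ge0 y.1.2; have := sqr_ge0 y.2 => h3 h2 h1.
by split; [split|]; apply: sq; lra.
Qed.

Lemma sigma3_gt0 : (0 < sigma S)%E.
Proof.
have e : sigma S = sigma setT.
  rewrite -(setvU S) measureU ?setICl //; last 2 first.
  - by apply: measurableC; exact: measurable_sphere3.
  - exact: measurable_sphere3.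
  by rewrite [X in (X + _)%E]sigma3_out add0e.
rewrite e sigma3E; apply: mule_gt0 => //.
have mb (a b : R) : measurable ((`[a, b]%classic `*` `[a, b]%classic) `*` `[a, b]%classic : set W3).
  by apply: measurableX; [apply: measurableX|]; exact: measurable_itv.
(* The cube [1/4, 1/2]^3 lies in the punctured unit ball, as |y|^2 is between 3/16 and 3/4 there. *)
apply: (@lt_le_trans _ _ (lebesgue3 R ((`[(1 / 4), (1 / 2)]%classic `*` `[(1 / 4), (1 / 2)]%classic) `*` `[(1 / 4), (1 / 2)]%classic))).
  rewrite lebesgue3_box; last by lra.
  by rewrite lte_fin exprn_gt0 //; lra.
apply: le_measure; rewrite ?inE //; first by rewrite preimage_setT setTI; exact: measurable_pballW.
move=> y [[/= h1 h2] h3]; split => //; rewrite /pballW /= sq3E dotE.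
move: h1 h2 h3; rewrite !in_itv /= => /andP[a1 a2] /andP[b1 b2] /andP[c1 c2].
by apply/andP; split; nra.
Qed.

Definition area : R := fine (sigma S).

Lemma sigma3S_finite : (sigma S < +oo)%E.
Proof.
apply: le_lt_trans sigma3_finite; apply: le_measure; rewrite ?inE //; exact: measurable_sphere3.
Qed.

Lemma sigma3S_fin_num : sigma S \is a fin_num.
Proof. by rewrite ge0_fin_numE ?measure_ge0 // sigma3S_finite. Qed.

Lemma areaE : sigma S = area%:E.
Proof. by rewrite /area fineK // sigma3S_fin_num. Qed.

Lemma area_gt0 : 0 < area.
Proof. by rewrite -lte_fin -areaE sigma3_gt0. Qed.

Lemma wcont_integrableS (f : V3 -> R) : wcont S f -> sigma.-integrable S (EFin \o f).
Proof.
move=> hf; apply: measurable_bounded_integrable.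
- exact: measurable_sphere3.
- exact: sigma3S_finite.
- exact: (wcont_measurable (@measurable_sphere3 R) hf).
have [M [M0 hM]] := wcont_bounded (@sphere3_compact R) hf.
by exists M; split; [exact: num_real|] => x xM y Sy; apply: le_trans (hM y Sy) (ltW xM).
Qed.

Definition sint (f : V3 -> R) : R := Rintegral sigma S f.

Lemma posfun_sint : posfun S sint.
Proof.
split=> [a b f g hf hg|f hf f0]; last exact: Rintegral_ge0.
rewrite /sint -!RintegralZl; try exact: measurable_sphere3; try exact: wcont_integrableS.
rewrite -RintegralD //; first exact: measurable_sphere3.
- by apply: wcont_integrableS; exact: wcontZ.
- by apply: wcont_integrableS; exact: wcontZ.
Qed.

Lemma sint1 : sint (fun _ => 1) = area.
Proof.
by rewrite /sint /Rintegral integral_cst ?mul1e //; exact: measurable_sphere3.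
Qed.

Lemma sint_isometry (T : V3 -> V3) (f : V3 -> R) : isometry3 T -> wcont S f -> (forall e, S e -> 0 <= f e) ->
  sint (fun e => f (T e)) = sint f.
Proof.
move=> iT hf f0; have mT := isometry3_measurable iT; rewrite /sint /Rintegral; congr fine.
have mS := @measurable_sphere3 R.
have := @ge0_integral_pushforward _ _ V3 V3 R T mT sigma S (EFin \o f) mS _ _.
rewrite (isometry3_sphere iT) => <-.
- apply: eq_measure_integral => A mA _; exact: sigma3_isometry.
- by apply/measurable_EFinP; exact: wcont_measurable.
- by move=> e; rewrite inE lee_fin; exact: f0.
Qed.
End SurfaceMeasure.

(** * The Poisson integral *)
Section PoissonRepresentation.
Variable R : realType.
Notation V3 := (V3 R).
Local Notation B := (@ball3 R).
Local Notation S := (@sphere3 R).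
Local Notation CB := [set x : V3 | enorm x <= 1].
Local Notation oB := (@B_open R).

Section ParameterFree.
Variables (P : topologicalType) (D : set V3) (S' : set P) (L : (P -> R) -> R).
Hypotheses (oD : open D) (cS' : compact S') (hL : posfun S' L).

Let dummy n (K : V3 -> P -> R) : JC D S' n K ->
  JC D ([set: R] `*` S') n (fun x (q : R * P) => K x q.2).
Proof. by move=> h; apply: (JC_fix (c := snd) oD _ _ h) => [|q []//]; exact: wcont_snd. Qed.

Lemma JCf_posfun n (K : V3 -> P -> R) : JC D S' n K -> JCf D n (fun x => L (K x)).
Proof. by move=> h; exact: (JC_posfun oD cS' hL (dummy h)). Qed.

Lemma pd_posfun (K : V3 -> P -> R) k x : JC D S' 1 K -> D x ->
  pd k (fun x => L (K x)) x = L (fun p => pd k (K^~ p) x).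
Proof. by move=> h Dx; exact: (derive_posfun oD cS' hL k (dummy h) Dx (p := 0) I).2. Qed.

Lemma pd2_posfun (K : V3 -> P -> R) k l x : JC D S' 2 K -> D x ->
  pd k (pd l (fun x => L (K x))) x = L (fun p => pd k (pd l (K^~ p)) x).
Proof.
move=> h Dx; apply: etrans (pd_on oD k (fun y Dy => pd_posfun l (JC_leS h) Dy) Dx) _.
exact: (pd_posfun k (JC_pd l h) Dx).
Qed.

Lemma JC_slicef n (K : V3 -> P -> R) x : JC D S' n K -> D x -> wcont S' (K x).
Proof. by move=> h Dx; exact: (JC_slice (dummy h) Dx (p := 0) I). Qed.

Local Opaque JC pd.

Lemma lap_posfun (K : V3 -> P -> R) x : JC D S' 2 K -> D x ->
  lap (fun x => L (K x)) x = L (fun p => lap (K^~ p) x).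
Proof.
move=> h Dx; rewrite /lap (posfun_sum hL).
  by apply: eq_bigr => k _; exact: pd2_posfun.
by move=> k; exact: (JC_slicef (JC_pd k (JC_pd k h)) Dx).
Qed.
End ParameterFree.

Local Opaque JC pd.

Lemma posfun_abs_le (T : topologicalType) (S' : set T) (L : (T -> R) -> R) (f G : T -> R) :
  posfun S' L -> wcont S' f -> wcont S' G -> (forall t, S' t -> `|f t| <= G t) -> `|L f| <= L G.
Proof.
move=> pr hf hG h; rewrite ler_norml; have -> : - L G = L (fun t => (-1) * G t) by rewrite (posfunZ pr) // mulN1r.
by apply/andP; split; apply: (posfun_le pr) => //; [exact: wcontZ|..] => t /h;
  rewrite ler_norml ?mulN1r => /andP[].
Qed.

Lemma wcont_weight (A : set V3) : wcont A (@weight R).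
Proof.
apply: (@wcont_eq _ _ _ (fun x => 1 - enorm x ^+ 2)); first by move=> x _; rewrite enorm2.
apply: wcontB; first exact: wcont_cst.
by apply: wcontX; exact/cont_wcont/enorm_cont.
Qed.

Lemma pd2_weight k (x : V3) : B x -> pd k (pd k (@weight R)) x = - 2.
Proof.
move=> Bx; apply: etrans (pd_on oB k (fun y Dy => pd_weight oB k Dy) Bx) _.
by rewrite (pd_Z oB _ k (JCf_coord oB 1 k) Bx) pd_coord eqxx mulr1.
Qed.

Lemma max_principle (g : V3 -> R) (M : R) : wcont CB g -> JCf B 2 g ->
  (forall x, B x -> lap g x = 0) -> (forall x, S x -> g x <= M) -> forall x, CB x -> g x <= M.
Proof.
move=> cg hg lg hS x0 Bx0; rewrite leNgt; apply/negP => gx0.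
(* The perturbation [- e * weight] has Laplacian 6 e > 0, which excludes an interior maximum of [h].
   It vanishes on the sphere and lowers [g] by at most [e], half the excess of [g x0] over [M],
   which excludes a maximum there. *)
pose e := (g x0 - M) / 2; have e0' : 0 < e by rewrite divr_gt0 // subr_gt0.
pose h x := g x + (- e) * weight x.
have ch : wcont CB h by apply: wcontD => //; apply: wcontZ; exact: wcont_weight.
have hB n : JCf B n (@weight R) := JCf_weight oB n.
have [x1 Bx1 hmax] : exists2 x1, CB x1 & forall y, CB y -> h y <= h x1.
  have cb0 : CB !=set0 by exists x0.
  have ch' : {within CB, continuous h} by apply/subspace_continuousP.
  have [x1 x1B hm] := compact_EVT_max cb0 (@cball3_compact R) ch'.
  by exists x1; [rewrite inE in x1B|move=> y yB; apply: hm; rewrite inE].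
have := Bx1; rewrite /= le_eqVlt => /orP[/eqP Sx1|Bx1'].
  have w1 : weight x1 = 0 by rewrite /weight -enorm2 Sx1 expr1n subrr.
  have h1 := hmax x0 Bx0; rewrite /h w1 mulr0 addr0 in h1.
  have h2 := hS x1 Sx1; have w2 : weight x0 <= 1 by rewrite gerBl dot_ge0.
  have w3 : e * weight x0 <= e by rewrite ler_piMr // ltW.
  by move: h1 h2 w3; rewrite mulNr /e; move: (g x0) (g x1) (_ * weight x0) gx0 => a b c; lra.
have ek k : pd k (pd k h) x1 = pd k (pd k g) x1 + e * 2.
  apply: etrans (pd_on oB k (g := fun y => pd k g y + (- e) * pd k (@weight R) y) _ Bx1') _.
    move=> y By; rewrite (pd_D k (JCf_leS hg) (JC_scale oB (- e) (hB 1%N)) By).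
    by rewrite (pd_Z oB _ k (hB 1%N) By).
  have hw2 := JCf_pd k (hB 2%N).
  rewrite (pd_D k (JCf_pd k hg) (JC_scale oB (- e) hw2) Bx1') (pd_Z oB _ k hw2 Bx1').
  by rewrite pd2_weight // mulrNN.
have hh : JCf B 2 h := JC_add oB hg (JC_scale oB (- e) (hB 2%N)).
have hm y : B y -> h y <= h x1 by move=> By; apply: hmax; exact: ltW.
have le0 : lap h x1 <= 0.
  rewrite /lap sum3E; have hk k := interior_max k oB hh Bx1' hm.
  by move: (hk (inord 0)) (hk (inord 1)) (hk (inord 2)); move: (pd _ _ _) (pd _ _ _) (pd _ _ _) => a b c; lra.
move: le0; rewrite /lap (eq_bigr _ (fun k _ => ek k)) big_split /= -/(lap g x1) (lg x1 Bx1') add0r sum3E.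
by move: e0'; clear; move: e => e; lra.
Qed.

Lemma harmonic_zero (g : V3 -> R) : wcont CB g -> JCf B 2 g ->
  (forall x, B x -> lap g x = 0) -> (forall x, S x -> g x = 0) -> forall x, CB x -> g x = 0.
Proof.
move=> cg hg lg hS x Bx; apply/le_anti/andP; split.
  by apply: (max_principle cg hg lg _ Bx) => y /hS ->.
have cg' : wcont CB (fun y => (-1) * g y) by apply: wcontZ.
have lg' y : B y -> lap (fun y => (-1) * g y) y = 0.
  by move=> By; rewrite (lap_Z oB _ hg By) (lg y By) mulr0.
have hS' y : S y -> (-1) * g y <= 0 by move=> /hS ->; rewrite mulr0.
by have := max_principle cg' (JC_scale oB (-1) hg) lg' hS' Bx; rewrite mulN1r oppr_le0.
Qed.

Lemma lap_cst (c : R) x : B x -> lap (fun=> c) x = 0.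
Proof.
move=> Bx; rewrite /lap big1 // => k _.
by apply: etrans (pd_on oB k (fun z _ => pd_cst c k z) Bx) _; rewrite pd_cst.
Qed.

Lemma JCf_scale n (f : V3 -> R) (r : R) : 0 <= r <= 1 -> JCf B n f -> JCf B n (fun y => f (r *: y)).
Proof.
move=> hr hf.
have h := JC_affine (S := [set: R]) (S' := [set: R]) (a := fun=> r) (b := fun=> 0) (c := fun p => p) oB oB
    (@wcont_cst _ _ _ _) (@wcont_cst _ _ _ _) (@wcont_id _ _) _ hf.
apply: (JC_eq oB _ (h _)) => [y p _ _|y p By _]; rewrite addr0 //; split => //; exact: B_star.
Qed.

Lemma lap_scale (f : V3 -> R) (r : R) x : 0 <= r <= 1 -> JCf B 2 f -> B x ->
  lap (fun y => f (r *: y)) x = r ^+ 2 * lap f (r *: x).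
Proof.
move=> hr hf Bx; rewrite /lap mulr_sumr; apply: eq_bigr => k _.
have e y : B y -> pd k (fun y => f (r *: y)) y = r * pd k f (r *: y).
  by move=> By; exact: (pd_scale k (JCf_leS hf) (B_star By hr)).
apply: etrans (pd_on oB k e Bx) _.
rewrite (pd_Z oB _ k (JCf_scale hr (JCf_pd k hf)) Bx) (pd_scale k (JCf_pd k hf) (B_star Bx hr)).
by rewrite mulrA expr2.
Qed.

Definition pint (g : V3 -> R) (x : V3) : R := sint (fun e => g e * Pn x e).

Lemma JC_weighted n (g : V3 -> R) (K : V3 -> V3 -> R) : wcont S g -> JC B S n K ->
  JC B S n (fun x e => g e * K x e).
Proof. by move=> hg hK; apply: (JC_mul oB) => //; exact: (JC_param oB). Qed.

Lemma JCf_pint n g : wcont S g -> JCf B n (pint g).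
Proof.
move=> hg; exact: (JCf_posfun oB (@sphere3_compact R) (@posfun_sint R) (JC_weighted hg (JC_Pn R n))).
Qed.

Lemma lap_pint g x : wcont S g -> B x -> lap (pint g) x = 0.
Proof.
move=> hg Bx; rewrite (lap_posfun oB (@sphere3_compact R) (@posfun_sint R) (JC_weighted hg (JC_Pn R 2)) Bx).
rewrite -[RHS](posfun0 (@posfun_sint R)); apply/esym; apply: (posfun_eq (@posfun_sint R)); first exact: wcont_cst.
move=> e Se; rewrite (lap_Z oB _ (JC_JCf oB (JC_Pn R 2) Se) Bx) lap_Pn // mulr0 //.
Qed.

Lemma wcont_Pn x : B x -> wcont S (Pn x).
Proof. by move=> Bx; exact: (JC_slicef oB (JC_Pn R 0) Bx). Qed.

Lemma sint_Pn_isometry T x : isometry3 T -> B x -> sint (Pn (T x)) = sint (Pn x).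
Proof.
move=> iT Bx; have [_ hZ hB hd] := iT.
have BT : B (T x) by move: Bx; rewrite /ball3 /= /enorm hd.
rewrite -(sint_isometry iT (wcont_Pn BT)); last by move=> e Se; exact: Pn_ge0.
by f_equal; apply/funext => e; rewrite /Pn /weight /Aq /sqd -hB !hd.
Qed.

(* [sint (Pn x)] is harmonic and rotation invariant, so the maximum principle on each ball makes it constant. *)
Lemma mass_const x : B x -> sint (Pn x) = area R.
Proof.
pose one (e : V3) : R := 1.
have one_c : wcont S one by exact: wcont_cst.
have pE : pint one = fun x => sint (Pn x).
  by apply/funext => y; rewrite /pint; f_equal; apply/funext => e; rewrite mul1r.
have P0 : sint (Pn 0) = area R.
  rewrite -sint1; apply: (posfun_eq (@posfun_sint R)); first exact: wcont_Pn (@B0 R).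
  by move=> e Se; rewrite /Pn Aq0 // /weight -(scale0r (0 : V3)) dotZl mul0r subr0 mulr1.
have rad y : B y -> sint (Pn y) = sint (Pn (enorm y *: @e0 R)).
  by move=> By; have [T [iT <-]] := isometry3_axis y; rewrite sint_Pn_isometry.
move=> Bx; rewrite -P0; set r := enorm x.
have r01 : 0 <= r <= 1 by rewrite enorm_ge0 /= ltW.
pose g y := pint one (r *: y) - sint (Pn (r *: @e0 R)).
have hc n : JCf B n (fun=> sint (Pn (r *: @e0 R))) by exact: (JC_cst _ oB).
have hs n : JCf B n (fun y => pint one (r *: y)) := JCf_scale r01 (JCf_pint n one_c).
have g0 : g 0 = 0.
  apply: (@harmonic_zero g); last by rewrite /= enorm0.
  - apply: wcontB; last exact: wcont_cst.
    apply: (@wcont_comp _ _ _ CB B (fun y => r *: y)); last exact: (JCf_wcont (JCf_pint 0 one_c)).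
      move=> y /= hy; rewrite /ball3 /= enormZ ger0_norm ?enorm_ge0 //.
      by apply: le_lt_trans (_ : r < 1); [rewrite ler_piMr ?enorm_ge0|].
    by apply: cont_wcont => y; apply: cvgZ; [exact: cvg_cst|exact: cvg_id].
  - exact: (JC_sub oB (hs 2%N) (hc 2%N)).
  - move=> y By; rewrite /g; have hc' := hc 2%N.
    have -> : lap (fun y => pint one (r *: y) - sint (Pn (r *: @e0 R))) y =
        lap (fun y => pint one (r *: y) + (-1) * sint (Pn (r *: @e0 R))) y.
      by apply: (lap_on oB _ By) => z _; rewrite mulN1r.
    rewrite (lap_D oB (hs 2%N) (JC_scale oB (-1) hc') By) (lap_Z oB _ hc' By).
    rewrite (lap_scale r01 (JCf_pint 2 one_c) By) (lap_pint one_c (B_star By r01)) mulr0 add0r.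
    by rewrite lap_cst // mulr0.
  - move=> w Sw; rewrite /g pE rad; last first.
      by rewrite /ball3 /= enormZ Sw mulr1 ger0_norm ?enorm_ge0.
    by rewrite enormZ Sw mulr1 ger0_norm ?enorm_ge0 // subrr.
move: g0; rewrite /g scaler0 pE => /eqP; rewrite subr_eq0 => /eqP ->.
exact: rad.
Qed.

(** The mass being constant, the difference is the integral of (g x - g e) Pn x e. Near [w]
    continuity of [g] makes it small; away from [w] the kernel is at most [weight x / d ^+ 3], and
    [weight x] is at most twice the distance from [x] to [w]. *)
Lemma poisson_boundary (g : V3 -> R) (w : V3) (eps : R) : wcont CB g -> S w -> 0 < eps ->
  exists2 d : R, 0 < d & forall x, B x -> enorm (x - w) < d -> `|area R * g x - pint g x| <= eps.
Proof.
move=> cg Sw eps0; have ar := area_gt0 R; have pr := @posfun_sint R.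
have SCB : S `<=` CB by move=> y /= ->.
have gS : wcont S g by exact: wcont_sub cg.
have [M [M0 hM]] := wcont_bounded (@cball3_compact R) cg.
pose e1 := eps / 2 / area R; have e10 : 0 < e1 by rewrite !divr_gt0.
have e12 : 0 < e1 / 2 by rewrite divr_gt0.
have [d d0 hd] : exists2 d : R, 0 < d & forall y, CB y -> enorm (y - w) < 2 * d -> `|g w - g y| < e1 / 2.
  have /cvgrPdist_lt/(_ _ e12) := cg w (SCB w Sw); rewrite near_withinE => /nbhs_normP[d /= d0 hd].
  exists (d / 2); first by rewrite divr_gt0.
  move=> y By hy; apply: hd => //; rewrite /ball_ /=; apply: le_lt_trans (norm_le_enorm _) _.
  by rewrite -(opprB y) enormN; apply: lt_le_trans hy _; rewrite mulrC divfK.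
pose C := 2 * M * d^-1 ^+ 3; have C0 : 0 < C by apply: mulr_gt0; [exact: mulr_gt0|apply: exprn_gt0; rewrite invr_gt0].
exists (Num.min d (eps / 2 / (2 * C * area R))).
  rewrite lt_min d0; apply: divr_gt0; first exact: divr_gt0.
  by apply: mulr_gt0 => //; exact: mulr_gt0.
move=> x Bx; rewrite lt_min => /andP[xd xe].
have cPn := wcont_Pn Bx; have w0 := weight_ge0 Bx.
have xw : weight x <= 2 * enorm (x - w) by exact: weight_le.
rewrite -(mass_const Bx) mulrC -(posfunZ pr _ cPn) -(posfunB pr) //; last 2 first.
- exact: wcontZ.
- exact: wcontM.
have BxC : CB x by exact: ltW.
apply: (le_trans (y := sint (fun e => e1 * Pn x e + C * weight x * 1))).
  apply: (posfun_abs_le pr).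
  - by apply: wcontB; [exact: wcontZ|exact: wcontM].
  - by apply: wcontD; [exact: wcontZ|exact: wcont_cst].
  move=> e Se; have p0 := Pn_ge0 e Bx; rewrite -mulrBl normrM (ger0_norm p0) mulr1.
  have [hc|hc] := ltrP (enorm (e - w)) (2 * d).
    apply: (le_trans (y := e1 * Pn x e)); last by rewrite lerDl mulr_ge0 // ltW.
    apply: ler_wpM2r => //.
    have h1 := hd e (SCB _ Se) hc; have h2 : `|g w - g x| < e1 / 2.
      by apply: hd => //; apply: lt_trans xd _; lra.
    have -> : g x - g e = (g w - g e) - (g w - g x) by ring.
    by apply: le_trans (ler_normB _ _) _; lra.
  apply: (le_trans (y := C * weight x)); last by rewrite lerDr mulr_ge0 // ltW.
  have de : d <= enorm (x - e).
    have := enormD (e - x) (x - w); rewrite addrA subrK -(opprB x e) enormN; lra.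
  have h1 : `|g x - g e| <= 2 * M.
    by apply: le_trans (ler_normB _ _) _; have := hM x BxC; have := hM e (SCB _ Se); lra.
  have h2 : Pn x e <= weight x * d^-1 ^+ 3.
    rewrite /Pn (@Aq_inv _ 3 (- (3 / 2))); last by field.
    apply: ler_wpM2l => //; apply: lerXn2r; rewrite ?nnegrE ?invr_ge0 ?enorm_ge0 ?(ltW d0) //.
    by rewrite lef_pV2 // posrE // (lt_le_trans d0).
  apply: le_trans (ler_pM _ _ h1 h2) _ => //.
  by rewrite /C le_eqVlt; apply/orP; left; apply/eqP; ring.
rewrite (posfunD pr); last 2 first.
- exact: wcontZ.
- exact: wcont_cst.
rewrite (posfunZ pr _ cPn) mass_const // (posfunZ pr); last exact: wcont_cst.
rewrite sint1; have -> : e1 * area R = eps / 2 by rewrite /e1 divfK // gt_eqF.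
suff : C * weight x * area R <= eps / 2 by lra.
have h3 : weight x <= 2 * (eps / 2 / (2 * C * area R)) by apply: le_trans xw _; rewrite ler_pM2l // ltW.
have -> : C * weight x * area R = weight x * (C * area R) by ring.
have Ca : 0 < C * area R by exact: mulr_gt0.
rewrite -ler_pdivlMr //; apply: le_trans h3 _.
rewrite le_eqVlt; apply/orP; left; apply/eqP; field.
by rewrite !gt_eqF.
Qed.

Theorem poisson_representation (g : V3 -> R) x : wcont CB g -> JCf B 2 g ->
  (forall y, B y -> lap g y = 0) -> B x -> area R * g x = pint g x.
Proof.
move=> cg hg lg Bx; have SCB : S `<=` CB by move=> y /= ->.
have gS : wcont S g by exact: wcont_sub cg.
pose v0 y := area R * g y + (-1) * pint g y.
(* The Poisson integral is meaningful inside the ball alone, so the difference is extended by 0;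
   [poisson_boundary] makes the extension continuous on the closed ball, and the maximum principle
   then makes it vanish. *)
pose v y := if `[< B y >] then v0 y else 0.
have vB y : B y -> v y = v0 y by rewrite /v => By; case: asboolP.
have hv0 : JCf B 2 v0 := JC_add oB (JC_scale oB _ hg) (JC_scale oB (-1) (JCf_pint 2 gS)).
have vS y : S y -> v y = 0.
  by move=> Sy; rewrite /v; case: asboolP => //; rewrite /ball3 /= Sy ltxx.
suff : v x = 0 by rewrite vB // /v0 mulN1r => /eqP; rewrite subr_eq0 => /eqP.
apply: (@harmonic_zero v); last exact: ltW.
- move=> y; rewrite /= le_eqVlt => /orP[/eqP Sy|By]; last first.
    have h0 : {for y, continuous v0} := wcont_open oB (JCf_wcont hv0) By.
    apply: cvg_within_filter; rewrite vB //.
    have nB : nbhs y B by apply: open_nbhs_nbhs; split; [exact: oB|].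
    by apply: cvg_trans h0; apply: near_eq_cvg; apply: filterS nB => z Bz; rewrite vB.
  rewrite (vS y Sy); apply/cvgrPdist_le => e e_gt0.
  have [d d0 hd] := poisson_boundary cg Sy e_gt0.
  have d3 : 0 < d / 3 by rewrite divr_gt0.
  rewrite near_withinE; have : \forall z \near y, `|y - z| < d / 3.
    by apply/nbhs_normP; exists (d / 3).
  apply: filterS => z hz _; rewrite sub0r normrN /v; case: asboolP => [Bz|_]; last by rewrite normr0 ltW.
  rewrite /v0 mulN1r; apply: hd => //; apply: le_lt_trans (enorm_le_norm _) _.
  by rewrite distrC mulrC -ltr_pdivlMr.
- by apply: (JC_eq oB _ hv0) => y p By _; rewrite vB.
- move=> y By; rewrite (lap_on oB vB By) /v0.
  rewrite (lap_D oB (JC_scale oB _ hg) (JC_scale oB (-1) (JCf_pint 2 gS)) By).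
  by rewrite (lap_Z oB _ hg By) (lap_Z oB _ (JCf_pint 2 gS) By) lg // lap_pint // !mulr0 addr0.
- exact: vS.
Qed.
End PoissonRepresentation.

(** * Smooth approximation of solutions *)
Section Averages.
Variable R : realType.
Notation V3 := (V3 R).
Local Notation leb := (@lebesgue_measure R).
Local Notation I01 := [set t : R | 0 <= t <= 1].
Implicit Types (f g : V3 -> R) (x y : V3) (i j k : 'I_3) (h r : R).

Definition Bl r : set V3 := [set x | enorm x < r].

Lemma Bl_open r : open (Bl r).
Proof.
have -> : Bl r = (@enorm R) @^-1` [set t | t < r] by [].
by apply: open_comp; [move=> x _; exact: enorm_cont|exact: open_lt].
Qed.

Lemma enorm_ebasis i : enorm (ebasis R i) = 1.
Proof.
rewrite /enorm /dot (bigD1 i) //= big1 ?addr0 ?coord_ebasis ?eqxx ?mulr1 ?sqrtr1 // => j ji.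
by rewrite coord_ebasis eq_sym (negbTE ji) mulr0.
Qed.

Lemma Bl_step r h i x s : 0 <= s <= h -> Bl (r - h) x -> Bl r (x + s *: ebasis R i).
Proof.
move=> /andP[s0 sh] hx; apply: le_lt_trans (enormD _ _) _; rewrite enormZ ger0_norm // enorm_ebasis.
by move: hx; rewrite /Bl /= mulr1; lra.
Qed.

Lemma Bl_sub r r' : r <= r' -> Bl r `<=` Bl r'.
Proof. by move=> h x /= hx; exact: lt_le_trans hx h. Qed.

Lemma JCf_sub (D D' : set V3) n f : open D -> open D' -> D' `<=` D -> JCf D n f -> JCf D' n f.
Proof. by move=> oD oD' s; apply: JC_subset. Qed.

Definition mean (f : R -> R) : R := \int[leb]_(t in `[0, 1]) f t.

Lemma posfun_mean : posfun I01 mean.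
Proof.
have -> : mean = fun f : R -> R => \int[leb]_(t in `[0, 1]) (1 * f t).
  by apply/funext => f; congr Rintegral; apply/funext => t; rewrite mul1r.
by apply: posfun_weighted => [|t _]; [exact: wcont_cst|exact: ler01].
Qed.

Lemma mean1 : mean (fun _ => 1) = 1.
Proof.
rewrite /mean (FTC01 (F := id) (f := fun=> 1)) ?subr0 //; first exact: wcont_cst.
exact: wcont_id.
Qed.

Lemma mean_close (f : R -> R) (c e : R) : wcont I01 f -> (forall t, I01 t -> `|f t - c| <= e) -> `|mean f - c| <= e.
Proof.
move=> cf h; have := posfun_norm posfun_mean (wcontB cf (@wcont_cst _ _ _ c)) h.
by rewrite (posfunB posfun_mean cf (@wcont_cst _ _ _ c)) (posfun_cst posfun_mean) mean1 !mulr1.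
Qed.

Lemma antiderivative01 (f : R -> R) : wcont I01 f ->
  exists G, wcont I01 G /\ forall t : R, 0 < t < 1 -> is_derive t (1 : R) G (f t).
Proof.
move=> cf; have fi := wcont_integrable cf.
exists (fun x : R => parameterized_integral leb 0 x f); split.
  by rewrite I01E; apply/subspace_continuousP; exact: parameterized_integral_continuous.
move=> t /andP[t0 t1]; have ft : {for t, continuous f}.
  apply: (@wcont_open _ _ (`]0, 1[%classic : set R)); [exact: itv_open| |by rewrite /= in_itv /= t0].
  by apply: wcont_sub cf => s; rewrite /= in_itv /= => /andP[/ltW -> /ltW ->].
have [d e] := continuous_FTC1_closed t1 fi t0 ft.
by apply: (DeriveDef d); apply: etrans e; apply/esym; exact: derive1E.
Qed.

Lemma is_derive_affine (G : R -> R) (a b t l : R) : is_derive (a * t + b) (1 : R) G l ->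
  is_derive t (1 : R) (fun s => G (a * s + b)) (a * l).
Proof.
move=> hG; have h : is_derive t (1 : R) (fun s : R => a * s + b) a.
  have h1 : is_derive t (1 : R) (fun s : R => a * s) a.
    have -> : (fun s : R => a * s) = (a *: id) by [].
    by apply: is_derive_eq; rewrite /GRing.scale /= mulr1.
  by have h2 := is_deriveD h1 (is_derive_cst b t 1); apply: is_derive_eq h2 _; rewrite addr0.
by rewrite mulrC; exact: (@is_derive1_comp _ G (fun s : R => a * s + b) t l a hG h).
Qed.

(** Affine change of variables, done by evaluating a primitive [G] at the transformed end points. *)
Lemma mean_affine (f : R -> R) (a b : R) : 0 < a -> 0 <= b -> a + b <= 1 -> wcont I01 f ->
  forall G, wcont I01 G -> (forall t : R, 0 < t < 1 -> is_derive t (1 : R) G (f t)) ->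
  mean (fun t => f (a * t + b)) = a^-1 * (G (a + b) - G b).
Proof.
move=> a0 b0 ab cf G cG hG.
have hI t : I01 t -> I01 (a * t + b).
  by move=> /= /andP[t0 t1]; have := mulr_ge0 (ltW a0) t0; have := ler_wpM2l (ltW a0) t1; rewrite mulr1; lra.
have ca : wcont I01 (fun t => a * t + b).
  by apply: wcontD; [apply: wcontZ; exact: wcont_id|exact: wcont_cst].
have cfa : wcont I01 (fun t => f (a * t + b)) := wcont_comp hI ca cf.
have cF : wcont I01 (fun t => a^-1 * G (a * t + b)) by apply: wcontZ; exact: (wcont_comp hI ca cG).
apply: etrans (FTC01 cfa cF _) _; last by rewrite mulr0 add0r mulr1 mulrBr.
move=> t /andP[t0 t1].
have h1 : is_derive t (1 : R) (fun s => G (a * s + b)) (a * f (a * t + b)).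
  apply: is_derive_affine; apply: hG.
  have p1 : 0 < a * t by exact: mulr_gt0.
  have p2 : a * t < a by rewrite gtr_pMr.
  by apply/andP; split; lra.
have h2 : is_derive t (1 : R) (a^-1 *: (fun s => G (a * s + b))) (a^-1 *: (a * f (a * t + b))) by exact: is_deriveZ.
have <- : a^-1 * (a * f (a * t + b)) = f (a * t + b) by rewrite mulKf // gt_eqF.
exact: h2.
Qed.

Lemma mean_half (f : R -> R) : wcont I01 f ->
  mean f = 2^-1 * (mean (fun t => f (2^-1 * t + 0)) + mean (fun t => f (2^-1 * t + 2^-1))).
Proof.
move=> cf; have [G [cG hG]] := antiderivative01 cf.
have e : mean f = G 1 - G 0 by exact: FTC01 cf cG hG.
have h1 : (0 : R) < 2^-1 by lra.
have h2 : (0 : R) <= 2^-1 by lra.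
have h3 : (2^-1 : R) + 0 <= 1 by lra.
have h4 : (2^-1 : R) + 2^-1 <= 1 by lra.
rewrite (mean_affine h1 (lexx 0) h3 cf cG hG) (mean_affine h1 h2 h4 cf cG hG) e invrK addr0.
have -> : (2^-1 : R) + 2^-1 = 1 by lra.
by move: (G 1) (G 0) (G _) => p q s; lra.
Qed.

(** The mean over a segment issuing from [x] in the positive direction, parametrised by [0, 1] so
    that the form [mean] does not depend on [h]. Each averaging shortens the domain by [h], as the
    radii [r - h] record. *)
Definition avg i h f x := mean (fun t => f (x + (t * h) *: ebasis R i)).

Lemma JC_segment n r h i f : 0 <= h -> JCf (Bl r) n f ->
  JC (Bl (r - h)) I01 n (fun x t => f (x + (t * h) *: ebasis R i)).
Proof.
move=> h0 hf.
apply: JC_eq (JC_affine (S' := I01) (a := fun=> 1) (b := fun t : R => (t * h) *: ebasis R i)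
  (c := fun t => t) (@Bl_open r) (@Bl_open (r - h)) _ _ _ _ hf) => //.
- exact: Bl_open.
- by move=> x t _ _; rewrite scale1r.
- exact: wcont_cst.
- by apply: cont_wcont => t; apply: cvgZ; [apply: cvgM; [exact: cvg_id|exact: cvg_cst]|exact: cvg_cst].
- exact: wcont_id.
- move=> x t Bx /= /andP[t0 t1]; rewrite scale1r; split => //; apply: Bl_step Bx.
  by rewrite mulr_ge0 //= ler_piMl.
Qed.

Lemma wcont_segment r h i f x : 0 <= h -> JCf (Bl r) 0 f -> Bl (r - h) x ->
  wcont I01 (fun t => f (x + (t * h) *: ebasis R i)).
Proof. by move=> h0 hf Bx; exact: (JC_slicef (@Bl_open _) (JC_segment i h0 hf) Bx). Qed.

Lemma JCf_avg n r h i f : 0 <= h -> JCf (Bl r) n f -> JCf (Bl (r - h)) n (avg i h f).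
Proof. by move=> h0 hf; exact: (JCf_posfun (@Bl_open _) (@I01_compact R) posfun_mean (JC_segment i h0 hf)). Qed.

Lemma avg_eq r h i f g x : 0 <= h -> JCf (Bl r) 0 f -> (forall y, Bl r y -> f y = g y) -> Bl (r - h) x ->
  avg i h f x = avg i h g x.
Proof.
move=> h0 hf fg Bx; apply: (posfun_eq posfun_mean); first exact: wcont_segment Bx.
by move=> t /= /andP[t0 t1]; apply: fg; apply: Bl_step Bx; rewrite mulr_ge0 //= ler_piMl.
Qed.

Lemma avg_lin r h i f g (a b : R) x : 0 <= h -> JCf (Bl r) 0 f -> JCf (Bl r) 0 g -> Bl (r - h) x ->
  avg i h (fun y => a * f y + b * g y) x = a * avg i h f x + b * avg i h g x.
Proof. by move=> h0 hf hg Bx; apply: posfun_mean.1; exact: wcont_segment Bx. Qed.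

Lemma avg_shift i h f (v x : V3) : avg i h (fun y => f (y + v)) x = avg i h f (x + v).
Proof. by congr mean; apply/funext => t; rewrite addrAC. Qed.

Lemma avg_close r h i f x (c e : R) : 0 <= h -> JCf (Bl r) 0 f -> Bl (r - h) x ->
  (forall t, 0 <= t <= h -> `|f (x + t *: ebasis R i) - c| <= e) -> `|avg i h f x - c| <= e.
Proof.
move=> h0 hf Bx he; apply: mean_close; first exact: wcont_segment Bx.
by move=> t /= /andP[t0 t1]; apply: he; rewrite mulr_ge0 //= ler_piMl.
Qed.

Lemma avg_half r h i f x : 0 <= h -> JCf (Bl r) 0 f -> Bl (r - h) x ->
  avg i h f x = 2^-1 * (avg i (h / 2) f x + avg i (h / 2) f (x + (h / 2) *: ebasis R i)).
Proof.
move=> h0 hf Bx; apply: etrans (mean_half (wcont_segment h0 hf Bx)) _; apply: (f_equal ( *%R 2^-1)).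
apply: (f_equal2 +%R); apply: (f_equal mean).
  by apply/funext => t; congr (f (_ + _ *: _)); ring.
by apply/funext => t; congr f; rewrite -addrA -scalerDl; congr (_ + _ *: _); ring.
Qed.

Local Opaque JC pd.

(** A halving relation in one direction passes through an average in another, so that splitting a
    face reduces to splitting one of its factors. *)
Lemma avg_mid r h j i f g (s : R) x : 0 <= h -> 0 <= s -> JCf (Bl r) 0 f -> JCf (Bl (r + s)) 0 g ->
  (forall y, Bl r y -> f y = 2^-1 * (g y + g (y + s *: ebasis R i))) -> Bl (r - h) x ->
  avg j h f x = 2^-1 * (avg j h g x + avg j h g (x + s *: ebasis R i)).
Proof.
move=> h0 s0 hf hg fg Bx; rewrite (avg_eq j h0 hf fg Bx) mulrDr -avg_shift.
have hs : JCf (Bl r) 0 (fun y => g (y + s *: ebasis R i)).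
  apply: JC_eq (JC_affine (S' := [set: R]) (a := fun=> 1) (b := fun _ : R => s *: ebasis R i)
    (c := fun t => t) (@Bl_open (r + s)) (@Bl_open r) _ _ _ _ hg) => //.
  - exact: Bl_open.
  - by move=> y t _ _; rewrite scale1r.
  - exact: wcont_cst.
  - exact: wcont_cst.
  - exact: wcont_id.
  - move=> y t By _; rewrite scale1r; split => //; apply: (@Bl_step _ s); first by rewrite s0 lexx.
    by rewrite addrK.
have hg' : JCf (Bl r) 0 g by apply: JCf_sub hg; [exact: Bl_open|exact: Bl_open|apply: Bl_sub; lra].
rewrite -(avg_lin j (2^-1) (2^-1) h0 hg' hs Bx); congr mean; apply/funext => t.
by rewrite mulrDr.
Qed.
End Averages.

(** * Difference quotients and the derivative gained by averaging *)

Section Goursat.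
Variable R : realType.
Notation V3 := (V3 R).
Local Notation I01 := [set t : R | 0 <= t <= 1].
Local Notation Bl := (@Bl R).
Local Notation oBl r := (@Bl_open R r).
Implicit Types (f g : V3 -> R) (x y : V3) (i j k : 'I_3) (h r : R).
Local Opaque JC pd.

Definition dquot k h f x := h^-1 * (f (x + h *: ebasis R k) - f x).

Lemma JCf_shift n r h i f : 0 <= h -> JCf (Bl r) n f -> JCf (Bl (r - h)) n (fun y => f (y + h *: ebasis R i)).
Proof.
move=> h0 hf.
have hD x (p : R) : Bl (r - h) x -> [set: R] p -> Bl r (1 *: x + h *: ebasis R i) /\ [set: R] p.
  by move=> Bx _; rewrite scale1r; split => //; apply: Bl_step Bx; rewrite h0 lexx.
have H := JC_affine (oBl r) (oBl (r - h)) (@wcont_cst R R _ 1) (@wcont_cst R V3 _ (h *: ebasis R i))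
  (@wcont_id R setT) hD hf.
by refine (JC_eq (oBl _) _ H) => y t _ _; rewrite scale1r.
Qed.

Lemma JCf_Bl n r r' f : r <= r' -> JCf (Bl r') n f -> JCf (Bl r) n f.
Proof. by move=> h; apply: JCf_sub; [exact: Bl_open|exact: Bl_open|exact: Bl_sub]. Qed.

Lemma JCf_dquot n r h k f : 0 <= h -> JCf (Bl r) n f -> JCf (Bl (r - h)) n (dquot k h f).
Proof.
move=> h0 hf; have h1 : JCf (Bl (r - h)) n f by apply: JCf_Bl hf; lra.
exact: (JC_scale (oBl _) h^-1 (JC_sub (oBl _) (JCf_shift k h0 hf) h1)).
Qed.

(* [f] has the continuous partial derivative [g] in the direction [k]; nothing is assumed in the others. *)
Definition has_pd k r f g := [/\ JCf (Bl r) 0 f, JCf (Bl r) 0 g &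
  forall x, Bl r x -> derivable f x (ebasis R k) /\ pd k f x = g x].

Lemma has_pd_eq k r f g g' : (forall x, Bl r x -> g x = g' x) -> has_pd k r f g -> has_pd k r f g'.
Proof.
move=> e [hf hg h]; split => //; first exact: (JC_eq (oBl r) (fun x _ Bx _ => e x Bx) hg).
by move=> x Bx; rewrite -e //; exact: h.
Qed.

Lemma avg_has_pd k i r h f g : 0 <= h -> has_pd k r f g -> has_pd k (r - h) (avg i h f) (avg i h g).
Proof.
move=> h0 [hf hg hd]; split; [exact: JCf_avg|exact: JCf_avg|move=> x Bx].
have hK := JC_segment i h0 hf; have hG := JC_segment i h0 hg.
have seg y t : Bl (r - h) y -> I01 t -> Bl r (y + (t * h) *: ebasis R i).
  by move=> By /= /andP[t0 t1]; apply: Bl_step By; rewrite mulr_ge0 //= ler_piMl.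
pose K := fun x (q : R * R) => f (x + (q.2 * h) *: ebasis R i).
have aff y (q : R * R) : Bl (r - h) y -> ([set: R] `*` I01) q ->
    derivable (K^~ q) y (ebasis R k) /\ pd k (K^~ q) y = g (y + (q.2 * h) *: ebasis R i).
  move=> By [_ hq]; have [d1 d2] := hd _ (seg y q.2 By hq).
  have [|e1 e2] := @derive_affine R f 1 ((q.2 * h) *: ebasis R i) y (ebasis R k).
    by rewrite scale1r.
  rewrite scale1r mul1r in e2.
  have kE : (fun y => f (1 *: y + (q.2 * h) *: ebasis R i)) = K^~ q.
    by apply/funext => z; rewrite scale1r.
  by rewrite kE in e1 e2; split; [exact: e1|exact: etrans e2 d2].
have fixJ K' : JC (Bl (r - h)) I01 0 K' -> JC (Bl (r - h)) ([set: R] `*` I01) 0 (fun x (q : R * R) => K' x q.2).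
  move=> hK'; have hc (q : R * R) : ([set: R] `*` I01) q -> I01 q.2 by case.
  exact: (JC_fix (oBl _) (@wcont_snd R R _) hc hK').
have [|||||d e] := @derive_posfun_dir R R R (Bl (r - h)) setT I01 (@mean R) (oBl _) (@I01_compact R) (posfun_mean R) K k x 0.
- exact: fixJ hK.
- by move=> y q By hq; have [] := aff y q By hq.
- by refine (JC_eq (oBl _) _ (fixJ _ hG)) => y q By hq; have [_ ->] := aff y q By hq.
- exact: Bx.
- by [].
split; first exact: d.
apply: etrans e _; apply: (posfun_eq (posfun_mean R)).
  apply: (wcont_eq _ (wcont_segment h0 hg Bx)) => t ht.
  by have [_ ->] := aff x (0, t) Bx (conj I ht).
by move=> t ht; have [_ ->] := aff x (0, t) Bx (conj I ht).
Qed.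

(** A moving average of a continuous function is a difference of values of a primitive, so its
    derivative in the averaged direction is a difference quotient of the function itself. *)
Lemma avg_gain i r h f : 0 < h -> JCf (Bl r) 0 f -> has_pd i (r - h) (avg i h f) (dquot i h f).
Proof.
move=> h0 hf; split; [exact: JCf_avg (ltW h0) hf|exact: JCf_dquot (ltW h0) hf|move=> x Bx].
set v := ebasis R i.
(* The primitive is taken on a segment longer by [d] on either side, so that the base point can move
   both ways; a quarter of the free room keeps that segment inside [Bl r]. *)
pose d := (r - h - enorm x) / 4.
have d0 : 0 < d by rewrite divr_gt0 // subr_gt0.
pose l := h + 2 * d; have l0 : 0 < l by rewrite addr_gt0 // mulr_gt0.
pose y := x + (- d) *: v.
have By : Bl (r - l) y.
  rewrite /Bl /=; apply: le_lt_trans (enormD _ _) _.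
  rewrite enormZ normrN gtr0_norm // enorm_ebasis mulr1.
  by move: d0; rewrite /l /d; move: (enorm x) => a; lra.
pose phi (t : R) := f (y + (t * l) *: v).
have cphi : wcont I01 phi := wcont_segment (ltW l0) hf By.
have [G [cG hG]] := antiderivative01 cphi.
have a0 : 0 < h / l by rewrite divr_gt0.
have phiE s : phi (s / l) = f (x + (s - d) *: v).
  by rewrite /phi divfK ?gt_eqF // /y -addrA -scalerDl addrC [- d + s]addrC addrC.
pose A s := (h / l)^-1 * (G (l^-1 * s + (d + h) / l) - G (l^-1 * s + d / l)).
have avgE s : `|s| < d -> avg i h f (x + s *: v) = A s.
  move=> /ltr_normlP[s1 s2].
  have b0 : 0 <= (s + d) / l by rewrite divr_ge0 ?(ltW l0) //; lra.
  have ab : h / l + (s + d) / l <= 1.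
    by rewrite -mulrDl ler_pdivrMr // mul1r /l; lra.
  have := mean_affine a0 b0 ab cphi cG hG; rewrite /A.
  have -> : l^-1 * s + (d + h) / l = h / l + (s + d) / l by ring.
  have -> : l^-1 * s + d / l = (s + d) / l by ring.
  move=> <-; rewrite /avg; f_equal; apply/funext => t.
  have -> : h / l * t + (s + d) / l = (t * h + s + d) / l by ring.
  by rewrite phiE addrK -addrA -scalerDl [s + _]addrC.
have dA : is_derive (0 : R) (1 : R) A (dquot i h f x).
  have g1 : is_derive (0 : R) (1 : R) (fun s => G (l^-1 * s + (d + h) / l)) (l^-1 * phi ((d + h) / l)).
    apply: is_derive_affine; rewrite mulr0 add0r; apply: hG.
    by apply/andP; split; [apply: divr_gt0 => //; exact: addr_gt0|rewrite ltr_pdivrMr // mul1r /l; lra].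
  have g2 : is_derive (0 : R) (1 : R) (fun s => G (l^-1 * s + d / l)) (l^-1 * phi (d / l)).
    apply: is_derive_affine; rewrite mulr0 add0r; apply: hG.
    by apply/andP; split; [exact: divr_gt0|rewrite ltr_pdivrMr // mul1r /l; lra].
  have <- : (h / l)^-1 * (l^-1 * phi ((d + h) / l) - l^-1 * phi (d / l)) = dquot i h f x.
    rewrite !phiE subrr scale0r addr0 addrAC subrr add0r /dquot -/v.
    by move: (f _) (f _) => p q; field; rewrite !gt_eqF.
  exact: (is_deriveZ (h / l)^-1 (is_deriveB g1 g2)).
have dline : is_derive (0 : R) (1 : R) (fun s => avg i h f (x + s *: v)) (dquot i h f x).
  apply: near_eq_is_derive dA; have n0 : \forall s \near (0 : R), `|s| < d by apply/nbhs_normP; exists d => //= s; rewrite /= sub0r normrN.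
  by apply: filterS n0 => s hs; rewrite avgE.
have [e1 e2] := dline; have x0 : x + (0 : R) *: v = x by rewrite scale0r addr0.
split; first by rewrite derivable_line x0 in e1.
by rewrite derive_line x0 in e2.
Qed.
End Goursat.

(** * Averages over boxes and fluxes through their faces *)

Section Flux.
Variable R : realType.
Notation V3 := (V3 R).
Local Notation Bl := (@Bl R).
Local Notation oBl r := (@Bl_open R r).
Implicit Types (f g : V3 -> R) (x y : V3) (i j k : 'I_3) (h r : R).
Local Opaque JC pd.

(** The two axes spanning the face orthogonal to [k] are taken in increasing order, so that [face]
    is [cell] with the average in direction [k] left out. *)
Definition fa k : 'I_3 := if k == inord 0 then inord 1 else inord 0.
Definition fb k : 'I_3 := if k == inord 2 then inord 1 else inord 2.
Lemma inord3 : [/\ (inord 0 == inord 1 :> 'I_3) = false, (inord 0 == inord 2 :> 'I_3) = false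
  & (inord 1 == inord 2 :> 'I_3) = false].
Proof. by rewrite -!val_eqE /= !inordK. Qed.

Lemma fa_neq k : (fa k == k) = false /\ (fb k == k) = false /\ (fb k == fa k) = false.
Proof.
have [n01 n02 n12] := inord3.
have [n10 n20 n21] : [/\ (inord 1 == inord 0 :> 'I_3) = false, (inord 2 == inord 0 :> 'I_3) = false
  & (inord 2 == inord 1 :> 'I_3) = false] by rewrite (eq_sym (inord 1)) !(eq_sym (inord 2)).
by case: (ord3P k) => ->; rewrite /fa /fb ?eqxx ?n01 ?n02 ?n12 ?n10 ?n20 ?n21 ?n01 ?n02 ?n12 ?eqxx ?n10 ?n20 ?n21; split.
Qed.

Lemma ord3_cases i k : [\/ i = fa k, i = fb k | i = k].
Proof.
have [n01 n02 n12] := inord3.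
case: (ord3P k) => ->; case: (ord3P i) => ->; rewrite /fa /fb ?eqxx ?n01 ?n02 ?n12 ?(eq_sym (inord 1) (inord 0))
  ?(eq_sym (inord 2) (inord 0)) ?(eq_sym (inord 2) (inord 1)) ?n01 ?n02 ?n12;
  by [constructor 1|constructor 2|constructor 3].
Qed.

Definition face (H : 'I_3 -> R) k f := avg (fa k) (H (fa k)) (avg (fb k) (H (fb k)) f).
Definition cell h f := avg (inord 0) h (avg (inord 1) h (avg (inord 2) h f)).
(** The outward flux of [F] through the box with corner [x] and sides [H], divided by the volume:
    the difference quotient pairs opposite faces. *)
Definition flux (H : 'I_3 -> R) (F : 'I_3 -> V3 -> R) x := \sum_(k < 3) face H k (dquot k (H k) (F k)) x.

Lemma dquot_avg k i h h' r f x : 0 <= h -> 0 <= h' -> JCf (Bl r) 0 f -> Bl (r - h - h') x ->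
  dquot k h (avg i h' f) x = avg i h' (dquot k h f) x.
Proof.
move=> h0 h0' hf Bx; have hf' : JCf (Bl (r - h)) 0 f by apply: JCf_Bl hf; lra.
have := avg_lin i h^-1 (- h^-1) h0' (JCf_shift k h0 hf) hf' Bx; rewrite avg_shift => e.
rewrite /dquot mulrBr -[- (_ * _)]mulNr -e; f_equal; apply/funext => y.
by rewrite mulrBr mulNr.
Qed.

(** The quotient of [avg_gain] commutes with the remaining averages. Hence the divergence of the
    cell averages of a field is exactly its [flux], the quantity that [goursat] makes zero. *)
Lemma cell_has_pd k r h f : 0 < h -> JCf (Bl r) 0 f ->
  has_pd k (r - h - h - h) (cell h f) (face (fun=> h) k (dquot k h f)).
Proof.
move=> h0 hf; have h0' := ltW h0; have [n01 n02 n12] := inord3.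
case: (ord3P k) => ->; rewrite /face /fa /fb ?eqxx ?n01 ?n02 ?n12 ?(eq_sym (inord 1) (inord 0)) ?(eq_sym (inord 2) (inord 0)) ?n01 ?n02.
- apply: (has_pd_eq _ (avg_gain (inord 0) h0 (JCf_avg (inord 1) h0' (JCf_avg (inord 2) h0' hf)))) => x Bx.
  rewrite (dquot_avg _ _ h0' h0' (JCf_avg (inord 2) h0' hf)) //.
  have hd := JCf_dquot (inord 0) h0' (JCf_avg (inord 2) h0' hf).
  by apply: (avg_eq _ h0' hd _ Bx) => y By; exact: (dquot_avg _ _ h0' h0' hf).
- apply: avg_has_pd => //; apply: (has_pd_eq _ (avg_gain (inord 1) h0 (JCf_avg (inord 2) h0' hf))) => x Bx.
  exact: (dquot_avg _ _ h0' h0' hf).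
- by apply: avg_has_pd => //; apply: avg_has_pd => //; exact: avg_gain.
Qed.

Lemma JCf_face n r h k f : 0 <= h -> JCf (Bl r) n f -> JCf (Bl (r - h - h)) n (face (fun=> h) k f).
Proof. by move=> h0 hf; apply: JCf_avg => //; exact: JCf_avg. Qed.

Lemma JCf_cell n r h f : 0 < h -> JCf (Bl r) n f -> JCf (Bl (r - h - h - h)) n.+1 (cell h f).
Proof.
move=> h0 hf; have hf0 : JCf (Bl r) 0 f := JCf_le (leq0n n) hf.
apply: (JC_S (oBl _)).
  by have [+ _ _] := cell_has_pd (inord 0) h0 hf0; exact: JC_wcont.
move=> k; exists (fun x _ => face (fun=> h) k (dquot k h f) x).
  by move=> x p Bx _; have [_ _] := cell_has_pd k h0 hf0; exact.
exact: (JCf_face k (ltW h0) (JCf_dquot k (ltW h0) hf)).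
Qed.

Lemma cell_pd k r h f x : 0 < h -> JCf (Bl r) 1 f -> Bl (r - h - h - h) x ->
  pd k (cell h f) x = cell h (pd k f) x.
Proof.
move=> h0 hf Bx; have h0' := ltW h0.
have hp : has_pd k r f (pd k f).
  split; [exact: JCf_leS hf|exact: JCf_pd hf|move=> y By; split => //; exact: JCf_derivable hf By].
by have [_ _ /(_ x Bx)[]] := avg_has_pd (inord 0) h0' (avg_has_pd (inord 1) h0' (avg_has_pd (inord 2) h0' hp)).
Qed.

Lemma cell_lin r h f g (a b : R) x : 0 <= h -> JCf (Bl r) 0 f -> JCf (Bl r) 0 g -> Bl (r - h - h - h) x ->
  cell h (fun y => a * f y + b * g y) x = a * cell h f x + b * cell h g x.
Proof.
move=> h0 hf hg Bx; have hfg : JCf (Bl r) 0 (fun y => a * f y + b * g y).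
  exact: (JC_add (oBl r) (JC_scale (oBl r) a hf) (JC_scale (oBl r) b hg)).
have e2 y : Bl (r - h) y -> avg (inord 2) h (fun y => a * f y + b * g y) y =
   a * avg (inord 2) h f y + b * avg (inord 2) h g y by exact: avg_lin.
have e1 y : Bl (r - h - h) y -> avg (inord 1) h (avg (inord 2) h (fun y => a * f y + b * g y)) y =
   a * avg (inord 1) h (avg (inord 2) h f) y + b * avg (inord 1) h (avg (inord 2) h g) y.
  move=> By; apply: etrans (avg_eq _ h0 (JCf_avg (inord 2) h0 hfg) e2 By) _.
  exact: (avg_lin _ _ _ h0 (JCf_avg (inord 2) h0 hf) (JCf_avg (inord 2) h0 hg) By).
apply: etrans (avg_eq _ h0 (JCf_avg (inord 1) h0 (JCf_avg (inord 2) h0 hfg)) e1 Bx) _.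
exact: (avg_lin _ _ _ h0 (JCf_avg (inord 1) h0 (JCf_avg (inord 2) h0 hf)) (JCf_avg (inord 1) h0 (JCf_avg (inord 2) h0 hg)) Bx).
Qed.

Lemma cell_close r h f x (c e d : R) : 0 <= h -> JCf (Bl r) 0 f -> Bl (r - h - h - h) x ->
  (forall y, enorm (y - x) <= d + 3 * h -> `|f y - c| <= e) ->
  forall y, enorm (y - x) <= d -> Bl (r - h - h - h) y -> `|cell h f y - c| <= e.
Proof.
move=> h0 hf Bx hc y hy By.
have step i t z s : 0 <= t <= h -> enorm (z - x) <= s -> enorm (z + t *: ebasis R i - x) <= s + h.
  move=> /andP[t0 th] hz; rewrite addrAC; apply: le_trans (enormD _ _) _.
  by rewrite enormZ ger0_norm // enorm_ebasis mulr1 lerD.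
have h1 := JCf_avg (inord 2) h0 hf; have h2 := JCf_avg (inord 1) h0 h1.
have e0 : (0 <= h) by [].
apply: (avg_close h0 h2 By) => t0 ht0.
apply: (avg_close h0 h1 (Bl_step _ ht0 By)) => t1 ht1.
apply: (avg_close h0 hf (Bl_step _ ht1 (Bl_step _ ht0 By))) => t2 ht2.
apply: hc; have := step (inord 2) _ _ _ ht2 (step (inord 1) _ _ _ ht1 (step (inord 0) _ _ _ ht0 hy)).
by move=> /le_trans; apply; lra.
Qed.

Definition upd i (H : 'I_3 -> R) : 'I_3 -> R := fun j => if j == i then H j / 2 else H j.

Lemma dquot_half k h f y : h != 0 ->
  dquot k h f y = 2^-1 * (dquot k (h / 2) f y + dquot k (h / 2) f (y + (h / 2) *: ebasis R k)).
Proof.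
move=> h0; rewrite /dquot -addrA -scalerDl; have -> : h / 2 + h / 2 = h by field.
by move: (f _) (f _) (f _) => a b c; field.
Qed.

(** Halving the box across direction [i]: an average along [i] splits into those over the two
    halves, and for [i = k] the difference quotient telescopes, the fluxes through the new inner
    face cancelling. *)
Lemma face_split i k (H : 'I_3 -> R) (h : R) f r x : (forall j, 0 < H j <= h) -> JCf (Bl r) 0 f ->
  Bl (r - 4 * h) x -> face H k (dquot k (H k) f) x =
  2^-1 * (face (upd i H) k (dquot k (upd i H k) f) x
    + face (upd i H) k (dquot k (upd i H k) f) (x + (H i / 2) *: ebasis R i)).
Proof.
move=> hH hf Bx; have [nak [nbk nba]] := fa_neq k.
have /andP[a0 ah] := hH (fa k); have /andP[b0 bh] := hH (fb k); have /andP[k0 kh] := hH k.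
have a0' := ltW a0; have b0' := ltW b0; have k0' := ltW k0.
have k2 : 0 <= H k / 2 by rewrite divr_ge0.
have b2 : 0 <= H (fb k) / 2 by rewrite divr_ge0.
have hd := JCf_dquot k k0' hf; have hdb := JCf_avg (fb k) b0' hd.
have Bx' : Bl (r - H k - H (fb k) - H (fa k)) x by apply: Bl_sub Bx; lra.
case: (ord3_cases i k) => ->; rewrite /face /upd ?eqxx ?nak ?nbk ?nba ?(eq_sym (fa k)) ?(eq_sym k) ?nak ?nbk ?nba.
- exact: avg_half a0' hdb Bx'.
- apply: (avg_mid (fa k) (i := fb k) a0' b2 hdb _ _ Bx').
    by apply: JCf_Bl (JCf_avg (fb k) b2 hd); lra.
  by move=> y By; exact: avg_half b0' hd By.
- have hd2 := JCf_dquot k k2 hf.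
  apply: (avg_mid (fa k) (i := k) a0' k2 hdb _ _ Bx').
    by apply: JCf_Bl (JCf_avg (fb k) b0' hd2); lra.
  move=> y By; apply: (avg_mid (fb k) (i := k) b0' k2 hd _ _ By); first by apply: JCf_Bl hd2; lra.
  by move=> z Bz; apply: dquot_half; rewrite gt_eqF.
Qed.

Lemma half_choice (p q s : R) : p = 2^-1 * (q + s) -> `|p| <= `|q| \/ `|p| <= `|s|.
Proof.
move=> e; have [|h1] := lerP `|p| `|q|; first by left.
have [|h2] := lerP `|p| `|s|; first by right.
have : `|p| <= 2^-1 * (`|q| + `|s|).
  by rewrite e normrM (@ger0_norm _ 2^-1) ?invr_ge0 // ler_wpM2l ?invr_ge0 // ler_normD.
by move: h1 h2; clear; lra.
Qed.

Lemma flux_split i (H : 'I_3 -> R) (h : R) (F : 'I_3 -> V3 -> R) r x : (forall j, 0 < H j <= h) ->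
  (forall k, JCf (Bl r) 0 (F k)) -> Bl (r - 4 * h) x ->
  exists2 s, 0 <= s <= H i / 2 & `|flux H F x| <= `|flux (upd i H) F (x + s *: ebasis R i)|.
Proof.
move=> hH hF Bx; have /andP[i0 _] := hH i.
have e : flux H F x = 2^-1 * (flux (upd i H) F x + flux (upd i H) F (x + (H i / 2) *: ebasis R i)).
  rewrite /flux -big_split mulr_sumr; apply: eq_bigr => k _; exact: face_split hH (hF k) Bx.
have h2 : 0 <= H i / 2 by rewrite divr_ge0 // ltW.
have [hl|hl] := half_choice e; last by exists (H i / 2); [rewrite h2 lexx|].
by exists 0; [rewrite lexx|rewrite scale0r addr0].
Qed.

(** One cut per direction restores the shape of a cube. The corner moves by at most [h / 2] at each
    cut, and the margin [6 * h] leaves both the [4 * h] that every cut requires and the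
    [6 * (h / 2)] of the next round. *)
Lemma flux_bisect (h : R) (F : 'I_3 -> V3 -> R) r x : 0 < h -> (forall k, JCf (Bl r) 0 (F k)) ->
  Bl (r - 6 * h) x -> exists y, [/\ forall i, coord i x <= coord i y <= coord i x + h / 2,
    Bl (r - 6 * (h / 2)) y & `|flux (fun=> h) F x| <= `|flux (fun=> h / 2) F y|].
Proof.
move=> h0 hF Bx; have [n01 n02 n12] := inord3.
have [q0 q1 q2 q3] : [/\ r - 6 * h <= r - 4 * h, r - 6 * h + h / 2 <= r - 4 * h,
  r - 6 * h + h / 2 + h / 2 <= r - 4 * h & r - 6 * h + h / 2 + h / 2 + h / 2 <= r - 6 * (h / 2)].
  by move: h0; clear; split; lra.
have hU i (H : 'I_3 -> R) : (forall j, 0 < H j <= h) -> forall j, 0 < upd i H j <= h.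
  move=> hH j; have /andP[j0 jh] := hH j; rewrite /upd; case: ifP => _; last by rewrite j0.
  by rewrite divr_gt0 //=; lra.
pose H0 : 'I_3 -> R := fun=> h; have hH0 j : 0 < H0 j <= h by rewrite /H0 h0 lexx.
pose H1 := upd (inord 0) H0; have hH1 j : 0 < H1 j <= h := hU (inord 0) _ hH0 j.
pose H2 := upd (inord 1) H1; have hH2 j : 0 < H2 j <= h := hU (inord 1) _ hH1 j.
have B0 : Bl (r - 4 * h) x by exact: Bl_sub q0 _ Bx.
have [s0 hs0 le0] := flux_split (inord 0) hH0 hF B0.
have E1 : H0 (inord 0) = h by [].
have E2 : H1 (inord 1) = h by rewrite /H1 /upd eq_sym n01.
have E3 : H2 (inord 2) = h by rewrite /H2 /H1 /upd !(eq_sym (inord 2)) n12 n02.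
rewrite E1 in hs0.
have B1 : Bl (r - 6 * h + h / 2) (x + s0 *: ebasis R (inord 0)).
  by apply: (Bl_step _ hs0); rewrite addrK.
have B1' : Bl (r - 4 * h) (x + s0 *: ebasis R (inord 0)) by exact: Bl_sub q1 _ B1.
have [s1 hs1 le1] := flux_split (inord 1) hH1 hF B1'; rewrite E2 in hs1.
have B2 : Bl (r - 6 * h + h / 2 + h / 2) (x + s0 *: ebasis R (inord 0) + s1 *: ebasis R (inord 1)).
  by apply: (Bl_step _ hs1); rewrite addrK.
have B2' : Bl (r - 4 * h) (x + s0 *: ebasis R (inord 0) + s1 *: ebasis R (inord 1)) by exact: Bl_sub q2 _ B2.
have [s2 hs2 le2] := flux_split (inord 2) hH2 hF B2'; rewrite E3 in hs2.
exists (x + s0 *: ebasis R (inord 0) + s1 *: ebasis R (inord 1) + s2 *: ebasis R (inord 2)); split.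
- move=> i; rewrite !coordD !coordZ !coord_ebasis.
  move: hs0 hs1 hs2 => /andP[a0 b0] /andP[a1 b1] /andP[a2 b2]; clear -h0 a0 b0 a1 b1 a2 b2 n01 n02 n12.
  case: (ord3P i) => ->; rewrite ?eqxx ?n01 ?n02 ?n12 ?(eq_sym (inord 1) (inord 0)) ?(eq_sym (inord 2)) ?n01 ?n02 ?n12 /=;
    move: (coord _ x) => c; apply/andP; split; lra.
- have B3 : Bl (r - 6 * h + h / 2 + h / 2 + h / 2)
      (x + s0 *: ebasis R (inord 0) + s1 *: ebasis R (inord 1) + s2 *: ebasis R (inord 2)).
    by apply: (Bl_step _ hs2); rewrite addrK.
  exact: Bl_sub q3 _ B3.
- have EH : upd (inord 2) H2 = fun=> h / 2; last first.
    by rewrite EH in le2; exact: le_trans le0 (le_trans le1 le2).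
  apply/funext => i; rewrite /H2 /H1 /upd /H0; clear.
  have [n01 n02 n12] := inord3.
  by case: (ord3P i) => ->; rewrite ?eqxx ?n01 ?n02 ?n12 ?(eq_sym (inord 1) (inord 0)) ?(eq_sym (inord 2)) ?n01 ?n02 ?n12.
Qed.
End Flux.

(** * Goursat's subdivision argument for divergence-free fields *)

Section ConservationLaw.
Variable R : realType.
Notation V3 := (V3 R).
Local Notation Bl := (@Bl R).
Local Notation oBl r := (@Bl_open R r).
Implicit Types (f g : V3 -> R) (x y : V3) (i j k : 'I_3) (h r : R).

Lemma diff_expand f x (e : R) : differentiable f x -> 0 < e ->
  \forall v \near (0 : V3), `|f (v + x) - f x - linform (fun k => pd k f x) v| <= e * `|v|.
Proof.
move=> df e0; have /eqaddoP := diff_locally df => /(_ e e0).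
apply: filterS => v; rewrite /= !fctE /= opprD addrA.
have -> : linform (fun k => pd k f x) v = 'd f x v; last by [].
rewrite [in RHS](ebasis_sum v) !sum3E !linearD !linearZ /= /linform sum3E /pd !deriveE //.
Qed.

Local Opaque JC pd.

Section Bisection.
Variables (r h0 : R) (F : 'I_3 -> V3 -> R) (x0 : V3).
Hypotheses (h0_gt0 : 0 < h0) (hF : forall k, JCf (Bl r) 0 (F k)) (Bx0 : Bl (r - 6 * h0) x0).

Let hn n : R := h0 / 2 ^+ n.
Let hn_gt0 n : 0 < hn n. Proof. by rewrite divr_gt0 // exprn_gt0. Qed.
Let hnS n : hn n.+1 = hn n / 2. Proof. by rewrite /hn exprSr invfM mulrA. Qed.

Lemma nested_boxes : exists X : nat -> V3, [/\ X 0%N = x0,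
  forall n, Bl (r - 6 * hn n) (X n),
  forall n i, coord i (X n) <= coord i (X n.+1) <= coord i (X n) + hn n.+1 &
  forall n, `|flux (fun=> h0) F x0| <= `|flux (fun=> hn n) F (X n)|].
Proof.
have [nx hnx] : {nx : nat -> V3 -> V3 | forall n x, Bl (r - 6 * hn n) x ->
   [/\ forall i, coord i x <= coord i (nx n x) <= coord i x + hn n.+1,
    Bl (r - 6 * hn n.+1) (nx n x) & `|flux (fun=> hn n) F x| <= `|flux (fun=> hn n.+1) F (nx n x)|]}.
  have H (q : nat * V3) : {y : V3 | Bl (r - 6 * hn q.1) q.2 ->
   [/\ forall i, coord i q.2 <= coord i y <= coord i q.2 + hn q.1.+1,
    Bl (r - 6 * hn q.1.+1) y & `|flux (fun=> hn q.1) F q.2| <= `|flux (fun=> hn q.1.+1) F y|]}.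
    (* Outside the admissible region the next corner is the dummy 0, which makes the choice a total
       function. *)
    apply: cid; have [Bq|nB] := pselect (Bl (r - 6 * hn q.1) q.2); last by exists 0.
    by have [y hy] := flux_bisect (hn_gt0 q.1) hF Bq; exists y; rewrite hnS.
  by exists (fun n x => sval (H (n, x))) => n x; exact: (svalP (H (n, x))).
pose X := fix X n := if n is n'.+1 then nx n' (X n') else x0.
have BX n : Bl (r - 6 * hn n) (X n).
  elim: n => [|n IH]; first by rewrite /hn expr0 divr1.
  by have [_ h _] := hnx n _ IH; exact: h.
exists X; split; [by []|exact: BX| |].
  by move=> n i; have [h _ _] := hnx n _ (BX n); exact: h.
elim=> [|n IH]; first by rewrite /hn expr0 divr1.
by apply: le_trans IH _; have [_ _ h] := hnx n _ (BX n); exact: h.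
Qed.

(** The corners increase in each coordinate and stay bounded; the coordinatewise supremum lies in
    every box, and the margin at the first stage keeps it inside [Bl r]. *)
Lemma nested_point : exists (X : nat -> V3) (z : V3), [/\ Bl r z,
  forall n, Bl (r - 6 * hn n) (X n),
  forall n, `|X n - z| <= hn n &
  forall n, `|flux (fun=> h0) F x0| <= `|flux (fun=> hn n) F (X n)|].
Proof.
have [X [X0 BX cX fX]] := nested_boxes.
have mono n m i : coord i (X n) <= coord i (X (n + m)%N) <= coord i (X n) + hn n - hn (n + m)%N.
  elim: m => [|m /andP[h1 h2]]; first by rewrite addn0 addrK lexx.
  have /andP[h3 h4] := cX (n + m)%N i; rewrite addnS.
  have e : hn (n + m)%N = 2 * hn (n + m).+1 by rewrite hnS; field.
  rewrite (le_trans h1 h3) /=; move: h2 h4; rewrite e.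
  by move: (coord i _) (coord i _) (coord i _) (hn n) (hn _) => a b c d q; lra.
pose A i := [set coord i (X n) | n in [set: nat]].
have A0 i : A i !=set0 by exists (coord i (X 0%N)); exists 0%N.
have ub n i : ubound (A i) (coord i (X n) + hn n).
  move=> _ [m _ <-]; have h := ltW (hn_gt0 n).
  have [nm|mn] := leqP n m.
    have /andP[_] := mono n (m - n)%N i; rewrite subnKC // => h2; have := hn_gt0 m.
    by move: h2; move: (coord i _) (coord i _) (hn n) (hn m) => a b c d; lra.
  have /andP[h2 _] := mono m (n - m)%N i; rewrite subnKC ?(ltnW mn) // in h2.
  by apply: le_trans h2 _; rewrite lerDl.
have hs i : has_sup (A i) by split => //; exists (coord i (X 0%N) + hn 0); exact: ub.
pose z := vec3 (fun i => sup (A i)).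
have zX n i : coord i (X n) <= coord i z <= coord i (X n) + hn n.
  rewrite vec3K; apply/andP; split; first by apply: sup_upper_bound => //; exists n.
  by apply: ge_sup => //; exact: ub.
have Xz n : `|X n - z| <= hn n.
  apply: norm_le_coord => i; rewrite coordB ler_norml; have /andP[h1 h2] := zX n i.
  by move: h1 h2 (hn_gt0 n); move: (coord i _) (coord i _) (hn n) => a b c; lra.
exists X, z; split; [|exact: BX|exact: Xz|exact: fX].
have e0 : hn 0 = h0 by rewrite /hn expr0 divr1.
have : enorm z <= enorm (X 0%N) + enorm (z - X 0%N) by rewrite -{1}(subrK (X 0%N) z) addrC; exact: enormD.
move=> /le_lt_trans; apply; have := enorm_le_norm (z - X 0%N); have := Xz 0%N; rewrite -normrN opprB e0.
have := BX 0%N; rewrite /Bl /= e0; move: h0_gt0.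
by move: (enorm _) (enorm _) (`|_|) h0 => a b c d; lra.
Qed.
End Bisection.

(** The expansion at [z] is used at [y] and at [y + h e_k], which are within 4 h and 5 h of [z]. The
    increment then carries an error of at most (4 + 5) h e / 9, whence the 9. *)
Lemma dquot_close k f (z y : V3) h (d e : R) : 0 < h -> 0 < e -> 5 * h < d ->
  (forall v, `|v| < d -> `|f (v + z) - f z - linform (fun k => pd k f z) v| <= e / 9 * `|v|) ->
  `|y - z| <= 4 * h -> `|dquot k h f y - pd k f z| <= e.
Proof.
move=> h0 e0 hd hf hy; set l := linform _ in hf.
have hek : `|h *: ebasis R k| <= h.
  by rewrite normrZ gtr0_norm // -[leRHS]mulr1 ler_pM2l //; apply: le_trans (norm_le_enorm _) _; rewrite enorm_ebasis.
have n1 : `|y + h *: ebasis R k - z| <= 5 * h.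
  rewrite addrAC; apply: le_trans (ler_normD _ _) _; move: hy hek; move: `|_| `|_| => a b; lra.
have d1 : `|y - z| < d by move: hy hd h0; move: `|_| => a; lra.
have r1 := hf _ d1; have r2 := hf _ (le_lt_trans n1 hd).
rewrite subrK in r1; rewrite subrK in r2.
have le : l (y + h *: ebasis R k - z) = l (y - z) + h * pd k f z.
  rewrite addrAC /l linearD linearZ /= /linform; congr (_ + h * _).
  rewrite (bigD1 k) //= coord_ebasis eqxx mul1r big1 ?addr0 // => j jk.
  by rewrite coord_ebasis eq_sym (negbTE jk) mul0r.
rewrite le in r2.
have b1 : e / 9 * `|y - z| <= e / 9 * (4 * h) by rewrite ler_pM2l // divr_gt0.
have b2 : e / 9 * `|y + h *: ebasis R k - z| <= e / 9 * (5 * h) by rewrite ler_pM2l // divr_gt0.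
have key : `|f (y + h *: ebasis R k) - f y - h * pd k f z| <= h * e.
  move: (le_trans r1 b1) (le_trans r2 b2); rewrite !ler_norml.
  have -> : e / 9 * (4 * h) = 4 / 9 * (h * e) by ring.
  have -> : e / 9 * (5 * h) = 5 / 9 * (h * e) by ring.
  move: (f _) (f _) (f _) (l _) (h * pd _ _ _) (h * e) => p q s t u w.
  by move=> /andP[? ?] /andP[? ?]; apply/andP; split; lra.
rewrite /dquot; have -> : h^-1 * (f (y + h *: ebasis R k) - f y) - pd k f z
   = h^-1 * (f (y + h *: ebasis R k) - f y - h * pd k f z).
  by rewrite [in RHS]mulrBr mulKf ?gt_eqF.
by rewrite normrM gtr0_norm ?invr_gt0 // mulrC ler_pdivrMr // [leRHS]mulrC.
Qed.

(* Goursat: a flux not vanishing over a box would persist, at the same scale, along a sequence of boxes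
   shrinking to a point, where differentiability and the pointwise equation force it to be negligible. *)
Theorem goursat (r h : R) (F : 'I_3 -> V3 -> R) x : 0 < h -> (forall k, JCf (Bl r) 0 (F k)) ->
  (forall k y, Bl r y -> differentiable (F k) y) ->
  (forall y, Bl r y -> \sum_(k < 3) pd k (F k) y = 0) ->
  Bl (r - 6 * h) x -> flux (fun=> h) F x = 0.
Proof.
move=> h0 hF dF eF Bx; have [X [z [Bz BX Xz fX]]] := nested_point h0 hF Bx.
apply/eqP; rewrite -normr_le0; apply/ler_addgt0Pl => e e0; rewrite addr0.
have e3 : 0 < e / 3 by rewrite divr_gt0.
have e39 : 0 < e / 3 / 9 by rewrite divr_gt0.
have [d d0 hd] : exists2 d : R, 0 < d & forall k v, `|v| < d ->
    `|F k (v + z) - F k z - linform (fun j => pd j (F k) z) v| <= e / 3 / 9 * `|v|.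
  have H k : \forall v \near (0 : V3), `|F k (v + z) - F k z - linform (fun j => pd j (F k) z) v| <= e / 3 / 9 * `|v|.
    exact: diff_expand (dF k z Bz) e39.
  have [d /= d0 hd] := (nbhs_normP _ _).1 (filterI (H (inord 0)) (filterI (H (inord 1)) (H (inord 2)))).
  exists d; first exact: d0.
  move=> k v hv; have hv' : ball_ Num.norm 0 d v by rewrite /ball_ /= sub0r normrN.
  have [a [b c]] := hd v hv'.
  by case: (ord3P k) => ->; [exact: a|exact: b|exact: c].
have [n hn] : exists n, 5 * (h / 2 ^+ n) < d.
  have [n hn] : exists n : nat, 5 * h / d < n%:R.
    by exists (Num.truncn (5 * h / d)).+1; apply: truncnS_gt.
  exists n; have p0 : (0 : R) < 2 ^+ n by exact: exprn_gt0.
  have h1 : 5 * h < n%:R * d by rewrite -ltr_pdivrMr.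
  have h2 : n%:R <= (2 : R) ^+ n by rewrite -natrX ler_nat ltnW // ltn_expl.
  rewrite mulrA ltr_pdivrMr // [d * _]mulrC; apply: lt_le_trans h1 _.
  by rewrite ler_pM2r.
set m := h / 2 ^+ n in hn; have m0 : 0 < m by rewrite divr_gt0 // exprn_gt0.
apply: le_trans (fX n) _; rewrite -/m.
rewrite /flux.
have Bm : Bl (r - m - m - m) (X n).
  by apply: Bl_sub (BX n); rewrite -/m; move: m0; clear; lra.
have fc k : `|face (fun=> m) k (dquot k m (F k)) (X n) - pd k (F k) z| <= e / 3.
  have hq := JCf_dquot k (ltW m0) (hF k); have hqb := JCf_avg (fb k) (ltW m0) hq.
  apply: (avg_close (ltW m0) hqb Bm) => s hs; have Bs := Bl_step (fa k) hs Bm.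
  apply: (avg_close (ltW m0) hq Bs) => t ht.
  apply: (dquot_close k m0 e3 hn (hd k)).
  have st i (q : R) : 0 <= q <= m -> `|q *: ebasis R i| <= m.
    move=> /andP[q0 qm]; rewrite normrZ ger0_norm // -[leRHS]mulr1; apply: ler_pM => //.
    by apply: le_trans (norm_le_enorm _) _; rewrite enorm_ebasis.
  rewrite addrAC [X n + _ - z]addrAC; apply: le_trans (ler_normD _ _) _.
  apply: le_trans (lerD (ler_normD _ _) (st _ _ ht)) _.
  have := Xz n; rewrite -/m; have := st (fa k) _ hs; move: m0; move: `|_| `|_| => a b; lra.
have := eF z Bz; rewrite !sum3E; move: (fc (inord 0)) (fc (inord 1)) (fc (inord 2)).
rewrite !ler_norml; move: (face _ _ _ _) (face _ _ _ _) (face _ _ _ _) (pd _ _ _) (pd _ _ _) (pd _ _ _).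
by move=> a b c a' b' c' /andP[? ?] /andP[? ?] /andP[? ?] ?; apply/andP; split; lra.
Qed.
End ConservationLaw.

(** * Averages of solutions are smooth solutions *)

Section SmoothApproximation.
Variable R : realType.
Notation V3 := (V3 R).
Local Notation Bl := (@Bl R).
Local Notation oBl r := (@Bl_open R r).
Local Notation CB := [set x : V3 | enorm x <= 1].
Implicit Types (f g : V3 -> R) (x y : V3) (i j k : 'I_3) (h r : R).
Variables (lam mu : R).
Local Notation lameop := (lameop lam mu).

(** This tensor, rather than the symmetric stress, has the operator as its divergence term by term,
    so that second derivatives need not be interchanged for a solution whose second derivatives may
    be discontinuous. *)
Definition stress (f : 'I_3 -> V3 -> R) i k x : R :=
  mu * pd k (f i) x + (lam + mu) * (k == i)%:R * (\sum_(j < 3) pd j (f j) x).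

Lemma coord_derive i (u : V3 -> V3) x v : derivable u x v ->
  derivable (coord i \o u) x v /\ 'D_v (coord i \o u) x = coord i ('D_v u x).
Proof.
move=> du; set D := 'D_v u x.
have h : (fun h : R => h^-1 *: (((coord i \o u) \o shift x) (h *: v) - (coord i \o u) x)) @ 0^' --> coord i D.
  have -> : (fun h : R => h^-1 *: (((coord i \o u) \o shift x) (h *: v) - (coord i \o u) x)) =
      (fun h : R => coord i (h^-1 *: ((u \o shift x) (h *: v) - u x))).
    by apply/funext => t; rewrite coordZ coordB.
  have du' : (fun h : R => h^-1 *: ((u \o shift x) (h *: v) - u x)) @ 0^' --> D := du.
  exact: (cvg_comp (fun h : R => h^-1 *: ((u \o shift x) (h *: v) - u x)) (coord i) du' (@coord_cont R i D)).
split; first by apply/cvg_ex; exists (coord i D).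
exact/cvg_lim.
Qed.

Lemma coord_differentiable i (u : V3 -> V3) x : differentiable u x -> differentiable (coord i \o u) x.
Proof.
move=> du; apply: (differentiable_comp du); have o : open [set: V3] := openT.
exact: (C1_differentiable o (JCf_coord o 1 i) I).
Qed.

Lemma differentiable_stress (f : 'I_3 -> V3 -> R) i k x : (forall i j, differentiable (pd j (f i)) x) ->
  differentiable (stress f i k) x /\ pd k (stress f i k) x =
  mu * pd k (pd k (f i)) x + (lam + mu) * (k == i)%:R * (\sum_(j < 3) pd k (pd j (f j)) x).
Proof.
move=> df; set c := (lam + mu) * _.
have -> : stress f i k = mu *: pd k (f i) +
    c *: (pd (inord 0) (f (inord 0)) + pd (inord 1) (f (inord 1)) + pd (inord 2) (f (inord 2))).
  by apply/funext => y; rewrite /stress sum3E.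
have d3 : differentiable (pd (inord 0) (f (inord 0)) + pd (inord 1) (f (inord 1)) + pd (inord 2) (f (inord 2))) x.
  by apply: differentiableD; [apply: differentiableD|]; exact: df.
split; first by apply: differentiableD; apply: differentiableZ; [exact: df|exact: d3].
have dd j i' := diff_derivable (v := ebasis R k) (df i' j).
rewrite /pd deriveD; [|exact/derivableZ/dd|exact/derivableZ/diff_derivable/d3].
rewrite (deriveZ _ (dd _ _)) deriveZ; last exact: diff_derivable.
rewrite deriveD; [|by apply: derivableD; exact: dd|exact: dd].
by rewrite deriveD; [|exact: dd|exact: dd]; rewrite sum3E.
Qed.

Lemma near_differentiable f g x : (\near x, f x = g x) -> differentiable f x -> differentiable g x.
Proof.
move=> fg df; have h : (g : V3 -> R^o) \o shift x = cst (g x : R^o) + ('d f x : V3 -> R^o) +o_ (0 : V3) id.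
  apply/eqaddoP => e e0; have /eqaddoP/(_ e e0) := diff_locally df.
  have fg' : \forall v \near (0 : V3), f (v + x) = g (v + x).
    have [d /= d0 hd] := (nbhs_normP _ _).1 fg; apply/nbhs_normP; exists d => // v.
    by rewrite /ball_ /= sub0r normrN => hv; apply: hd; rewrite /ball_ /= opprD addrCA subrr addr0 normrN.
  by apply: filterS2 fg' => v; rewrite /= !fctE /= => -> ; rewrite (nbhs_singleton fg).
have cl : continuous ('d f x : V3 -> R^o) by exact: diff_continuous.
have e : 'd (g : V3 -> R^o) x = ('d f x : V3 -> R^o) :> (V3 -> R^o) by exact: diff_unique cl h.
by apply/diff_locallyP; rewrite e.
Qed.

Lemma sum_delta (c : R) (F : 'I_3 -> R) i : \sum_(k < 3) c * (k == i)%:R * F k = c * F i.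
Proof.
rewrite (bigD1 i) //= eqxx mulr1 big1 ?addr0 // => k ki.
by rewrite (negbTE ki) mulr0 mul0r.
Qed.

Local Opaque JC pd.

Lemma stress_div (f : 'I_3 -> V3 -> R) i x : (forall i j, differentiable (pd j (f i)) x) ->
  \sum_(k < 3) pd k (stress f i k) x = lameop f i x.
Proof.
move=> df; rewrite (eq_bigr _ (fun k _ => (differentiable_stress i k df).2)) big_split /=.
rewrite /lameop /lap mulr_sumr; apply: (f_equal (+%R _)).
exact: (sum_delta (lam + mu) (fun k => \sum_(j < 3) pd k (pd j (f j)) x) i).
Qed.

Lemma cell_stress r h (f : 'I_3 -> V3 -> R) i k x : 0 < h -> (forall i, JCf (Bl r) 1 (f i)) ->
  Bl (r - h - h - h) x -> stress (fun i => cell h (f i)) i k x = cell h (stress f i k) x.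
Proof.
move=> h0 hf Bx; have h0' := ltW h0.
have hp j i' : JCf (Bl r) 0 (pd j (f i')) := JCf_pd j (hf i').
have hd : JCf (Bl r) 0 (fun y => \sum_(j < 3) pd j (f j) y) by apply: (JCf_sum (oBl r)).
rewrite /stress (cell_lin mu ((lam + mu) * (k == i)%:R) h0' (hp k i) hd Bx) (cell_pd k h0 (hf i) Bx).
f_equal; f_equal.
rewrite sum3E !(cell_pd _ h0 (hf _) Bx).
have -> : (fun y => \sum_(j < 3) pd j (f j) y) = fun y => 1 * (1 * pd (inord 0) (f (inord 0)) y
    + 1 * pd (inord 1) (f (inord 1)) y) + 1 * pd (inord 2) (f (inord 2)) y.
  by apply/funext => y; rewrite !mul1r sum3E.
have h01 : JCf (Bl r) 0 (fun y => 1 * pd (inord 0) (f (inord 0)) y + 1 * pd (inord 1) (f (inord 1)) y).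
  exact: (JC_add (oBl r) (JC_scale (oBl r) 1 (hp _ _)) (JC_scale (oBl r) 1 (hp _ _))).
rewrite (cell_lin 1 1 h0' h01 (hp _ _) Bx) (cell_lin 1 1 h0' (hp _ _) (hp _ _) Bx).
by move: (cell h _ x) (cell h _ x) (cell h _ x) => a b c; rewrite !mul1r.
Qed.

(** Averaging the equation itself would require integrable second derivatives. Instead the operator
    applied to the averages is the divergence of the averaged stress, hence the flux of the stress
    through a cube, which [goursat] makes zero. *)
Lemma cell_lame r h (f : 'I_3 -> V3 -> R) i x : 0 < h -> (forall i, JCf (Bl r) 1 (f i)) ->
  (forall i j y, Bl r y -> differentiable (pd j (f i)) y) -> (forall i y, Bl r y -> lameop f i y = 0) ->
  Bl (r - 6 * h) x -> lameop (fun i => cell h (f i)) i x = 0.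
Proof.
move=> h0 hf df ef Bx.
have sub : Bl (r - 6 * h) `<=` Bl (r - h - h - h) by apply: Bl_sub; move: h0; lra.
have hc i' : JCf (Bl (r - h - h - h)) 2 (cell h (f i')) := JCf_cell h0 (hf i').
rewrite -stress_div; last first.
  by move=> i' j; exact: (C1_differentiable (oBl _) (JCf_pd j (hc i')) (sub _ Bx)).
have hs k : JCf (Bl r) 0 (stress f i k).
  have hd : JCf (Bl r) 0 (fun y => \sum_(j < 3) pd j (f j) y) by apply: (JCf_sum (oBl r)) => j; exact: JCf_pd (hf j).
  exact: (JC_add (oBl r) (JC_scale (oBl r) mu (JCf_pd k (hf i))) (JC_scale (oBl r) ((lam + mu) * (k == i)%:R) hd)).
have ds k y : Bl r y -> differentiable (stress f i k) y.
  by move=> By; have [] := differentiable_stress i k (fun i' j => df i' j y By).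
have es y : Bl r y -> \sum_(k < 3) pd k (stress f i k) y = 0.
  by move=> By; rewrite stress_div ?ef // => i' j; exact: df.
rewrite -[RHS](goursat h0 hs ds es Bx) /flux; apply: eq_bigr => k _.
have [_ _ /(_ x (sub _ Bx))[_ e]] := cell_has_pd k h0 (hs k).
apply: etrans _ e; apply: (pd_on (oBl _) k _ (sub _ Bx)) => y By; exact: cell_stress.
Qed.

Lemma cell_lame_step n r h (f : 'I_3 -> V3 -> R) : 0 < h -> (forall i, JCf (Bl r) n.+2 (f i)) ->
  (forall i y, Bl r y -> lameop f i y = 0) ->
  (forall i, JCf (Bl (r - 6 * h)) n.+3 (cell h (f i))) /\
  (forall i y, Bl (r - 6 * h) y -> lameop (fun i => cell h (f i)) i y = 0).
Proof.
move=> h0 hf ef; split=> i.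
  by apply: JCf_Bl (JCf_cell h0 (hf i)); move: h0; lra.
have hf2 j : JCf (Bl r) 2 (f j) by exact: (JCf_le (m := 2) _ (hf j)).
move=> y; apply: (cell_lame i h0 (fun j => JCf_leS (hf2 j)) _ ef) => j k z Bz.
exact: (C1_differentiable (oBl _) (JCf_pd k (hf2 j)) Bz).
Qed.

Lemma JCf_scaleBl n r (t : R) f : 0 < t -> JCf (Bl r) n f -> JCf (Bl (r / t)) n (fun y => f (t *: y)).
Proof.
move=> t0 hf.
have hD x (p : R) : Bl (r / t) x -> [set: R] p -> Bl r (t *: x + 0) /\ [set: R] p.
  by move=> Bx _; split => //; rewrite addr0 /Bl /= enormZ gtr0_norm // mulrC -ltr_pdivlMr.
have H := JC_affine (oBl r) (oBl (r / t)) (@wcont_cst R R _ t) (@wcont_cst R V3 _ 0) (@wcont_id R setT) hD hf.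
by refine (JC_eq (oBl _) _ H) => y p _ _; rewrite addr0.
Qed.

Lemma pd_scaleBl r (t : R) f k x : 0 < t -> JCf (Bl r) 1 f -> Bl (r / t) x ->
  pd k (fun y => f (t *: y)) x = t * pd k f (t *: x).
Proof.
move=> t0 hf Bx; have Btx : Bl r (t *: x) by rewrite /Bl /= enormZ gtr0_norm // mulrC -ltr_pdivlMr.
have [|_ e] := @derive_affine R f t 0 x (ebasis R k); first by rewrite addr0; exact: JCf_derivable hf Btx.
rewrite addr0 in e; rewrite -[RHS]e.
by have -> : (fun y => f (t *: y + 0)) = (fun y => f (t *: y)) by apply/funext => y; rewrite addr0.
Qed.

Lemma pd2_scaleBl r (t : R) f k l x : 0 < t -> JCf (Bl r) 2 f -> Bl (r / t) x ->
  pd l (pd k (fun y => f (t *: y))) x = t ^+ 2 * pd l (pd k f) (t *: x).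
Proof.
move=> t0 hf Bx; apply: etrans (pd_on (oBl _) l (fun y By => pd_scaleBl k t0 (JCf_leS hf) By) Bx) _.
rewrite (pd_Z (oBl _) t l (JCf_scaleBl t0 (JCf_pd k hf)) Bx) (pd_scaleBl l t0 (JCf_pd k hf) Bx).
by rewrite mulrA expr2.
Qed.

Lemma lameop_scale r (t : R) (f : 'I_3 -> V3 -> R) i x : 0 < t -> (forall i, JCf (Bl r) 2 (f i)) ->
  Bl (r / t) x -> lameop (fun j y => f j (t *: y)) i x = t ^+ 2 * lameop f i (t *: x).
Proof.
move=> t0 hf Bx; rewrite /lameop /lap.
have key (F G : 'I_3 -> R) : mu * (\sum_(k < 3) t ^+ 2 * F k) + (lam + mu) * (\sum_(k < 3) t ^+ 2 * G k) =
    t ^+ 2 * (mu * (\sum_(k < 3) F k) + (lam + mu) * (\sum_(k < 3) G k)).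
  by rewrite -!mulr_sumr; move: (\sum_(k < 3) F k) (\sum_(k < 3) G k) => a b; ring.
apply: etrans (f_equal2 +%R (f_equal ( *%R mu) (eq_bigr _ (fun k _ => pd2_scaleBl k k t0 (hf i) Bx)))
  (f_equal ( *%R (lam + mu)) (eq_bigr _ (fun j _ => pd2_scaleBl j i t0 (hf j) Bx)))) _.
exact: key.
Qed.

Lemma lame_solution_C1 (u : V3 -> V3) : lame_solution lam mu u ->
  [/\ forall i, JCf (Bl 1) 1 (coord i \o u),
    forall i j y, Bl 1 y -> differentiable (pd j (coord i \o u)) y &
    forall i y, Bl 1 y -> lameop (fun i => coord i \o u) i y = 0].
Proof.
move=> hu.
have dd i j y : Bl 1 y -> differentiable (pd j (coord i \o u)) y.
  move=> By; have [_ [d2 _]] := hu y By.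
  have dc : differentiable (coord i \o 'D_(ebasis R j) u) y := coord_differentiable i (d2 j).
  have nB : nbhs y (Bl 1) by apply: open_nbhs_nbhs; split; [exact: Bl_open|].
  apply: (near_differentiable _ dc); apply: filterS nB => z Bz; have [d1 _] := hu z Bz.
  by have [_ e] := coord_derive i (diff_derivable (v := ebasis R j) d1); exact: esym e.
split => //.
- move=> i; apply: (JC_S (oBl _)).
    have hc : wcont (Bl 1) (coord i \o u).
      move=> x Bx; have [d1 _] := hu x Bx; apply: cvg_within_filter.
      exact: differentiable_continuous (coord_differentiable i d1).
    by apply: (@wcont_comp _ _ _ _ (Bl 1) fst (coord i \o u)) => //; [move=> z []|exact: wcont_fst].
  move=> k; exists (fun x _ => pd k (coord i \o u) x).
    move=> x p Bx _; split => //; have [d1 _] := hu x Bx.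
    by have [d _] := coord_derive i (diff_derivable (v := ebasis R k) d1).
  split => //.
  have hc : wcont (Bl 1) (pd k (coord i \o u)).
    by move=> x Bx; apply: cvg_within_filter; exact: differentiable_continuous (dd i k x Bx).
  by apply: (@wcont_comp _ _ _ _ (Bl 1) fst (pd k (coord i \o u))) => //; [move=> z []|exact: wcont_fst].
- by move=> i y By; have [_ [_ e]] := hu y By; rewrite -lameopE.
Qed.

Lemma shift_uniform (f : V3 -> R) r (e : R) : 0 < r < 1 -> wcont (Bl 1) f -> 0 < e ->
  exists2 d : R, 0 < d & forall x y, enorm x <= r -> enorm (y - x) <= d -> `|f y - f x| <= e.
Proof.
move=> /andP[r0 r1] cf e0.
have hF : wcont (Bl (1 - r) `*` CB) (fun z : V3 * V3 => f (r *: z.2 + z.1)).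
  apply: (@wcont_comp _ _ _ _ (Bl 1) (fun z : V3 * V3 => r *: z.2 + z.1)) cf.
    move=> [s x] [/= hs hx]; apply: le_lt_trans (enormD _ _) _; rewrite enormZ gtr0_norm //.
    by move: hs; rewrite /Bl /= => hs; have := ler_wpM2l (ltW r0) hx; rewrite mulr1; move: (enorm _) (_ * _) hs => a b; lra.
  apply: cont_wcont => z; apply: cvgD; last exact: cvg_fst.
  by apply: cvgZ; [exact: cvg_cst|exact: cvg_snd].
have h0 : Bl (1 - r) 0 by rewrite /Bl /= enorm0 subr_gt0.
have := wcont_uniform (@cball3_compact R) hF h0 e0; rewrite near_withinE => /nbhs_normP[d /= d0 hd].
pose d' := Num.min (d / 2) ((1 - r) / 2).
have d'0 : 0 < d' by rewrite lt_min !divr_gt0 // subr_gt0.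
exists d' => // x y hx; rewrite le_min => /andP[y1 y2].
have Bs : Bl (1 - r) (y - x) by rewrite /Bl /=; apply: le_lt_trans y2 _; rewrite ltr_pdivrMr //; lra.
have hs : ball_ Num.norm 0 d (y - x).
  rewrite /ball_ /= sub0r normrN; apply: le_lt_trans (norm_le_enorm _) _.
  by apply: le_lt_trans y1 _; rewrite ltr_pdivrMr //; lra.
have hx' : CB (r^-1 *: x) by rewrite /= enormZ gtr0_norm ?invr_gt0 // mulrC ler_pdivrMr // mul1r.
have := hd _ hs Bs _ hx'.
by rewrite /= !scalerA mulfV ?gt_eqF // scale1r addr0 [x + _]addrC subrK distrC.
Qed.

(** Three averagings raise C^1 to C^4, the regularity asked by [smooth_representation]. The dilation
    by [r] turns a ball slightly larger than that of radius [r] into one containing the closed unit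
    ball. *)
Theorem lame_approx (u : V3 -> V3) r (e : R) : lame_solution lam mu u -> 0 < r < 1 -> 0 < e ->
  exists (q : R) (v : 'I_3 -> V3 -> R), [/\ 1 < q, forall i, JCf (Bl q) 4 (v i),
    forall i x, Bl q x -> lameop v i x = 0 &
    forall i x, CB x -> `|v i x - coord i (u (r *: x))| <= e].
Proof.
move=> hu r01 e0; have /andP[r0 r1] := r01.
have [c1 d1 l1] := lame_solution_C1 hu.
pose f i := coord i \o u.
have [d d0 hd] : exists2 d : R, 0 < d & forall i x y, enorm x <= r -> enorm (y - x) <= d -> `|f i y - f i x| <= e.
  have H i := shift_uniform r01 (JCf_wcont (c1 i)) e0.
  have [a a0 ha] := H (inord 0); have [b b0 hb] := H (inord 1); have [c c0 hc] := H (inord 2).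
  exists (Num.min a (Num.min b c)); first by rewrite !lt_min a0 b0.
  move=> i x y hx; rewrite !le_min => /andP[ya /andP[yb yc]].
  by case: (ord3P i) => ->; [exact: ha|exact: hb|exact: hc].
(* Each averaging shrinks the domain by [6 * h], in all [18 * h], for which [(1 - r) / 40] leaves
   room; each reaches points at distance at most [3 * h], in all [9 * h], kept below the modulus
   [d]. *)
pose h := Num.min (d / 9) ((1 - r) / 40).
have h0 : 0 < h by rewrite lt_min !divr_gt0 // subr_gt0.
have hd9 : 9 * h <= d by rewrite mulrC -ler_pdivlMr // ge_min lexx.
have hr : 40 * h <= 1 - r by rewrite mulrC -ler_pdivlMr // ge_min lexx orbT.
clearbody h.
pose f1 i := cell h (f i); pose f2 i := cell h (f1 i); pose f3 i := cell h (f2 i).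
have e1 i y : Bl (1 - 6 * h) y -> lameop f1 i y = 0 by exact: cell_lame.
have c2 i : JCf (Bl (1 - 6 * h)) 2 (f1 i) by apply: JCf_Bl (JCf_cell h0 (c1 i)); move: h0; lra.
have [c3 e2] := cell_lame_step h0 c2 e1.
have [c4 e3] := cell_lame_step h0 c3 e2.
set rho := 1 - 6 * h - 6 * h - 6 * h in c4 e3.
have rr : r < rho by move: hr h0; rewrite /rho; clear; lra.
exists (rho / r), (fun i x => f3 i (r *: x)); split.
- by rewrite ltr_pdivlMr // mul1r.
- by move=> i; apply: JCf_scaleBl => //; exact: c4.
- move=> i x Bx; rewrite (lameop_scale i r0 _ Bx); last by move=> j; exact: (JCf_le (m := 2) _ (c4 j)).
  by rewrite e3 ?mulr0 // /Bl /= enormZ gtr0_norm // mulrC -ltr_pdivlMr.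
- move=> i x hx; set z := r *: x; have hz : enorm z <= r by rewrite enormZ gtr0_norm // ler_piMr // ltW.
  have zz t : 0 <= t -> enorm (z - z) <= t by rewrite subrr enorm0.
  have B1 : Bl (1 - h - h - h) z by apply: le_lt_trans hz _; move: hr h0; clear; lra.
  have B2 : Bl (1 - 6 * h - h - h - h) z by apply: le_lt_trans hz _; move: hr h0; clear; lra.
  have B3 : Bl (1 - 6 * h - 6 * h - h - h - h) z by apply: le_lt_trans hz _; move: hr h0; clear; lra.
  have near s y : enorm (y - z) <= s -> enorm y <= r + s.
    move=> hy; rewrite -(subrK z y); apply: le_trans (enormD _ _) _.
    by move: hy hz; move: (enorm _) (enorm _) => a b; lra.
  have F1 y : enorm (y - z) <= 6 * h -> `|f1 i y - coord i (u z)| <= e.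
    move=> hy; have hy2 := near _ _ hy.
    apply: (cell_close (d := 6 * h) (ltW h0) (JCf_leS (c1 i)) B1 _ hy).
      by move=> y' hy'; apply: hd => //; apply: le_trans hd9; move: hy'; lra.
    by apply: le_lt_trans hy2 _; move: hr h0; clear; lra.
  have F2 y : enorm (y - z) <= 3 * h -> `|f2 i y - coord i (u z)| <= e.
    move=> hy; have hy2 := near _ _ hy.
    apply: (cell_close (d := 3 * h) (ltW h0) (JCf_le (m := 0) isT (c2 i)) B2 _ hy).
      by move=> y' hy'; apply: F1; move: hy'; lra.
    by apply: le_lt_trans hy2 _; move: hr h0; clear; lra.
  apply: (cell_close (d := 0) (ltW h0) (JCf_le (m := 0) isT (c3 i)) B3 _ (zz 0 (lexx 0)) B3).
  by move=> y' hy'; apply: F2; move: hy'; lra.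
Qed.
End SmoothApproximation.

(** * Boundary representation *)
Section SmoothRepresentation.
Variable R : realType.
Notation V3 := (V3 R).
Local Notation B := (@ball3 R).
Local Notation S := (@sphere3 R).
Local Notation CB := [set x : V3 | enorm x <= 1].
Local Notation oB := (@B_open R).
Implicit Types (f g : V3 -> R) (x y : V3) (i j k : 'I_3).
Variables (lam mu : R).
Hypotheses (hmu : 0 < mu) (hlm : 0 < 2 * mu + lam).
Notation al := (alpha_e lam mu).
Notation be := (beta_e lam mu).
Local Opaque JC pd.

Lemma lap_sum (D : set V3) (F : 'I_3 -> V3 -> R) x : open D -> (forall i, JCf D 2 (F i)) -> D x ->
  lap (fun y => \sum_(i < 3) F i y) x = \sum_(i < 3) lap (F i) x.
Proof.
move=> oD hF Dx.
have -> : (fun y => \sum_(i < 3) F i y) = fun y => (F (inord 0) y + F (inord 1) y) + F (inord 2) y.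
  by apply/funext => y; rewrite sum3E.
rewrite (lap_D oD (JC_add oD (hF _) (hF _)) (hF _) Dx) (lap_D oD (hF _) (hF _) Dx).
by rewrite [RHS]sum3E.
Qed.

Section Solution.
Variables (D : set V3) (v : 'I_3 -> V3 -> R).
Hypotheses (oD : open D) (starD : forall x (t : R), D x -> 0 <= t <= 1 -> D (t *: x)).
Hypotheses (hv : forall i, JCf D 4 (v i)) (ev : forall i x, D x -> lameop lam mu v i x = 0).

Definition dvg (v : 'I_3 -> V3 -> R) x := \sum_(j < 3) pd j (v j) x.
(** For harmonic W the Laplacian of (1 - |x|^2) W is - 4 (x . grad W + (3/2) W). Harmonicity of
    [harmonic_part] thus asks for an Euler equation with constant 3/2, whence the exponent 1/2 of
    [Tf]; the factor in front is the one that cancels [lap (v i)], itself a multiple of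
    [pd i (dvg v)]. *)
Definition potential i x : R := (lam + 3 * mu) / mu / 2 * Tf 2^-1 (pd i (dvg v)) x.
Definition harmonic_part i x : R := v i x + (- be) * (weight x * potential i x).
Local Notation d := (dvg v).
Local Notation W := potential.
Local Notation U := harmonic_part.

Let hd : JCf D 3 d. Proof. by apply: (JCf_sum oD) => j; exact: JCf_pd (hv j). Qed.
Let hv1 i : JCf D 1 (v i) := JCf_le (m := 1) (n := 4) isT (hv i).
Let hv2 i : JCf D 2 (v i) := JCf_le (m := 2) (n := 4) isT (hv i).
Let hd1 : JCf D 1 d := JCf_le (m := 1) (n := 3) isT hd.
Let hp1 i : JCf D 1 (pd i d) := JCf_leS (JCf_pd i hd).
Let h2 : 0 < 2^-1 :> R. Proof. by rewrite invr_gt0. Qed.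
Let hW i : JCf D 2 (W i). Proof. exact: (JC_scale oD _ (JCf_Tf oD starD h2 (JCf_pd i hd))). Qed.

Lemma lame_grad i x : D x -> mu * lap (v i) x + (lam + mu) * pd i d x = 0.
Proof.
move=> Dx; rewrite -(ev i Dx) /lameop; apply: (f_equal (fun z => _ + _ * z)).
by apply: (pd_sum oD i _ Dx) => j; exact: (JCf_pd j (hv2 j)).
Qed.

(** Taking the divergence of the system leaves (2 mu + lam) lap (div v) = 0. *)
Lemma dvg_harmonic x : D x -> lap d x = 0.
Proof.
move=> Dx.
have e i : mu * lap (pd i (v i)) x + (lam + mu) * pd i (pd i d) x = 0.
  have := pd_eq0 oD i (fun y Dy => lame_grad i Dy) Dx.
  have l1 : JCf D 1 (lap (v i)) := JCf_leS (JCf_lap oD (hv i)).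
  have g1 := hp1 i.
  move=> <-; apply/esym.
  rewrite (pd_D i (JC_scale oD mu l1) (JC_scale oD (lam + mu) g1) Dx).
  rewrite (pd_Z oD mu i l1 Dx) (pd_Z oD (lam + mu) i g1 Dx).
  by rewrite (lap_pd oD i (JCf_leS (hv i)) Dx).
have s : \sum_(i < 3) (mu * lap (pd i (v i)) x + (lam + mu) * pd i (pd i d) x) = 0.
  by rewrite big1 // => i _; exact: e.
rewrite big_split /= -!mulr_sumr in s.
have l : lap d x = \sum_(i < 3) lap (pd i (v i)) x.
  by apply: (lap_sum oD _ Dx) => i; exact: (JCf_leS (JCf_pd i (hv i))).
rewrite -l -/(lap d x) -mulrDl in s; move/eqP: s; rewrite mulf_eq0 => /orP[|/eqP //].
by rewrite gt_eqF //; move: hmu hlm; lra.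
Qed.

Lemma potential_harmonic i x : D x -> lap (W i) x = 0.
Proof.
move=> Dx; have ht : JCf D 2 (Tf 2^-1 (pd i d)) := JCf_Tf oD starD h2 (JCf_pd i hd).
rewrite (lap_Z oD _ ht Dx) (lap_Tf oD starD h2 (JCf_pd i hd) _ Dx) ?mulr0 //.
by move=> y Dy; rewrite (lap_pd oD i hd Dy); exact: (pd_eq0 oD i dvg_harmonic Dy).
Qed.

Lemma pd_potential i j x : D x -> pd j (W i) x = (lam + 3 * mu) / mu / 2 * Tf (2^-1 + 1) (pd j (pd i d)) x.
Proof.
move=> Dx; have hp := hp1 i.
have ht : JCf D 1 (Tf 2^-1 (pd i d)) := JCf_Tf oD starD h2 hp.
by rewrite (pd_Z oD _ j ht Dx) (pd_Tf oD starD h2 j hp Dx).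
Qed.

Lemma potential_euler i x : D x ->
  \sum_(k < 3) coord k x * pd k (W i) x + 3 / 2 * W i x = (lam + 3 * mu) / mu / 2 * pd i d x.
Proof.
move=> Dx; have hp := hp1 i.
have ht : JCf D 1 (Tf 2^-1 (pd i d)) := JCf_Tf oD starD h2 hp.
have := euler_Tf oD starD h2 hp Dx; rewrite /W; set c := (lam + 3 * mu) / mu / 2.
have -> : \sum_(k < 3) coord k x * pd k (fun x => c * Tf 2^-1 (pd i d) x) x =
   c * (\sum_(k < 3) coord k x * pd k (Tf 2^-1 (pd i d)) x).
  by rewrite mulr_sumr; apply: eq_bigr => k _; rewrite (pd_Z oD c k ht Dx) mulrCA.
by move=> ->; move: c (Tf _ _ _) (pd _ _ _) => c a b; field.
Qed.

Lemma potential_sym i j x : D x -> pd j (W i) x = pd i (W j) x.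
Proof.
move=> Dx; rewrite (pd_potential i j Dx) (pd_potential j i Dx); apply: (f_equal ( *%R _)).
by apply: (Tf_on starD _ _ Dx) => y Dy; exact: schwarz oD (JCf_leS hd) Dy.
Qed.

Lemma potential_div x : D x -> \sum_(i < 3) pd i (W i) x = 0.
Proof.
move=> Dx; have h32 : (0 : R) < 2^-1 + 1 by apply: addr_gt0.
rewrite (eq_bigr _ (fun i _ => pd_potential i i Dx)) -mulr_sumr.
rewrite (Tf_sum starD h32 _ Dx); last by move=> i; exact: (JCf_pd i (hp1 i)).
by rewrite (Tf_eq0 starD h32 dvg_harmonic Dx) mulr0.
Qed.

Let hwW i : JCf D 2 (fun y => weight y * W i y) := JC_mul oD (JCf_weight oD 2) (hW i).
Let hU i : JCf D 2 (U i). Proof. exact: (JC_add oD (hv2 i) (JC_scale oD (- be) (hwW i))). Qed.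

Lemma harmonic_part_lap i x : D x -> lap (U i) x = 0.
Proof.
move=> Dx; rewrite (lap_D oD (hv2 i) (JC_scale oD (- be) (hwW i)) Dx).
rewrite (lap_Z oD (- be) (hwW i) Dx) (lap_weight oD (hW i) Dx) (potential_harmonic i Dx).
have := lame_grad i Dx; have := potential_euler i Dx; rewrite /beta_e.
move: (\sum_(k < 3) _) (W i x) (pd i d x) (lap (v i) x) (weight x) => E w g l c e1 e2.
have m0 : mu != 0 by rewrite gt_eqF.
have l0 : 2 * lam + 6 * mu != 0 by rewrite gt_eqF //; move: hmu hlm; lra.
have -> : l = - (lam + mu) / mu * g.
  by apply: (mulfI m0); rewrite [RHS]mulrC mulrAC divfK // mulNr; move: e2; lra.
have -> : E = (lam + 3 * mu) / mu / 2 * g - 3 / 2 * w by rewrite -e1 addrK.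
by field; rewrite m0 l0.
Qed.

Lemma dvg_harmonic_part x : D x -> dvg U x = d x + 2 * be * (\sum_(i < 3) coord i x * W i x).
Proof.
move=> Dx; have e i : pd i (U i) x = pd i (v i) x + 2 * be * (coord i x * W i x) - be * weight x * pd i (W i) x.
  rewrite (pd_D i (hv1 i) (JC_scale oD (- be) (JCf_leS (hwW i))) Dx).
  rewrite (pd_Z oD (- be) i (JCf_leS (hwW i)) Dx) (pd_M i (JCf_weight oD 1) (JCf_leS (hW i)) Dx).
  rewrite (pd_weight oD i Dx); move: (pd _ _ _) (pd _ _ _) (W i x) (coord i x) (weight x) => a b c z w; ring.
rewrite /dvg (eq_bigr _ (fun i _ => e i)) !big_split /= sumrN -!mulr_sumr potential_div //.
by rewrite mulr0 subr0.
Qed.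

(** Expressing [dvg v] through the divergence of the harmonic part turns the constant 3/2 of
    [potential_euler] into 2 - alpha, the constant of the kernel, and makes the right-hand side
    depend on the boundary values alone. That the potential is curl free and divergence free enters
    here. *)
Lemma potential_eq j x : D x ->
  \sum_(i < 3) coord i x * pd i (W j) x + (1 - al + 1) * W j x = pd j (dvg U) x.
Proof.
move=> Dx; have hc i : JCf D 1 (fun y => coord i y * W i y) := JC_mul oD (JCf_coord oD 1 i) (JCf_leS (hW i)).
have hs : JCf D 1 (fun y => \sum_(i < 3) coord i y * W i y) by apply: (JCf_sum oD).
have -> : pd j (dvg U) x = pd j d x + 2 * be * (W j x + \sum_(i < 3) coord i x * pd i (W j) x).
  apply: etrans (pd_on oD j dvg_harmonic_part Dx) _.
  rewrite (pd_D j (hd1) (JC_scale oD (2 * be) hs) Dx) (pd_Z oD _ j hs Dx).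
  apply: (f_equal (fun z => _ + _ * z)); apply: etrans (pd_sum oD j hc Dx) _.
  have e i : pd j (fun y => coord i y * W i y) x = 1 * (i == j)%:R * W i x + coord i x * pd i (W j) x.
    rewrite (pd_M j (JCf_coord oD 1 i) (JCf_leS (hW i)) Dx) pd_coord (potential_sym i j Dx) mul1r.
    by rewrite addrC (eq_sym j) [W i x * _]mulrC.
  by rewrite (eq_bigr _ (fun i _ => e i)) big_split /= sum_delta mul1r.
have := potential_euler j Dx; rewrite /beta_e /alpha_e.
move: (\sum_(k < 3) _) (W j x) (pd j d x) => E w g e.
have m0 : mu != 0 by rewrite gt_eqF.
have l0 : lam + 3 * mu != 0 by rewrite gt_eqF //; move: hmu hlm; lra.
have l1 : 2 * lam + 6 * mu != 0 by rewrite gt_eqF //; move: hmu hlm; lra.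
have -> : g = mu / (lam + 3 * mu) * 2 * (E + 3 / 2 * w) by rewrite e; field; rewrite m0 l0.
by field; rewrite l0 l1.
Qed.

Hypothesis (CBD : CB `<=` D).

(* Both sides solve the same Euler equation, with right hand side the hessian of the Poisson integral. *)
Lemma smooth_representation i x : B x -> area R * v i x = \sum_(j < 3) sint (fun e => v j e * Kn lam mu i j x e).
Proof.
move=> Bx; have a1 := alpha_lt1 hmu hlm.
have BD : B `<=` D by move=> y By; apply: CBD; exact: ltW.
have SD : S `<=` D by move=> y /= Sy; apply: CBD; rewrite /= Sy.
have BU j : JCf B 2 (U j) := JCf_sub oD oB BD (hU j).
have BW j : JCf B 2 (W j) := JCf_sub oD oB BD (hW j).
have Sv j : wcont S (v j) := wcont_sub SD (JCf_wcont (hv j)).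
have pU j y : B y -> area R * U j y = pint (v j) y.
  move=> By; rewrite (@poisson_representation R (U j) y).
  - apply: (posfun_eq (@posfun_sint R)).
      by apply: wcontM; [exact: wcont_sub SD (JCf_wcont (hU j))|exact: wcont_Pn].
    by move=> e Se; rewrite /U /weight (sphere3_dot Se) subrr mul0r mulr0 addr0.
  - exact: wcont_sub CBD (JCf_wcont (hU j)).
  - exact: BU.
  - by move=> z Bz; exact: harmonic_part_lap (BD _ Bz).
  - exact: By.
have hM j n : JC B S n (fun y e => v j e * Mk lam mu i j y e) := JC_weighted (Sv j) (JC_Mk hmu hlm n i j).
pose Q y := \sum_(j < 3) sint (fun e => v j e * Mk lam mu i j y e).
have hQj n j : JCf B n (fun y => sint (fun e => v j e * Mk lam mu i j y e)).
  exact: (JCf_posfun oB (@sphere3_compact R) (@posfun_sint R) (hM j n)).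
have hQ : JCf B 1 Q by apply: (JCf_sum oB).
have eW y : B y -> \sum_(k < 3) coord k y * pd k (fun z => area R * W i z) y + (1 - al + 1) * (area R * W i y)
    = area R * pd i (dvg U) y.
  move=> By; rewrite -(potential_eq i (BD _ By)).
  rewrite (eq_bigr (fun k => area R * (coord k y * pd k (W i) y))); last first.
    by move=> k _; rewrite (pd_Z oB _ k (JCf_leS (BW i)) By) mulrCA.
  by rewrite -mulr_sumr mulrCA -mulrDr.
have eQ y : B y -> \sum_(k < 3) coord k y * pd k Q y + (1 - al + 1) * Q y = area R * pd i (dvg U) y.
  move=> By.
  have -> : area R * pd i (dvg U) y = \sum_(j < 3) sint (fun e => v j e * Wk i j y e).
    have e1 : pd i (dvg U) y = \sum_(j < 3) pd i (pd j (U j)) y.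
      by apply: (pd_sum oB i _ By) => j; exact: JCf_pd (BU j).
    rewrite e1 mulr_sumr; apply: eq_bigr => j _.
    have e2 z : B z -> area R * pd j (U j) z = pd j (pint (v j)) z.
      by move=> Bz; rewrite -(pd_Z oB _ j (JCf_leS (BU j)) Bz); exact: (pd_on oB j (pU j) Bz).
    rewrite -(pd_Z oB _ i (JCf_pd j (BU j)) By); apply: etrans (pd_on oB i e2 By) _.
    have hP := JC_weighted (Sv j) (JC_Pn R 2).
    apply: etrans (pd2_posfun oB (@sphere3_compact R) (@posfun_sint R) i j hP By) _.
    apply: (posfun_eq (@posfun_sint R)).
      exact: (JC_slicef oB (JC_pd i (JC_pd j hP)) By).
    move=> e Se; have hp : JCf B 2 (fun z => Pn z e) := JC_JCf oB (JC_Pn R 2) Se.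
    rewrite -(pd2_Pn Se i j By); apply: etrans (pd_on oB i (fun z Bz => pd_Z oB _ j (JCf_leS hp) Bz) By) _.
    exact: (pd_Z oB _ i (JCf_pd j hp) By).
  have e3 j : sint (fun e => v j e * Wk i j y e) =
      \sum_(k < 3) coord k y * pd k (fun z => sint (fun e => v j e * Mk lam mu i j z e)) y
      + (1 - al + 1) * sint (fun e => v j e * Mk lam mu i j y e).
    have pe k : pd k (fun z => sint (fun e => v j e * Mk lam mu i j z e)) y =
        sint (fun e => pd k (fun z => v j e * Mk lam mu i j z e) y).
      exact: (pd_posfun oB (@sphere3_compact R) (@posfun_sint R) k (hM j 1%N) By).
    have c1 k : wcont S (fun e => pd k (fun z => v j e * Mk lam mu i j z e) y).
      exact: (JC_slicef oB (JC_pd k (hM j 1%N)) By).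
    have c0 : wcont S (fun e => v j e * Mk lam mu i j y e) := JC_slicef oB (hM j 0%N) By.
    have pr := @posfun_sint R.
    rewrite -(posfunZ pr _ c0).
    rewrite (eq_bigr (fun k => sint (fun e => coord k y * pd k (fun z => v j e * Mk lam mu i j z e) y))); last first.
      by move=> k _; rewrite (posfunZ pr _ (c1 k)) pe.
    rewrite -(posfun_sum pr); last by move=> k; apply: wcontZ; exact: c1.
    rewrite -(posfunD pr); last 2 first.
    - by apply: wcont_sum => k; apply: wcontZ; exact: c1.
    - exact: wcontZ.
    apply/esym; apply: (posfun_eq pr).
      by apply: wcontD; [apply: wcont_sum => k; apply: wcontZ; exact: c1|exact: wcontZ].
    move=> e Se; have hm : JCf B 1 (fun z => Mk lam mu i j z e) := JC_JCf oB (JC_Mk hmu hlm 1 i j) Se.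
    rewrite -(euler_radial oB (@B_star R) a1 (JC_Wk R 1 i j) By Se).
    rewrite mulrDr mulr_sumr [v j e * (_ * _)]mulrCA; apply: (f_equal2 +%R) => //.
    by apply: eq_bigr => k _; rewrite (pd_Z oB _ k hm By) mulrCA.
  rewrite (eq_bigr _ (fun j _ => e3 j)) big_split /= -mulr_sumr exchange_big /=.
  apply: (f_equal2 +%R) => //; apply: eq_bigr => k _; rewrite -mulr_sumr.
  by apply: (f_equal ( *%R _)); exact: (pd_sum oB k (fun j => hQj 1%N j) By).
have WQ : area R * W i x = Q x.
  rewrite (radial_solve oB (@B_star R) a1 (JC_scale oB (area R) (JCf_leS (BW i))) eW Bx).
  by rewrite (radial_solve oB (@B_star R) a1 hQ eQ Bx).
have -> : area R * v i x = area R * U i x + be * (weight x * Q x).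
  by rewrite -WQ /U; move: (v i x) (weight x) (W i x) (area R) => a b c e; ring.
rewrite (pU i x Bx) /Q !mulr_sumr.
have e j : sint (fun e => v j e * Kn lam mu i j x e) =
    1 * (j == i)%:R * pint (v j) x + be * (weight x * sint (fun e => v j e * Mk lam mu i j x e)).
  have cP : wcont S (fun e => v j e * Pn x e) by apply: wcontM => //; exact: wcont_Pn.
  have cM : wcont S (fun e => v j e * Mk lam mu i j x e) := JC_slicef oB (hM j 0%N) Bx.
  rewrite mulrA mul1r -((@posfun_sint R).1 _ _ _ _ cP cM); f_equal; apply/funext => e.
  by rewrite /Kn (eq_sym i); move: (v j e) (weight x) (Mk _ _ _ _ _ _) (Pn x e) => a b c z; ring.
by rewrite (eq_bigr _ (fun j _ => e j)) big_split /= sum_delta mul1r.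
Qed.
End Solution.
End SmoothRepresentation.

(** * The boundary identity for arbitrary solutions *)

Section RadialTraces.
Variable R : realType.
Notation V3 := (V3 R).
Local Notation B := (@ball3 R).
Local Notation S := (@sphere3 R).
Local Notation CB := [set x : V3 | enorm x <= 1].
Local Notation oB := (@B_open R).
Implicit Types (x y : V3) (i j k : 'I_3).
Variables (lam mu : R).
Hypotheses (hmu : 0 < mu) (hlm : 0 < 2 * mu + lam).
Local Opaque JC pd.

Definition trace (u : V3 -> V3) (r : R) j (e : V3) : R := coord j (u (r *: e)).

Lemma wcont_trace u r j : lame_solution lam mu u -> 0 <= r < 1 -> wcont CB (trace u r j).
Proof.
move=> hu /andP[r0 r1]; have [c1 _ _] := lame_solution_C1 hu.
apply: (@wcont_comp _ _ _ CB (Bl 1) (fun e => r *: e)) (JCf_wcont (c1 j)).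
  move=> e /= he; rewrite /Bl /= enormZ ger0_norm //.
  by apply: le_lt_trans (_ : r < 1); [rewrite ler_piMr|].
by apply: cont_wcont => y; apply: cvgZ; [exact: cvg_cst|exact: cvg_id].
Qed.

Lemma wcont_Kn i j x (Bx : B x) : wcont S (Kn lam mu i j x).
Proof. exact: (JC_slicef oB (JC_Kn hmu hlm 0 i j) Bx). Qed.

Lemma norm_eq0_eps (a C : R) : 0 <= C -> (forall e, 0 < e -> `|a| <= C * e) -> a = 0.
Proof.
move=> C0 h; apply/eqP; rewrite -normr_le0; apply/ler_addgt0Pl => e e0; rewrite addr0.
have C1 : 0 < C + 1 by rewrite ltr_wpDl.
have e1 : 0 < e / (C + 1) by rewrite divr_gt0.
apply: le_trans (h _ e1) _; rewrite mulrA ler_pdivrMr // mulrC ler_pM2l // lerDl //.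
Qed.

(** The identity holds for smooth approximants. Passing back to [u] costs [area R * e] on the left
    and at most [Kbound lam mu * area R * e] per component on the right, because the kernel is
    dominated by [Pn], whose mass does not depend on [x]. *)
Theorem lame_representation u r i x : lame_solution lam mu u -> 0 < r < 1 -> B x ->
  area R * trace u r i x = \sum_(j < 3) sint (fun e => trace u r j e * Kn lam mu i j x e).
Proof.
move=> hu r01 Bx; have pr := @posfun_sint R; have a0 := area_gt0 R.
have r01' : 0 <= r < 1 by case/andP: r01 => /ltW -> ->.
have SCB : S `<=` CB by move=> y /= ->.
have ct j : wcont S (trace u r j) := wcont_sub SCB (wcont_trace hu r01').
have cK j : wcont S (Kn lam mu i j x) := wcont_Kn Bx; have K0 := Kbound_ge0 lam mu.
apply/eqP; rewrite -subr_eq0; apply/eqP.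
apply: (@norm_eq0_eps _ (area R + 3 * (Kbound lam mu * area R))).
  by rewrite addr_ge0 ?(ltW a0) // mulr_ge0 // mulr_ge0 // ltW.
move=> e e0; have [q [v [q1 hv ev cv]]] := lame_approx hu r01 e0.
have starD z (t : R) : Bl q z -> 0 <= t <= 1 -> Bl q (t *: z).
  move=> Bz /andP[t0 t1]; rewrite /Bl /= enormZ ger0_norm //; apply: le_lt_trans Bz.
  by rewrite ler_piMl // enorm_ge0.
have CBD : CB `<=` Bl q by move=> y /= hy; exact: le_lt_trans hy q1.
have rep := smooth_representation hmu hlm (@Bl_open R q) starD hv ev CBD i Bx.
have cvS j : wcont S (v j) := wcont_sub (subset_trans SCB CBD) (JCf_wcont (hv j)).
have h1 : `|area R * trace u r i x - area R * v i x| <= area R * e.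
  rewrite -mulrBr normrM gtr0_norm // ler_pM2l // distrC; apply: cv; exact: ltW.
have h2 j : `|sint (fun e => trace u r j e * Kn lam mu i j x e) - sint (fun e => v j e * Kn lam mu i j x e)|
    <= Kbound lam mu * area R * e.
  have c1 : wcont S (fun e => trace u r j e * Kn lam mu i j x e) by exact: wcontM.
  have c2 : wcont S (fun e => v j e * Kn lam mu i j x e) by exact: wcontM.
  rewrite -(posfunB pr c1 c2) -(mass_const Bx).
  have cP : wcont S (fun z => Kbound lam mu * e * Pn x z) by apply: wcontZ; exact: wcont_Pn.
  have -> : Kbound lam mu * sint (Pn x) * e = sint (fun z => Kbound lam mu * e * Pn x z).
    by rewrite (posfunZ pr _ (wcont_Pn Bx)); ring.
  apply: (posfun_abs_le pr (wcontB c1 c2) cP) => z Sz.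
  rewrite -mulrBl normrM; have -> : Kbound lam mu * e * Pn x z = e * (Kbound lam mu * Pn x z) by ring.
  apply: ler_pM => //; first by rewrite distrC; apply: cv; exact: SCB.
  exact: Kn_bound.
have h3 : `|\sum_(j < 3) sint (fun e => trace u r j e * Kn lam mu i j x e) - area R * v i x| <=
    3 * (Kbound lam mu * area R * e).
  rewrite rep -sumrB; apply: le_trans (ler_norm_sum _ _ _) _.
  apply: le_trans (ler_sum _ (fun j _ => h2 j)) _.
  by rewrite sumr_const card_ord -[leLHS]mulr_natl.
move: h1 h3; rewrite !ler_norml; move: (area R * v i x) (area R * trace _ _ _ _) (\sum_(j < 3) _) => a b c.
have -> : (area R + 3 * (Kbound lam mu * area R)) * e = area R * e + 3 * (Kbound lam mu * area R * e) by ring.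
move: (area R * e) (3 * _) => p s /andP[? ?] /andP[? ?]; apply/andP; split; lra.
Qed.
End RadialTraces.

(** * Limits of bounded sequences along an ultrafilter *)

Section BoundedLimits.
Variable R : realType.

(** An ultrafilter finer than the filter at infinity gives every bounded real sequence a limit,
    linearly and monotonically, so that one choice serves all test functions and no subsequence has
    to be extracted. *)
Definition ulim_filter : set_system nat := sval (cid (@ultraFilterLemma nat \oo _)).
Lemma ulim_ultra : UltraFilter ulim_filter /\ \oo `<=` ulim_filter.
Proof. exact: (svalP (cid (@ultraFilterLemma nat \oo _))). Qed.
Instance ulim_proper : ProperFilter ulim_filter. Proof. by case: ulim_ultra => -[]. Qed.

Definition ulim (x : nat -> R) : R := lim (x @ ulim_filter).

Definition bounded_seq (x : nat -> R) := exists M, forall n, `|x n| <= M.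

Lemma ulim_cvg x : bounded_seq x -> x @ ulim_filter --> ulim x.
Proof.
move=> [M hM]; have := @segment_compact R (- M) M; rewrite compact_ultra => cM.
have U : UltraFilter (x @ ulim_filter).
  split; first exact: fmap_proper_filter.
  move=> G GF sG; rewrite predeqE => A; split; last exact: sG.
  move=> GA; have [uA|nA] := in_ultra_setVsetC (x @^-1` A) (ulim_ultra.1); first exact: uA.
  have /filter_ex[z []] : G (A `&` ~` A) by apply: filterI => //; exact: sG.
  by [].
have [|l [_ hl]] := cM _ U; last by rewrite /ulim (cvg_lim _ hl).
apply: (filterE (F := ulim_filter)) => n; rewrite /= in_itv /= -ler_norml; exact: hM.
Qed.

Lemma bounded_lin x y (a b : R) : bounded_seq x -> bounded_seq y -> bounded_seq (fun n => a * x n + b * y n).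
Proof.
move=> [M hM] [N hN]; exists (`|a| * M + `|b| * N) => n; apply: le_trans (ler_normD _ _) _.
by rewrite !normrM; apply: lerD; apply: ler_wpM2l.
Qed.

Lemma ulim_lin x y (a b : R) : bounded_seq x -> bounded_seq y ->
  ulim (fun n => a * x n + b * y n) = a * ulim x + b * ulim y.
Proof.
move=> bx by'; apply: cvg_lim => //; apply: cvgD; apply: cvgM; [exact: cvg_cst| |exact: cvg_cst|]; exact: ulim_cvg.
Qed.

Lemma ulim_le x y : bounded_seq x -> bounded_seq y -> (forall n, x n <= y n) -> ulim x <= ulim y.
Proof. by move=> bx by' h; apply: ler_lim; [apply/cvg_ex; exists (ulim x); exact: ulim_cvg|apply/cvg_ex; exists (ulim y); exact: ulim_cvg|exact: filterE]. Qed.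

Lemma ulim_cst c : ulim (fun=> c) = c.
Proof. by apply: cvg_lim => //; exact: cvg_cst. Qed.

Lemma ulim_abs x M : (forall n, `|x n| <= M) -> `|ulim x| <= M.
Proof.
move=> h; have bx : bounded_seq x by exists M.
have bc c : bounded_seq (fun=> c) by exists `|c|.
have h1 : ulim (fun=> - M) <= ulim x.
  by apply: (ulim_le (bc _) bx) => n; have := h n; rewrite ler_norml => /andP[].
have h2 : ulim x <= ulim (fun=> M).
  by apply: (ulim_le bx (bc _)) => n; have := h n; rewrite ler_norml => /andP[].
by rewrite !ulim_cst in h1 h2; rewrite ler_norml h1.
Qed.

Lemma ulim_lim x l : x @ \oo --> l -> ulim x = l.
Proof. by move=> h; apply: cvg_lim => //; apply: cvg_trans h => A; exact: ulim_ultra.2. Qed.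
End BoundedLimits.

(** * Weak limits and the case p > 1 *)
Section BoundedMeasurable.
Context d (T : measurableType d) (R : realType).

Definition bmeas (g : T -> R) := measurable_fun setT g /\ exists M, forall x, `|g x| <= M.

Lemma bmeas_lin (a b : R) f g : bmeas f -> bmeas g -> bmeas (fun x => a * f x + b * g x).
Proof.
move=> [mf [M hM]] [mg [N hN]]; split.
  by apply: measurable_funD; apply: measurable_funM => //; exact: measurable_cst.
exists (`|a| * M + `|b| * N) => x; apply: le_trans (ler_normD _ _) _.
by rewrite !normrM; apply: lerD; apply: ler_wpM2l.
Qed.

Lemma bmeas_cst (c : R) : bmeas (fun=> c).
Proof. by split; [exact: measurable_cst|exists `|c|]. Qed.

Lemma bmeas_indic (A : set T) : measurable A -> bmeas (\1_A : T -> R).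
Proof.
move=> mA; split; first exact: measurable_indic.
by exists 1 => x; rewrite indicE; case: (_ \in _); rewrite ?normr1 ?normr0.
Qed.

(** Boundedness is for the sup norm; countable additivity is left out because a weak limit does not
    have it a priori. *)
Definition blinear (L : (T -> R) -> R) :=
  (forall (a b : R) f g, bmeas f -> bmeas g -> L (fun x => a * f x + b * g x) = a * L f + b * L g) /\
  exists C, 0 <= C /\ forall M g, bmeas g -> (forall x, `|g x| <= M) -> `|L g| <= C * M.

Definition stair n (y : R) : R := \sum_(k < n) (k.+1%:R <= y)%R%:R.

Lemma stair_le n y : 0 <= y -> stair n y <= y /\ Num.min y n%:R - 1 <= stair n y.
Proof.
move=> y0; rewrite /stair; elim: n => [|n [h1 h2]].
  by rewrite big_ord0; split => //; rewrite subr_le0 ge_min ler01 orbT.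
have hn : (n%:R : R) + 1 = n.+1%:R by rewrite -natr1.
have s_le m : \sum_(k < m) (k.+1%:R <= y)%R%:R <= m%:R :> R.
  elim: m => [|m IHm]; first by rewrite big_ord0.
  by rewrite big_ord_recr /= -[leRHS]natr1; apply: lerD => //; case: (m.+1%:R <= y)%R.
have full : n%:R <= y -> \sum_(k < n) (k.+1%:R <= y)%R%:R = n%:R :> R.
  move=> ny; rewrite -[RHS]mulr1 mulr_natl -[n in RHS]card_ord -sumr_const; apply: eq_bigr => i _.
  by rewrite (le_trans _ ny) // ler_nat.
rewrite big_ord_recr /=; case: (lerP n.+1%:R y) => hy; last first.
  rewrite addr0; split => //.
  case: (leP n%:R y) => [ny|yn]; first by rewrite full //; move: hy; rewrite -hn; lra.
  by rewrite (min_idPl (ltW yn)) in h2.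
have -> : true%:R = 1 :> R by [].
rewrite -hn in hy *; split; first by have := s_le n; lra.
have ny : n%:R <= y by move: hy; lra.
by rewrite (full ny); lra.
Qed.

Lemma blinear_eq0 (L : (T -> R) -> R) : blinear L -> (forall A, measurable A -> L \1_A = 0) ->
  forall g, bmeas g -> L g = 0.
Proof.
move=> [lin [C [C0 hC]]] ind g bg; have [mg [M0 hM0]] := bg.
pose M := `|M0| + 1; have M_gt0 : 0 < M by rewrite ltr_wpDl.
have hM x : `|g x| <= M by apply: le_trans (hM0 x) _; apply: le_trans (ler_norm _) _; rewrite lerDl.
have L1 : L (fun=> 1) = 0.
  by rewrite -(ind setT measurableT); f_equal; apply/funext => x; rewrite indicT.
apply: (@norm_eq0_eps R _ C C0) => e e0.
pose n := (Num.truncn (2 * M / e)).+1.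
have hn : 2 * M / e < n%:R by exact: truncnS_gt.
have n0 : 0 < n%:R :> R by rewrite ltr0n.
pose h x := n%:R / (2 * M) * (g x + M).
have h_ge0 x : 0 <= h x.
  apply: mulr_ge0; first by rewrite divr_ge0 // ltW // mulr_gt0.
  by have := hM x; rewrite ler_norml; move=> /andP[]; lra.
have h_le x : h x <= n%:R.
  rewrite /h mulrAC ler_pdivrMr ?mulr_gt0 //; apply: ler_wpM2l; first exact: ltW.
  by have := hM x; rewrite ler_norml; move=> /andP[]; lra.
have bh : bmeas h.
  have -> : h = fun x => n%:R / (2 * M) * g x + (n%:R / (2 * M) * M) * 1 by apply/funext => x; rewrite /h mulr1 mulrDr.
  by apply: bmeas_lin => //; exact: bmeas_cst.
have mh := bh.1.
have mset k : measurable [set x | k.+1%:R <= h x].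
  have -> : [set x | k.+1%:R <= h x] = setT `&` h @^-1` `[k.+1%:R, +oo[%classic.
    by rewrite setTI; apply/seteqP; split => x /=; rewrite in_itv /= andbT.
  by apply: mh => //; exact: measurable_itv.
have [bs Ls] : bmeas (fun x => stair n (h x)) /\ L (fun x => stair n (h x)) = 0.
  elim: (n) => [|m [bm Lm]].
    have -> : (fun x => stair 0 (h x)) = fun x => 0 * 1 + 0 * 1.
      by apply/funext => x; rewrite /stair big_ord0 !mul0r addr0.
    split; first by apply: bmeas_lin; exact: bmeas_cst.
    by rewrite lin; [rewrite !mul0r addr0|exact: bmeas_cst|exact: bmeas_cst].
  have -> : (fun x => stair m.+1 (h x)) = fun x => 1 * stair m (h x) + 1 * \1_[set x | m.+1%:R <= h x] x.
    apply/funext => x; rewrite /stair big_ord_recr /= !mul1r indicE.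
    have -> // : (x \in [set x | m.+1%:R <= h x]) = (m.+1%:R <= h x).
    by apply/idP/idP; rewrite inE.
  have bi := bmeas_indic (mset m); split; first exact: bmeas_lin.
  by rewrite lin // Lm ind // !mulr0 addr0.
have eg : g = fun x => (2 * M / n%:R) * (1 * h x + (-1) * stair n (h x)) + (2 * M / n%:R) * (stair n (h x) + (- (n%:R / 2)) * 1).
  apply/funext => x; move: (stair n (h x)) => s; rewrite /h; move: (g x) => y.
  by field; rewrite gt_eqF //= gt_eqF.
have b1 : bmeas (fun x => 1 * h x + (-1) * stair n (h x)) by exact: bmeas_lin.
have b2 : bmeas (fun x => stair n (h x) + (- (n%:R / 2)) * 1).
  have -> : (fun x => stair n (h x) + (- (n%:R / 2)) * 1) = fun x => 1 * stair n (h x) + (- (n%:R / 2)) * 1.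
    by apply/funext => x; rewrite mul1r.
  by apply: bmeas_lin => //; exact: bmeas_cst.
have L2 : L (fun x => stair n (h x) + (- (n%:R / 2)) * 1) = 0.
  have -> : (fun x => stair n (h x) + (- (n%:R / 2)) * 1) = fun x => 1 * stair n (h x) + (- (n%:R / 2)) * 1.
    by apply/funext => x; rewrite mul1r.
  by rewrite lin // ?Ls ?L1 ?mulr0 ?addr0 //; exact: bmeas_cst.
have bd : `|L (fun x => 1 * h x + (-1) * stair n (h x))| <= C * 1.
  apply: hC => // x; rewrite mul1r mulN1r; have [s1 s2] := stair_le n (h_ge0 x).
  rewrite (min_idPl (h_le x)) in s2; rewrite ger0_norm; [lra|by rewrite subr_ge0].
have Lg : L g = 2 * M / n%:R * L (fun x => 1 * h x + (-1) * stair n (h x)).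
  rewrite {1}eg; apply: etrans (lin _ _ _ _ b1 b2) _.
  by rewrite L2 mulr0 addr0.
rewrite mulr1 in bd; rewrite Lg normrM.
rewrite ger0_norm; last by rewrite divr_ge0 // mulr_ge0 // ltW.
rewrite mulrC; apply: le_trans (ler_wpM2r _ bd) _; first by rewrite divr_ge0 // mulr_ge0 // ltW.
apply: ler_wpM2l => //; rewrite ler_pdivrMr //.
by rewrite ltr_pdivrMr // in hn; rewrite [leRHS]mulrC; exact: ltW.
Qed.

Lemma blinear_sub L1 L2 : blinear L1 -> blinear L2 -> blinear (fun g => L1 g - L2 g).
Proof.
move=> [l1 [C1 [c1 h1]]] [l2 [C2 [c2 h2]]]; split.
  by move=> a b f g bf bg; rewrite l1 // l2 //; ring.
exists (C1 + C2); split; first exact: addr_ge0.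
move=> M g bg hg; apply: le_trans (ler_normB _ _) _; rewrite mulrDl.
by apply: lerD; [exact: h1|exact: h2].
Qed.

Lemma blinear_ext L1 L2 : blinear L1 -> blinear L2 ->
  (forall A, measurable A -> L1 \1_A = L2 \1_A) -> forall g, bmeas g -> L1 g = L2 g.
Proof.
move=> h1 h2 ind g bg; apply/eqP; rewrite -subr_eq0; apply/eqP.
by apply: (blinear_eq0 (blinear_sub h1 h2)) => // A mA; rewrite ind // subrr.
Qed.
End BoundedMeasurable.

(** * Weak limits of uniformly integrable sequences have densities *)

Section WeakLimits.
Context d (T : measurableType d) (R : realType) (mu : {finite_measure set T -> \bar R}).
Variable D : set T.
Hypothesis mD : measurable D.

Definition paired (f g : T -> R) : R := \int[mu]_(x in D) (g x * f x).

Lemma paired_integrable f g : mu.-integrable D (EFin \o f) -> bmeas g ->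
  mu.-integrable D (EFin \o (fun x => g x * f x)).
Proof.
move=> hf [mg [M hM]].
apply: (integrableMr mD (h := g) (g := EFin \o f)) => //; first exact: measurable_funTS.
exists M; split; [exact: num_real|] => z Mz x Dx; exact: le_trans (hM x) (ltW Mz).
Qed.

Lemma integrable_norm f : mu.-integrable D (EFin \o f) -> mu.-integrable D (EFin \o (fun x => `|f x|)).
Proof. by move=> hf; have := integrable_abse hf; apply: eq_integrable => // x _ /=. Qed.

Lemma paired_abs f g M : mu.-integrable D (EFin \o f) -> bmeas g -> (forall x, `|g x| <= M) ->
  `|paired f g| <= (\int[mu]_(x in D) `|f x|) * M.
Proof.
move=> hf bg hM; have hp := paired_integrable hf bg.
apply: le_trans (le_normr_Rintegral mD hp) _.
rewrite -RintegralZr //; last exact: integrable_norm.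
apply: le_Rintegral => //; first exact: integrable_norm.
  by have := integrableZr mD M (integrable_norm hf); apply: eq_integrable => // x _; rewrite /= EFinM.
by move=> x _; rewrite normrM mulrC ler_wpM2l.
Qed.

Lemma blinear_paired f : mu.-integrable D (EFin \o f) -> blinear (paired f).
Proof.
move=> hf; split.
  move=> a b g h bg bh; rewrite /paired -!RintegralZl //; try exact: paired_integrable.
  rewrite -RintegralD //.
  - by apply: eq_Rintegral => x _; ring.
  - by have := integrableZl mD a (paired_integrable hf bg); apply: eq_integrable => // x _; rewrite /= EFinM.
  - by have := integrableZl mD b (paired_integrable hf bh); apply: eq_integrable => // x _; rewrite /= EFinM.
exists (\int[mu]_(x in D) `|f x|); split; first exact: Rintegral_ge0.
by move=> M g bg hM; exact: paired_abs.
Qed.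

Variable t : nat -> T -> R.
Hypothesis ti : forall n, mu.-integrable D (EFin \o t n).
Variable C : R.
Hypothesis tC : forall n, \int[mu]_(x in D) `|t n x| <= C.

Definition weak_limit g : R := ulim (fun n => paired (t n) g).

Lemma paired_bounded g : bmeas g -> bounded_seq (fun n => paired (t n) g).
Proof.
move=> bg; have [_ [M hM]] := bg; exists (C * `|M|) => n.
apply: le_trans (paired_abs (ti n) bg hM) _; apply: ler_pM => //.
- exact: Rintegral_ge0.
- by apply: le_trans (normr_ge0 _) (hM point).
- exact: ler_norm.
Qed.

Lemma blinear_weak_limit : blinear weak_limit.
Proof.
split.
  move=> a b f g bf bg; rewrite /weak_limit -ulim_lin; [|exact: paired_bounded|exact: paired_bounded].
  by f_equal; apply/funext => n; have [l _] := blinear_paired (ti n); exact: l.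
exists C; split; first by apply: le_trans (tC 0%N); exact: Rintegral_ge0.
move=> M g bg hM; apply: ulim_abs => n; apply: le_trans (paired_abs (ti n) bg hM) _.
by apply: ler_wpM2r => //; apply: le_trans (normr_ge0 _) (hM point).
Qed.

Hypothesis uniform : forall e, 0 < e -> exists2 dl : R, 0 < dl & forall n (A : set T), measurable A ->
  (mu A < dl%:E)%E -> \int[mu]_(x in D) (\1_A x * `|t n x|) <= e.

Lemma weak_limit_small e : 0 < e -> exists2 dl : R, 0 < dl & forall A, measurable A ->
  (mu A < dl%:E)%E -> `|weak_limit \1_A| <= e.
Proof.
move=> /uniform[dl dl0 h]; exists dl => // A mA hA; apply: ulim_abs => n; have bi := @bmeas_indic _ T R A mA.
apply: le_trans (le_normr_Rintegral mD (paired_integrable (ti n) bi)) _.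
have -> : \int[mu]_(x in D) `|\1_A x * t n x| = \int[mu]_(x in D) (\1_A x * `|t n x|).
  by apply: eq_Rintegral => x _; rewrite normrM (@ger0_norm _ (\1_A x)).
exact: h.
Qed.

Definition limit_charge (A : set T) : \bar R := (weak_limit \1_A)%:E.

Let limit_charge0 : limit_charge set0 = 0%E.
Proof.
rewrite /limit_charge; have [l _] := blinear_weak_limit.
have b0 := @bmeas_cst _ T R 0.
have -> : (\1_set0 : T -> R) = fun x => 0 * 0 + 0 * 0.
  by apply/funext => x; rewrite indic0 mul0r addr0.
by rewrite l // !mul0r addr0.
Qed.

Let limit_charge_fin A : measurable A -> limit_charge A \is a fin_num.
Proof. by []. Qed.

Lemma weak_limitU (A B : set T) : measurable A -> measurable B -> A `&` B = set0 ->
  weak_limit \1_(A `|` B) = weak_limit \1_A + weak_limit \1_B.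
Proof.
move=> mA mB AB; have [l _] := blinear_weak_limit.
rewrite -[weak_limit \1_A]mul1r -[weak_limit \1_B]mul1r -l; [|exact: bmeas_indic|exact: bmeas_indic].
f_equal; apply/funext => x; rewrite !mul1r !indicE in_setU.
have [xA|xA] := boolP (x \in A); have [xB|xB] := boolP (x \in B); rewrite ?addr0 ?add0r //.
have H : (A `&` B) x by split; [rewrite inE in xA|rewrite inE in xB].
by rewrite AB in H.
Qed.

(** Limits along the ultrafilter need not commute with countable sums. Uniform integrability repairs
    this: the tail of the union has small measure, hence a small weak limit. *)
Let limit_charge_sigma : semi_sigma_additive limit_charge.
Proof.
move=> F mF tF mUF.
pose A n := \big[setU/set0]_(i < n) F i.
have mA n : measurable (A n) by apply: bigsetU_measurable.
have AUF n : A n `<=` \bigcup_n F n by exact: bigsetU_bigcup.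
have sumE n : (\sum_(0 <= i < n) limit_charge (F i))%E = limit_charge (A n).
  elim: n => [|n IH]; first by rewrite big_geq // /A big_ord0 limit_charge0.
  rewrite big_nat_recr //= IH /limit_charge -EFinD; congr EFin.
  rewrite /A big_ord_recr /= -weak_limitU //; first exact: mA.
  have tF' : trivIset (fun i : nat => xpredT i) F by move=> i j _ _; exact: tF.
  exact: (@trivIset_bigsetUI _ xpredT F tF' n n isT (leqnn n)).
under eq_fun do rewrite sumE.
apply/fine_cvgP; split; first exact: nearW.
apply/cvgrPdist_le => e e0; have [dl dl0 hd] := weak_limit_small e0.
have mucv : mu (A n) @[n --> \oo] --> mu (\bigcup_n F n).
  have := @measure_semi_sigma_additive _ _ _ mu F mF tF mUF.
  apply: cvg_trans; apply: near_eq_cvg; apply: nearW => n.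
  by rewrite /A measure_bigsetU // big_mkord.
have fU : mu (\bigcup_n F n) \is a fin_num by exact: fin_num_measure.
rewrite -(fineK fU) in mucv.
have /fine_cvgP[_ /cvgrPdist_lt/(_ dl dl0)] := mucv.
apply: filterS => n hn.
have mDif : measurable ((\bigcup_n F n) `\` A n) by exact: measurableD.
have small : (mu ((\bigcup_n F n) `\` A n) < dl%:E)%E.
  rewrite measureD //; last by rewrite -ge0_fin_numE.
  rewrite (setIidr (@AUF n)); have hn' : fine (mu (\bigcup_n F n)) - fine (mu (A n)) < dl.
    exact: le_lt_trans (ler_norm _) hn.
  rewrite -lte_fin EFinB (fineK fU) (fineK (fin_num_measure mu _ (mA n))) in hn'.
  exact: hn'.
have -> : fine (limit_charge (\bigcup_n F n)) - fine (limit_charge (A n)) = weak_limit \1_((\bigcup_n F n) `\` A n).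
  rewrite /limit_charge /= -[in X in X - _](setDUK (@AUF n)) weak_limitU //; last by apply/seteqP; split=> // x [? []].
  by rewrite addrC addKr.
exact: hd.
Qed.

HB.instance Definition _ := isCharge.Build _ T R limit_charge limit_charge0 limit_charge_fin limit_charge_sigma.

(** Smallness on small sets also gives absolute continuity, so Radon-Nikodym yields a density;
    agreement on indicators extends to bounded measurable functions by [blinear_ext]. *)
Theorem weak_limit_density : exists f : T -> R, [/\ measurable_fun setT f, mu.-integrable setT (EFin \o f) &
  forall g, bmeas g -> paired f g = weak_limit g].
Proof.
have dom : limit_charge `<< mu.
  apply/null_content_dominatesP => A mA mu0; congr EFin; apply/eqP; rewrite -normr_le0.
  apply/ler_addgt0Pl => e e0; rewrite addr0; have [dl dl0 hd] := weak_limit_small e0.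
  by apply: hd => //; rewrite mu0 lte_fin.
pose nu : {charge set T -> \bar R} := limit_charge.
pose g := Radon_Nikodym nu mu; pose f := fine \o g.
have gE : g = EFin \o f.
  by apply/funext => x; rewrite /f /= fineK //; exact: Radon_Nikodym_fin_num.
have gi : mu.-integrable setT g by exact: Radon_Nikodym_integrable.
have fi : mu.-integrable setT (EFin \o f) by rewrite -gE.
have mf : measurable_fun setT f by apply/measurable_EFinP; exact: measurable_int fi.
have fD : mu.-integrable D (EFin \o f) by apply: integrableS fi.
exists f; split => //; apply: blinear_ext; [exact: blinear_paired|exact: blinear_weak_limit|].
move=> A mA.
have e1 : paired f \1_A = \int[mu]_(x in D `&` A) f x.
  rewrite Rintegral_mkcondr; apply: eq_Rintegral => x _; rewrite patchE indicE.
  by case: (x \in A); rewrite ?mul1r ?mul0r.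
have e2 : weak_limit \1_A = weak_limit \1_(D `&` A).
  rewrite /weak_limit; f_equal; apply/funext => n; apply: eq_Rintegral => x xD.
  by rewrite !indicE in_setI xD.
have mDA : measurable (D `&` A) by exact: measurableI.
rewrite e1 e2; apply: EFin_inj; have := Radon_Nikodym_integral dom mDA.
move=> h; apply: etrans (esym h); rewrite -/nu -/g gE /Rintegral fineK //.
by apply: integrable_fin_num => //; exact: integrableS fi.
Qed.
End WeakLimits.

(** * Integrals against measures concentrated on a set *)

Section ConcentratedMeasures.
Context d (T : measurableType d) (R : realType) (mu : {measure set T -> \bar R}).
Variable D : set T.
Hypotheses (mD : measurable D) (mu0 : mu (~` D) = 0%E).
Import HBNNSimple.
Local Open Scope ereal_scope.

(* No measurability is assumed: the lower integral only sees simple functions, and these may be cut off to [D]. *)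
Lemma integral_concentrated (f : T -> \bar R) : \int[mu]_x f x = \int[mu]_(x in D) f x.
Proof.
have key (g : T -> \bar R) : (forall x, 0 <= g x) ->
    ereal_sup [set sintegral mu h | h in [set h : {nnsfun T >-> R} | forall x : T, (h x)%:E <= g x]] =
    ereal_sup [set sintegral mu h | h in [set h : {nnsfun T >-> R} | forall x : T, (h x)%:E <= (g \_ D) x]].
  move=> g0; apply/eqP; rewrite eq_le; apply/andP; split.
    apply: ge_ereal_sup => _ [h /= hg <-]; apply: ereal_sup_ubound => /=.
    exists (proj_nnsfun h mD).
      move=> x; rewrite /= mindicE patchE; case: ifPn => xD; rewrite ?mulr1 ?mulr0 //.
    have cut (k : {nnsfun T >-> R}) : \int[mu]_x (k x)%:E = \int[mu]_(x in D) (k x)%:E.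
      rewrite (@ge0_negligible_integral _ _ _ mu setT (~` D)) //; last 3 first.
      - exact: measurableC.
      - by apply/measurable_EFinP; exact: measurable_funTS.
      - by move=> x _; rewrite lee_fin.
      by rewrite setTD setCK.
    rewrite -!integralT_nnsfun !cut; apply: eq_integral => x xD.
    by rewrite /= mindicE xD mulr1.
  apply: ge_ereal_sup => _ [h /= hg <-]; apply: ereal_sup_ubound => /=; exists h => // x.
  by apply: le_trans (hg x) _; rewrite patchE; case: ifPn.
rewrite [RHS]integral_mkcond /integral /= !patch_setT.
rewrite funepos_restrict funeneg_restrict; congr (_ - _); exact: key.
Qed.
End ConcentratedMeasures.

(** * Weak limits of sequences bounded in L^p, p > 1 *)

Section LpLimits.
Context d (T : measurableType d) (R : realType) (mu : {finite_measure set T -> \bar R}).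
Variables (D : set T) (p : R).
Hypotheses (mD : measurable D) (p1 : 1 < p).

(** Young's inequality for the exponents [p] and [p / (p - 1)], in the shape that lets the term in
    [powR b p] be absorbed when [b] is the quantity to be bounded. *)
Lemma young_powR (a b : R) : 0 <= a -> 0 <= b ->
  a * powR b (p - 1) <= powR a p / p + (1 - p^-1) * powR b p.
Proof.
move=> a0 b0; have p0 : 0 < p by exact: lt_trans p1.
have pm : 0 < p - 1 by rewrite subr_gt0.
have q0 : 0 < p / (p - 1) by rewrite divr_gt0.
have e : p^-1 + (p / (p - 1))^-1 = 1 by field; rewrite !gt_eqF.
apply: le_trans (conjugate_powR a0 (powR_ge0 b (p - 1)) p0 q0 e) _; rewrite lerD2l.
rewrite -powRrM mulrC; have -> : (p - 1) * (p / (p - 1)) = p by field; rewrite gt_eqF.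
have e2 : (p / (p - 1))^-1 = 1 - p^-1 by apply/eqP; rewrite eq_sym subr_eq addrC e.
by rewrite e2.
Qed.

Lemma powR_mulpm1 (a : R) : 0 <= a -> powR a p = a * powR a (p - 1).
Proof.
move=> a0; transitivity (powR a (1 + (p - 1))); first by f_equal; ring.
rewrite [LHS]powRD ?powRr1 //.
by rewrite [1 + _]addrC subrK (gt_eqF (lt_trans ltr01 p1)).
Qed.

(** Superlinear growth of the power: [k] is the point where [e * powR a p] catches up with [a].
    Integrated over a small set, it bounds a trace by a small share of its p-th power plus [k] times
    the measure, which is uniform integrability. *)
Lemma linear_le_powR (e : R) : 0 < e -> exists2 k : R, 0 < k & forall a, 0 <= a -> a <= e * powR a p + k.
Proof.
move=> e0; have pm : 0 < p - 1 by rewrite subr_gt0.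
pose k := powR e^-1 (p - 1)^-1; have k0 : 0 < k by rewrite powR_gt0 // invr_gt0.
exists k => // a a0; have [ak|ka] := leP a k.
  by apply: le_trans ak _; rewrite lerDr mulr_ge0 ?powR_ge0 // ltW.
apply: (@le_trans _ _ (e * powR a p)); last by rewrite lerDl ltW.
have kp : powR k (p - 1) = e^-1 by rewrite /k -powRrM mulVf ?gt_eqF // powRr1 // ltW // invr_gt0.
have h : e^-1 <= powR a (p - 1).
  by rewrite -kp ge0_ler_powR ?nnegrE // ltW.
have -> : powR a p = a * powR a (p - 1).
  exact: powR_mulpm1.
rewrite mulrCA -[leLHS]mulr1; apply: ler_wpM2l => //.
by rewrite mulrC -ler_pdivrMr // mul1r.
Qed.

Variables (t : nat -> T -> R) (K : R).
Hypothesis mt : forall n, measurable_fun D (t n).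
Local Notation tp n := (fun x => powR `|t n x| p).
Hypothesis tpi : forall n, mu.-integrable D (EFin \o tp n).
Hypothesis tpK : forall n, \int[mu]_(x in D) powR `|t n x| p <= K.

Let cst_int (c : R) : mu.-integrable D (EFin \o (fun=> c)).
Proof. by apply: finite_measure_integrable_cst. Qed.

Let integrable_dom (f g : T -> R) : measurable_fun D f -> mu.-integrable D (EFin \o g) ->
  (forall x, D x -> `|f x| <= g x) -> mu.-integrable D (EFin \o f).
Proof.
move=> mf gi h; apply: (le_integrable mD _ _ gi); first exact/measurable_EFinP.
by move=> x Dx; rewrite /= lee_fin; apply: le_trans (h x Dx) (ler_norm _).
Qed.

Let bound_int (e k : R) n : mu.-integrable D (EFin \o (fun x => e * tp n x + k)).
Proof.
have h1 := integrableZl mD e (tpi n).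
by have := integrableD mD h1 (cst_int k); apply: eq_integrable => // x _; rewrite /= EFinD EFinM.
Qed.

Let ti n : mu.-integrable D (EFin \o t n).
Proof.
have [k k0 hk] := linear_le_powR ltr01; apply: integrable_dom (bound_int 1 k n) _ => // x Dx.
exact: hk.
Qed.

Let tC : exists C, forall n, \int[mu]_(x in D) `|t n x| <= C.
Proof.
have [k k0 hk] := linear_le_powR ltr01; exists (K + k * fine (mu D)) => n.
apply: (@le_trans _ _ (\int[mu]_(x in D) (1 * tp n x + k))).
  apply: (le_Rintegral mD (integrable_norm mD (ti n)) (bound_int 1 k n)) => x Dx; exact: hk.
rewrite RintegralD //; last by have := bound_int 1 0 n; apply: eq_integrable => // x _; rewrite /= addr0.
rewrite Rintegral_cst // lerD2r RintegralZl // mul1r; exact: tpK.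
Qed.

Let uniform e : 0 < e -> exists2 dl : R, 0 < dl & forall n (A : set T), measurable A ->
  (mu A < dl%:E)%E -> \int[mu]_(x in D) (\1_A x * `|t n x|) <= e.
Proof.
move=> e0; pose K' := `|K| + 1; have K0 : 0 < K' by rewrite ltr_wpDl.
have d0 : 0 < e / 2 / K' by rewrite !divr_gt0.
have [k k0 hk] := linear_le_powR d0.
exists (e / 2 / k) => [|n A mA hA]; first by rewrite !divr_gt0.
have bi := @bmeas_indic _ T R A mA; set dd := e / 2 / K'.
have i1 : mu.-integrable D (EFin \o (fun x => dd * tp n x)).
  by have := bound_int dd 0 n; apply: eq_integrable => // x _; rewrite /= addr0.
have i2 : mu.-integrable D (EFin \o (fun x => \1_A x * k)) := paired_integrable mD (cst_int k) bi.
apply: (@le_trans _ _ (\int[mu]_(x in D) (dd * tp n x + \1_A x * k))).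
  apply: le_Rintegral => //.
  - exact: (paired_integrable mD (integrable_norm mD (ti n)) bi).
  - by have := integrableD mD i1 i2; apply: eq_integrable => // x _; rewrite /= EFinD.
  - move=> x Dx; have p0 : 0 <= dd * tp n x by rewrite mulr_ge0 ?powR_ge0 // ltW.
    rewrite indicE; case: (x \in A); rewrite ?mul1r ?mul0r ?addr0 //.
    exact: hk.
rewrite RintegralD // RintegralZl //.
have -> : \int[mu]_(x in D) (\1_A x * k) = fine (mu (A `&` D)) * k.
  rewrite RintegralZr //; last by have := paired_integrable mD (cst_int 1) bi; apply: eq_integrable => // x _; rewrite /= mulr1.
  by rewrite /Rintegral integral_indic.
have h1 : dd * \int[mu]_(x in D) tp n x <= e / 2.
  rewrite /dd -mulrA -[leRHS]mulr1; apply: ler_wpM2l; first by rewrite divr_ge0 // ltW.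
  rewrite mulrC ler_pdivrMr // mul1r; apply: le_trans (tpK n) _.
  by apply: le_trans (ler_norm _) _; rewrite lerDl.
have h2 : fine (mu (A `&` D)) * k <= e / 2.
  rewrite -ler_pdivlMr //; have le1 : (mu (A `&` D) <= mu A)%E.
    by apply: le_measure; rewrite ?inE //; exact: measurableI.
  have := le_lt_trans le1 hA; rewrite -(fineK (fin_num_measure mu _ (measurableI _ _ mA mD))) lte_fin; exact: ltW.
lra.
Qed.

Definition truncation (f : T -> R) (m : R) x : R := Num.min `|f x| m.

(** Bounds pass to the limit [f] by testing it against functions of itself: the sign of [f] times
    the power p - 1 of the truncated [|f|] for the p-norm, the sign of [f] on the set where [|f|]
    exceeds [M] for the sup norm. Such functions are bounded and measurable but not continuous,
    hence the choice of test functions. *)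
Theorem Lp_limit : exists f : T -> R, [/\ measurable_fun setT f, mu.-integrable setT (EFin \o f),
  forall g, bmeas g -> paired mu D f g = weak_limit mu D t g,
  (\int[mu]_(x in D) (powR `|f x| p)%:E <= K%:E)%E &
  forall M, (forall n x, D x -> `|t n x| <= M) -> mu (D `&` [set x | M < `|f x|]) = 0%E].
Proof.
have [C hC] := tC; have [f [mf fi fE]] := weak_limit_density mD ti hC uniform.
have p0 : 0 < p by exact: lt_trans p1.
have fD : mu.-integrable D (EFin \o f) by apply: integrableS fi.
have bsg (s : R -> R) M : measurable_fun setT s -> (forall y, `|s y| <= M) -> bmeas (s \o f).
  by move=> ms hs; split; [exact: measurableT_comp|exists M => x; exact: hs].
have msg : measurable_fun [set: R] (fun y : R => Num.sg y).
  have -> : (fun y : R => Num.sg y) = fun y => \1_[set y : R | 0 < y] y - \1_[set y : R | y < 0] y.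
    apply/funext => y; rewrite !indicE; case: sgrP => hy.
    - by rewrite !memNset ?subrr //= hy ltxx.
    - by rewrite mem_set // memNset ?subr0 //= ltNge (ltW hy).
    - by rewrite memNset ?sub0r ?mem_set //= ltNge (ltW hy).
  apply: measurable_funB; apply: measurable_indic.
    have -> : [set y : R | 0 < y] = `]0, +oo[%classic by apply/seteqP; split => y /=; rewrite in_itv /= andbT.
    exact: measurable_itv.
  have -> : [set y : R | y < 0] = `]-oo, 0[%classic by apply/seteqP; split => y /=; rewrite in_itv.
  exact: measurable_itv.
have mmin m : measurable_fun [set: R] (fun y : R => Num.min `|y| m).
  by apply: measurable_minr; [exact: normr_measurable|exact: measurable_cst].
have hJ m : 0 <= m -> \int[mu]_(x in D) powR (truncation f m x) p <= K.
  move=> m0; pose g := (fun y : R => Num.sg y * powR (Num.min `|y| m) (p - 1)) \o f.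
  have min0 (y : R) : 0 <= Num.min `|y| m by rewrite le_min normr_ge0.
  have powle r : 0 <= r -> forall y : R, powR (Num.min `|y| m) r <= powR m r.
    by move=> r0 y; rewrite ge0_ler_powR ?nnegrE // ge_min lexx orbT.
  have pm : 0 <= p - 1 by rewrite subr_ge0 ltW.
  have mpow r : measurable_fun [set: R] (fun y : R => powR (Num.min `|y| m) r).
    exact: (measurableT_comp (f := @powR R ^~ r) (@measurable_powR R r) (mmin m)).
  have bg : bmeas g.
    apply: (bsg _ (powR m (p - 1))); first exact: measurable_funM.
    move=> y; rewrite normrM (ger0_norm (powR_ge0 _ _)) -[leRHS]mul1r; apply: ler_pM; [exact: normr_ge0|exact: powR_ge0| |exact: powle].
    by rewrite normr_sg; case: (y != 0).
  have bJ : bmeas (fun x => powR (truncation f m x) p).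
    apply: (bsg (fun y => powR (Num.min `|y| m) p) (powR m p)) => // y.
    by rewrite ger0_norm ?powR_ge0 //; apply: powle; exact: ltW.
  have iJ : mu.-integrable D (EFin \o (fun x => powR (truncation f m x) p)).
    by have := paired_integrable mD (cst_int 1) bJ; apply: eq_integrable => // x _; rewrite /= mulr1.
  set J := \int[mu]_(x in D) _.
  have h1 : J <= paired mu D f g.
    apply: le_Rintegral => //; first exact: (paired_integrable mD _ bg).
    move=> x Dx; rewrite /g /= mulrAC -normrEsg /truncation.
    have -> : powR (Num.min `|f x| m) p = Num.min `|f x| m * powR (Num.min `|f x| m) (p - 1).
      exact: powR_mulpm1.
    by apply: ler_wpM2r; [exact: powR_ge0|rewrite ge_min lexx].
  have h2 : weak_limit mu D t g <= K / p + (1 - p^-1) * J.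
    have bb : bounded_seq (fun=> K / p + (1 - p^-1) * J) by exists `|K / p + (1 - p^-1) * J|.
    rewrite /weak_limit -[leRHS]ulim_cst; apply: ulim_le => //; first exact: (paired_bounded mD ti hC bg).
    move=> n; pose q x := p^-1 * tp n x + (1 - p^-1) * powR (truncation f m x) p.
    have i1 : mu.-integrable D (EFin \o (fun x => p^-1 * tp n x)).
      by have := bound_int p^-1 0 n; apply: eq_integrable => // x _; rewrite /= addr0.
    have i2 : mu.-integrable D (EFin \o (fun x => (1 - p^-1) * powR (truncation f m x) p)).
      by have := integrableZl mD (1 - p^-1) iJ; apply: eq_integrable => // x _; rewrite /= EFinM.
    apply: (@le_trans _ _ (\int[mu]_(x in D) q x)).
      apply: le_Rintegral => //; first exact: (paired_integrable mD _ bg).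
        by have := integrableD mD i1 i2; apply: eq_integrable => // x _; rewrite /= EFinD.
      move=> x Dx; apply: le_trans (ler_norm _) _; rewrite normrM mulrC /g /= normrM.
      rewrite (ger0_norm (powR_ge0 _ _)); apply: le_trans (_ : `|t n x| * powR (truncation f m x) (p - 1) <= _).
        apply: ler_wpM2l => //; rewrite -[leRHS]mul1r; apply: ler_wpM2r; first exact: powR_ge0.
        by rewrite normr_sg; case: (f x != 0).
      by have := young_powR (normr_ge0 (t n x)) (min0 (f x)); rewrite [_ / p]mulrC.
    rewrite RintegralD // !RintegralZl // lerD2r mulrC ler_pM2r ?invr_gt0 //; exact: tpK.
  (* Thanks to the truncation [J] is finite, so the share [(1 - p^-1) * J] can be moved to the
     left. *)
  rewrite fE // in h1; have h3 := le_trans h1 h2.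
  have : J / p <= K / p by move: h3; rewrite mulrBl mul1r [p^-1 * J]mulrC; move: (J / p) (K / p) => a b; lra.
  by rewrite ler_pM2r ?invr_gt0.
exists f; split => //.
  (* Monotone convergence in the height removes the truncation. *)
  pose g n x := (powR (truncation f n%:R x) p)%:E.
  have gm n : measurable_fun D (g n).
    apply/measurable_EFinP; apply: measurable_funTS.
    exact: (measurableT_comp (measurableT_comp (f := @powR R ^~ p) (@measurable_powR R p) (mmin n%:R)) mf).
  have gnn n x : D x -> (0 <= g n x)%E by move=> _; rewrite lee_fin powR_ge0.
  have gnd x : D x -> {homo g^~ x : n m / (n <= m)%N >-> (n <= m)%E}.
    move=> _ n m nm; rewrite lee_fin ge0_ler_powR ?nnegrE ?(ltW p0) ?le_min ?normr_ge0 //=.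
    by rewrite /truncation ge_min lexx /= ge_min ler_nat nm orbT.
  have gl x : limn (g ^~ x) = (powR `|f x| p)%:E.
    apply: cvg_lim => //; apply: cvg_near_cst; exists (Num.truncn `|f x|).+1 => // n /= hn.
    rewrite /g /truncation (min_idPl _) //; apply: le_trans (ltW (truncnS_gt _)) _.
    by rewrite ler_nat.
  have := monotone_convergence mu mD gm gnn gnd.
  under eq_integral do rewrite gl.
  move=> ->; apply: lime_le.
    apply: ereal_nondecreasing_is_cvgn => n m nm; apply: ge0_le_integral => //; try exact: gnn; try exact: gm.
    by move=> x Dx; exact: gnd.
  apply: nearW => n; have := hJ n%:R (ler0n _ _); rewrite -lee_fin /Rintegral fineK //.
  apply: integrable_fin_num => //.
  have bJ : bmeas (fun x => powR (truncation f n%:R x) p).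
    apply: (bsg (fun y => powR (Num.min `|y| n%:R) p) (powR n%:R p)).
      exact: (measurableT_comp (f := @powR R ^~ p) (@measurable_powR R p) (mmin n%:R)).
    move=> y; rewrite ger0_norm ?powR_ge0 // ge0_ler_powR ?nnegrE ?(ltW p0) ?le_min ?normr_ge0 //=.
    by rewrite ge_min lexx orbT.
  by have := paired_integrable mD (cst_int 1) bJ; apply: eq_integrable => // x _; rewrite /= mulr1.
move=> M hM.
have mabs : measurable_fun setT (fun x => `|f x|) by apply: measurableT_comp.
have mA : measurable [set x | M < `|f x|].
  have -> : [set x | M < `|f x|] = setT `&` (fun x => `|f x|) @^-1` `]M, +oo[%classic.
    by rewrite setTI; apply/seteqP; split => x /=; rewrite in_itv /= andbT.
  by apply: mabs => //; exact: measurable_itv.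
set A := [set x | M < `|f x|] in mA *.
pose g := fun x => Num.sg (f x) * \1_A x.
have bg : bmeas g.
  split; first by apply: measurable_funM; [exact: (measurableT_comp msg mf)|exact: measurable_indic].
  exists 1 => x; rewrite normrM -[leRHS]mul1r; apply: ler_pM => //.
    by rewrite normr_sg; case: (f x != 0).
  by rewrite indicE; case: (x \in A); rewrite ?normr1 ?normr0.
have bA := @bmeas_indic _ T R A mA.
have i1 := paired_integrable mD fD bg.
have i2 := paired_integrable mD (cst_int M) bA.
have gf x : g x * f x = \1_A x * `|f x| by rewrite /g mulrAC -normrEsg mulrC.
have h1 : paired mu D f g <= \int[mu]_(x in D) (\1_A x * M).
  rewrite fE // /weak_limit -[leRHS]ulim_cst; apply: ulim_le; first exact: (paired_bounded mD ti hC bg).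
    by exists `|\int[mu]_(x in D) (\1_A x * M)|.
  move=> n; apply: le_Rintegral => //; first exact: (paired_integrable mD _ bg).
  move=> x Dx; apply: le_trans (ler_norm _) _; rewrite /g normrM normrM.
  rewrite indicE; case: (x \in A); rewrite ?normr0 ?mulr0 ?mul0r // normr1 mulr1 mul1r -[leRHS]mul1r.
  by apply: ler_pM => //; [rewrite normr_sg; case: (f x != 0)|exact: hM].
(* [w] is nonnegative and its integral is not positive, so it vanishes almost everywhere, whereas it
   is positive on [A]. *)
pose w x := \1_A x * (`|f x| - M).
have w0 x : 0 <= w x.
  by rewrite /w indicE; case: (boolP (x \in A)) => xA; rewrite ?mul0r // mul1r subr_ge0; rewrite inE in xA; exact: ltW.
have wE : (fun x => g x * f x - \1_A x * M) = w by apply/funext => x; rewrite gf /w mulrBr.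
have wi : mu.-integrable D (EFin \o w).
  by rewrite -wE; have := integrableB mD i1 i2; apply: eq_integrable => // x _; rewrite /= EFinB.
have w_int : \int[mu]_(x in D) w x = 0.
  apply/eqP; rewrite eq_le Rintegral_ge0 // andbT -wE RintegralB // subr_le0; exact: h1.
have : ae_eq mu D (EFin \o w) (cst 0%E).
  apply/(ae_eq_integral_abs mu mD (measurable_int _ wi)).
  rewrite -(fineK (integrable_fin_num mD (integrable_abse wi))).
  rewrite -[RHS](congr1 EFin w_int) /Rintegral; congr (fine _)%:E; apply: eq_integral => x _.
  by rewrite /= ger0_norm.
move=> [N [mN N0 sN]]; apply/eqP; rewrite -measure_le0 -N0.
apply: le_measure; rewrite ?inE //; first exact: measurableI.
move=> x [Dx Ax]; apply: sN => /= /(_ Dx) [].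
by rewrite /w indicE mem_set // mul1r => /eqP; rewrite subr_eq0 gt_eqF.
Qed.
End LpLimits.

(** * Boundary densities of Hardy fields for p > 1 *)

Section SurfaceLimits.
Variable R : realType.
Notation V3 := (V3 R).
Local Notation B := (@ball3 R).
Local Notation S := (@sphere3 R).
Local Notation CB := [set x : V3 | enorm x <= 1].
Local Notation sigma := (sigma3 R).
Implicit Types (x y : V3) (i j k : 'I_3).

(** A copy of [sigma3] that carries the finite-measure instance required by the limit theorems. *)
Definition surf : set V3 -> \bar R := sigma3 R.
HB.instance Definition _ := Measure.on surf.
Lemma surf_fin : fin_num_fun surf.
Proof.
move=> A mA; rewrite ge0_fin_numE //; apply: le_lt_trans (sigma3_finite R).
by apply: le_measure; rewrite ?inE.
Qed.
HB.instance Definition _ := Measure_isFinite.Build _ _ _ surf surf_fin.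

Lemma integral_sphere (f : V3 -> \bar R) : (\int[sigma]_x f x = \int[sigma]_(x in S) f x)%E.
Proof. exact: (integral_concentrated (@measurable_sphere3 R) (@sigma3_out R)). Qed.

(** Radii tending to 1 and positive from the first term on, as [lame_representation] asks for
    [0 < r]. *)
Definition rn n : R := n.+1%:R / n.+2%:R.

Lemma rn01 n : 0 < rn n < 1.
Proof. by rewrite /rn divr_gt0 //= ltr_pdivrMr // mul1r ltr_nat. Qed.

Lemma rn_cvg : rn @ \oo --> (1 : R).
Proof.
have -> : rn = fun n => 1 - n.+2%:R^-1.
  apply/funext => n; rewrite /rn; have n0 : n.+2%:R != 0 :> R by rewrite pnatr_eq0.
  by apply: (mulIf n0); rewrite divfK // mulrBl mulVf // mul1r -(natr1 n.+1) addrK.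
rewrite -[X in _ --> X]subr0; apply: cvgB; first exact: cvg_cst.
have h : (fun n => (n.+1%:R : R)^-1) @ \oo --> (0 : R) := @cvg_harmonic R.
by rewrite (cvg_shiftS (fun n => (n.+1%:R : R)^-1)).
Qed.

(** The kernel is continuous on the sphere only; cut off there it becomes a bounded measurable
    function on the whole space, admissible as a test function. *)
Definition cutS (g : V3 -> R) x : R := \1_S x * g x.

Lemma cutS_bmeas g : wcont S g -> bmeas (cutS g).
Proof.
move=> hg; have mS := @measurable_sphere3 R.
have -> : cutS g = g \_ S.
  by apply/funext => x; rewrite /cutS patchE indicE; case: (x \in S); rewrite ?mul1r ?mul0r.
split; first by apply/(measurable_restrictT _ mS); exact: wcont_measurable.
have [M [M0 hM]] := wcont_bounded (@sphere3_compact R) hg.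
exists M => x; rewrite patchE; case: ifPn => [|_]; last by rewrite normr0 ltW.
by rewrite inE; exact: hM.
Qed.

Lemma paired_cutS f g : paired surf S f (cutS g) = \int[sigma]_(x in S) (g x * f x).
Proof. by apply: eq_Rintegral => x xS; rewrite /cutS indicE xS mul1r. Qed.

Lemma wcont_normpow_integrable (f : V3 -> R) (p : R) : 0 <= p -> wcont S f ->
  sigma.-integrable S (EFin \o (fun x => powR `|f x| p)).
Proof.
move=> p0 hf; have mS := @measurable_sphere3 R.
have [M [M0 hM]] := wcont_bounded (@sphere3_compact R) hf.
apply: measurable_bounded_integrable => //; first exact: sigma3S_finite.
  apply: (measurableT_comp (f := @powR R ^~ p) (@measurable_powR R p)).
  by apply: measurableT_comp => //; exact: wcont_measurable.
exists (powR M p); split; [exact: num_real|move=> y My x Sx; apply: le_trans (ltW My)].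
by rewrite ger0_norm ?powR_ge0 // ge0_ler_powR ?nnegrE ?(ltW M0) //; exact: hM.
Qed.

Variables (lam mu : R).
Hypotheses (hmu : 0 < mu) (hlm : 0 < 2 * mu + lam).

Lemma trace_cvg u i x : lame_solution lam mu u -> B x -> trace u (rn n) i x @[n --> \oo] --> coord i (u x).
Proof.
move=> hu Bx; have [c1 _ _] := lame_solution_C1 hu.
have cx : {for x, continuous (coord i \o u)} := wcont_open (@Bl_open R 1) (JCf_wcont (c1 i)) Bx.
have h : (rn n *: x) @[n --> \oo] --> x by rewrite -[X in _ --> X]scale1r; apply: cvgZ; [exact: rn_cvg|exact: cvg_cst].
exact: (cvg_comp _ _ h cx).
Qed.

Lemma ulim_sum3 (s0 s1 s2 : nat -> R) l : bounded_seq s0 -> bounded_seq s1 -> bounded_seq s2 ->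
  (fun n => s0 n + s1 n + s2 n) @ \oo --> l -> ulim s0 + ulim s1 + ulim s2 = l.
Proof.
move=> b0 b1 b2 h; have b01 := bounded_lin 1 1 b0 b1.
have e1 := ulim_lin 1 1 b0 b1; have e2 := ulim_lin 1 1 b01 b2.
rewrite !mul1r in e1 e2; rewrite -e1 -e2; apply: ulim_lim.
have -> // : (fun n => 1 * (1 * s0 n + 1 * s1 n) + 1 * s2 n) = fun n => s0 n + s1 n + s2 n.
by apply/funext => n; rewrite !mul1r.
Qed.

(** At radius [rn n] the identity has three terms, each with a limit along the ultrafilter; their
    sum is [area R * trace u (rn n) i x] and converges in the ordinary sense, which identifies the
    sum of the three limits. *)
Lemma weak_limit_representation (u : V3 -> V3) (L : 'I_3 -> (V3 -> R) -> R) i x : lame_solution lam mu u -> B x ->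
  (forall j, bounded_seq (fun n => sint (fun e => trace u (rn n) j e * Kn lam mu i j x e))) ->
  (forall j, L j (Kn lam mu i j x) = ulim (fun n => sint (fun e => trace u (rn n) j e * Kn lam mu i j x e))) ->
  area R * coord i (u x) = \sum_(j < 3) L j (Kn lam mu i j x).
Proof.
move=> hu Bx hb hL; rewrite sum3E !hL; apply/esym; apply: (ulim_sum3 (hb _) (hb _) (hb _)).
have -> : (fun n => sint (fun e => trace u (rn n) (inord 0) e * Kn lam mu i (inord 0) x e) +
    sint (fun e => trace u (rn n) (inord 1) e * Kn lam mu i (inord 1) x e) +
    sint (fun e => trace u (rn n) (inord 2) e * Kn lam mu i (inord 2) x e)) =
    fun n => area R * trace u (rn n) i x.
  by apply/funext => n; rewrite (lame_representation hmu hlm i hu (rn01 n) Bx) sum3E.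
by apply: cvgM; [exact: cvg_cst|exact: trace_cvg].
Qed.

Lemma norm_coord_ex x : exists k, `|x| = `|coord k x|.
Proof.
rewrite norm3E /Num.max; case: ifP => _; first by exists (inord 2); rewrite coordE.
by case: ifP => _; [exists (inord 1)|exists (inord 0)]; rewrite coordE.
Qed.

Lemma powR_enorm_le (p : R) x : 0 <= p -> powR (enorm x) p <= \sum_(j < 3) powR 3 p * powR `|coord j x| p.
Proof.
move=> p0; have [k hk] := norm_coord_ex x.
apply: (@le_trans _ _ (powR 3 p * powR `|coord k x| p)).
  rewrite -powRM // -hk ge0_ler_powR ?nnegrE ?enorm_ge0 ?mulr_ge0 //; exact: enorm_le_norm.
rewrite (bigD1 k) //= lerDl; apply: sumr_ge0 => j _; apply: mulr_ge0; exact: powR_ge0.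
Qed.

Lemma density_representation (u : V3 -> V3) (f : 'I_3 -> V3 -> R) : lame_solution lam mu u ->
  (forall j, sigma.-integrable S (EFin \o f j)) ->
  (forall i x, B x -> area R * coord i (u x) = \sum_(j < 3) \int[sigma]_(e in S) (Kn lam mu i j x e * f j e)) ->
  forall x, B x -> u x = Pe_fun lam mu (fun e => vec3 (fun j => 4 * pi / area R * f j e)) x.
Proof.
move=> hu fi h x Bx; apply: coord_inj => i; rewrite /Pe_fun vec3K.
have a0 := area_gt0 R; have mS := @measurable_sphere3 R.
have pi0 : pi != 0 :> R by rewrite gt_eqF // pi_gt0.
have e j : \int[sigma]_(e in S) (Pe_kernel lam mu i j x e * coord j (vec3 (fun j => 4 * pi / area R * f j e)))
    = (area R)^-1 * \int[sigma]_(e in S) (Kn lam mu i j x e * f j e).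
  rewrite -RintegralZl //; last first.
    have bK := cutS_bmeas (wcont_Kn hmu hlm (i := i) (j := j) Bx).
    have := paired_integrable (mu := surf) mS (fi j) bK; apply: eq_integrable => // y yS.
    by rewrite /= /cutS indicE yS mul1r.
  apply: eq_Rintegral => y yS; have Sy : S y by rewrite inE in yS.
  rewrite vec3K (Pe_kernelE hmu hlm i j Sy Bx).
  have a1 : area R != 0 by rewrite gt_eqF.
  by move: (Kn _ _ _ _ _ _) (f j y) (pi) pi0 (area R) a1 => a b z z0 w w0; field; rewrite ?z0 ?w0.
rewrite (eq_bigr _ (fun j _ => e j)) -mulr_sumr -h // mulKf // gt_eqF //.
Qed.

Section Density.
Variables (u : V3 -> V3) (p K : R).
Hypotheses (hu : lame_solution lam mu u) (p1 : 1 < p).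
Hypothesis hK : forall n j, sint (fun e => powR `|trace u (rn n) j e| p) <= K.

Let ct n j : wcont S (trace u (rn n) j).
Proof.
have SCB : S `<=` CB by move=> y /= ->.
by apply: wcont_sub SCB (wcont_trace hu _); case/andP: (rn01 n) => /ltW -> ->.
Qed.

Lemma density_exists : exists f : 'I_3 -> V3 -> R, [/\
  forall j, measurable_fun setT (f j), forall j, sigma.-integrable S (EFin \o f j),
  forall i x, B x -> area R * coord i (u x) = \sum_(j < 3) \int[sigma]_(e in S) (Kn lam mu i j x e * f j e),
  forall j, (\int[sigma]_(x in S) (powR `|f j x| p)%:E <= K%:E)%E &
  forall M, (forall x i, B x -> `|coord i (u x)| <= M) -> forall j, sigma (S `&` [set x | M < `|f j x|]) = 0%E].
Proof.
have mS := @measurable_sphere3 R; have p0 : 0 <= p by apply: ltW; apply: lt_trans p1.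
have H j := Lp_limit (mu := surf) mS p1 (t := fun n => trace u (rn n) j) (K := K)
  (fun n => wcont_measurable mS (@ct n j)) (fun n => wcont_normpow_integrable p0 (@ct n j)) (fun n => hK n j).
pose f j := sval (cid (H j)).
have hf j := svalP (cid (H j)).
exists f; split.
- by move=> j; have [] := hf j.
- by move=> j; have [_ fi _ _ _] := hf j; exact: integrableS fi.
- move=> i x Bx.
  have pE n j : paired surf S (trace u (rn n) j) (cutS (Kn lam mu i j x)) =
      sint (fun e => trace u (rn n) j e * Kn lam mu i j x e).
    by rewrite paired_cutS; apply: eq_Rintegral => e _; rewrite mulrC.
  have bK j := cutS_bmeas (wcont_Kn hmu hlm (i := i) (j := j) Bx).
  have [C0 hC0] := wcont_bounded (@sphere3_compact R) (wcont_Kn hmu hlm (i := i) (j := i) Bx).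
  have bnd j : bounded_seq (fun n => sint (fun e => trace u (rn n) j e * Kn lam mu i j x e)).
    have [k k0 hk] := linear_le_powR p1 ltr01.
    have [M [M0 hM]] := wcont_bounded (@sphere3_compact R) (wcont_Kn hmu hlm (i := i) (j := j) Bx).
    exists ((K + k * area R) * M) => n; rewrite -pE.
    have ti : surf.-integrable S (EFin \o trace u (rn n) j) := wcont_integrableS (@ct n j).
    have hM' y : `|cutS (Kn lam mu i j x) y| <= M.
      rewrite /cutS indicE; case: (boolP (y \in S)) => yS; last by rewrite mul0r normr0 ltW.
      by rewrite mul1r; apply: hM; rewrite inE in yS.
    apply: le_trans (paired_abs mS ti (bK j) hM') _; apply: ler_wpM2r; first exact: ltW.
    have i1 := wcont_normpow_integrable p0 (@ct n j).
    have i2 : sigma.-integrable S (EFin \o (fun=> k)) := wcont_integrableS (@wcont_cst _ _ _ _).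
    apply: (@le_trans _ _ (\int[sigma]_(e in S) (powR `|trace u (rn n) j e| p + k))).
      apply: le_Rintegral => //; first exact: (integrable_norm mS ti).
        by have := integrableD mS i1 i2; apply: eq_integrable => // y _; rewrite /= EFinD.
      by move=> y _; have := hk _ (normr_ge0 (trace u (rn n) j y)); rewrite mul1r.
    rewrite RintegralD // Rintegral_cst //; apply: lerD; first exact: hK.
    by rewrite /area lexx.
  rewrite (weak_limit_representation (L := fun j g => \int[sigma]_(e in S) (g e * f j e)) hu Bx bnd) //.
  move=> j; have [_ _ hw _ _] := hf j; rewrite -paired_cutS (hw _ (bK j)).
  by rewrite /weak_limit; f_equal; apply/funext => n; exact: pE.
- by move=> j; have [_ _ _ h _] := hf j; exact: h.
- move=> M hM j; have [_ _ _ _ h] := hf j; apply: h => n x Sx; rewrite /trace; apply: hM.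
  have /andP[r0 r1] := rn01 n; rewrite /ball3 /= enormZ gtr0_norm // (_ : enorm x = 1) ?mulr1 //.
Qed.
End Density.

Lemma Lnorm_sphere_lty (p : R) (f : V3 -> V3) : 0 < p ->
  (\int[sigma]_(x in S) (powR (enorm (f x)) p)%:E < +oo)%E ->
  (Lnorm sigma p%:E (fun w => (enorm (f w))%:E) < +oo)%E.
Proof.
move=> p0 h; rewrite unlock /= integral_sphere; apply: poweR_lty.
rewrite (eq_integral (fun x => (powR (enorm (f x)) p)%:E)) // => x _.
by rewrite /= ger0_norm // enorm_ge0.
Qed.

Lemma Lnorm_sphere_le (p C : R) (f : V3 -> V3) : 0 < p ->
  (Lnorm sigma p%:E (fun w => (enorm (f w))%:E) <= C%:E)%E ->
  (\int[sigma]_(x in S) (powR (enorm (f x)) p)%:E <= (powR C p)%:E)%E.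
Proof.
move=> p0 h; have pn : p != 0 by rewrite gt_eqF.
have e : (\int[sigma]_(x in S) (powR (enorm (f x)) p)%:E =
    Lnorm sigma p%:E (fun w => (enorm (f w))%:E) `^ p)%E.
  rewrite (poweR_Lnorm _ _ pn) integral_sphere; apply: eq_integral => x _.
  by rewrite /= ger0_norm // enorm_ge0.
rewrite e -poweR_EFin; have n0 := Lnorm_ge0 sigma p%:E (fun w => (enorm (f w))%:E).
have C0 : (0 <= C%:E)%E by exact: le_trans n0 h.
by apply: gt0_ler_poweR; [exact: ltW|rewrite in_itv /= n0 leey|rewrite in_itv /= C0 leey|exact: h].
Qed.

Lemma wcont_enorm (A : set V3) (f : V3 -> V3) : (forall i, wcont A (fun e => coord i (f e))) ->
  wcont A (fun e => enorm (f e)).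
Proof.
move=> hf; apply: (@wcont_comp _ _ _ A setT (fun e => dot (f e) (f e)) Num.sqrt) => //.
  by apply: wcont_sum => i; exact: wcontM.
by apply: cont_wcont; exact: sqrt_continuous.
Qed.

Lemma scaled_vec_le (c : R) (a : 'I_3 -> R) M : 0 <= c -> (forall j, `|a j| <= M) ->
  enorm (vec3 (fun j => c * a j)) <= 3 * (c * M).
Proof.
move=> c0 h; apply: le_trans (enorm_le_norm _) _; rewrite ler_pM2l //.
by apply: norm_le_coord => i; rewrite vec3K normrM ger0_norm // ler_wpM2l.
Qed.

Theorem hardy_fun (p : \bar R) u : (1 < p)%E -> hardy_e lam mu p u ->
  exists f : V3 -> V3, Lp_sphere p f /\ forall x, B x -> u x = Pe_fun lam mu f x.
Proof.
have mS := @measurable_sphere3 R; have a0 := area_gt0 R.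
pose c := 4 * pi / area R; have c0 : 0 <= c by rewrite divr_ge0 ?(ltW a0) // mulr_ge0 // pi_ge0.
have SB n e : S e -> B (rn n *: e).
  by move=> Se; have /andP[r0 r1] := rn01 n; rewrite /ball3 /= enormZ gtr0_norm // (_ : enorm e = 1) ?mulr1.
have r01 n : 0 <= rn n < 1 by case/andP: (rn01 n) => /ltW -> ->.
have ct n j : lame_solution lam mu u -> wcont S (trace u (rn n) j).
  move=> hu; have SCB : S `<=` CB by move=> y /= ->.
  exact: wcont_sub SCB (wcont_trace hu (r01 n)).
have mF (f : 'I_3 -> V3 -> R) : (forall j, measurable_fun setT (f j)) ->
    measurable_fun setT (fun e => vec3 (fun j => c * f j e)).
  move=> mf; apply: measurable_to_V3 => i.
  apply: (eq_measurable_fun (fun x => c * f i x)); first by move=> x _; rewrite /= vec3K.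
  by apply: measurable_funM; [exact: measurable_cst|exact: mf].
have mFi (f : 'I_3 -> V3 -> R) : (forall j, measurable_fun setT (f j)) ->
    forall i, measurable_fun S (coord i \o (fun e => vec3 (fun j => c * f j e))).
  by move=> mf i; apply: measurable_funTS; exact: (measurableT_comp (measurable_coord i) (mF f mf)).
case: p => [p| |//]; rewrite ?lte_fin => p1 [hu].
  move=> [C hC]; have p0 : 0 < p by exact: lt_trans p1.
  have hK n j : sint (fun e => powR `|trace u (rn n) j e| p) <= powR C p.
    have h := Lnorm_sphere_le p0 (hC _ (r01 n)).
    have it := wcont_normpow_integrable (ltW p0) (ct n j hu).
    have ie := wcont_normpow_integrable (ltW p0) (wcont_enorm (fun i => ct n i hu)).
    rewrite -lee_fin; apply: le_trans h; rewrite -(fineK (x := \int[sigma]_(x in S) _)); last first.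
      have := integrable_fin_num mS ie; congr (_ \is a fin_num); apply: eq_integral => x _.
      by rewrite /= ger0_norm // enorm_ge0.
    rewrite lee_fin; apply: le_Rintegral => //.
      by move: ie; apply: eq_integrable => // x _; rewrite /= ger0_norm // enorm_ge0.
    by move=> x _; rewrite ge0_ler_powR ?nnegrE ?enorm_ge0 ?(ltW p0) //; exact: coord_le_enorm.
  have [f [mf fi fr fK _]] := density_exists hu p1 hK.
  exists (fun e => vec3 (fun j => c * f j e)); split; last exact: (density_representation hu fi fr).
  split; first exact: mFi.
  apply: Lnorm_sphere_lty => //.
  have ip j : sigma.-integrable S (EFin \o (fun e => powR 3 p * powR c p * powR `|f j e| p)).
    have h : sigma.-integrable S (EFin \o (fun e => powR `|f j e| p)).
      apply/integrableP; split.
        apply/measurable_EFinP; apply: (measurableT_comp (f := @powR R ^~ p) (@measurable_powR R p)).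
        by apply: measurableT_comp => //; exact: measurable_funTS.
      apply: le_lt_trans (ltry (powR C p)); apply: le_trans (fK j).
      by rewrite le_eqVlt; apply/orP; left; apply/eqP; apply: eq_integral => x _; rewrite /= ger0_norm ?powR_ge0.
    by have := integrableZl mS (powR 3 p * powR c p) h; apply: eq_integrable => // x _; rewrite /= EFinM.
  have ig : sigma.-integrable S (EFin \o (fun e => powR (enorm (vec3 (fun j => c * f j e))) p)).
    have i3 := integrableD mS (integrableD mS (ip (inord 0)) (ip (inord 1))) (ip (inord 2)).
    apply: (le_integrable mS _ _ i3).
      apply/measurable_EFinP; apply: (measurableT_comp (f := @powR R ^~ p) (@measurable_powR R p)).
      by apply: measurable_funTS; exact: (measurableT_comp (f := @enorm R) (@measurable_enorm R) (mF f mf)).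
    move=> x _; rewrite /= lee_fin ger0_norm ?powR_ge0 //; apply: le_trans (ler_norm _).
    apply: le_trans (powR_enorm_le _ (ltW p0)) _; rewrite sum3E !vec3K.
    have nc j : powR `|c * f j x| p = powR c p * powR `|f j x| p by rewrite normrM (ger0_norm c0) powRM.
    by rewrite !nc !mulrA.
  have /integrableP[_] := ig; apply: le_lt_trans.
  rewrite le_eqVlt; apply/orP; left; apply/eqP; apply: eq_integral => x _.
  by rewrite /= ger0_norm ?powR_ge0.
move=> [C hC].
have C0 : 0 <= C by apply: le_trans (enorm_ge0 _) (hC 0 (@B0 R)).
(* For [p = +oo] the traces are bounded, hence bounded in L^2: exponent 2 supplies the density, and
   the last clause of [density_exists] its essential bound. *)
have hK n j : sint (fun e => powR `|trace u (rn n) j e| 2) <= powR C 2 * area R.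
  have it := wcont_normpow_integrable (ler0n R 2) (ct n j hu).
  rewrite -sint1 -(posfunZ (@posfun_sint R)); last exact: wcont_cst.
  apply: le_Rintegral => //; first by apply: wcont_integrableS; exact: wcont_cst.
  move=> x Sx; rewrite mulr1 ge0_ler_powR ?nnegrE //.
  by apply: le_trans (coord_le_enorm _ _) _; apply: hC; exact: SB.
have p1' : 1 < 2 :> R by rewrite ltr1n.
have [f [mf fi fr _ fM]] := density_exists hu p1' hK.
exists (fun e => vec3 (fun j => c * f j e)); split; last exact: (density_representation hu fi fr).
split; first exact: mFi.
have hM j : sigma (S `&` [set x | C < `|f j x|]) = 0%E.
  by apply: fM => x i Bx; apply: le_trans (coord_le_enorm _ _) (hC x Bx).
have mj j : measurable (S `&` [set x | C < `|f j x|]).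
  apply: measurableI => //.
  have -> : [set x | C < `|f j x|] = setT `&` (fun x => `|f j x|) @^-1` `]C, +oo[%classic.
    by rewrite setTI; apply/seteqP; split => x /=; rewrite in_itv /= andbT.
  have ma : measurable_fun setT (fun x => `|f j x|) by apply: measurableT_comp.
  by apply: ma => //; exact: measurable_itv.
(* The norm of exponent [+oo] is the essential supremum if the total mass is positive and 0
   otherwise. *)
rewrite unlock /=; case: ifP => _; last exact: ltry.
apply: (@le_lt_trans _ _ (3 * (c * C))%:E); last exact: ltry.
apply/ess_supP.
pose A j := S `&` [set x | C < `|f j x|].
(* The exceptional null set: the complement of the sphere and the three sets where a component
   exceeds [C]. *)
exists (~` S `|` (A (inord 0) `|` (A (inord 1) `|` A (inord 2)))); split.
- by apply: measurableU; [exact: measurableC|apply: measurableU; [exact: mj|apply: measurableU; exact: mj]].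
- rewrite measureU0 ?sigma3_out //; [exact: measurableC| |].
    by apply: measurableU; [exact: mj|apply: measurableU; exact: mj].
  rewrite measureU0 ?hM //; [exact: mj|by apply: measurableU; exact: mj|].
  by rewrite measureU0 ?hM //; exact: mj.
move=> x; apply: contra_notP => /not_orP[/contrapT Sx /not_orP[n0 /not_orP[n1 n2]]] /=.
rewrite /= lee_fin ger0_norm ?enorm_ge0 //; apply: scaled_vec_le => // j.
have nj : ~ (S `&` [set x | C < `|f j x|]) x by case: (ord3P j) => ->.
by rewrite leNgt; apply/negP => h; exact: nj.
Qed.
End SurfaceLimits.

(** * Riesz representation and the case p = 1 *)
Section FiniteMeasures.
Variable R : realType.
Notation V3 := (V3 R).
Variables (S : set V3) (m : {finite_measure set V3 -> \bar R}).
Hypotheses (cS : compact S) (mS : measurable S).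
Implicit Types (g : V3 -> R).

Lemma wcont_integrable_finite g : wcont S g -> m.-integrable S (EFin \o g).
Proof.
move=> hg; apply: measurable_bounded_integrable => //.
- by rewrite -ge0_fin_numE // fin_num_measure.
- exact: wcont_measurable.
have [M [M0 hM]] := wcont_bounded cS hg.
by exists M; split; [exact: num_real|] => x xM y Sy; apply: le_trans (hM y Sy) (ltW xM).
Qed.

Lemma posfun_integral : posfun S (fun g => \int[m]_(x in S) g x).
Proof.
split=> [a b f g hf hg|f hf f0]; last exact: Rintegral_ge0.
rewrite -!RintegralZl //; try exact: wcont_integrable_finite.
rewrite -RintegralD //; by apply: wcont_integrable_finite; exact: wcontZ.
Qed.

End FiniteMeasures.

(** * Riesz representation of positive linear forms on a compact set *)

Section RieszRepresentation.
Variable R : realType.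
Notation V3 := (V3 R).
Variables (S : set V3) (L : (V3 -> R) -> R).
Hypotheses (cS : compact S) (mS : measurable S) (hL : posfun S L).
Implicit Types (E X : set V3) (g : V3 -> R) (h : nat -> V3 -> R).

Definition covers E h := [/\ forall n, wcont S (h n), forall n x, S x -> 0 <= h n x,
  forall n x, S x -> h n x <= h n.+1 x & forall x, E x -> S x -> exists n, 1 <= h n x].

(* Covering by increasing sequences of continuous functions makes countable subadditivity a diagonal argument. *)
Definition costs E : set R := [set c | exists2 h, covers E h & forall n, L (h n) <= c].
Definition content E : R := inf (costs E).

Lemma covers_le E h n m x : covers E h -> S x -> (n <= m)%N -> h n x <= h m x.
Proof.
move=> [_ _ mono _] Sx /subnK <-; elim: (m - n)%N => [|k IH]; first by rewrite add0n.
by rewrite addSn; exact: le_trans IH (mono _ _ Sx).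
Qed.

Lemma covers1 E : covers E (fun _ _ => 1).
Proof. by split => // [n|x _ _]; [exact: wcont_cst|exists 0%N]. Qed.

Lemma costs_nonempty E : costs E (L (fun _ => 1)).
Proof. by exists (fun _ _ => 1) => //; exact: covers1. Qed.

Lemma costs_ge0 E c : costs E c -> 0 <= c.
Proof. by move=> [h [ch h0 _ _] hc]; apply: le_trans (hc 0%N); apply: hL.2; [exact: ch|exact: h0]. Qed.

Lemma costs_inf E : has_inf (costs E).
Proof. by split; [exists (L (fun _ => 1)); exact: costs_nonempty|exists 0 => c; exact: costs_ge0]. Qed.

Lemma content_ge0 E : 0 <= content E.
Proof. by apply: lb_le_inf; [exists (L (fun _ => 1)); exact: costs_nonempty|move=> c; exact: costs_ge0]. Qed.

Lemma content_le_cost E c : costs E c -> content E <= c.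
Proof. by move=> hc; apply: ge_inf => //; case: (costs_inf E). Qed.

Lemma content_adherent E e : 0 < e -> exists2 h, covers E h & forall n, L (h n) <= content E + e.
Proof.
move=> e0; have [c [h ch hc] cl] := inf_adherent e0 (costs_inf E).
by exists h => // n; apply: le_trans (hc n) _; exact: ltW.
Qed.

Lemma content_sub E X : E `<=` X -> content E <= content X.
Proof.
move=> EX; apply: lb_le_inf; first by exists (L (fun _ => 1)); exact: costs_nonempty.
move=> c [h [h1 h2 h3 h4] hc]; apply: content_le_cost; exists h => //; split => // x Ex; exact/h4/EX.
Qed.

Definition outer E : \bar R := (content E)%:E.

Lemma content_out E : E `&` S = set0 -> content E = 0.
Proof.
move=> ES; apply/eqP; rewrite eq_le content_ge0 andbT; apply: content_le_cost.
exists (fun _ _ => 0); last by move=> n; rewrite (posfun0 hL).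
split => // [n|x Ex Sx]; first exact: wcont_cst.
by have : (E `&` S) x by []; rewrite ES.
Qed.

Let outer0 : outer set0 = 0%E.
Proof. by rewrite /outer content_out // set0I. Qed.

Let outer_ge0 E : (0 <= outer E)%E.
Proof. by rewrite lee_fin content_ge0. Qed.

Let outer_le : {homo outer : A B / A `<=` B >-> (A <= B)%E}.
Proof. by move=> A B AB; rewrite lee_fin; exact: content_sub. Qed.

Let outer_subadd : sigma_subadditive outer.
Proof.
move=> F; apply/lee_addgt0Pr => e e0.
pose a k := e / (2 ^ k.+1)%:R; have a0 k : 0 < a k by rewrite divr_gt0 // ltr0n expn_gt0.
have H k := content_adherent (F k) (a0 k).
pose h k := sval (cid2 (H k)).
have hc k : covers (F k) (h k) by rewrite /h; case: cid2.
have hb k n : L (h k n) <= content (F k) + a k by rewrite /h; case: cid2.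
(* Stage [n] uses the first [n + 1] covers, each at its [n]-th function: a finite sum, still
   increasing in [n], that reaches 1 wherever one of the covers does. *)
pose G n x := \sum_(k < n.+1) h k n x.
have cG : covers (\bigcup_n F n) G.
  split.
  - by move=> n; apply: wcont_sum => k; have [] := hc k.
  - by move=> n x Sx; apply: sumr_ge0 => k _; have [_ + _ _] := hc k; exact.
  - move=> n x Sx; rewrite /G [leRHS]big_ord_recr /= -[leLHS]addr0; apply: lerD.
      by apply: ler_sum => k _; have [_ _ + _] := hc k; exact.
    by have [_ + _ _] := hc n.+1; exact.
  - move=> x [k _ Fx] Sx; have [_ h0 _ +] := hc k; move=> /(_ x Fx Sx)[n hn].
    exists (maxn n k); have km : (k < (maxn n k).+1)%N by rewrite ltnS leq_maxr.
    apply: le_trans hn _; apply: le_trans (covers_le (hc k) Sx (leq_maxl n k)) _.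
    rewrite /G (bigD1 (Ordinal km)) //= lerDl; apply: sumr_ge0 => i _; have [_ + _ _] := hc i; exact.
apply: le_trans (epsilon_trick xpredT (fun n => outer_ge0 (F n)) (ltW e0)).
set T := (\sum_(i <oo) _)%E.
have T0 : (0 <= T)%E by apply: nneseries_ge0 => n _ _; apply: adde_ge0; [exact: outer_ge0|rewrite lee_fin; exact: ltW (a0 n)].
have part n : ((\sum_(0 <= k < n) (content (F k) + a k))%:E <= T)%E.
  rewrite -sumEFin; apply: le_trans (nneseries_lim_ge n _); first by apply: lee_sum => k _; rewrite EFinD.
  by move=> k _ _; apply: adde_ge0; [exact: outer_ge0|rewrite lee_fin; exact: ltW (a0 k)].
case: (T) T0 part => [t| |//] _ part; last exact: leey.
rewrite lee_fin; apply: content_le_cost; exists G => // n.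
have -> : L (G n) = \sum_(k < n.+1) L (h k n) by apply: (posfun_sum hL) => k; have [] := hc k.
apply: le_trans (_ : \sum_(k < n.+1) (content (F k) + a k) <= t).
  by apply: ler_sum => k _; exact: hb.
by have := part n.+1; rewrite lee_fin big_mkord.
Qed.

HB.instance Definition _ := isOuterMeasure.Build R V3 outer outer0 outer_ge0 outer_le outer_subadd.

(** A cover of [X] is split by the cut-offs [rho m], which vanish off [E] and increase to its
    indicator. For fixed [m] the part [h n * (1 - rho m)] still covers the points of [X] outside
    [E], while the diagonal [h n * rho n] covers those inside. *)
Lemma halfspace_caratheodory (f : V3 -> R) : continuous f -> outer.-caratheodory [set x | 0 < f x].
Proof.
move=> cf; apply: le_caratheodory_measurable => X; rewrite /outer /= -EFinD lee_fin.
set E := [set x | 0 < f x].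
pose rho (m : nat) x : R := Num.min 1 (m%:R * Num.max 0 (f x)).
have rho01 m x : 0 <= rho m x <= 1.
  by rewrite le_min ler01 ge_min lexx /= andbT mulr_ge0 // le_max lexx.
have rhoS m x : rho m x <= rho m.+1 x.
  rewrite /rho le_min ge_min lexx /= ge_min; apply/orP; right.
  by apply: ler_wpM2r; [rewrite le_max lexx|rewrite ler_nat].
have rho_c m : wcont S (rho m).
  have -> : rho m = fun x => - Num.max (- 1) (- (m%:R * Num.max 0 (f x))).
    by apply/funext => x; rewrite /rho oppr_max !opprK.
  apply: wcontN; apply: wcont_max; first exact: wcont_cst.
  by apply: wcontN; apply: wcontZ; apply: wcont_max; [exact: wcont_cst|exact: cont_wcont].
apply: lb_le_inf; first by exists (L (fun _ => 1)); exact: costs_nonempty.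
move=> c [h ch hc]; have [hcont h_ge0 h_mono h_cov] := ch.
apply/ler_addgt0Pl => e e0.
have cr m n : wcont S (fun x => h n x * rho m x) by exact: wcontM.
have cr' m n : wcont S (fun x => h n x * (1 - rho m x)).
  by apply: wcontM => //; apply: wcontB => //; exact: wcont_cst.
have mono1 m n n' x : S x -> (n <= n')%N -> h n x * rho m x <= h n' x * rho m x.
  by move=> Sx nn; have /andP[r0 _] := rho01 m x; apply: ler_wpM2r => //; exact: (covers_le ch Sx nn).
have mono2 m n n' x : S x -> (n <= n')%N -> h n x * (1 - rho m x) <= h n' x * (1 - rho m x).
  move=> Sx nn; have /andP[_ r1] := rho01 m x; apply: ler_wpM2r; first by rewrite subr_ge0.
  exact: (covers_le ch Sx nn).
have key m n : L (fun x => h n x * rho m x) <= c - content (X `&` ~` E) + e.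
  (* Otherwise the content of [X] minus [E], diminished by [e], would be one of the costs of that
     set, below their infimum. *)
  have [n0 hn0] : exists n0, content (X `&` ~` E) - e <= L (fun x => h n0 x * (1 - rho m x)).
    apply: contrapT => /forallNP no.
    suff : content (X `&` ~` E) <= content (X `&` ~` E) - e by move: (content _) => q; lra.
    apply: content_le_cost; exists (fun n x => h n x * (1 - rho m x)).
      split => // [n' x Sx|n' x Sx|x [Xx nEx] Sx].
      - by have /andP[_ r1] := rho01 m x; rewrite mulr_ge0 ?h_ge0 // subr_ge0.
      - exact: mono2 Sx (leqnSn n').
      - have [n' hn'] := h_cov x Xx Sx; exists n'.
        have -> : rho m x = 0; last by rewrite subr0 mulr1.
        rewrite /rho (max_idPl _) ?mulr0 ?(min_idPr ler01) //.
        by rewrite leNgt; apply/negP => fx; exact: nEx.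
    by move=> n'; have /negP := no n'; rewrite -ltNge => /ltW.
  pose N := maxn n n0.
  have s1 : L (fun x => h n x * rho m x) <= L (fun x => h N x * rho m x).
    by apply: (posfun_le hL) => // x Sx; exact: mono1 Sx (leq_maxl n n0).
  have s2 : L (fun x => h n0 x * (1 - rho m x)) <= L (fun x => h N x * (1 - rho m x)).
    by apply: (posfun_le hL) => // x Sx; exact: mono2 Sx (leq_maxr n n0).
  have s3 : L (fun x => h N x * rho m x) + L (fun x => h N x * (1 - rho m x)) = L (h N).
    by rewrite -(posfunD hL) //; f_equal; apply/funext => x; rewrite -mulrDr addrC subrK mulr1.
  have s4 := hc N; lra.
suff : content (X `&` E) <= c - content (X `&` ~` E) + e by lra.
apply: content_le_cost; exists (fun n x => h n x * rho n x) => //.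
split => // [n x Sx|n x Sx|x [Xx Ex] Sx].
- by have /andP[r0 _] := rho01 n x; rewrite mulr_ge0 ?h_ge0.
- have /andP[r0 _] := rho01 n x; apply: ler_pM => //; [exact: h_ge0|exact: h_mono].
- have [n hn] := h_cov x Xx Sx; have fx : 0 < f x by [].
  exists (maxn n (Num.truncn (f x)^-1).+1); set N := maxn _ _.
  have -> : rho N x = 1; last by rewrite mulr1; apply: le_trans hn (covers_le ch Sx (leq_maxl _ _)).
  rewrite /rho (max_idPr (ltW fx)) (min_idPl _) //.
  rewrite -ler_pdivrMr // mul1r; apply: le_trans (ltW (truncnS_gt _)) _.
  by rewrite ler_nat leq_maxr.
Qed.

(** The half-spaces where a coordinate exceeds a constant are Caratheodory measurable and generate
    the sigma-algebra of [V3]; this is phrased as measurability of the identity map. *)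
Lemma borel_caratheodory (A : set V3) : measurable A -> outer.-cara.-measurable A.
Proof.
have mid : measurable_fun setT (idfun : caratheodory_type outer -> V3).
  apply: measurable_to_V3 => i; apply: (measurability _ (RGenOInfty.measurableE R)) => // _ [_ [a ->] <-].
  rewrite setTI; have cf : continuous (fun x : V3 => coord i x - a).
    by move=> x; apply: cvgB; [exact: coord_cont|exact: cvg_cst].
  have := halfspace_caratheodory cf; congr (outer.-caratheodory _).
  by apply/seteqP; split => x /=; rewrite in_itv /= andbT subr_gt0.
by move=> mA; rewrite -[A](setTI A); exact: mid.
Qed.

Definition riesz_measure (A : set V3) : \bar R := outer A.

Let riesz0 : riesz_measure set0 = 0%E. Proof. exact: outer0. Qed.
Let riesz_ge0 A : (0 <= riesz_measure A)%E. Proof. exact: outer_ge0. Qed.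
Let riesz_sigma : semi_sigma_additive riesz_measure.
Proof.
move=> F mF tF mUF.
exact: (@caratheodory_measure_sigma_additive R V3 outer F (fun n => borel_caratheodory (mF n)) tF (borel_caratheodory mUF)).
Qed.
HB.instance Definition _ := isMeasure.Build _ _ _ riesz_measure riesz0 riesz_ge0 riesz_sigma.
Lemma riesz_fin : fin_num_fun riesz_measure. Proof. by []. Qed.
HB.instance Definition _ := Measure_isFinite.Build _ _ _ riesz_measure riesz_fin.

(** Dini's theorem for an increasing sequence that passes above [g] pointwise without having to
    converge to it. *)
Lemma dini h g e : (forall n, wcont S (h n)) -> (forall n x, S x -> h n x <= h n.+1 x) -> wcont S g ->
  (forall x, S x -> exists n, g x <= h n x) -> 0 < e -> exists n, forall x, S x -> g x <= h n x + e.
Proof.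
move=> ch mono cg hg e0.
have mono' n m x : S x -> (n <= m)%N -> h n x <= h m x.
  move=> Sx /subnK <-; elim: (m - n)%N => [|k IH]; first by rewrite add0n.
  by rewrite addSn; exact: le_trans IH (mono _ _ Sx).
have := cS; move=> /compact_near_coveringP cov.
have : \forall n \near \oo, forall x, S x -> S x -> g x <= h n x + e.
  apply: cov => x Sx; have [n0 hn0] := hg x Sx; have e2 : 0 < e / 2 by rewrite divr_gt0.
  have /cvgrPdist_lt/(_ _ e2) := cg x Sx; rewrite near_withinE => n1.
  have /cvgrPdist_lt/(_ _ e2) := ch n0 x Sx; rewrite near_withinE => n2.
  exists (([set y | S y -> `|g x - g y| < e / 2] `&` [set y | S y -> `|h n0 x - h n0 y| < e / 2]), [set n | (n0 <= n)%N]).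
    by split; [exact: filterI n1 n2|exists n0].
  move=> [y n] /= [[y1 y2] nn] Sy; have := y1 Sy; have := y2 Sy; have := mono' _ _ _ Sy nn.
  rewrite !ltr_norml; move: hn0; move: (g x) (g y) (h n0 x) (h n0 y) (h n y) => a b c d q.
  by move=> ? ? /andP[? ?] /andP[? ?]; lra.
by case=> n _ /(_ n (leqnn n)) hn; exists n => x Sx; exact: hn.
Qed.

(** A cover dominates [g] pointwise, each point at its own stage; compactness, through [dini], makes
    a single stage suffice up to a uniform error, and positivity then compares the values of [L]. *)
Lemma content_ge E g : wcont S g -> (forall x, S x -> g x <= 1) -> (forall x, S x -> ~ E x -> g x <= 0) ->
  L g <= content E.
Proof.
move=> cg g1 gE; apply: lb_le_inf; first by exists (L (fun _ => 1)); exact: costs_nonempty.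
move=> c [h [hcont h0 hm hcov] hc]; have L1 := posfun1_ge0 hL.
apply/ler_addgt0Pl => e e0; have e1 : 0 < e / (L (fun _ => 1) + 1) by rewrite divr_gt0 // ltr_wpDl.
have [|n hn] := dini hcont hm cg _ e1.
  move=> x Sx; have [Ex|nEx] := pselect (E x).
    by have [n hn] := hcov x Ex Sx; exists n; exact: le_trans (g1 x Sx) hn.
  by exists 0%N; exact: le_trans (gE x Sx nEx) (h0 _ _ Sx).
have cc : wcont S (fun _ : V3 => e / (L (fun _ => 1) + 1)) by exact: wcont_cst.
have : L g <= L (fun x => h n x + e / (L (fun _ => 1) + 1)) by apply: (posfun_le hL) => //; exact: wcontD.
rewrite (posfunD hL) // (posfun_cst hL) => /le_trans; apply; rewrite addrC; apply: lerD => //.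
by rewrite mulrAC ler_pdivrMr ?ltr_wpDl // ler_pM2l // lerDl.
Qed.

Lemma content_le E g : wcont S g -> (forall x, S x -> 0 <= g x) -> (forall x, S x -> E x -> 1 <= g x) ->
  content E <= L g.
Proof.
move=> cg g0 gE; apply: content_le_cost; exists (fun=> g) => //; split => // x Ex Sx; exists 0%N; exact: gE.
Qed.

Local Notation m := riesz_measure.
(** The slice of [y] between the heights [k] and [k + 1], for a layer-cake decomposition. *)
Definition clamp (k : nat) (y : R) : R := Num.min (Num.max (y - k%:R) 0) 1.

Lemma clampE k y : ((k%:R + 1 <= y -> clamp k y = 1) * (y <= k%:R -> clamp k y = 0)) *
  (k%:R <= y <= k%:R + 1 -> clamp k y = y - k%:R).
Proof.
rewrite /clamp; split; first split.
- by move=> h; rewrite (max_idPl _) ?(min_idPr _) //; lra.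
- by move=> h; rewrite (max_idPr _) ?(min_idPl _) //; lra.
- by move=> /andP[? ?]; rewrite (max_idPl _) ?(min_idPl _) //; lra.
Qed.

Lemma sum_clamp n y : 0 <= y -> \sum_(k < n) clamp k y = Num.min y n%:R.
Proof.
move=> y0; elim: n => [|n IH]; first by rewrite big_ord0 (min_idPr y0).
rewrite big_ord_recr /= IH -natr1; have [[c1 c2] c3] := clampE n y.
have [h|h] := lerP y n%:R; first by rewrite c2 // addr0; apply/esym/min_idPl; lra.
have [h'|h'] := lerP y (n%:R + 1); first by rewrite c3 ?(ltW h) // subrKC.
by rewrite c1 // ltW.
Qed.

Lemma riesz_out : m (~` S) = 0%E.
Proof. by rewrite /m /outer content_out // setICl. Qed.

(** On each slice both [L] and the integral lie between the contents of the level sets at heights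
    [k + 1] and [k]. The gaps telescope, so the total error is at most the mass, whatever the height
    of [g]. *)
Lemma riesz_layer g n : wcont S g -> (forall x, S x -> 0 <= g x <= n%:R) ->
  `|L g - \int[m]_(x in S) g x| <= L (fun _ => 1).
Proof.
move=> cg g0; pose A k := S `&` [set x | k%:R <= g x].
have mA k : measurable (A k).
  have -> : A k = S `&` g @^-1` `[k%:R, +oo[%classic.
    by apply/seteqP; split => x [Sx /=] h; split => //=; rewrite in_itv /= andbT in h *.
  by apply: (wcont_measurable mS cg) => //; exact: measurable_itv.
pose b k := content (A k).
have cc k : wcont S (fun x => clamp k (g x)).
  have -> : (fun x => clamp k (g x)) = fun x => - Num.max (- Num.max (g x - k%:R) 0) (- 1).
    by apply/funext => x; rewrite /clamp oppr_max !opprK.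
  apply: wcontN; apply: wcont_max; last exact: wcont_cst.
  by apply: wcontN; apply: wcont_max; [apply: wcontB => //|]; exact: wcont_cst.
have clE k x : [/\ 0 <= clamp k (g x) <= 1, k.+1%:R <= g x -> clamp k (g x) = 1 & g x < k%:R -> clamp k (g x) = 0].
  have [[c1 c2] c3] := clampE k (g x); rewrite -natr1; split=> [|//|/ltW //].
  have [/c2 ->|h] := lerP (g x) k%:R; first by rewrite lexx ler01.
  have [h'|/ltW/c1 ->] := lerP (g x) (k%:R + 1); last by rewrite lexx ler01.
  by rewrite c3 ?(ltW h) //; lra.
have hL1 k : b k.+1 <= L (fun x => clamp k (g x)) <= b k.
  apply/andP; split.
    apply: content_le => // x Sx; first by have [/andP[]] := clE k x.
    by move=> [_ hx]; have [_ -> //] := clE k x.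
  apply: content_ge => // x Sx; first by have [/andP[]] := clE k x.
  move=> nA; have [_ _ -> //] := clE k x; rewrite ltNge; apply/negP => h; exact: nA.
have hI k : b k.+1 <= \int[m]_(x in S) clamp k (g x) <= b k.
  have bE j : b j = \int[m]_(x in S) \1_(A j) x.
    by rewrite /Rintegral integral_indic //= /m /outer /= setIC setIA setIid.
  have ib j : m.-integrable S (EFin \o (\1_(A j) : V3 -> R)).
    have := paired_integrable (mu := m) mS (@wcont_integrable_finite R S m cS mS _ (@wcont_cst V3 R S 1)) (@bmeas_indic _ _ R _ (mA j)).
    by apply: eq_integrable => // x _; rewrite /= mulr1.
  rewrite !bE; apply/andP; split; apply: le_Rintegral => //; try exact: (wcont_integrable_finite _ cS mS).
    move=> x Sx; rewrite indicE; case: (boolP (_ \in _)) => hx.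
      by rewrite inE in hx; have [_ -> //] := clE k x; case: hx.
    by have [/andP[]] := clE k x.
  move=> x Sx; rewrite indicE; case: (boolP (_ \in _)) => hx; first by have [/andP[]] := clE k x.
  have [_ _ -> //] := clE k x; rewrite ltNge; apply/negP => h; move/negP: hx; apply; rewrite inE.
  by split.
have gE x : S x -> g x = \sum_(k < n) clamp k (g x).
  by move=> Sx; have /andP[a0 a1] := g0 x Sx; rewrite sum_clamp // (min_idPl a1).
have cs : wcont S (fun x => \sum_(k < n) clamp k (g x)) by apply: wcont_sum.
have LE : L g = \sum_(k < n) L (fun x => clamp k (g x)).
  by rewrite (posfun_eq hL cg gE) (posfun_sum hL) // => k.
have IE : \int[m]_(x in S) g x = \sum_(k < n) \int[m]_(x in S) clamp k (g x).
  by rewrite (posfun_eq (posfun_integral m cS mS) cg gE) (posfun_sum (posfun_integral m cS mS)) // => k.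
rewrite LE IE -sumrB; apply: le_trans (ler_norm_sum _ _ _) _.
apply: (@le_trans _ _ (\sum_(k < n) (b k - b k.+1))).
  apply: ler_sum => k _; have /andP[l1 l2] := hL1 k; have /andP[i1 i2] := hI k.
  by rewrite ler_norml; move: (L _) (Rintegral _ _ _) l1 l2 i1 i2 => y z *; apply/andP; split; lra.
have -> : \sum_(k < n) (b k - b k.+1) = b 0%N - b n.
  elim: (n) => [|k IH]; first by rewrite big_ord0 subrr.
  by rewrite big_ord_recr /= IH; ring.
apply: (@le_trans _ _ (b 0%N)); first by rewrite gerBl content_ge0.
exact/content_le_cost/costs_nonempty.
Qed.

(** The error in [riesz_layer] does not grow with the function: applied to [N] times a nonnegative
    function and divided by [N], it tends to 0. Adding a constant then settles functions of any
    sign. *)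
Lemma riesz_measureE g : wcont S g -> L g = \int[m]_(x in S) g x.
Proof.
have pos (f : V3 -> R) : wcont S f -> (forall x, S x -> 0 <= f x) -> L f = \int[m]_(x in S) f x.
  move=> cf f0; apply/eqP; rewrite -subr_eq0; apply/eqP.
  apply: (@norm_eq0_eps R _ _ (posfun1_ge0 hL)) => e e0.
  pose N := (Num.truncn e^-1).+1; have N0 : 0 < N%:R :> R by rewrite ltr0n.
  have hN : e^-1 < N%:R by exact: truncnS_gt.
  have [M [M0 hM]] := wcont_bounded cS cf.
  pose n := (Num.truncn (N%:R * M)).+1.
  have cN : wcont S (fun x => N%:R * f x) by exact: wcontZ.
  have : `|L (fun x => N%:R * f x) - \int[m]_(x in S) (N%:R * f x)| <= L (fun _ => 1).
    apply: (@riesz_layer _ n) => // x Sx; rewrite mulr_ge0 ?f0 ?(ltW N0) //=.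
    apply: le_trans (ltW (truncnS_gt _)); rewrite ler_pM2l //.
    by apply: le_trans (hM x Sx); exact: ler_norm.
  rewrite (posfunZ hL) // (posfunZ (posfun_integral m cS mS)) // -mulrBr normrM (gtr0_norm N0) => h.
  rewrite -(ler_pM2l N0); apply: le_trans h _; rewrite mulrCA -[leLHS]mulr1; apply: ler_wpM2l; first exact: posfun1_ge0 hL.
  by rewrite -ler_pdivrMr // mul1r ltW.
move=> cg; have [M [M0 hM]] := wcont_bounded cS cg.
have cM : wcont S (fun _ : V3 => M) by exact: wcont_cst.
have e1 : L (fun x => g x + M) = \int[m]_(x in S) (g x + M).
  apply: pos; first exact: wcontD.
  by move=> x Sx; have := hM x Sx; rewrite ler_norml => /andP[]; lra.
have e2 : L (fun _ => M) = \int[m]_(x in S) M by apply: pos => // x _; exact: ltW.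
by move: e1; rewrite (posfunD hL) // (posfunD (posfun_integral m cS mS)) // e2 => /addIr.
Qed.

Theorem riesz_representation : exists m : {finite_measure set V3 -> \bar R},
  m (~` S) = 0%E /\ forall g, wcont S g -> L g = \int[m]_(x in S) g x.
Proof. by exists m; split; [exact: riesz_out|exact: riesz_measureE]. Qed.
End RieszRepresentation.

(** * Integration against charges on the sphere *)

Section ChargesOnSphere.
Variable R : realType.
Notation V3 := (V3 R).
Local Notation S := (@sphere3 R).
Local Notation mS := (@measurable_sphere3 R).
Local Notation cS := (@sphere3_compact R).
Implicit Types (nu : {charge set V3 -> \bar R}) (m : {finite_measure set V3 -> \bar R}).

(** The Hahn decomposition inside [charge_integral] is an arbitrary choice; what is retained is a
    pair of finite measures whose difference is the charge. *)
Lemma charge_integral_jordan nu : exists m1 m2 : {finite_measure set V3 -> \bar R}, [/\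
  forall A, measurable A -> nu A = (m1 A - m2 A)%E,
  charge_on_sphere nu -> m1 (~` S) = 0%E /\ m2 (~` S) = 0%E &
  forall g, charge_integral nu g = \int[m1]_x g x - \int[m2]_x g x].
Proof.
rewrite /charge_integral; set PN := cid _; set NN := cid _; move: NN => [N hPN] /=.
have [[mP _] [mN _] _ _] := hPN.
exists (jordan_pos hPN), (jordan_neg hPN); split=> //.
  by move=> A mA; rewrite [LHS](jordan_decomp hPN mA) /cadd /= cscaleN1.
move=> h; split.
  apply: etrans (cjordan_posE hPN _) _; rewrite /crestr0 mem_set; last exact: measurableC mS.
  by rewrite /crestr setIC -setDE h.
apply: etrans (cjordan_negE hPN _) _; rewrite /crestr0 mem_set; last exact: measurableC mS.
by rewrite /crestr setIC -setDE h // oppe0.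
Qed.

Lemma blinear_integral m : blinear (fun g => \int[m]_x g x).
Proof.
have i1 : m.-integrable setT (EFin \o (fun=> 1)) by exact: finite_measure_integrable_cst.
have := blinear_paired measurableT i1; congr blinear; apply/funext => g.
by rewrite /paired; apply: eq_Rintegral => x _; rewrite mulr1.
Qed.

Lemma blinear_scale c (L : (V3 -> R) -> R) : blinear L -> blinear (fun g => c * L g).
Proof.
move=> [l1 [C [c0 h]]]; split=> [a b f g bf bg|]; first by rewrite l1 //; ring.
exists (`|c| * C); split=> [|M g bg hg]; first exact: mulr_ge0.
by rewrite normrM -mulrA ler_wpM2l // h.
Qed.

Lemma integral_cutS m g : m (~` S) = 0%E -> \int[m]_x cutS g x = \int[m]_(x in S) g x.
Proof.
move=> m0; rewrite /Rintegral (integral_concentrated mS m0); congr fine.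
by apply: eq_integral => x xS; rewrite /cutS indicE xS mul1r.
Qed.

Lemma charge_integral_sphere nu : charge_on_sphere nu -> exists m1 m2 : {finite_measure set V3 -> \bar R}, [/\
  m1 (~` S) = 0%E, m2 (~` S) = 0%E, forall A, measurable A -> nu A = (m1 A - m2 A)%E &
  forall (a : R) (g h : V3 -> R), wcont S h -> (forall x, S x -> g x = a * h x) ->
  charge_integral nu g = a * (\int[m1]_(x in S) h x - \int[m2]_(x in S) h x)].
Proof.
move=> hnu; have [m1 [m2 [h1 h2 h3]]] := charge_integral_jordan nu; have [n1 n2] := h2 hnu.
exists m1, m2; split=> // a g h ch gh; rewrite h3.
have I m : m (~` S) = 0%E -> \int[m]_x g x = a * \int[m]_(x in S) h x.
  move=> m0; have ih : m.-integrable S (EFin \o h) := @wcont_integrable_finite R S m cS mS h ch.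
  rewrite -(RintegralZl a mS ih) /Rintegral (integral_concentrated mS m0); congr fine.
  by apply: eq_integral => x; rewrite inE => xS; rewrite gh.
by rewrite !I // mulrBr.
Qed.

(** The Jordan parts chosen for [nu] need not be multiples of [m1] and [m2], but both differences
    are bounded linear forms with the same values on indicators, hence on all bounded measurable
    functions. *)
Lemma charge_integral_difference nu c (m1 m2 : {finite_measure set V3 -> \bar R}) :
  m1 (~` S) = 0%E -> m2 (~` S) = 0%E ->
  (forall A, measurable A -> nu A = (c%:E * m1 A - c%:E * m2 A)%E) -> charge_on_sphere nu /\
  forall (a : R) (g h : V3 -> R), wcont S h -> (forall x, S x -> g x = a * h x) ->
  charge_integral nu g = a * (c * (\int[m1]_(x in S) h x - \int[m2]_(x in S) h x)).
Proof.
move=> z1 z2 hnu.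
have sph : charge_on_sphere nu.
  have z m A : m (~` S) = 0%E -> measurable A -> m (A `\` S) = 0%E.
    move=> m0 mA; apply/eqP; rewrite -measure_le0 -m0.
    by apply: le_measure; rewrite ?inE; [apply: measurableD => //; exact: mS|exact: measurableC mS|move=> x []].
  by move=> A mA; rewrite hnu ?z // ?mule0 ?subee //; apply: measurableD => //; exact: mS.
split=> // a g h ch gh; have [n1 [n2 [w1 w2 hn hi]]] := charge_integral_sphere sph.
rewrite (hi a g h ch gh) -!integral_cutS //; congr (_ * _).
have b1 := blinear_sub (blinear_integral n1) (blinear_integral n2).
have b2 := blinear_scale c (blinear_sub (blinear_integral m1) (blinear_integral m2)).
apply: (blinear_ext b1 b2) => [A mA|]; last exact: cutS_bmeas.
have I m : \int[m]_x (\1_A x : R) = fine (m A) by rewrite /Rintegral integral_indic // setIT.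
have fm m := fin_num_measure m A mA.
have := hn A mA; rewrite hnu // !I -(fineK (fm m1)) -(fineK (fm m2)) -(fineK (fm n1)) -(fineK (fm n2)) /=.
by rewrite -!EFinM -!EFinB => -[<-]; rewrite mulrBr.
Qed.
End ChargesOnSphere.

(** * Boundary measures of Hardy fields for p = 1 *)

Section HardyOne.
Variable R : realType.
Notation V3 := (V3 R).
Local Notation B := (@ball3 R).
Local Notation S := (@sphere3 R).
Local Notation CB := [set x : V3 | enorm x <= 1].
Local Notation sigma := (sigma3 R).
Local Notation mS := (@measurable_sphere3 R).
Local Notation cS := (@sphere3_compact R).
Variables (lam mu : R).
Hypotheses (hmu : 0 < mu) (hlm : 0 < 2 * mu + lam).
Local Opaque JC pd.

Lemma wcont_norm (A : set V3) (f : V3 -> R) : wcont A f -> wcont A (fun x => `|f x|).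
Proof. by move=> cf; apply: (@wcont_comp _ _ _ A setT f (fun y => `|y|)) => //; apply: cont_wcont; exact: norm_continuous. Qed.

Section Limit.
Variables (t : nat -> V3 -> R) (C : R).
Hypotheses (ct : forall n, wcont S (t n)) (tC : forall n, sint (fun e => `|t n e|) <= C).

Lemma sint_weighted_abs n g M : wcont S g -> (forall e, S e -> `|g e| <= M) ->
  `|sint (fun e => t n e * g e)| <= M * C.
Proof.
move=> cg hM; have M0 : 0 <= M.
  have e1 : S (ebasis R (inord 0)) by exact: enorm_ebasis.
  exact: le_trans (normr_ge0 _) (hM _ e1).
have ca : wcont S (fun e => `|t n e|) by exact: wcont_norm.
apply: (@le_trans _ _ (sint (fun e => M * `|t n e|))).
  apply: (posfun_abs_le (@posfun_sint R)); [exact: wcontM|exact: wcontZ|].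
  by move=> e Se; rewrite normrM mulrC ler_wpM2r // hM.
by rewrite (posfunZ (@posfun_sint R)) // ler_wpM2l.
Qed.

Lemma bounded_sint g : wcont S g -> bounded_seq (fun n => sint (fun e => t n e * g e)).
Proof.
move=> cg; have [M [_ hM]] := wcont_bounded cS cg.
by exists (M * C) => n; exact: sint_weighted_abs.
Qed.

(** A bound in L^1 gives no uniform integrability: mass may concentrate on null sets, so the limit
    is studied on continuous functions. *)
Definition weak_functional g : R := ulim (fun n => sint (fun e => t n e * g e)).

Lemma posfun_weak_functional : (forall n e, S e -> 0 <= t n e) -> posfun S weak_functional.
Proof.
move=> t0; split=> [a b f g cf cg|f cf f0].
  rewrite -ulim_lin; [|exact: bounded_sint|exact: bounded_sint].
  rewrite /weak_functional; f_equal; apply/funext => n.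
  rewrite -((@posfun_sint R).1 a b); [|exact: wcontM|exact: wcontM].
  by f_equal; apply/funext => e; ring.
rewrite -(ulim_cst (0 : R)); apply: ulim_le; [by exists 0 => n; rewrite normr0|exact: bounded_sint|].
by move=> n; apply: (@posfun_sint R).2 => [|e Se]; [exact: wcontM|rewrite mulr_ge0 ?t0 ?f0].
Qed.
End Limit.

Theorem hardy_meas u : hardy_e lam mu 1%E u -> exists nu : 'I_3 -> {charge set V3 -> \bar R},
  (forall j, charge_on_sphere (nu j)) /\ (forall x, B x -> u x = Pe_meas lam mu nu x).
Proof.
move=> [hu [C hC]]; have a0 := area_gt0 R.
have r01 n : 0 <= rn R n < 1 by case/andP: (rn01 R n) => /ltW -> ->.
have ct n j : wcont S (trace u (rn R n) j).
  have SCB : S `<=` CB by move=> y /= ->.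
  exact: wcont_sub SCB (wcont_trace hu (r01 n)).
have hK n j : sint (fun e => `|trace u (rn R n) j e|) <= powR C 1.
  have h := Lnorm_sphere_le ltr01 (hC _ (r01 n)).
  have ce := wcont_enorm (fun i => ct n i).
  rewrite -lee_fin; apply: le_trans h; rewrite -(fineK (x := \int[sigma]_(x in S) _)); last first.
    have := integrable_fin_num mS (wcont_integrableS ce); congr (_ \is a fin_num); apply: eq_integral => x _.
    by rewrite /= powRr1 // enorm_ge0.
  rewrite lee_fin; apply: le_Rintegral; first exact: mS.
  - by apply: wcont_integrableS; exact: wcont_norm.
  - apply: wcont_integrableS; have -> // : (fun e => powR (enorm (u (rn R n *: e))) 1) = fun e => enorm (u (rn R n *: e)).
    by apply/funext => x; rewrite powRr1 // enorm_ge0.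
  - by move=> x _; rewrite powRr1 ?enorm_ge0 //; exact: coord_le_enorm.
(* [s = 1] and [s = - 1] select the positive and the negative part of a trace, so that both limits
   are positive forms. *)
pose t (s : R) j n e := Num.max 0 (s * trace u (rn R n) j e).
have tt s j n e : t s j n e = Num.max 0 (s * trace u (rn R n) j e) by [].
have ctt s j n : wcont S (t s j n) by apply: wcont_max; [exact: wcont_cst|exact: wcontZ].
have t0 s j n e : 0 <= t s j n e by rewrite le_max lexx.
have tC s j n : `|s| = 1 -> sint (fun e => `|t s j n e|) <= powR C 1.
  move=> s1; apply: le_trans (hK n j); apply: (posfun_le (@posfun_sint R)); [exact: wcont_norm|exact: wcont_norm|].
  move=> e _; rewrite ger0_norm // tt ge_max normr_ge0 /=; apply: le_trans (ler_norm _) _.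
  by rewrite normrM s1 mul1r.
have n1 : `|1 : R| = 1 by exact: normr1.
have n2 : `|- 1 : R| = 1 by rewrite normrN normr1.
have P j := riesz_representation cS mS (posfun_weak_functional (ctt 1 j) (fun n => tC 1 j n n1) (fun n e _ => t0 1 j n e)).
have N j := riesz_representation cS mS (posfun_weak_functional (ctt (-1) j) (fun n => tC (-1) j n n2) (fun n e _ => t0 (-1) j n e)).
have [mp hp] := choice P; have [mn hn] := choice N.
pose c := 4 * pi / area R.
pose nu j : {charge set V3 -> \bar R} :=
  cadd (cscale c (charge_of_finite_measure (mp j))) (cscale (- c) (charge_of_finite_measure (mn j))).
have hnu j A : measurable A -> nu j A = (c%:E * mp j A - c%:E * mn j A)%E.
  by move=> mA; rewrite /= /cadd /= /cscale /= EFinN mulNe.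
have H j := charge_integral_difference (hp j).1 (hn j).1 (hnu j).
exists nu; split=> [j|x Bx]; first by have [] := H j.
apply: coord_inj => i; rewrite /Pe_meas vec3K.
have cK j := wcont_Kn hmu hlm (i := i) (j := j) Bx.
have E j : charge_integral (nu j) (Pe_kernel lam mu i j x) = (area R)^-1 * (weak_functional (t 1 j) (Kn lam mu i j x)
    - weak_functional (t (-1) j) (Kn lam mu i j x)).
  have [_ hj] := H j.
  rewrite (hj (4 * pi)^-1 _ _ (cK j) (fun e Se => Pe_kernelE hmu hlm i j Se Bx)).
  rewrite -(hp j).2 // -(hn j).2 //; have pi0 : pi != 0 :> R by rewrite gt_eqF // pi_gt0.
  have a1 : area R != 0 by rewrite gt_eqF.
  by rewrite /c; move: (_ - _) (pi) pi0 (area R) a1 => z q q0 w w0; field; rewrite q0 w0.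
rewrite (eq_bigr _ (fun j _ => E j)) -mulr_sumr.
rewrite -(weak_limit_representation hmu hlm (L := fun j g => weak_functional (t 1 j) g - weak_functional (t (-1) j) g) hu Bx).
- by rewrite mulKf // gt_eqF.
- by move=> j; exact: (bounded_sint (fun n => ct n j) (fun n => hK n j)).
move=> j; have b1 := bounded_sint (ctt 1 j) (fun n => tC 1 j n n1) (cK j).
have b2 := bounded_sint (ctt (-1) j) (fun n => tC (-1) j n n2) (cK j).
have := ulim_lin 1 (-1) b1 b2; rewrite mul1r mulN1r => <-; f_equal; apply/funext => n.
rewrite mul1r mulN1r -(posfunB (@posfun_sint R)); [|exact: wcontM|exact: wcontM].
f_equal; apply/funext => e; rewrite -mulrBl !tt; congr (_ * _); move: (trace _ _ _ _) => y.
by rewrite mul1r mulN1r; have [h|h] := lerP 0 y; [rewrite (max_idPl (_ : - y <= 0)) ?oppr_le0 // subr0|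
  rewrite (max_idPr (_ : 0 <= - y)) ?oppr_ge0 ?ltW // sub0r opprK].
Qed.
End HardyOne.

(** * The converse implications *)
Section WeightedFunctionals.
Variable R : realType.
Notation V3 := (V3 R).
Local Notation B := (@ball3 R).
Local Notation S := (@sphere3 R).
Local Notation sigma := (sigma3 R).
Local Notation mS := (@measurable_sphere3 R).
Local Notation cS := (@sphere3_compact R).
Local Notation oB := (@B_open R).
Local Opaque JC pd.

Section Weight.
Variables (m : {finite_measure set V3 -> \bar R}) (h : V3 -> R).
Hypothesis (ih : m.-integrable S (EFin \o h)).

Lemma weighted_integrable (g : V3 -> R) : wcont S g -> m.-integrable S (EFin \o (fun e => g e * h e)).
Proof.
move=> cg; have [M [M0 hM]] := wcont_bounded cS cg.
apply: (integrableMr mS (h := g) (g := EFin \o h)) => //; first by apply: wcont_measurable cg; exact: mS.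
exists M; split; [exact: num_real|] => z Mz x Sx; exact: le_trans (hM x Sx) (ltW Mz).
Qed.

Lemma posfun_density : (forall e, S e -> 0 <= h e) -> posfun S (fun g => \int[m]_(e in S) (g e * h e)).
Proof.
move=> h0; split=> [a b f g cf cg|f cf f0].
  have ca : wcont S (fun e => a * f e) by exact: wcontZ.
  have cb : wcont S (fun e => b * g e) by exact: wcontZ.
  have i1 := weighted_integrable cf; have i2 := weighted_integrable cg.
  rewrite -(RintegralZl a mS i1) -(RintegralZl b mS i2) -RintegralD.
  - by apply: eq_Rintegral => e _; ring.
  - exact: mS.
  - by have := weighted_integrable ca; apply: eq_integrable; [exact: mS|] => e _; rewrite /= mulrA.
  - by have := weighted_integrable cb; apply: eq_integrable; [exact: mS|] => e _; rewrite /= mulrA.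
by apply: Rintegral_ge0 => e Se; rewrite mulr_ge0 ?f0 ?h0.
Qed.

Lemma scaled_ball r e : 0 <= r < 1 -> S e -> B (r *: e).
Proof. by move=> /andP[r0 r1] Se; rewrite /ball3 /= enormZ ger0_norm // (_ : enorm e = 1) ?mulr1. Qed.

Lemma sint_mass r : m (~` S) = 0%E -> 0 <= r < 1 -> (forall e, S e -> 0 <= h e) ->
  sint (fun w => \int[m]_(e in S) (Pn (r *: w) e * h e)) = area R * \int[m]_(e in S) h e.
Proof.
move=> m0 r01 h0.
(* The cut-off and the absolute value make the integrand nonnegative and measurable on the whole
   product, as Tonelli's theorem asks, without changing it on the sphere times the sphere. *)
pose K (z : V3 * V3) : R := `|Pn (r *: z.1) z.2 * cutS h z.2|.
have mc i (b : bool) : measurable_fun setT (fun z : V3 * V3 => coord i (if b then z.1 else z.2)).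
  by case: b; [exact: (measurableT_comp (measurable_coord i) measurable_fst)|
    exact: (measurableT_comp (measurable_coord i) measurable_snd)].
have mK : measurable_fun setT (EFin \o K).
  apply/measurable_EFinP; apply: measurableT_comp => //; apply: measurable_funM.
    have -> : (fun z : V3 * V3 => Pn (r *: z.1) z.2) = fun z => (1 - \sum_(i < 3) (r * coord i z.1) * (r * coord i z.1)) *
        powR (\sum_(i < 3) (r * coord i z.1 - coord i z.2) * (r * coord i z.1 - coord i z.2)) (- (3 / 2)).
      apply/funext => z; rewrite /Pn /weight /Aq /sqd /dot; congr ((1 - _) * powR _ _).
        by apply: eq_bigr => i _; rewrite coordZ.
      by apply: eq_bigr => i _; rewrite coordB coordZ.
    have mr i : measurable_fun setT (fun z : V3 * V3 => r * coord i z.1) by apply: measurable_funM => //; exact: (mc i true).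
    have md i : measurable_fun setT (fun z : V3 * V3 => r * coord i z.1 - coord i z.2).
      by apply: measurable_funB => //; exact: (mc i false).
    apply: measurable_funM.
      by apply: measurable_funB => //; apply: measurable_sum => i; exact: measurable_funM.
    apply: (measurableT_comp (f := @powR R ^~ (- (3 / 2))) (@measurable_powR R _)).
    by apply: measurable_sum => i; exact: measurable_funM.
  apply: (measurableT_comp (f := cutS h)) => //.
  have -> : cutS h = h \_ S.
    by apply/funext => x; rewrite /cutS patchE indicE; case: (x \in S); rewrite ?mul1r ?mul0r.
  apply/(measurable_restrictT _ mS); apply/measurable_EFinP.
  by have /integrableP[] := ih.
have Kp w e : S w -> S e -> K (w, e) = Pn (r *: w) e * h e.
  move=> Sw Se; rewrite /K /cutS indicE mem_set //= mul1r ger0_norm //.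
  by apply: mulr_ge0; [apply: Pn_ge0; exact: scaled_ball|exact: h0].
have F := fubini_tonelli (m1 := @surf R) (m2 := m) _ mK (fun z => normr_ge0 (Pn (r *: z.1) z.2 * cutS h z.2) : (0 <= (K z)%:E)%E).
have LI w : S w -> (\int[m]_e (K (w, e))%:E = (\int[m]_(e in S) (Pn (r *: w) e * h e))%:E)%E.
  move=> Sw; rewrite (integral_concentrated mS m0) /Rintegral fineK.
    by apply: eq_integral => e; rewrite inE => Se; rewrite Kp.
  by apply: (integrable_fin_num mS); apply: weighted_integrable; apply: wcont_Pn; exact: scaled_ball.
have RI e : S e -> (\int[@surf R]_w (K (w, e))%:E = (area R * h e)%:E)%E.
  move=> Se; have Bre : B (r *: e) by exact: scaled_ball.
  rewrite -(mass_const Bre) mulrC -(posfunZ (@posfun_sint R)); last exact: wcont_Pn.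
  rewrite (integral_concentrated (mu := @surf R) mS (@sigma3_out R)) /sint /Rintegral fineK.
    by apply: eq_integral => w; rewrite inE => Sw; rewrite Kp // (Pn_sym r Sw Se) mulrC.
  apply: (integrable_fin_num mS); apply: wcont_integrableS; apply: wcontZ; exact: wcont_Pn.
rewrite -(RintegralZl (area R) mS ih) /sint /Rintegral; congr fine.
have -> : (\int[sigma]_(w in S) (\int[m]_(e in S) (Pn (r *: w) e * h e))%:E = \int[@surf R]_w \int[m]_e (K (w, e))%:E)%E.
  rewrite [RHS](integral_concentrated (mu := @surf R) mS (@sigma3_out R)).
  by apply: eq_integral => w; rewrite inE => Sw; rewrite LI.
rewrite [LHS]F (integral_concentrated mS m0).
by apply: eq_integral => e; rewrite inE => Se; rewrite RI.
Qed.
End Weight.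
End WeightedFunctionals.

(** * Positive forms applied to the kernel solve the system *)

Section LameFields.
Variable R : realType.
Notation V3 := (V3 R).
Local Notation B := (@ball3 R).
Local Notation S := (@sphere3 R).
Local Notation mS := (@measurable_sphere3 R).
Local Notation cS := (@sphere3_compact R).
Local Notation oB := (@B_open R).
Variables (lam mu : R).
Hypotheses (hmu : 0 < mu) (hlm : 0 < 2 * mu + lam).
Local Opaque JC pd.

Definition lame_field (v : 'I_3 -> V3 -> R) :=
  (forall i, JCf B 2 (v i)) /\ forall i x, B x -> lameop lam mu v i x = 0.

Lemma pd2_lin a b (f g : V3 -> R) k l x : JCf B 2 f -> JCf B 2 g -> B x ->
  pd k (pd l (fun y => a * f y + b * g y)) x = a * pd k (pd l f) x + b * pd k (pd l g) x.
Proof.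
have H k' (f' g' : V3 -> R) y : JCf B 1 f' -> JCf B 1 g' -> B y ->
    pd k' (fun y => a * f' y + b * g' y) y = a * pd k' f' y + b * pd k' g' y.
  move=> hf hg By; apply: etrans (pd_D _ (JC_scale oB _ hf) (JC_scale oB _ hg) By) _.
  exact: (f_equal2 +%R (pd_Z oB a k' hf By) (pd_Z oB b k' hg By)).
move=> hf hg Bx; apply: etrans (pd_on oB k (fun y By => H l f g y (JCf_leS hf) (JCf_leS hg) By) Bx) _.
exact: (H k _ _ x (JCf_pd l hf) (JCf_pd l hg) Bx).
Qed.

Lemma lame_field_lin a b v w : lame_field v -> lame_field w -> lame_field (fun i x => a * v i x + b * w i x).
Proof.
have E0 (p q s t : R) : mu * p + (lam + mu) * s = 0 -> mu * q + (lam + mu) * t = 0 ->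
    mu * (a * p + b * q) + (lam + mu) * (a * s + b * t) = 0.
  move=> h1 h2; have -> : mu * (a * p + b * q) + (lam + mu) * (a * s + b * t) =
    a * (mu * p + (lam + mu) * s) + b * (mu * q + (lam + mu) * t) by ring.
  by rewrite h1 h2 !mulr0 addr0.
move=> [v1 v2] [w1 w2]; split=> [i|i x Bx]; first exact: (JC_add oB (JC_scale oB _ (v1 i)) (JC_scale oB _ (w1 i))).
have e1 : lap (fun x => a * v i x + b * w i x) x = a * lap (v i) x + b * lap (w i) x.
  rewrite /lap !mulr_sumr -big_split; apply: eq_bigr => k _; exact: pd2_lin.
have e2 : \sum_(j < 3) pd i (pd j (fun x => a * v j x + b * w j x)) x =
    a * (\sum_(j < 3) pd i (pd j (v j)) x) + b * (\sum_(j < 3) pd i (pd j (w j)) x).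
  rewrite !mulr_sumr -big_split; apply: eq_bigr => k _; exact: pd2_lin.
apply: etrans (f_equal2 (fun s t => mu * s + (lam + mu) * t) e1 e2) _.
have h1 : mu * lap (v i) x + (lam + mu) * (\sum_(j < 3) pd i (pd j (v j)) x) = 0 := v2 i x Bx.
have h2 : mu * lap (w i) x + (lam + mu) * (\sum_(j < 3) pd i (pd j (w j)) x) = 0 := w2 i x Bx.
exact: (E0 _ _ _ _ h1 h2).
Qed.

Lemma lame_field_posfun (L : (V3 -> R) -> R) j : posfun S L -> lame_field (fun i x => L (Kn lam mu i j x)).
Proof.
move=> hL; have hK n i : JC B S n (Kn lam mu i j) := JC_Kn hmu hlm n i j.
split=> [i|i x Bx]; first exact: (JCf_posfun oB cS hL (hK 2%N i)).
have c1 k l i' : wcont S (fun e => pd k (pd l (Kn lam mu i' j ^~ e)) x).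
  exact: (JC_slicef oB (JC_pd k (JC_pd l (hK 2%N i'))) Bx).
have cl : wcont S (fun e => lap (Kn lam mu i j ^~ e) x) by apply: wcont_sum => k; exact: c1.
have cd : wcont S (fun e => \sum_(l < 3) pd i (pd l (Kn lam mu l j ^~ e)) x) by apply: wcont_sum => k; exact: c1.
have e1 := lap_posfun oB cS hL (hK 2%N i) Bx.
have e2 : \sum_(l < 3) pd i (pd l (fun x => L (Kn lam mu l j x))) x =
    L (fun e => \sum_(l < 3) pd i (pd l (Kn lam mu l j ^~ e)) x).
  have hs := @posfun_sum R V3 S L hL 'I_3 (index_enum 'I_3) (fun l e => pd i (pd l (Kn lam mu l j ^~ e)) x) (fun l => c1 i l l).
  apply: etrans _ (esym hs); apply: eq_bigr => l _; exact: (pd2_posfun oB cS hL i l (hK 2%N l) Bx).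
apply: etrans (f_equal2 (fun s t => mu * s + (lam + mu) * t) e1 e2) _.
apply: etrans (esym (hL.1 mu (lam + mu) _ _ cl cd)) _.
apply: etrans (posfun_eq hL (g := fun=> 0) _ _) (posfun0 hL).
  exact: (wcontD (wcontZ cl) (wcontZ cd)).
by move=> e Se; exact: (Kn_lame hmu hlm i j Se Bx).
Qed.

(** [lame_solution] asks for total differentiability of [u] and of its first derivatives, which
    components of class C^2 provide. *)
Lemma lame_field_solution (u : V3 -> V3) v : lame_field v ->
  (forall x, B x -> forall i, coord i (u x) = v i x) -> lame_solution lam mu u.
Proof.
move=> [v1 v2] uv.
have hu i : JCf B 2 (coord i \o u).
  by apply: (JC_eq oB _ (v1 i)) => x p Bx _; rewrite /= uv.
have du x : B x -> differentiable u x.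
  by move=> Bx; apply: (C1_differentiable3 oB _ Bx) => i; exact: JCf_leS.
move=> x Bx; split; [exact: du|split=> [k|i]].
  apply: (C1_differentiable3 oB _ Bx) => i.
  apply: (JC_eq oB _ (JCf_pd k (hu i))) => y p By _.
  have dd : derivable u y (ebasis R k) by apply: diff_derivable; exact: du.
  by have [_ h] := coord_derive i dd; exact: h.
by rewrite lameopE; exact: etrans (lameop_on lam mu i oB (fun k y By => uv y By k) Bx) (v2 i x Bx).
Qed.

Section Representation.
Variables (u : V3 -> V3) (c : R) (Lp Lm : 'I_3 -> (V3 -> R) -> R).
Hypotheses (hp : forall j, posfun S (Lp j)) (hm : forall j, posfun S (Lm j)).
Hypothesis hu : forall x, B x -> forall i,
  coord i (u x) = c * \sum_(j < 3) (Lp j (Kn lam mu i j x) - Lm j (Kn lam mu i j x)).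

Lemma lame_of_functionals : lame_solution lam mu u.
Proof.
have E6 (a b d e f g : R) : c * (a - b + (d - e) + (f - g)) =
  c * (1 * (1 * a + (-1) * b) + 1 * (1 * d + (-1) * e)) + c * (1 * f + (-1) * g) by ring.
pose V j i x := 1 * Lp j (Kn lam mu i j x) + (-1) * Lm j (Kn lam mu i j x).
have hV j : lame_field (V j) by apply: lame_field_lin; exact: lame_field_posfun.
have h := lame_field_lin c c (lame_field_lin 1 1 (hV (inord 0)) (hV (inord 1))) (hV (inord 2)).
apply: (lame_field_solution h) => x Bx i; rewrite hu // sum3E /V; exact: E6.
Qed.

Lemma enorm_functionals x : B x -> enorm (u x) <= 3 * (`|c| * Kbound lam mu) * \sum_(j < 3) (Lp j (Pn x) + Lm j (Pn x)).
Proof.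
move=> Bx; apply: le_trans (enorm_le_norm _) _; rewrite -mulrA ler_pM2l //.
apply: norm_le_coord => i; rewrite hu // normrM -mulrA; apply: ler_wpM2l => //.
rewrite mulr_sumr; apply: le_trans (ler_norm_sum _ _ _) _; apply: ler_sum => j _.
have b L : posfun S L -> `|L (Kn lam mu i j x)| <= Kbound lam mu * L (Pn x).
  move=> hL; rewrite -(posfunZ hL); last exact: wcont_Pn.
  apply: (posfun_abs_le hL); [exact: (wcont_Kn hmu hlm (i := i) (j := j) Bx)|apply: wcontZ; exact: wcont_Pn|].
  by move=> e Se; exact: Kn_bound.
by apply: le_trans (ler_normB _ _) _; rewrite mulrDr; apply: lerD; apply: b.
Qed.
End Representation.
End LameFields.

(** * Hardy norms of Poisson integrals *)

Section NormBounds.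
Variable R : realType.
Notation V3 := (V3 R).
Local Notation B := (@ball3 R).
Local Notation S := (@sphere3 R).
Local Notation CB := [set x : V3 | enorm x <= 1].
Local Notation sigma := (sigma3 R).
Local Notation mS := (@measurable_sphere3 R).
Local Notation cS := (@sphere3_compact R).
Local Notation oB := (@B_open R).
Local Opaque JC pd.

Lemma Lnorm_sphere_ge (p D : R) (f : V3 -> V3) : 0 < p ->
  (\int[sigma]_(x in S) (powR (enorm (f x)) p)%:E <= D%:E)%E ->
  (Lnorm sigma p%:E (fun w => (enorm (f w))%:E) <= (powR D p^-1)%:E)%E.
Proof.
move=> p0 h; rewrite unlock /= integral_sphere.
have e : (\int[sigma]_(x in S) (`|(enorm (f x))%:E| `^ p) = \int[sigma]_(x in S) (powR (enorm (f x)) p)%:E)%E.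
  by apply: eq_integral => x _; rewrite /= ger0_norm // enorm_ge0.
have n0 : (0 <= \int[sigma]_(x in S) (powR (enorm (f x)) p)%:E)%E.
  by apply: integral_ge0 => x _; rewrite lee_fin powR_ge0.
have D0 : (0 <= D%:E)%E by exact: le_trans n0 h.
rewrite e -poweR_EFin; apply: gt0_ler_poweR; [by rewrite invr_ge0 ltW|by rewrite in_itv /= n0 leey|by rewrite in_itv /= D0 leey|exact: h].
Qed.

Variables (lam mu : R).
Hypotheses (hmu : 0 < mu) (hlm : 0 < 2 * mu + lam).

Lemma wcont_scaled (f : V3 -> R) r : 0 <= r < 1 -> JCf B 0 f -> wcont S (fun w => f (r *: w)).
Proof.
move=> r01 hf; apply: (@wcont_comp _ _ _ S B (fun w : V3 => r *: w) f _ _ (JCf_wcont hf)).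
  by move=> w Sw; exact: scaled_ball.
by apply: cont_wcont => w; exact: scaler_continuous.
Qed.

Lemma wcont_enorm_scaled u r : lame_solution lam mu u -> 0 <= r < 1 -> wcont S (fun w => enorm (u (r *: w))).
Proof.
move=> hu r01; apply: (wcont_enorm (f := fun w => u (r *: w))) => i.
have SCB : S `<=` CB by move=> y /= ->.
exact: wcont_sub SCB (wcont_trace (j := i) hu r01).
Qed.

Lemma wcont_powR_ge0 (f : V3 -> R) p : 0 < p -> wcont S f -> (forall e, S e -> 0 <= f e) ->
  sigma.-integrable S (EFin \o (fun e => powR (f e) p)).
Proof.
move=> p0 cf f0; have := wcont_normpow_integrable (ltW p0) cf; apply: eq_integrable; first exact: mS.
by move=> e; rewrite inE => Se; rewrite /= ger0_norm // f0.
Qed.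

Lemma hardy_e_finite (p D : R) u : 0 < p -> lame_solution lam mu u ->
  (forall r, 0 <= r < 1 -> sint (fun w => powR (enorm (u (r *: w))) p) <= D) -> hardy_e lam mu p%:E u.
Proof.
move=> p0 hu hD; split=> //; exists (powR D p^-1) => r r01; apply: Lnorm_sphere_ge => //.
have ih := wcont_powR_ge0 p0 (wcont_enorm_scaled hu r01) (fun e _ => enorm_ge0 _).
by rewrite -(fineK (integrable_fin_num mS ih)) lee_fin; exact: hD.
Qed.

Theorem hardy_meas_converse u (nu : 'I_3 -> {charge set V3 -> \bar R}) : (forall j, charge_on_sphere (nu j)) ->
  (forall x, B x -> u x = Pe_meas lam mu nu x) -> hardy_e lam mu 1%E u.
Proof.
move=> hnu hu; have [m1 h1] := choice (fun j => charge_integral_sphere (hnu j)); have [m2 h2] := choice h1.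
pose L (m : 'I_3 -> {finite_measure set V3 -> \bar R}) j (g : V3 -> R) := \int[m j]_(e in S) g e.
have hL m j : posfun S (L m j) by apply: posfun_integral; [exact: cS|exact: mS].
have hf x : B x -> forall i, coord i (u x) = (4 * pi)^-1 *
    \sum_(j < 3) (L m1 j (Kn lam mu i j x) - L m2 j (Kn lam mu i j x)).
  move=> Bx i; rewrite hu // /Pe_meas vec3K mulr_sumr; apply: eq_bigr => j _.
  have [_ _ _ hj] := h2 j.
  by rewrite (hj (4 * pi)^-1 _ _ (wcont_Kn hmu hlm (i := i) (j := j) Bx) (fun e Se => Pe_kernelE hmu hlm i j Se Bx)).
have lu := lame_of_functionals hmu hlm (hL m1) (hL m2) hf.
pose A := 3 * (`|(4 * pi)^-1| * Kbound lam mu).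
pose D := A * \sum_(j < 3) (area R * L m1 j (fun=> 1) + area R * L m2 j (fun=> 1)).
apply: (@hardy_e_finite 1 D) => // r r01.
have cw m j : wcont S (fun w => L m j (Pn (r *: w))).
  exact: (wcont_scaled r01 (JCf_posfun oB cS (hL m j) (JC_Pn R 0))).
have cD j : wcont S (fun w => L m1 j (Pn (r *: w)) + L m2 j (Pn (r *: w))) by exact: wcontD (cw m1 j) (cw m2 j).
have cs : wcont S (fun w => \sum_(j < 3) (L m1 j (Pn (r *: w)) + L m2 j (Pn (r *: w)))) by exact: wcont_sum cD.
have ce := wcont_enorm_scaled lu r01.
have -> : (fun w => powR (enorm (u (r *: w))) 1) = fun w => enorm (u (r *: w)).
  by apply/funext => w; rewrite powRr1 // enorm_ge0.
have cA : wcont S (fun w => A * \sum_(j < 3) (L m1 j (Pn (r *: w)) + L m2 j (Pn (r *: w)))) by exact: wcontZ cs.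
apply: (@le_trans _ _ (sint (fun w => A * \sum_(j < 3) (L m1 j (Pn (r *: w)) + L m2 j (Pn (r *: w)))))).
  apply: (posfun_le (@posfun_sint R) ce cA) => w Sw.
  exact: (enorm_functionals hmu hlm (hL m1) (hL m2) hf (scaled_ball r01 Sw)).
rewrite (posfunZ (@posfun_sint R)) // (posfun_sum (@posfun_sint R)) // le_eqVlt; apply/orP; left; apply/eqP.
congr (_ * _); apply: eq_bigr => j _; rewrite (posfunD (@posfun_sint R)) //.
have M (m : 'I_3 -> {finite_measure set V3 -> \bar R}) : m j (~` S) = 0%E -> sint (fun w => L m j (Pn (r *: w))) = area R * L m j (fun=> 1).
  move=> m0; rewrite /L; have i1 := @wcont_integrable_finite R S (m j) cS mS _ (@wcont_cst V3 R S 1).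
  rewrite -(sint_mass i1 m0 r01 (fun _ _ => ler01)); f_equal; apply/funext => w.
  by apply: eq_Rintegral => e _; rewrite mulr1.
by have [z1 z2 _ _] := h2 j; rewrite (M m1 z1) (M m2 z2).
Qed.

Section FunctionRepresentation.
Variables (u f : V3 -> V3).
Hypotheses (mf : forall i, measurable_fun S (coord i \o f)).
Hypothesis uf : forall x, B x -> u x = Pe_fun lam mu f x.

Lemma measurable_enorm_on : measurable_fun S (fun e => enorm (f e)).
Proof.
pose f' e := if e \in S then f e else 0.
have mf' : measurable_fun setT f'.
  apply: measurable_to_V3 => i; have -> : coord i \o f' = (coord i \o f) \_ S.
    by apply/funext => e; rewrite /f' /= patchE /=; case: (e \in S); rewrite ?coord0.
  by apply/(measurable_restrictT _ mS); exact: mf.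
apply: (eq_measurable_fun (fun e => enorm (f' e))); first by move=> e Se; rewrite /f' Se.
by apply: measurable_funTS; exact: (measurableT_comp (@measurable_enorm R) mf').
Qed.

Hypothesis iN : sigma.-integrable S (EFin \o (fun e => enorm (f e))).

Let fs (s : R) j e := Num.max 0 (s * coord j (f e)).

Let fs_int s j : `|s| = 1 -> (@surf R).-integrable S (EFin \o fs s j).
Proof.
move=> s1; apply: (le_integrable mS _ _ iN).
  apply/measurable_EFinP; apply: measurable_maxr; first exact: measurable_cst.
  by apply: measurable_funM; [exact: measurable_cst|exact: mf].
move=> e _; rewrite /= lee_fin [leRHS]ger0_norm ?enorm_ge0 // ger0_norm ?le_max ?lexx //.
rewrite /fs ge_max enorm_ge0 /=; apply: le_trans (ler_norm _) _; rewrite normrM s1 mul1r; exact: coord_le_enorm.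
Qed.

Let fsE j e : fs 1 j e - fs (-1) j e = coord j (f e) /\ fs 1 j e + fs (-1) j e = `|coord j (f e)|.
Proof.
rewrite /fs mul1r mulN1r; move: (coord j (f e)) => y; have [h|h] := lerP 0 y.
  by rewrite (max_idPl (_ : - y <= 0)) ?oppr_le0 // subr0 addr0 ger0_norm.
by rewrite (max_idPr (_ : 0 <= - y)) ?oppr_ge0 ?ltW // sub0r opprK add0r ltr0_norm.
Qed.

(** Integrability of [|f|] is common to finite and infinite exponents, so the bound serves both; the
    positive and negative parts of the components supply the positive forms. *)
Lemma function_bound : lame_solution lam mu u /\ exists2 A, 0 <= A &
  forall x, B x -> enorm (u x) <= A * \int[sigma]_(e in S) (Pn x e * enorm (f e)).
Proof.
have n1 : `|1 : R| = 1 by exact: normr1.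
have n2 : `|- 1 : R| = 1 by rewrite normrN normr1.
have hs s j e : 0 <= fs s j e by rewrite le_max lexx.
pose L s j (g : V3 -> R) := \int[sigma]_(e in S) (g e * fs s j e).
have hL s j : `|s| = 1 -> posfun S (L s j) by move=> s1; apply: (posfun_density (fs_int j s1)) => e _; exact: hs.
have wi s j (g : V3 -> R) : `|s| = 1 -> wcont S g -> sigma.-integrable S (EFin \o (fun e => g e * fs s j e)).
  by move=> s1 cg; exact: (weighted_integrable (fs_int j s1) cg).
have hf x : B x -> forall i, coord i (u x) = (4 * pi)^-1 *
    \sum_(j < 3) (L 1 j (Kn lam mu i j x) - L (-1) j (Kn lam mu i j x)).
  move=> Bx i; rewrite uf // /Pe_fun vec3K mulr_sumr; apply: eq_bigr => j _.
  have cK := wcont_Kn hmu hlm (i := i) (j := j) Bx.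
  have i1 := wi _ j _ n1 cK; have i2 := wi _ j _ n2 cK.
  rewrite /L -(RintegralB mS i1 i2) -RintegralZl; [|exact: mS|].
    apply: eq_Rintegral => e; rewrite inE => Se; have [d _] := fsE j e.
    by rewrite (Pe_kernelE hmu hlm i j Se Bx) -d -mulrBr mulrA.
  by have := integrableB mS i1 i2; apply: eq_integrable; [exact: mS|] => e _; rewrite /= EFinB.
split; first exact: (lame_of_functionals hmu hlm (fun j => hL 1 j n1) (fun j => hL (-1) j n2) hf).
exists (3 * (`|(4 * pi)^-1| * Kbound lam mu) * 3).
  by rewrite !mulr_ge0 ?Kbound_ge0.
move=> x Bx; apply: le_trans (enorm_functionals hmu hlm (fun j => hL 1 j n1) (fun j => hL (-1) j n2) hf Bx) _.
rewrite -[leRHS]mulrA; apply: ler_wpM2l; first by rewrite !mulr_ge0 ?Kbound_ge0.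
have -> : 3 * \int[sigma]_(e in S) (Pn x e * enorm (f e)) = \sum_(j < 3) \int[sigma]_(e in S) (Pn x e * enorm (f e)).
  by rewrite sum3E; ring.
apply: ler_sum => j _; have cP := wcont_Pn Bx; have i1 := wi _ j _ n1 cP; have i2 := wi _ j _ n2 cP.
rewrite /L -(RintegralD mS i1 i2); apply: le_Rintegral; first exact: mS.
- by have := integrableD mS i1 i2; apply: eq_integrable; [exact: mS|] => e _; rewrite /= EFinD.
- exact: (weighted_integrable (m := @surf R) iN cP).
- move=> e Se; have [_ d] := fsE j e; rewrite -mulrDr d; apply: ler_wpM2l; last exact: coord_le_enorm.
  exact: Pn_ge0.
Qed.
End FunctionRepresentation.

Section Jensen.
Variables (p : R) (N : V3 -> R).
Hypotheses (p1 : 1 < p) (N0 : forall e, 0 <= N e).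
Hypotheses (iN : sigma.-integrable S (EFin \o N)) (iNp : sigma.-integrable S (EFin \o (fun e => powR (N e) p))).

(** Jensen's inequality from Young's: with [M] the mean of [N] for the density [Pn x / area R], the
    inequality N M^(p-1) <= N^p / p + (1 - 1/p) M^p is integrated against [Pn x]. The left side
    gives [area R] times M^p, and the share 1 - 1/p of it is absorbed. *)
Lemma poisson_jensen x : B x ->
  powR ((\int[sigma]_(e in S) (Pn x e * N e)) / area R) p <= (area R)^-1 * \int[sigma]_(e in S) (Pn x e * powR (N e) p).
Proof.
move=> Bx; have a0 := area_gt0 R; have cP := wcont_Pn Bx; have p0 : 0 < p by exact: lt_trans p1.
set I := \int[sigma]_(e in S) (Pn x e * N e); set M := I / area R.
have i1 := weighted_integrable (m := @surf R) iN cP; have i2 := weighted_integrable (m := @surf R) iNp cP.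
have i3 := wcont_integrableS cP.
have M0 : 0 <= M.
  by rewrite divr_ge0 ?(ltW a0) //; apply: Rintegral_ge0 => e Se; rewrite mulr_ge0 ?N0 ?Pn_ge0.
pose c := (1 - p^-1) * powR M p.
have ic1 : sigma.-integrable S (EFin \o (fun e => powR M (p - 1) * (Pn x e * N e))).
  by have := integrableZl mS (powR M (p - 1)) i1; apply: eq_integrable; [exact: mS|] => e _; rewrite /= EFinM.
have ic2 : sigma.-integrable S (EFin \o (fun e => p^-1 * (Pn x e * powR (N e) p))).
  by have := integrableZl mS p^-1 i2; apply: eq_integrable; [exact: mS|] => e _; rewrite /= EFinM.
have ic3 : sigma.-integrable S (EFin \o (fun e => c * Pn x e)).
  by have := integrableZl mS c i3; apply: eq_integrable; [exact: mS|] => e _; rewrite /= EFinM.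
have key : \int[sigma]_(e in S) (powR M (p - 1) * (Pn x e * N e)) <=
    \int[sigma]_(e in S) (p^-1 * (Pn x e * powR (N e) p) + c * Pn x e).
  apply: le_Rintegral; [exact: mS|exact: ic1| |].
    by have := integrableD mS ic2 ic3; apply: eq_integrable; [exact: mS|] => e _; rewrite /= EFinD.
  move=> e Se; have P0 : 0 <= Pn x e by exact: Pn_ge0.
  have := ler_wpM2l P0 (young_powR p1 (N0 e) M0); rewrite /c.
  by move: (powR M _) (powR M _) (powR (N e) p) (N e) (Pn x e) (p^-1) => a b n n' P q; lra.
move: key; rewrite (RintegralD mS ic2 ic3) (RintegralZl _ mS i1) (RintegralZl _ mS i2) (RintegralZl _ mS i3).
have -> : \int[sigma]_(e in S) Pn x e = area R by exact: mass_const.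
rewrite -/I; have -> : I = M * area R by rewrite /M divfK // gt_eqF.
set J := \int[sigma]_(e in S) (Pn x e * powR (N e) p).
rewrite mulrA [powR M (p - 1) * M]mulrC -powR_mulpm1 // /c => key.
rewrite mulrC ler_pdivlMr //.
have q0 : 0 < p^-1 by rewrite invr_gt0.
rewrite -(ler_pM2l q0); move: key; move: (powR M p) (area R) (p^-1) J => s t q j; lra.
Qed.
End Jensen.

Theorem hardy_fun_converse (p : \bar R) u (f : V3 -> V3) : (1 < p)%E -> Lp_sphere p f ->
  (forall x, B x -> u x = Pe_fun lam mu f x) -> hardy_e lam mu p u.
Proof.
move=> p1 [mf hL] uf; have mN := measurable_enorm_on mf; have a0 := area_gt0 R.
pose N e := enorm (f e); have N0 e : 0 <= N e by exact: enorm_ge0.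
case: p p1 hL => [p| |//]; rewrite ?lte_fin => p1 hL.
  have p0 : 0 < p by exact: lt_trans p1.
  have iNp : sigma.-integrable S (EFin \o (fun e => powR (N e) p)).
    apply/integrableP; split.
      by apply/measurable_EFinP; apply: (measurableT_comp (f := @powR R ^~ p) (@measurable_powR R p)).
    have -> : (\int[sigma]_(x in S) `|(EFin \o (fun e => powR (N e) p)) x| =
        Lnorm sigma p%:E (fun w => (enorm (f w))%:E) `^ p)%E.
      rewrite (poweR_Lnorm _ _ (lt0r_neq0 p0)) integral_sphere; apply: eq_integral => x _.
      by rewrite /= (ger0_norm (powR_ge0 _ _)) (ger0_norm (enorm_ge0 _)).
    exact: poweR_lty.
  have iN : sigma.-integrable S (EFin \o N).
    have [k k0 hk] := linear_le_powR p1 ltr01.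
    have ik := integrableD mS iNp (wcont_integrableS (@wcont_cst V3 R S k)).
    apply: (le_integrable mS _ _ ik); first exact/measurable_EFinP.
    move=> e _; rewrite /= lee_fin ger0_norm // ger0_norm; last by rewrite addr_ge0 ?powR_ge0 ?(ltW k0).
    by have := hk _ (N0 e); rewrite mul1r.
  have [lu [A A0 hA]] := function_bound mf uf iN.
  pose T x := \int[@surf R]_(e in S) (Pn x e * powR (N e) p).
  (* The factor [A * area R] rewrites the bound of [function_bound] in terms of the mean to which
     [poisson_jensen] applies. *)
  pose C := powR (A * area R) p * (area R)^-1.
  have C0 : 0 <= C by rewrite mulr_ge0 ?powR_ge0 // invr_ge0 ltW.
  have hC x : B x -> powR (enorm (u x)) p <= C * T x.
    move=> Bx; rewrite /C -mulrA.
    have I0 : 0 <= \int[sigma]_(e in S) (Pn x e * N e) by apply: Rintegral_ge0 => e Se; rewrite mulr_ge0 ?Pn_ge0.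
    apply: le_trans (ler_wpM2l (powR_ge0 _ _) (poisson_jensen p1 N0 iN iNp Bx)).
    rewrite -powRM ?mulr_ge0 ?invr_ge0 ?(ltW a0) //.
    apply: ge0_ler_powR; rewrite ?nnegrE ?enorm_ge0 ?(ltW p0) //.
      by rewrite !mulr_ge0 ?invr_ge0 ?(ltW a0).
    by rewrite -mulrA [area R * _]mulrC divfK ?gt_eqF //; exact: hA.
  pose J := \int[@surf R]_(e in S) powR (N e) p.
  apply: (@hardy_e_finite p (C * (area R * J))) => // r r01.
  have L0 : posfun S (fun g => \int[@surf R]_(e in S) (g e * powR (N e) p)).
    by apply: (posfun_density (m := @surf R) iNp) => e _; exact: powR_ge0.
  have cT : wcont S (fun w => T (r *: w)) := wcont_scaled r01 (JCf_posfun oB cS L0 (JC_Pn R 0)).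
  rewrite /J -(sint_mass (m := @surf R) iNp (@sigma3_out R) r01 (fun e _ => powR_ge0 _ _)).
  rewrite -(posfunZ (@posfun_sint R) C cT); apply: le_Rintegral; first exact: mS.
  - exact: (wcont_powR_ge0 p0 (wcont_enorm_scaled lu r01) (fun e _ => enorm_ge0 _)).
  - by apply: wcont_integrableS; exact: wcontZ.
  - by move=> w Sw; apply: hC; exact: scaled_ball.
(* Positive total mass is what makes the norm of exponent [+oo] an essential supremum. *)
have s0 : (0 < sigma setT)%E.
  by apply: lt_le_trans (sigma3_gt0 R) _; apply: le_measure; rewrite ?inE //; exact: mS.
have [C C0 hC] : exists2 C : R, 0 <= C & {ae sigma, forall e, N e <= C}.
  move: hL; rewrite unlock /= s0; set es := ess_sup _ _ => hes.
  have [c hc] : exists c : R, (es <= c%:E)%E.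
    by move: hes; case: es => [c _|//|_]; [exists c|exists 0; rewrite leNye].
  exists (Num.max 0 c); first by rewrite le_max lexx.
  move/ess_supP: hc; apply: filterS => e; rewrite /= lee_fin ger0_norm ?enorm_ge0 // => h.
  by rewrite le_max h orbT.
(* [N] is at most [C] almost everywhere only; its truncation at [C] is bounded everywhere and has
   the same integrals. *)
have mn : measurable_fun S (fun e => Num.min (N e) C) by apply: measurable_minr => //; exact: measurable_cst.
have iM : sigma.-integrable S (EFin \o (fun e => Num.min (N e) C)).
  apply: (le_integrable mS _ _ (wcont_integrableS (@wcont_cst V3 R S C))); first exact/measurable_EFinP.
  by move=> e _; rewrite /= lee_fin ger0_norm ?le_min ?N0 // ger0_norm // ge_min lexx orbT.
have E (g : V3 -> R) : measurable_fun S g ->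
    (\int[sigma]_(e in S) (g e * N e)%:E = \int[sigma]_(e in S) (g e * Num.min (N e) C)%:E)%E.
  move=> mg; apply: ae_eq_integral; first exact: mS.
  - by apply/measurable_EFinP; exact: measurable_funM.
  - by apply/measurable_EFinP; exact: measurable_funM.
  - by move: hC; apply: filterS => e h _; rewrite (min_idPl h).
have iN : sigma.-integrable S (EFin \o N).
  apply/integrableP; split; first exact/measurable_EFinP.
  have /integrableP[_] := iM; congr (_ < _)%E.
  have e1 := E (fun=> 1) (measurable_cst _).
  have -> : (\int[sigma]_(e in S) `|(EFin \o N) e| = \int[sigma]_(e in S) (1 * N e)%:E)%E.
    by apply: eq_integral => e _; rewrite mul1r /= ger0_norm.
  by rewrite e1; apply: eq_integral => e _; rewrite mul1r /= ger0_norm // le_min N0.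
have [lu [A A0 hA]] := function_bound mf uf iN.
split=> //; exists (A * (area R * C)) => x Bx; apply: le_trans (hA x Bx) _; apply: ler_wpM2l => //.
have cP := wcont_Pn Bx.
rewrite /Rintegral E; last by apply: wcont_measurable cP; exact: mS.
rewrite -(mass_const Bx) /sint -RintegralZr; [|exact: mS|exact: wcont_integrableS].
apply: le_Rintegral; first exact: mS.
- exact: (weighted_integrable (m := @surf R) iM cP).
- have := integrableZr mS C (wcont_integrableS cP); apply: eq_integrable; first exact: mS.
  by move=> e _; rewrite /= EFinM.
- by move=> e Se; apply: ler_wpM2l; [exact: Pn_ge0|rewrite ge_min lexx orbT].
Qed.
End NormBounds.

Theorem mainTheorem4 (R : realType) (lam mu : R)
    (hmu : 0 < mu) (hlm : 0 < 2 * mu + lam) :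
  (* (1) 1 < p <= +oo *)
  (forall (p : \bar R), (1 < p)%E -> forall u : V3 R -> V3 R,
     hardy_e lam mu p u <->
     exists f : V3 R -> V3 R,
       Lp_sphere p f /\ (forall x, ball3 x -> u x = Pe_fun lam mu f x))
  /\
  (* (2) p = 1 *)
  (forall u : V3 R -> V3 R,
     hardy_e lam mu 1%E u <->
     exists nu : 'I_3 -> {charge set V3 R -> \bar R},
       (forall j, charge_on_sphere (nu j)) /\
       (forall x, ball3 x -> u x = Pe_meas lam mu nu x)).
Proof.
split=> [p p1 u|u]; split.
- exact: hardy_fun.
- by move=> [f [hf uf]]; exact: hardy_fun_converse uf.
- exact: hardy_meas.
- by move=> [nu [hnu uf]]; exact: hardy_meas_converse uf.
Qed.
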